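(* Suppose Assumptions A(i),(ii) hold, and let $(g_j)_{j\ge0}$ be univariate filters satisfying (W-1)–(W-3) with $m=1$, $\gamma_j=2^j$ and $M\ge K+\delta(q_0)$. Given observations $Y_1,\dots,Y_N$, let $W_{j,k}=\sum_tg_j(2^jk-t)Y_t$, let $n_j=N2^{-j}+O(1)$ be the number of coefficients at scale $j$ computable from the sample, $\hat\sigma_j^2=\frac1{n_j}\sum_{k=0}^{n_j-1}W_{j,k}^2$, and for fixed $p\ge1$ and weights $w_0,\dots,w_p$ with $\sum_iw_i=0$ and $\sum_i iw_i=1/(2\log2)$ set $\hat d_0=\sum_{i=0}^pw_i\log\hat\sigma_{j+i}^2$. Let $j=j_N$ be such that $j_N\to\infty$ and $N2^{-j_N}\to\infty$ as $N\to\infty$. Then $\hat d_0\to d_0=K+\delta(q_0)$ in probability as $N\to\infty$.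
   Context: Let $0<d<1/2$, $X$ a centered stationary Gaussian process with unit variance and spectral density $f(\lambda)=|1-e^{-i\lambda}|^{-2d}f^*(\lambda)$, $f^*$ a bounded spectral density, continuous and positive at $0$, with $|f^*(\lambda)-f^*(0)|\le Cf^*(0)|\lambda|^\beta$ for some $\beta\in(0,2]$ (Assumption A(i)). $G$ with $E[G(X_0)]=0$, $E[G(X_0)^2]<\infty$, $G=\sum_{q\ge1}\frac{c_q}{q!}H_q$ ($H_q$ Hermite polynomials), Hermite rank $q_0$; Assumption A(ii): $q_0<1/(1-2d)$ and for every $\lambda>0$, $c_q=O((q!)^de^{-\lambda q})$. $\delta(q)=qd-(q-1)/2$. $K\ge0$ integer, $(\Delta^KY)_t=G(X_t)$. Filter conditions, with $\widehat g_j(\lambda)=\sum_\tau g_j(\tau)e^{-i\lambda\tau}$: (W-1) $\mathrm{supp}(g_j)\subset2^j[-A,A]$ for some $A>0$; (W-2) $|\widehat g_j(\lambda)|\le C2^{j/2}|2^j\lambda|^M(1+2^j|\lambda|)^{-\alpha-M}$ on $[-\pi,\pi]$ with integer $M\ge K$, $\alpha>1$; (W-3) $2^{-j/2}\widehat g_j(2^{-j}\lambda)e^{i\Phi_j(\lambda)}\to\widehat g_\infty(\lambda)$ locally uniformly for some phases $\Phi_j$ and a non-identically-zero $\widehat g_\infty$. *)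

(* Defs.v *)
From HB Require Import structures.
From mathcomp Require Import all_boot all_order all_algebra.
From mathcomp Require Import all_classical all_reals all_analysis.
Set Implicit Arguments. Unset Strict Implicit. Unset Printing Implicit Defensive.
Import Order.TTheory GRing.Theory Num.Theory.
Import numFieldNormedType.Exports.
Local Open Scope classical_set_scope.
Local Open Scope ring_scope.

Section Defs.
Variable R : realType.

(* Probabilists' Hermite polynomials: H_0 = 1, H_1 = x,
   H_{q+1} x = x H_q x - q H_{q-1} x.  hermite_pair q x = (H_q x, H_{q+1} x). *)
Fixpoint hermite_pair (q : nat) (x : R) : R * R :=
  match q with
  | 0%N => (1, x)
  | q'.+1 => let: (a, b) := hermite_pair q' x in (b, x * b - q'.+1%:R * a)
  end.
Definition hermite (q : nat) (x : R) : R := (hermite_pair q x).1.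

Definition bdiff (y : int -> R) : int -> R := fun t => y t - y (t - 1).

(* |1 - e^{-i lambda}| = 2 |sin(lambda/2)| *)
Definition abs_one_minus_exp (l : R) : R := 2 * `|sin (l / 2)|.

Definition spec_density (d : R) (fstar : R -> R) (l : R) : R :=
  abs_one_minus_exp l `^ (- (2 * d)) * fstar l.

(* autocovariance r(h) = \int_{-pi}^{pi} cos(lambda h) f(lambda) d lambda
   (real form of \int e^{i lambda h} f(lambda) d lambda for even f) *)
Definition autocov (f : R -> R) (h : int) : R :=
  fine (\int[lebesgue_measure]_(x in `[(- pi)%R, pi%R]) (cos (x * h%:~R) * f x)%:E)%E.

(* window half-width for a filter with support in 2^j [-A, A] *)
Definition win (A : R) (j : nat) : nat := `|Num.ceil (A * 2 ^+ j)|%N.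

(* real and imaginary parts of ghat_j(lambda) = sum_tau g_j(tau) e^{-i lambda tau};
   the sum is over the window [-win A j, win A j] which contains supp(g_j). *)
Definition ghat_re (A : R) (g : nat -> int -> R) (j : nat) (l : R) : R :=
  \sum_(i < (win A j).*2.+1)
     g j (i%:Z - (win A j)%:Z) * cos (l * (i%:Z - (win A j)%:Z)%:~R).
Definition ghat_im (A : R) (g : nat -> int -> R) (j : nat) (l : R) : R :=
  - \sum_(i < (win A j).*2.+1)
     g j (i%:Z - (win A j)%:Z) * sin (l * (i%:Z - (win A j)%:Z)%:~R).

Definition cmod (a b : R) : R := Num.sqrt (a ^+ 2 + b ^+ 2).

(* W_{j,k} = sum_t g_j(2^j k - t) Y_t, summed over t with 2^j k - t in the window *)
Definition wcoef (A : R) (g : nat -> int -> R) (y : int -> R) (j : nat) (k : int) : R :=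
  \sum_(i < (win A j).*2.+1)
     g j (i%:Z - (win A j)%:Z) * y ((2 ^ j)%N%:Z * k - (i%:Z - (win A j)%:Z)).

Definition sig2hat (A : R) (g : nat -> int -> R) (y : int -> R) (j : nat)
  (k0 : int) (n : nat) : R :=
  n%:R^-1 * \sum_(i < n) (wcoef A g y j (k0 + i%:Z)) ^+ 2.

Definition dhat (A : R) (g : nat -> int -> R) (y : int -> R) (p : nat) (w : nat -> R)
  (j : nat) (k0 : nat -> int) (n : nat -> nat) : R :=
  \sum_(i < p.+1) w i * ln (sig2hat A g y (j + i) (k0 (j + i)%N) (n (j + i)%N)).

Definition hdelta (d : R) (q : nat) : R := q%:R * d - (q%:R - 1) / 2.

(* real/imag parts of 2^{-j/2} ghat_j(2^{-j} lambda) e^{i Phi_j(lambda)} *)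
Definition resc_re (A : R) (g : nat -> int -> R) (Phi : nat -> R -> R) (j : nat) (l : R) : R :=
  2 `^ (- (j%:R / 2)) *
  (ghat_re A g j (l / 2 ^+ j) * cos (Phi j l) - ghat_im A g j (l / 2 ^+ j) * sin (Phi j l)).
Definition resc_im (A : R) (g : nat -> int -> R) (Phi : nat -> R -> R) (j : nat) (l : R) : R :=
  2 `^ (- (j%:R / 2)) *
  (ghat_re A g j (l / 2 ^+ j) * sin (Phi j l) + ghat_im A g j (l / 2 ^+ j) * cos (Phi j l)).

End Defs.

(* Centered Gaussian process on (T, P) indexed by int with covariance function r:
   every finite linear combination Z = sum_i a_i X_{t_i} is Gaussian with mean 0 and
   variance v = sum_{i,l} a_i a_l r(t_i - t_l), expressed via its characteristic
   function E[e^{iuZ}] = exp(-u^2 v / 2), i.e. E[cos(uZ)] = exp(-u^2 v/2), E[sin(uZ)] = 0. *)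
Definition centered_gaussian_process {R : realType} {d : measure_display}
  {T : measurableType d} (P : probability T R) (X : int -> T -> R) (r : int -> R) : Prop :=
  (forall t, measurable_fun setT (X t)) /\
  forall (m : nat) (ts : 'I_m -> int) (a : 'I_m -> R) (u : R),
    let Z := fun w => \sum_(i < m) a i * X (ts i) w in
    let v := \sum_(i < m) \sum_(l < m) a i * a l * r (ts i - ts l) in
    (\int[P]_w (cos (u * Z w))%:E = (expR (- (u ^+ 2 * v) / 2))%:E)%E /\
    (\int[P]_w (sin (u * Z w))%:E = 0)%E.

Definition hcoef {R : realType} {d : measure_display} {T : measurableType d}
  (P : probability T R) (X0 : T -> R) (G : R -> R) (q : nat) : R :=
  fine (\int[P]_w (G (X0 w) * hermite q (X0 w))%:E)%E.

(* Main.v *)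
(** Let d0 = K + delta(q0).  By (W-2) each ghat_j vanishes at 0 to order M > K, so K differences
    can be moved from the filter to Y by Abel summation, and W_{j,k} = 2^{j d0} sum_i a_j(i)
    G(X_{2^j k - i}) with weights of size O(2^{j (q0 (1-2d)/2 - 1)}) on O(2^j) points.

    In the Hermite expansion of G(X) only the rank q0 matters, because the weighted sums of the
    terms q > q0 have covariances r^q, which are summable against these weights with a vanishing
    bound.  The covariance r of X is compared with the explicit covariance rho_d of the density
    |1 - e^{-ix}|^{-2d} in the order for which quadratic forms increase even after a further
    pointwise product, and then rho_d^{q0} with rho_delta, both decaying like h^{-q0 (1-2d)}.
    Thus the variance of W_{j,k} 2^{-j d0} converges to a constant times
    lim 2^{-2 j d0} int |ghat_j|^2 |1 - e^{-ix}|^{-2 d0} dx, which after rescaling is, by dominated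
    convergence and (W-3), int |ghat_oo(y)|^2 |y|^{-2 d0} dy > 0.

    For the law of large numbers X is replaced inside H_{q0} by its moving average over 2^{j-l}
    points, uniformly close in mean square as l grows.  The averaged field has pointwise small
    covariances at distances much larger than 2^j, so that an explicit recursion for fourth
    moments of Wick powers (Gaussian integration by parts) makes W_{j,k}^2 and W_{j,k'}^2
    asymptotically uncorrelated as |k - k'| grows.  Hence 2^{-2 j d0} sigma_j^2 converges in L1,
    uniformly over sample windows, and the regression weights turn this into convergence of
    dhat. *)

Require Import Defs.
From HB Require Import structures.
From mathcomp Require Import all_boot all_order all_algebra.
From mathcomp Require Import all_classical all_reals all_analysis.
From mathcomp Require Import measurable_realfun normal_distribution.
From mathcomp Require Import exponential_distribution.
From mathcomp Require Import ring lra zify.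
Import Order.TTheory GRing.Theory Num.Theory.
Import numFieldNormedType.Exports.
Set Implicit Arguments. Unset Strict Implicit. Unset Printing Implicit Defensive.
Local Open Scope classical_set_scope.
Local Open Scope ring_scope.

(** * Integrals and derivatives *)

(** Since [fstar] is only bounded and continuous at 0, the covariance of X has no usable pointwise
    rate of decay. Only its quadratic forms can be compared, through the spectral densities; the
    weights may change sign and rank q0 brings in the power r^q0, so the comparison has to survive
    pointwise products. Pointwise decay is available for the explicit kernels alone, where a
    two-term recursion gives the exact power law. The exponent delta = (1 - q0 (1 - 2d)) / 2 is
    dictated by 1 - 2 delta = q0 (1 - 2d): rho_delta decays like rho_d^q0 and, unlike that power,
    has an explicit spectral density, so that its form is a frequency integral. The same obstacle
    explains the smoothing: fourth moments of Wick powers need covariances that are small entry by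
    entry, and averaging over a window proportional to 2^j damps all frequencies except those near
    0, where [fstar] is nearly constant. All moment computations start from the characteristic
    functions of linear combinations, which are the data given about X. *)

Lemma eq_cvg_unique (R : realType) (u v : nat -> R) (l l' : R) :
  u @ \oo --> l -> v @ \oo --> l' -> u =1 v -> l = l'.
Proof.
move=> hu hv /funext E; apply: (cvg_unique _ hu); first exact: norm_hausdorff.
by rewrite E.
Qed.

Lemma cvg_to_eq (R : realType) T (F : set_system T) (u : T -> R) (l l' : R) :
  u @ F --> l -> l = l' -> u @ F --> l'.
Proof. by move=> h <-. Qed.

Lemma cvg_ge_near (R : realType) (u : nat -> R) (l K : R) :
  u @ \oo --> l -> (\forall n \near \oo, K <= u n) -> K <= l.
Proof. by move=> h hK; rewrite -(cvg_lim _ h)//; apply: limr_ge => //; apply: cvgP h. Qed.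

Lemma indicCx (R : pzRingType) T (B : set T) (x : T) : \1_(~` B) x = 1 - \1_B x :> R.
Proof. by rewrite !indicE in_setC; case: (x \in B); rewrite /= ?subrr ?subr0. Qed.

Section RealIntegral.
Context {d : measure_display} {T : measurableType d} {R : realType}
  (mu : {measure set T -> \bar R}) (D : set T) (mD : measurable D).

(** Integrability of a real-valued function, so that later statements stay in [R] together with the
    real integral. *)
Definition itb (f : T -> R) := mu.-integrable D (EFin \o f).

Implicit Types f g : T -> R.

Lemma itb_meas f : itb f -> measurable_fun D f.
Proof. by move=> /measurable_int /measurable_EFinP. Qed.

Lemma itbD f g : itb f -> itb g -> itb (fun x => f x + g x).
Proof. by move=> hf hg; apply: (integrableD mD hf hg). Qed.

Lemma itbN f : itb f -> itb (fun x => - f x).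
Proof. by move=> hf; apply: (integrableN hf). Qed.

Lemma itbB f g : itb f -> itb g -> itb (fun x => f x - g x).
Proof. by move=> hf hg; apply: itbD => //; exact: itbN. Qed.

Lemma itbZ c f : itb f -> itb (fun x => c * f x).
Proof. by move=> hf; apply: (integrableZl mD c hf). Qed.

Lemma itb0 : itb (fun=> 0).
Proof. exact: integrable0. Qed.

Lemma itb_sum I (s : seq I) (Q : pred I) (F : I -> T -> R) :
  (forall i, Q i -> itb (F i)) -> itb (fun x => \sum_(i <- s | Q i) F i x).
Proof.
move=> h; elim: s => [|a s IH].
  by under [X in itb X]eq_fun do rewrite big_nil; exact: itb0.
under [X in itb X]eq_fun do rewrite big_cons.
by case: (boolP (Q a)) => // /h ha; exact: itbD.
Qed.

Lemma itb_le f g : measurable_fun D f -> (forall x, D x -> `|f x| <= `|g x|) ->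
  itb g -> itb f.
Proof.
move=> mf fg ig; apply: (le_integrable mD _ _ ig) => [|x Dx]; first exact/measurable_EFinP.
by rewrite /= lee_fin fg.
Qed.

Lemma RintD f g : itb f -> itb g ->
  \int[mu]_(x in D) (f x + g x) = \int[mu]_(x in D) f x + \int[mu]_(x in D) g x.
Proof. by move=> hf hg; rewrite RintegralD. Qed.

Lemma RintB f g : itb f -> itb g ->
  \int[mu]_(x in D) (f x - g x) = \int[mu]_(x in D) f x - \int[mu]_(x in D) g x.
Proof. by move=> hf hg; rewrite RintegralB. Qed.

Lemma RintZ c f : itb f -> \int[mu]_(x in D) (c * f x) = c * \int[mu]_(x in D) f x.
Proof. by move=> hf; rewrite RintegralZl. Qed.

Lemma Rint_sum I (s : seq I) (Q : pred I) (F : I -> T -> R) :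
  (forall i, Q i -> itb (F i)) ->
  \int[mu]_(x in D) (\sum_(i <- s | Q i) F i x) =
  \sum_(i <- s | Q i) \int[mu]_(x in D) F i x.
Proof.
move=> h; elim: s => [|a s IH].
  rewrite big_nil; under eq_Rintegral do rewrite big_nil.
  by rewrite /Rintegral integral0.
under eq_Rintegral do rewrite big_cons.
rewrite big_cons; case: (boolP (Q a)) => // Qa.
by rewrite RintD ?IH//; [exact: h|exact: itb_sum].
Qed.

Lemma le_Rint f g : itb f -> itb g -> (forall x, D x -> f x <= g x) ->
  \int[mu]_(x in D) f x <= \int[mu]_(x in D) g x.
Proof. by move=> hf hg h; apply: le_Rintegral. Qed.

Lemma Rint_norm_le f g : itb f -> itb g -> (forall x, D x -> `|f x| <= g x) ->
  `|\int[mu]_(x in D) f x| <= \int[mu]_(x in D) g x.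
Proof.
move=> hf hg h; apply: (le_trans (le_normr_Rintegral mD hf)).
apply: le_Rint => //; exact: (integrable_norm hf).
Qed.

Lemma Rint_dct (f_ : nat -> T -> R) (f g : T -> R) :
  (forall n, measurable_fun D (f_ n)) ->
  (forall x, D x -> f_ n x @[n --> \oo] --> f x) ->
  itb g -> (forall n x, D x -> `|f_ n x| <= g x) ->
  itb f /\ (\int[mu]_(x in D) f_ n x @[n --> \oo] --> \int[mu]_(x in D) f x).
Proof.
move=> mf cf ig dom.
have mff : measurable_fun D f by exact: measurable_fun_cvg cf.
have [| | | | |h1 _ h3] := @dominated_convergence _ _ _ mu D mD
    (fun n => EFin \o f_ n) (EFin \o f) (EFin \o g).
- by move=> n; apply/measurable_EFinP.
- exact/measurable_EFinP.
- by apply: aeW => x Dx; apply: cvg_EFin; [exact: nearW|exact: cf].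
- exact: ig.
- by apply: aeW => x n Dx; rewrite /= lee_fin dom.
split => //; apply: fine_cvg; rewrite fineK; first exact: h3.
exact: integrable_fin_num.
Qed.

Lemma EFin_Rint f : itb f ->
  ((\int[mu]_(x in D) f x)%:E = \int[mu]_(x in D) (f x)%:E)%E.
Proof. by move=> hf; rewrite /Rintegral fineK//; apply: integrable_fin_num. Qed.

End RealIntegral.

Section FTC.
Context {R : realType}.
Notation mu := (@lebesgue_measure R).

Lemma Rint_ftc (f F : R -> R) (a b : R) : a < b ->
  (forall x, a <= x <= b -> is_derive x 1 F (f x)) ->
  {within `[a, b], continuous f} ->
  \int[mu]_(x in `[a, b]) f x = F b - F a.
Proof.
move=> ab dF cf.
have cF x : a <= x <= b -> {for x, continuous F}.
  by move=> /dF h; apply/differentiable_continuous/derivable1_diffP.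
rewrite /Rintegral (continuous_FTC2 ab cf (F := F)) -?EFinB//.
- split.
  + by move=> x; rewrite in_itv/= => /andP[/ltW h1 /ltW h2]; case: (dF x); rewrite ?h1.
  + by apply: cvg_at_right_filter; apply: cF; rewrite lexx ltW.
  + by apply: cvg_at_left_filter; apply: cF; rewrite lexx ltW.
- move=> x; rewrite in_itv/= => /andP[/ltW h1 /ltW h2].
  have h := dF x; rewrite h1 h2 in h; have {}h := h isT.
  by rewrite derive1E derive_val.
Qed.

Lemma itb_continuous (f : R -> R) (a b : R) :
  {within `[a, b], continuous f} -> itb mu `[a, b] f.
Proof.
by move=> cf; apply: continuous_compact_integrable => //; exact: segment_compact.
Qed.

End FTC.

(** * Derivatives of explicit expressions *)

Section DeriveAuto.
Context {R : realType}.
Implicit Types (f g : R -> R) (x : R).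

Lemma dv_id x : is_derive x 1 (fun y : R => y) 1.
Proof. exact: is_derive_id. Qed.

Lemma dv_cst (c : R) x : is_derive x 1 (fun=> c) 0.
Proof. exact: is_derive_cst. Qed.

Lemma dv_add f g df dg x : is_derive x 1 f df -> is_derive x 1 g dg ->
  is_derive x 1 (fun y => f y + g y) (df + dg).
Proof. by move=> h1 h2; apply: is_deriveD. Qed.

Lemma dv_opp f df x : is_derive x 1 f df -> is_derive x 1 (fun y => - f y) (- df).
Proof. by move=> h1; apply: is_deriveN. Qed.

Lemma dv_mul f g df dg x : is_derive x 1 f df -> is_derive x 1 g dg ->
  is_derive x 1 (fun y => f y * g y) (df * g x + f x * dg).
Proof.
move=> h1 h2; apply: (@is_derive_eq _ _ _ _ _ _ _ _ (is_deriveM h1 h2)).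
by rewrite /GRing.scale /= addrC [_ * df]mulrC.
Qed.

Lemma dv_comp (h : R -> R) f dh df x : is_derive (f x) 1 h dh -> is_derive x 1 f df ->
  is_derive x 1 (fun y => h (f y)) (dh * df).
Proof. by move=> h1 h2; apply: (is_derive1_comp h1 h2). Qed.

Lemma dv_pow f n df x : is_derive x 1 f df ->
  is_derive x 1 (fun y => f y ^+ n) (n%:R * f x ^+ n.-1 * df).
Proof.
move=> h; elim: n => [|n IH].
  apply: (is_derive_eq (dv_cst 1 x)); ring.
rewrite (_ : (fun y => f y ^+ n.+1) = fun y => f y * f y ^+ n); last first.
  by apply/funext => y; rewrite exprS.
apply: (is_derive_eq (dv_mul h IH)).
by case: n {IH} => [|n]; rewrite ?expr0 ?mul0r ?mulr0 /= ?exprS -?[in RHS]natr1; ring.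
Qed.

Lemma dv_expR f df x : is_derive x 1 f df ->
  is_derive x 1 (fun y => expR (f y)) (expR (f x) * df).
Proof. by move=> h; apply: dv_comp. Qed.

Lemma dv_sin f df x : is_derive x 1 f df ->
  is_derive x 1 (fun y => sin (f y)) (cos (f x) * df).
Proof. by move=> h; apply: dv_comp. Qed.

Lemma dv_cos f df x : is_derive x 1 f df ->
  is_derive x 1 (fun y => cos (f y)) (- sin (f x) * df).
Proof. by move=> h; apply: dv_comp. Qed.

Lemma dv_atan f df x : is_derive x 1 f df ->
  is_derive x 1 (fun y => atan (f y)) ((1 + f x ^+ 2)^-1 * df).
Proof.
by move=> h; apply: dv_comp.
Qed.

Lemma dv_powR f df a x : 0 < f x -> is_derive x 1 f df ->
  is_derive x 1 (fun y => f y `^ a) (a * f x `^ (a - 1) * df).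
Proof. by move=> fx h; apply: (dv_comp (h := fun z => z `^ a)) => //; apply: is_derive1_powR. Qed.

Lemma dv_inv f df x : f x != 0 -> is_derive x 1 f df ->
  is_derive x 1 (fun y => (f y)^-1) (- (f x) ^- 2 * df).
Proof. by move=> fx h; apply: (is_derive_eq (is_deriveV fx h)). Qed.

Lemma dv_continuous f df x : is_derive x 1 f df -> {for x, continuous f}.
Proof. by move=> [h _]; apply/differentiable_continuous/derivable1_diffP. Qed.

End DeriveAuto.

(** The derivative is synthesized by unification along the expression. [derive_auto] leaves the side
    conditions of inverses and real powers, then the equation between the synthesized and the
    claimed derivative. *)
Ltac derive_step := first
  [ eapply dv_cst | eapply dv_id | eapply dv_add | eapply dv_opp | eapply dv_mul
  | eapply dv_pow | eapply dv_expR | eapply dv_sin | eapply dv_cos | eapply dv_atan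
  | eapply dv_inv | eapply dv_powR ].
Ltac derive_auto := eapply is_derive_eq; [repeat derive_step | rewrite /=].
Ltac cont_auto := let x := fresh "x" in move=> x; eapply dv_continuous; repeat derive_step.

(** * Measures determined by cosine and sine transforms *)

Section Fubini.
Context {R : realType} d1 d2 (T1 : measurableType d1) (T2 : measurableType d2)
  (m1 : {sigma_finite_measure set T1 -> \bar R})
  (m2 : {sigma_finite_measure set T2 -> \bar R}).

(** The product bound makes the integrand jointly integrable, which is what Fubini's theorem
    needs. *)
Lemma Rint_fubini (f : T1 -> T2 -> R) (g : T1 -> R) (h : T2 -> R) :
  measurable_fun setT (fun p => f p.1 p.2) ->
  itb m1 setT g -> itb m2 setT h -> (forall t u, `|f t u| <= g t * h u) ->
  \int[m1]_t (\int[m2]_u f t u) = \int[m2]_u (\int[m1]_t f t u).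
Proof.
move=> mf ig ih dom.
have mf1 t : measurable_fun setT (f t) by exact: (measurableT_comp mf (pair1_measurable t)).
have mf2 u : measurable_fun setT (f ^~ u) by exact: (measurableT_comp mf (pair2_measurable u)).
have i1 t : itb m2 setT (f t).
  apply: itb_le (itbZ measurableT (g t) ih) => // u _.
  by rewrite (le_trans (dom t u))// ler_norm.
have i2 u : itb m1 setT (f ^~ u).
  apply: itb_le (itbZ measurableT (h u) ig) => // t _.
  by rewrite (le_trans (dom t u))// mulrC ler_norm.
have mF : measurable_fun setT (fun p : T1 * T2 => (f p.1 p.2)%:E) by exact/measurable_EFinP.
have iF : (m1 \x m2)%E.-integrable setT (fun p => (f p.1 p.2)%:E).
  apply/(integrable12ltyP _ _ mF) => /=.
  have ihn : itb m2 setT (Num.norm \o h) by exact: (integrable_norm ih).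
  have ign : itb m1 setT (Num.norm \o g) by exact: (integrable_norm ig).
  pose c := \int[m2]_u `|h u|.
  apply: (@le_lt_trans _ _ (\int[m1]_t (c * `|g t|)%:E)%E).
    apply: ge0_le_integral; first exact: measurableT.
    - by move=> t _; apply: integral_ge0.
    - have := @measurable_fun_fubini_tonelli_F _ _ T1 T2 R m2 (abse \o (fun p : T1 * T2 => (f p.1 p.2)%:E)).
      by apply; [exact: (measurableT_comp _ mF)|by move=> x; rewrite lee_fin normr_ge0].
    - apply/measurable_EFinP; apply: measurable_funM => //.
      exact: itb_meas ign.
    - move=> t _; rewrite mulrC /c -(RintZ measurableT)// EFin_Rint//; last exact: itbZ.
      apply: ge0_le_integral; first exact: measurableT.
      + by move=> u _; rewrite lee_fin.
      + by apply/measurable_EFinP; apply: measurableT_comp.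
      + by apply/measurable_EFinP; apply: measurable_funM => //; exact: itb_meas ihn.
      + by move=> u _; rewrite lee_fin -normrM (le_trans (dom t u))// ler_norm.
  by have /integrable_lty := itbZ measurableT c ign; exact.
have := @Fubini _ _ _ _ _ m1 m2 _ iF.
rewrite /Rintegral => E; congr fine; transitivity (\int[m1]_t \int[m2]_u (f t u)%:E)%E.
  by apply: eq_integral => t _; rewrite -EFin_Rint.
rewrite E; apply: eq_integral => u _; rewrite -EFin_Rint//; exact: i2.
Qed.

End Fubini.

Section CosSinTransform.
Context {R : realType}.
Notation mu := (@lebesgue_measure R).

Lemma cvg_expRN (e : R) : 0 < e -> expR (- e * x) @[x --> +oo%R] --> (0 : R).
Proof.
move=> e0; rewrite (_ : (fun x => _) = (fun z => expR (- z)) \o (fun z => e * z)).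
  by apply: (@cvg_comp _ _ _ _ _ _ (pinfty_nbhs R)); [exact: gt0_cvgMry|exact: cvgr_expR].
by apply: eq_fun => x; rewrite mulNr.
Qed.

Lemma cvg_expRN_bounded (e C : R) (f : R -> R) : 0 < e ->
  (forall u, `|f u| <= C * expR (- e * u)) -> f u @[u --> +oo%R] --> (0 : R).
Proof.
move=> e0 h.
have hC : C * expR (- e * u) @[u --> +oo%R] --> (0 : R).
  by rewrite -(mulr0 C); apply: cvgM; [exact: cvg_cst|exact: cvg_expRN].
apply: (@squeeze_cvgr _ _ _ _ (fun u => - (C * expR (- e * u))) (fun u => C * expR (- e * u))) => //.
  by apply: nearW => u; rewrite -ler_norml.
by rewrite -oppr0; apply: cvgN.
Qed.

Lemma itb_exp_pdf (e : R) : 0 < e -> itb mu setT (exponential_pdf e).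
Proof. exact: integrable_exponential_pdf. Qed.

Lemma itb_exp_cos (e x : R) : 0 < e -> itb mu setT (fun u => exponential_pdf e u * cos (u * x)).
Proof.
move=> e0; apply: itb_le (itb_exp_pdf e0) => //.
  apply: measurable_funM; first exact: measurable_exponential_pdf.
  apply: measurableT_comp; first exact: continuous_measurable_fun (@continuous_cos R).
  by apply: measurable_funM.
move=> u _; rewrite normrM ler_piMr//.
by rewrite ler_norml cos_geN1 cos_le1.
Qed.

(** Up to a factor, the cosine transform of the exponential density is the Cauchy kernel of width e,
    an approximate identity as e tends to 0. *)
Lemma Rint_exp_cos (e x : R) : 0 < e ->
  \int[mu]_u (exponential_pdf e u * cos (u * x)) = e ^+ 2 / (e ^+ 2 + x ^+ 2).
Proof.
move=> e0.
have q1 : 0 < e ^+ 2 + x ^+ 2 by rewrite ltr_pwDl ?exprn_gt0 ?sqr_ge0.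
have q0 : e ^+ 2 + x ^+ 2 != 0 by rewrite gt_eqF.
(* Antiderivative for the weight 1 + cos instead of cos: the fundamental theorem on a half-line is
   applied to a nonnegative integrand, and the extra mass 1 is subtracted afterwards. *)
pose F : R -> R := fun u => expR (- e * u) *
  (- 1 + e * (x * sin (u * x) - e * cos (u * x)) / (e ^+ 2 + x ^+ 2)).
pose f : R -> R := fun u => e * expR (- e * u) * (1 + cos (u * x)).
have dF (u : R) : is_derive u 1 F (f u).
  rewrite /F; derive_auto; rewrite /f; field.
  by rewrite q0.
have cf : continuous f.
  by rewrite /f; cont_auto.
have f0 (u : R) : 0 <= f u.
  have hc := cos_geN1 (u * x); apply: mulr_ge0; last lra.
  by rewrite mulr_ge0 ?expR_ge0// ltW.
have key : \int[mu]_(u in `[0, +oo[) f u = 0 - F 0.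
  rewrite /Rintegral (@ge0_continuous_FTC2y _ f F 0 0) //.
  - exact: continuous_subspaceT.
  - apply: (@cvg_expRN_bounded e (1 + e * (`|x| + e) / (e ^+ 2 + x ^+ 2))) => // u.
    rewrite /F normrM gtr0_norm ?expR_gt0// mulrC ler_pM2r ?expR_gt0//.
    rewrite (le_trans (ler_normD _ _))// normrN1 lerD2l !normrM gtr0_norm// [X in _ * X <= _]gtr0_norm ?invr_gt0//.
    rewrite ler_pM2r ?invr_gt0// ler_pM2l// (le_trans (ler_normB _ _))// !normrM (gtr0_norm e0).
    apply: lerD; rewrite ler_piMr// ?(ltW e0)// ler_norml ?sin_geN1 ?sin_le1 ?cos_geN1 ?cos_le1//.
  - by apply: cvg_at_right_filter; exact: (dv_continuous (dF 0)).
  - by move=> u _; rewrite derive1E derive_val.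
have E : (fun u => exponential_pdf e u * cos (u * x)) =
    (fun u => exponential_pdf e u * (1 + cos (u * x)) - exponential_pdf e u).
  by apply/funext => u; ring.
have ipos : itb mu setT (fun u => exponential_pdf e u * (1 + cos (u * x))).
  under [X in itb _ _ X]eq_fun do rewrite mulrDr mulr1.
  by apply: itbD => //; [exact: itb_exp_pdf|exact: itb_exp_cos].
rewrite E RintB//; last exact: itb_exp_pdf.
rewrite [X in _ - X](_ : _ = 1); last first.
  by rewrite /Rintegral integral_exponential_pdf.
rewrite [X in X - _](_ : _ = 0 - F 0).
  by rewrite /F mulr0 expR0 mul0r sin0 cos0; field.
rewrite -key [RHS]Rintegral_mkcond; apply: eq_Rintegral => u _.
rewrite /exponential_pdf !patchE; case: ifP => // _; last by rewrite mul0r.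
Qed.

Lemma Rint_cauchy_itv (e x a b : R) : 0 < e -> a < b ->
  \int[mu]_y (\1_`[a, b] y * (e ^+ 2 / (e ^+ 2 + (y - x) ^+ 2))) =
  e * (atan ((b - x) / e) - atan ((a - x) / e)).
Proof.
move=> e0 ab.
have q (y : R) : e ^+ 2 + (y - x) ^+ 2 != 0.
  by rewrite gt_eqF// ltr_pwDl ?exprn_gt0 ?sqr_ge0.
have e1 : e != 0 by rewrite gt_eqF.
rewrite mulrBr; transitivity (\int[mu]_(y in `[a, b]) (e ^+ 2 / (e ^+ 2 + (y - x) ^+ 2))).
  rewrite [RHS]Rintegral_mkcond; apply: eq_Rintegral => u _.
  by rewrite patchE indicE; case: ifP => _; rewrite ?mul1r ?mul0r.
apply: (@Rint_ftc R _ (fun y => e * atan ((y - x) / e))) => //.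
- move=> y _; derive_auto; field; by rewrite e1 q.
- by apply: continuous_subspaceT; cont_auto.
Qed.

Section Transform.
Context {d} {T : measurableType d} (P : probability T R) (Z D : T -> R).
Hypotheses (mZ : measurable_fun setT Z) (iD : itb P setT D).

(** Smoothing the indicator of [a, b] by a Cauchy kernel gives a difference of arctangents. Two
    exchanges of integrals express its mean under the signed density [D] through the cosine and sine
    transforms alone. *)
Lemma Rint_mollified (e a b : R) : 0 < e -> a < b ->
  \int[P]_t (D t * (e * (atan ((b - Z t) / e) - atan ((a - Z t) / e)))) =
  \int[mu]_y (\1_`[a, b] y * \int[mu]_u (exponential_pdf e u *
    (cos (u * y) * \int[P]_t (D t * cos (u * Z t)) +
     sin (u * y) * \int[P]_t (D t * sin (u * Z t))))).
Proof.
move=> e0 ab.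
have mD := itb_meas iD.
have q (y : R) : 0 < e ^+ 2 + y ^+ 2 by rewrite ltr_pwDl ?exprn_gt0 ?sqr_ge0.
have mcos : measurable_fun setT (@cos R) by exact: continuous_measurable_fun (@continuous_cos R).
have msin : measurable_fun setT (@sin R) by exact: continuous_measurable_fun (@continuous_sin R).
have normrk (z : R) : `|e ^+ 2 / (e ^+ 2 + z ^+ 2)| <= 1.
  by rewrite ger0_norm ?divr_ge0 ?sqr_ge0 ?(ltW (q _))// ler_pdivrMr// mul1r lerDl sqr_ge0.
have mk : measurable_fun setT (fun z : R => e ^+ 2 / (e ^+ 2 + z ^+ 2)).
  by apply: continuous_measurable_fun; cont_auto; rewrite gt_eqF.
have iDc u : itb P setT (fun t => D t * cos (u * Z t)).
  apply: itb_le iD => //.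
    by apply: measurable_funM => //; apply: measurableT_comp => //; apply: measurable_funM.
  by move=> t _; rewrite normrM ler_piMr// ler_norml cos_geN1 cos_le1.
have iDs u : itb P setT (fun t => D t * sin (u * Z t)).
  apply: itb_le iD => //.
    by apply: measurable_funM => //; apply: measurableT_comp => //; apply: measurable_funM.
  by move=> t _; rewrite normrM ler_piMr// ler_norml sin_geN1 sin_le1.
transitivity (\int[P]_t \int[mu]_y (D t * (\1_`[a, b] y * (e ^+ 2 / (e ^+ 2 + (y - Z t) ^+ 2))))).
  apply: eq_Rintegral => t _; rewrite RintZ//; last first.
    apply: itb_le (integrable_indic_itv a b true false) => //.
      apply: measurable_funM => //.
      apply: (measurableT_comp (f := fun z : R => e ^+ 2 / (e ^+ 2 + z ^+ 2))) => //.
      exact: measurable_funB.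
    by move=> y _; rewrite normrM ler_piMr.
  by rewrite Rint_cauchy_itv.
rewrite (@Rint_fubini R _ _ _ _ P mu _ (fun t => `|D t|) (\1_`[a, b])).
- apply: eq_Rintegral => y _.
  transitivity (\int[P]_t (\1_`[a, b] y * \int[mu]_u (D t * (exponential_pdf e u * cos (u * (y - Z t)))))).
    apply: eq_Rintegral => t _; rewrite RintZ//; last exact: itb_exp_cos.
    by rewrite Rint_exp_cos//; ring.
  rewrite RintZ//; last first.
    rewrite (_ : (fun t => _) = (fun t => D t * (e ^+ 2 / (e ^+ 2 + (y - Z t) ^+ 2)))); last first.
      by apply/funext => t; rewrite RintZ ?Rint_exp_cos//; exact: itb_exp_cos.
    apply: itb_le iD => //.
      apply: measurable_funM => //.
      apply: (measurableT_comp (f := fun z : R => e ^+ 2 / (e ^+ 2 + z ^+ 2))) => //.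
      exact: measurable_funB.
    move=> t _; rewrite normrM ler_piMr// normrk.
  congr (_ * _).
  rewrite (@Rint_fubini R _ _ _ _ P mu _ (fun t => `|D t|) (exponential_pdf e)).
  + apply: eq_Rintegral => u _.
    rewrite -!RintZ// -RintD//; [|exact: itbZ|exact: itbZ].
    rewrite -RintZ//; last by apply: itbD => //; exact: itbZ.
    by apply: eq_Rintegral => t _; rewrite mulrBr cosB; ring.
  + apply: measurable_funM; first exact: measurableT_comp mD (measurable_fst).
    apply: measurable_funM; first exact: measurableT_comp (measurable_exponential_pdf e) (measurable_snd).
    apply: measurableT_comp => //; apply: measurable_funM; first exact: measurable_snd.
    by apply: measurable_funB => //; exact: measurableT_comp mZ (measurable_fst).
  + exact: (integrable_norm iD).
  + exact: itb_exp_pdf.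
  + move=> t u; rewrite !normrM ler_wpM2l// (ger0_norm (exponential_pdf_ge0 (ltW e0) u)).
    by rewrite ler_piMr ?exponential_pdf_ge0 ?(ltW e0)// ler_norml cos_geN1 cos_le1.
- apply: measurable_funM; first exact: measurableT_comp mD (measurable_fst).
  apply: measurable_funM.
    apply: (measurableT_comp (f := \1_`[a, b] : R -> R)); last exact: measurable_snd.
    exact: measurable_indic.
  apply: (measurableT_comp (f := fun z : R => e ^+ 2 / (e ^+ 2 + z ^+ 2))) => //.
  by apply: measurable_funB; [exact: measurable_snd|exact: measurableT_comp mZ (measurable_fst)].
- exact: (integrable_norm iD).
- exact: (integrable_indic_itv a b true false).
- move=> t y; rewrite [X in X <= _]normrM ler_wpM2l// normrM.
  by rewrite [X in X * _]ger0_norm// ler_piMr.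
Qed.

End Transform.

Lemma cvg_atan_nat (v : nat -> R) : (\forall n \near \oo, n%:R <= v n) ->
  atan (v n) @[n --> \oo] --> pi / 2.
Proof.
move=> h; apply: (@squeeze_cvgr _ _ _ _ (fun n => atan n%:R) (fun=> pi / 2)).
- near=> n; rewrite (ltW (atan_ltpi2 _)) andbT; apply: le_atan.
  by near: n.
- exact: (cvg_comp _ _ (@cvgr_idn R) (@cvgy_atan R)).
- exact: cvg_cst.
Unshelve. all: end_near. Qed.

(** The interval [a + 1/(n+1), a + n + 2] exhausts the open half-line, and the width (n+1)^-2 is
    small against the gap 1/(n+1) at the left end, so that the limit is 0 also at x = a. *)
Lemma cvg_atan_step (a x : R) :
  (atan ((a + n.+2%:R - x) / (n.+1%:R ^- 2)) - atan ((a + n.+1%:R^-1 - x) / (n.+1%:R ^- 2))) / pi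
    @[n --> \oo] --> (\1_`]a, +oo[ x : R).
Proof.
have h1 : atan ((a + n.+2%:R - x) / (n.+1%:R ^- 2)) @[n --> \oo] --> pi / 2.
  apply: cvg_atan_nat; near=> n; rewrite invrK.
  have nx : x - a <= n%:R by near: n; exact: nbhs_infty_ger.
  rewrite -!natr1; have : 0 <= (n%:R : R) by [].
  by move: (n%:R : R) nx => m; nra.
have np (n : nat) : (n.+1%:R : R) != 0 by [].
rewrite indicE; case: (ltP a x) => hx.
- rewrite mem_set/=; last by rewrite in_itv/= hx.
  have h2 : atan ((a + n.+1%:R^-1 - x) / (n.+1%:R ^- 2)) @[n --> \oo] --> - (pi / 2).
    under eq_fun do rewrite -[atan _]opprK -atanN.
    apply: cvgN; apply: cvg_atan_nat; near=> n; rewrite invrK.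
    rewrite (_ : - _ = n.+1%:R * ((x - a) * n.+1%:R - 1)); last first.
      by field.
    have nx : 2 / (x - a) <= n%:R by near: n; exact: nbhs_infty_ger.
    move: nx; rewrite ler_pdivrMr ?subr_gt0// -[n.+1%:R]natr1.
    have : 0 <= (n%:R : R) by []. move: (n%:R : R) => m; nra.
  apply: cvg_to_eq (cvgM (cvgB h1 h2) (cvg_cst (pi : R)^-1)) _.
  by rewrite opprK -splitr divff// gt_eqF// pi_gt0.
- rewrite memNset/=; last by rewrite in_itv/= andbT; apply/negP; rewrite -leNgt.
  have h2 : atan ((a + n.+1%:R^-1 - x) / (n.+1%:R ^- 2)) @[n --> \oo] --> pi / 2.
    apply: cvg_atan_nat; apply: nearW => n; rewrite invrK.
    rewrite (_ : _ * _ = n.+1%:R + (a - x) * n.+1%:R ^+ 2); last by field.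
    have := sqr_ge0 (n.+1%:R : R); rewrite -natr1; nra.
  by apply: cvg_to_eq (cvgM (cvgB h1 h2) (cvg_cst (pi : R)^-1)) _; rewrite subrr mul0r.
Unshelve. all: end_near. Qed.

Section Uniqueness.
Context {d} {T : measurableType d} (P : probability T R) (Z D : T -> R).
Context {d'} {T' : measurableType d'} (P' : probability T' R) (Z' D' : T' -> R).
Hypotheses (mZ : measurable_fun setT Z) (iD : itb P setT D).
Hypotheses (mZ' : measurable_fun setT Z') (iD' : itb P' setT D').
Hypothesis eqcos : forall u : R,
  \int[P]_t (D t * cos (u * Z t)) = \int[P']_t (D' t * cos (u * Z' t)).
Hypothesis eqsin : forall u : R,
  \int[P]_t (D t * sin (u * Z t)) = \int[P']_t (D' t * sin (u * Z' t)).

Lemma itb_mul_indic {d0} {T0 : measurableType d0} (P0 : probability T0 R) (Z0 D0 : T0 -> R)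
  (S : set R) : measurable S -> measurable_fun setT Z0 -> itb P0 setT D0 ->
  itb P0 setT (fun t => D0 t * \1_S (Z0 t)).
Proof.
move=> mS mZ0 iD0; have mD0 := itb_meas iD0; apply: itb_le iD0 => //.
  apply: measurable_funM => //.
  by apply: (measurableT_comp (f := \1_S : R -> R)).
by move=> t _; rewrite normrM ler_piMr// ger0_norm// indicE; case: (_ \in _).
Qed.

Lemma cvg_Rint_atan_step {d0} {T0 : measurableType d0} (P0 : probability T0 R) (Z0 D0 : T0 -> R)
  (a : R) : measurable_fun setT Z0 -> itb P0 setT D0 ->
  \int[P0]_t (D0 t * ((atan ((a + n.+2%:R - Z0 t) / (n.+1%:R ^- 2)) -
     atan ((a + n.+1%:R^-1 - Z0 t) / (n.+1%:R ^- 2))) / pi)) @[n --> \oo] -->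
  \int[P0]_t (D0 t * \1_`]a, +oo[ (Z0 t)).
Proof.
move=> mZ0 iD0; apply: (Rint_dct measurableT (g := fun t => `|D0 t|) _ _ _ _).2.
- move=> n; apply: measurable_funM; first exact: itb_meas iD0.
  apply: measurable_funM => //.
  have matan : measurable_fun setT (@atan R).
    by apply: continuous_measurable_fun => x; exact: continuous_atan.
  by apply: measurable_funB; apply: measurableT_comp => //; apply: measurable_funM => //; exact: measurable_funB.
- by move=> t _; apply: cvgM; [exact: cvg_cst|exact: cvg_atan_step].
- exact: (integrable_norm iD0).
- move=> n t _; rewrite normrM ler_piMr// normrM [X in _ * X]gtr0_norm ?invr_gt0 ?pi_gt0//.
  rewrite ler_pdivrMr ?pi_gt0// mul1r ler_norml.
  move: (_ / _) (_ / _) => y z.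
  by have := atan_ltpi2 y; have := atan_ltpi2 z; have := atan_gtNpi2 y; have := atan_gtNpi2 z; lra.
Qed.

(** The mollified integrals of both sides are the same functional of the transforms; the common
    factor e pi is cancelled before passing to the limit. *)
Lemma uniq_halfline (a : R) :
  \int[P]_t (D t * \1_`]a, +oo[ (Z t)) = \int[P']_t (D' t * \1_`]a, +oo[ (Z' t)).
Proof.
have h := @cvg_Rint_atan_step _ _ P Z D a mZ iD.
have h' := @cvg_Rint_atan_step _ _ P' Z' D' a mZ' iD'.
apply: (eq_cvg_unique h h') => n.
have e0 : 0 < (n.+1%:R : R) ^- 2 by rewrite invr_gt0 exprn_gt0.
have ab : a + n.+1%:R^-1 < a + n.+2%:R.
  by rewrite ltrD2l (@le_lt_trans _ _ 1)// ?ltr1n// invf_le1// ler1n.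
have := @Rint_mollified _ _ P Z D mZ iD _ _ _ e0 ab.
have := @Rint_mollified _ _ P' Z' D' mZ' iD' _ _ _ e0 ab.
under [in X in _ = X -> _]eq_Rintegral do under eq_Rintegral do rewrite -eqcos -eqsin.
move=> <-.
move: ((n.+1%:R : R) ^- 2) e0 => e e0.
have aux d0 (T0 : measurableType d0) (P0 : probability T0 R) (Z0 D0 : T0 -> R) :
   measurable_fun setT Z0 -> itb P0 setT D0 ->
   \int[P0]_t (D0 t * (e * (atan ((a + n.+2%:R - Z0 t) / e) - atan ((a + n.+1%:R^-1 - Z0 t) / e)))) =
   (e * pi) * \int[P0]_t (D0 t * ((atan ((a + n.+2%:R - Z0 t) / e) - atan ((a + n.+1%:R^-1 - Z0 t) / e)) / pi)).
  move=> mZ0 iD0; rewrite -RintZ//.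
    have pn : pi != 0 :> R by rewrite gt_eqF// pi_gt0.
    apply: eq_Rintegral => t _; rewrite -[in LHS](divfK pn (_ - _)).
    by move: (_ / pi) => y; ring.
  have mD0 := itb_meas iD0; apply: itb_le iD0 => //.
    apply: measurable_funM => //; apply: measurable_funM => //.
    have matan : measurable_fun setT (@atan R).
      by apply: continuous_measurable_fun => x; exact: continuous_atan.
    by apply: measurable_funB; apply: measurableT_comp => //; apply: measurable_funM => //; exact: measurable_funB.
  move=> t _; rewrite normrM ler_piMr// normrM [X in _ * X]gtr0_norm ?invr_gt0 ?pi_gt0//.
  rewrite ler_pdivrMr ?pi_gt0// mul1r ler_norml.
  move: (_ / _) (_ / _) => y z.
  by have := atan_ltpi2 y; have := atan_ltpi2 z; have := atan_gtNpi2 y; have := atan_gtNpi2 z; lra.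
rewrite !aux// => /mulfI; apply.
by rewrite mulf_neq0 ?gt_eqF ?pi_gt0.
Qed.

(** Open half-lines are stable under intersection and generate the Borel sets. Signed densities are
    allowed because there are two uses: with density 1 the lemma identifies Gaussian laws, with
    density G it shows that a function orthogonal to all powers vanishes. *)
Lemma uniq_measurable (S : set R) : measurable S ->
  \int[P]_t (D t * \1_S (Z t)) = \int[P']_t (D' t * \1_S (Z' t)).
Proof.
pose Q (S : set R) := \int[P]_t (D t * \1_S (Z t)) = \int[P']_t (D' t * \1_S (Z' t)).
have tot : \int[P]_t D t = \int[P']_t D' t.
  have := eqcos 0; under eq_Rintegral do rewrite mul0r cos0 mulr1.
  by under [in X in _ = X -> _]eq_Rintegral do rewrite mul0r cos0 mulr1.
move=> mS; apply: (dynkin_induction (G := @RGenOInfty.G R) (P := Q)) => //.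
- exact: RGenOInfty.measurableE.
- move=> _ _ [x ->] [y ->]; exists (Num.max x y); rewrite predeqE => z /=.
  by rewrite !in_itv/= !andbT gt_max; split => [[-> ->]//|/andP].
- rewrite /Q; under eq_Rintegral do rewrite indicT mulr1.
  by under [in RHS]eq_Rintegral do rewrite indicT mulr1.
- by move=> _ [x ->]; exact: uniq_halfline.
- move=> B mB QB; rewrite /Q.
  under eq_Rintegral do rewrite indicCx mulrBr mulr1.
  under [in RHS]eq_Rintegral do rewrite indicCx mulrBr mulr1.
  rewrite !RintB ?QB ?tot//; exact: itb_mul_indic.
- move=> F mF tF QF; rewrite /Q.
  have aux d0 (T0 : measurableType d0) (P0 : probability T0 R) (Z0 D0 : T0 -> R) :
      measurable_fun setT Z0 -> itb P0 setT D0 ->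
      \sum_(i < n) \int[P0]_t (D0 t * \1_(F i) (Z0 t)) @[n --> \oo] -->
      \int[P0]_t (D0 t * \1_(\bigcup_n F n) (Z0 t)).
    move=> mZ0 iD0.
    have iF i : itb P0 setT (fun t => D0 t * \1_(F i) (Z0 t)) by exact: itb_mul_indic.
    rewrite (_ : (fun n => _) = (fun n => \int[P0]_t (\sum_(i < n) D0 t * \1_(F i) (Z0 t)))); last first.
      by apply/funext => n; rewrite (Rint_sum measurableT).
    (* By disjointness at most one index contributes: the partial sums of indicators are 0 or 1,
       which gives both the limit and the domination. *)
    have sumF x n : (exists2 k, F k x & \sum_(i < n) \1_(F i) x = (k < n)%N%:R :> R) \/
        (~ (\bigcup_n F n) x /\ \sum_(i < n) \1_(F i) x = 0 :> R).
      have [[k _ Fk]|nF] := pselect ((\bigcup_n F n) x).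
        left; exists k => //.
        have E i : \1_(F i) x = (i == k)%:R :> R.
          rewrite indicE; have [->|ik] := eqVneq i k; first by rewrite mem_set.
          rewrite memNset// => Fi; move: ik; apply/negP; rewrite negbK; apply/eqP.
          by apply: tF => //; exists x.
        under eq_bigr do rewrite E.
        have [kn|nk] := ltnP k n.
          rewrite (bigD1 (Ordinal kn))//= eqxx big1 ?addr0// => i ik.
          by rewrite -val_eqE/= in ik; rewrite (negbTE ik).
        by rewrite big1// => i _; rewrite ltn_eqF// (leq_trans (ltn_ord i)).
      right; split => //; rewrite big1// => i _; rewrite indicE memNset// => Fi.
      by apply: nF; exists i.
    apply: (Rint_dct measurableT (g := fun t => `|D0 t|) _ _ _ _).2.
    + by move=> n; apply: itb_meas; apply: itb_sum.
    + move=> t _; under eq_fun do rewrite -mulr_sumr; apply: cvgM; first exact: cvg_cst.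
      case: (sumF (Z0 t) 0%N) => [[k Fk _]|[nF _]].
        rewrite indicE mem_set; last by exists k.
        apply: cvg_near_cst; near=> n.
        case: (sumF (Z0 t) n) => [[l Fl ->]|[nF _]]; last by exfalso; apply: nF; exists k.
        have -> : l = k by apply: tF => //; exists (Z0 t).
        rewrite (_ : (k < n)%N)//; near: n; exact: nbhs_infty_gt.
      rewrite indicE memNset//; apply: cvg_near_cst; apply: nearW => n.
      by case: (sumF (Z0 t) n) => [[l Fl _]|[_ ->]] //; exfalso; apply: nF; exists l.
    + exact: (integrable_norm iD0).
    + move=> n t _; rewrite -mulr_sumr normrM ler_piMr//.
      case: (sumF (Z0 t) n) => [[l Fl ->]|[_ ->]]; rewrite ?normr0//.
      by case: (_ < _)%N; rewrite ?normr1 ?normr0.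
  have h := aux _ _ P Z D mZ iD; have h' := aux _ _ P' Z' D' mZ' iD'.
  by apply: (eq_cvg_unique h h') => n; apply: eq_bigr => i _; exact: QF.
- exact: (eq_ind _ (fun M : set (set R) => M S) mS _ (RGenOInfty.measurableE R)).
Unshelve. all: by end_near. Qed.

End Uniqueness.

End CosSinTransform.

(** * Gaussian laws *)

Section StandardNormal.
Context {R : realType}.
Notation mu := (@lebesgue_measure R).
Notation gam := (normal_prob (0 : R) 1).
Notation w := (normal_pdf (0 : R) 1).

(** The normal law is defined by integrating its density, which therefore agrees almost everywhere
    with the Radon-Nikodym derivative; the change of variables is known for the latter. *)
Lemma ge0_integral_normal (f : R -> \bar R) : measurable_fun setT f ->
  (forall x, (0 <= f x)%E) ->
  (\int[gam]_x f x = \int[mu]_x (f x * (w x)%:E))%E.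
Proof.
move=> mf f0; have dom := normal_prob_dominates (0 : R) 1.
rewrite -(Radon_Nikodym_SigmaFinite.change_of_variables dom f0 measurableT mf).
have iRN := Radon_Nikodym_SigmaFinite.f_integrable dom.
apply: ae_eq_integral => //.
- by apply: emeasurable_funM => //; exact: measurable_int iRN.
- apply: emeasurable_funM => //; apply/measurable_EFinP; exact: measurable_normal_pdf.
- apply: ae_eqe_mul2l; apply: integral_ae_eq => //.
  + by apply/measurable_EFinP; exact: measurable_normal_pdf.
  + by move=> E _ mE; rewrite -Radon_Nikodym_SigmaFinite.f_integral.
Qed.

Lemma itb_normal (f : R -> R) : measurable_fun setT f ->
  itb mu setT (fun x => f x * w x) -> itb gam setT f.
Proof.
move=> mf /integrableP[_ h]; apply/integrableP; split; first exact/measurable_EFinP.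
rewrite ge0_integral_normal//; last by apply: measurableT_comp => //; exact/measurable_EFinP.
apply: le_lt_trans h; rewrite le_eqVlt; apply/orP; left; apply/eqP.
apply: eq_integral => x _; rewrite /= -EFinM normrM; congr (_ * _)%:E.
by rewrite ger0_norm// normal_pdf_ge0.
Qed.

(** The nonnegative case suffices, through f = (f + |f|) - |f|. *)
Lemma Rint_normal (f : R -> R) : measurable_fun setT f ->
  itb mu setT (fun x => f x * w x) -> \int[gam]_x f x = \int[mu]_x (f x * w x).
Proof.
move=> mf h; have ig := itb_normal mf h.
have w0 x : 0 <= w x by exact: normal_pdf_ge0.
have mw : measurable_fun setT w by exact: measurable_normal_pdf.
have key (g : R -> R) : measurable_fun setT g -> (forall x, 0 <= g x) ->
    \int[gam]_x g x = \int[mu]_x (g x * w x).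
  move=> mg g0; rewrite /Rintegral ge0_integral_normal//; first exact/measurable_EFinP.
have mn : measurable_fun setT (fun x => `|f x|) by exact: measurableT_comp.
have in1 : itb gam setT (fun x => `|f x|) by exact: (integrable_norm ig).
have hn : itb mu setT (fun x => `|f x| * w x).
  apply: itb_le h => //; first by apply: measurable_funM.
  by move=> x _; rewrite !normrM normr_id.
have -> : \int[gam]_x f x = \int[gam]_x (f x + `|f x|) - \int[gam]_x `|f x|.
  by rewrite RintD// addrK.
rewrite !key//; last 2 first.
- exact: measurable_funD.
- by move=> x; have := ler_norm (- f x); rewrite normrN; lra.
rewrite -RintB//; last first.
  rewrite (_ : (fun x => _) = (fun x => f x * w x + `|f x| * w x)); first exact: itbD.
  by apply/funext => x; rewrite mulrDl.
by apply: eq_Rintegral => x _; rewrite mulrDl addrK.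
Qed.

Lemma normal_pdf01E (x : R) : w x = normal_peak 1 * expR (- (x ^+ 2 / 2)).
Proof.
by rewrite normal_pdfE ?oner_eq0// /normal_fun subr0 expr1n mulNr.
Qed.

Lemma peak_gt0 : 0 < normal_peak (1 : R).
Proof. by rewrite normal_peak_gt0// oner_eq0. Qed.

(** The exponent x^2 / 4 is that of the centered normal density of variance 2. *)
Lemma itb_expN4 : itb mu setT (fun x : R => expR (- (x ^+ 2 / 4))).
Proof.
have s0 : Num.sqrt (2 : R) != 0 by rewrite gt_eqF// sqrtr_gt0.
rewrite (_ : (fun x => _) = (fun x => (normal_peak (Num.sqrt 2))^-1 * normal_pdf 0 (Num.sqrt 2) x)).
  by apply: itbZ => //; exact: integrable_normal_pdf.
apply/funext => x; rewrite normal_pdfE// mulKf ?gt_eqF ?normal_peak_gt0//.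
by rewrite /normal_fun subr0 sqr_sqrtr// mulNr -[2 *+ 2]mulr_natr -natrM.
Qed.

(** Half of the Gaussian exponent pays for the exponential factor: a |x| <= a^2 + x^2 / 4. *)
Lemma exp_abs_pdf_le (a x : R) :
  expR (a * `|x|) * w x <= normal_peak 1 * expR (a ^+ 2) * expR (- (x ^+ 2 / 4)).
Proof.
rewrite normal_pdf01E mulrCA -mulrA ler_pM2l ?peak_gt0// -!expRD ler_expR.
rewrite -(real_normK (num_real x)); have := sqr_ge0 (a - `|x| / 2); nra.
Qed.

Lemma itb_normal_exp (a : R) : itb gam setT (fun x => expR (a * `|x|)).
Proof.
have me : measurable_fun setT (fun x : R => expR (a * `|x|)).
  by apply: measurableT_comp => //; apply: measurable_funM => //; exact: measurableT_comp.
apply: itb_normal => //.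
apply: itb_le (itbZ measurableT (normal_peak 1 * expR (a ^+ 2)) itb_expN4) => //.
  by apply: measurable_funM => //; exact: measurable_normal_pdf.
move=> x _; rewrite [leLHS]ger0_norm; last by rewrite mulr_ge0 ?expR_ge0 ?normal_pdf_ge0.
exact: le_trans (exp_abs_pdf_le a x) (ler_norm _).
Qed.

Lemma expr_le_exp (m : nat) (x : R) : 0 <= x -> x ^+ m <= m`!%:R * expR x.
Proof.
move=> x0; case: m => [|m].
  by rewrite expr0 fact0 mul1r -expR0 ler_expR.
have := expR_ge1Dxn m x0; have : 0 < (m.+1`!%:R : R) by rewrite ltr0n fact_gt0.
move=> f0 h; rewrite mulrC -ler_pdivrMr//; lra.
Qed.

Lemma itb_normal_pow (m : nat) : itb gam setT (fun x => x ^+ m).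
Proof.
apply: itb_le (itbZ measurableT (m`!%:R) (itb_normal_exp 1)) => //.
move=> x _; rewrite normrX mul1r (le_trans (expr_le_exp m (normr_ge0 x)))//.
by rewrite ler_norm.
Qed.

Lemma Rint_total_derivative (F f : R -> R) (C : R) :
  (forall x : R, is_derive x 1 F (f x)) -> continuous f -> itb mu setT f ->
  (forall x, `|F x| <= C * expR (- (x ^+ 2 / 4))) -> \int[mu]_x f x = 0.
Proof.
move=> dF cf jf Fb.
have mf := itb_meas jf.
have [_ h1] : itb mu setT f /\ \int[mu]_x (\1_`[- n.+1%:R, n.+1%:R] x * f x) @[n --> \oo] --> \int[mu]_x f x.
  apply: (@Rint_dct _ _ _ mu _ measurableT (fun n x => \1_`[- n.+1%:R, n.+1%:R] x * f x)
    f (fun x => `|f x|)).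
  - by move=> n; apply: measurable_funM.
  - move=> x _; apply: cvg_near_cst; near=> n.
    rewrite indicE mem_set ?mul1r//= in_itv/= -ler_norml.
    have : `|x| <= n%:R by near: n; exact: nbhs_infty_ger.
    by move/le_trans; apply; rewrite ler_nat.
  - exact: (integrable_norm jf).
  - by move=> n x _; rewrite normrM ler_piMl// indicE; case: (_ \in _); rewrite ?normr1 ?normr0.
have h2 : \int[mu]_x (\1_`[- n.+1%:R, n.+1%:R] x * f x) @[n --> \oo] --> (0 : R).
  have E n : \int[mu]_x (\1_`[- n.+1%:R, n.+1%:R] x * f x) = F n.+1%:R - F (- n.+1%:R).
    rewrite -(@Rint_ftc R f F (- n.+1%:R) n.+1%:R)//.
    + rewrite [RHS]Rintegral_mkcond; apply: eq_Rintegral => u _.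
      by rewrite patchE indicE; case: ifP => _; rewrite ?mul1r ?mul0r.
    + by rewrite gtrN.
    + exact: continuous_subspaceT.
  rewrite (_ : (fun n => _) = (fun n => F n.+1%:R - F (- n.+1%:R))); last exact/funext.
  have he : 2 * `|C| * expR 4 * expR (- n%:R) @[n --> \oo] --> (0 : R).
    rewrite -(mulr0 (2 * `|C| * expR 4)); apply: cvgM; first exact: cvg_cst.
    exact: cvgn_expR.
  apply: (@squeeze_cvgr _ _ _ _ (fun n => - (2 * `|C| * expR 4 * expR (- n%:R))) (fun n => 2 * `|C| * expR 4 * expR (- n%:R))) => //.
    apply: nearW => n; rewrite -ler_norml (le_trans (ler_normB _ _))//.
    have hb (y : R) : `|y| = n.+1%:R -> `|F y| <= `|C| * expR 4 * expR (- n%:R).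
      move=> yn; rewrite (le_trans (Fb y))// (le_trans (ler_wpM2r (expR_ge0 _) (ler_norm C)))//.
      rewrite -mulrA ler_wpM2l// -expRD ler_expR -(real_normK (num_real y)) yn -natr1.
      by have := sqr_ge0 ((n%:R : R) - 1); nra.
    have := hb n.+1%:R; rewrite ger0_norm// => /(_ erefl) H1.
    have := hb (- n.+1%:R); rewrite normrN ger0_norm// => /(_ erefl) H2.
    lra.
  by rewrite -oppr0; apply: cvgN.
exact: (eq_cvg_unique h1 h2).
Unshelve. all: end_near. Qed.

Lemma is_derive_normal_pdf (x : R) : is_derive x 1 w (- x * w x).
Proof.
rewrite (_ : w = fun x => normal_peak 1 * expR (- (x ^+ 2 / 2))); last first.
  by apply/funext => y; rewrite normal_pdf01E.
by derive_auto; field.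
Qed.

Lemma abs_pow_pdf_le m (x : R) :
  `|x| ^+ m * w x <= m`!%:R * (normal_peak 1 * expR 1) * expR (- (x ^+ 2 / 4)).
Proof.
have h := exp_abs_pdf_le 1 x; rewrite mul1r expr1n in h.
rewrite -mulrA; apply: (@le_trans _ _ (m`!%:R * (expR `|x| * w x))).
  by rewrite mulrA ler_wpM2r ?normal_pdf_ge0// expr_le_exp.
by rewrite ler_wpM2l.
Qed.

Lemma Rint_normalE m : \int[gam]_x (x ^+ m) = \int[mu]_x (x ^+ m * w x).
Proof.
apply: Rint_normal => //.
apply: itb_le (itbZ measurableT (m`!%:R * (normal_peak 1 * expR 1)) itb_expN4) => //.
  by apply: measurable_funM => //; exact: measurable_normal_pdf.
move=> x _; rewrite normrM normrX [X in _ * X]ger0_norm ?normal_pdf_ge0//.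
by rewrite (le_trans (abs_pow_pdf_le _ _))// ler_norm.
Qed.

Lemma itb_pow_pdf m : itb mu setT (fun x : R => x ^+ m * w x).
Proof.
apply: itb_le (itbZ measurableT (m`!%:R * (normal_peak 1 * expR 1)) itb_expN4) => //.
  by apply: measurable_funM => //; exact: measurable_normal_pdf.
move=> x _; rewrite normrM normrX [X in _ * X]ger0_norm ?normal_pdf_ge0//.
by rewrite (le_trans (abs_pow_pdf_le _ _))// ler_norm.
Qed.

Definition nmom (m : nat) : R := \int[gam]_x (x ^+ m).

Lemma nmom0 : nmom 0 = 1.
Proof.
rewrite /nmom; under eq_Rintegral do rewrite expr0.
by rewrite Rintegral_cst//= [X in fine X](@probability_setT _ _ _ gam) mulr1.
Qed.

(** Stein's identity: the density satisfies w' = - x w, so the integrand is the derivative of - x^m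
    w. At m = 0 the truncated predecessor is harmless because its factor is 0. *)
Lemma Rint_stein m : \int[mu]_x (x ^+ m.+1 * w x - m%:R * (x ^+ m.-1 * w x)) = 0.
Proof.
apply: (@Rint_total_derivative (fun x => - (x ^+ m * w x)) _ (m`!%:R * (normal_peak 1 * expR 1))).
- move=> x; apply: (is_derive_eq (dv_opp (dv_mul (dv_pow m (dv_id x)) (is_derive_normal_pdf x)))).
  by rewrite exprS; ring.
- move=> x; eapply dv_continuous; repeat derive_step; exact: is_derive_normal_pdf.
- by apply: itbB => //; [exact: itb_pow_pdf|apply: itbZ => //; exact: itb_pow_pdf].
- by move=> x; rewrite normrN normrM normrX [X in _ * X]ger0_norm ?normal_pdf_ge0// abs_pow_pdf_le.
Qed.

Lemma nmomS m : nmom m.+1 = m%:R * nmom m.-1.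
Proof.
rewrite /nmom !Rint_normalE; apply/eqP; rewrite -subr_eq0; apply/eqP.
rewrite -RintZ//; last exact: itb_pow_pdf.
by rewrite -RintB ?Rint_stein//; [exact: itb_pow_pdf|apply: itbZ => //; exact: itb_pow_pdf].
Qed.

Lemma nmom_odd k : nmom k.*2.+1 = 0.
Proof.
elim: k => [|k IH]; first by rewrite nmomS mul0r.
by rewrite doubleS nmomS /= IH mulr0.
Qed.

Lemma nmom_even k : nmom k.*2 = (k.*2)`!%:R / (2 ^+ k * k`!%:R).
Proof.
elim: k => [|k IH]; first by rewrite nmom0 fact0 expr0 mulr1 divr1.
rewrite doubleS nmomS /= IH !factS !natrM exprS.
have -> : (k.*2.+2%:R : R) = 2 * (k%:R + 1) by rewrite -!natr1 -muln2 natrM; ring.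
have -> : (k.*2.+1%:R : R) = 2 * k%:R + 1 by rewrite -!natr1 -muln2 natrM; ring.
have -> : (k.+1%:R : R) = k%:R + 1 by rewrite natr1.
have f1 : (k`!%:R : R) != 0 by rewrite pnatr_eq0 -lt0n fact_gt0.
have f2 : (2 : R) ^+ k != 0 by rewrite expf_neq0.
have f3 : (k%:R : R) + 1 != 0 by rewrite natr1.
by field; rewrite f1 f2 f3.
Qed.

End StandardNormal.

(** * Trigonometric series under the integral sign *)

Section CosSeries.
Context {R : realType}.

Lemma series_exp_le (x : R) n : 0 <= x -> \sum_(k < n) x ^+ k / k`!%:R <= expR x.
Proof.
move=> x0; rewrite -(big_mkord xpredT (fun k => x ^+ k / k`!%:R)).
rewrite /expR; apply: (@nondecreasing_cvgn_le R (series (exp_coeff x))).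
  by apply: nondecreasing_series => i _ _; rewrite exp_coeff_ge0.
exact: is_cvg_series_exp_coeff.
Qed.

Lemma series_exp_even_le (x : R) n : 0 <= x ->
  \sum_(k < n) x ^+ k.*2 / (k.*2)`!%:R <= expR x.
Proof.
move=> x0; apply: le_trans (series_exp_le n.*2 x0).
elim: n => [|n IH]; first by rewrite !big_ord0.
rewrite doubleS !big_ord_recr /= -addrA lerD// lerDl divr_ge0// exprn_ge0//.
Qed.

Lemma series_exp_odd_le (x : R) n : 0 <= x ->
  \sum_(k < n) x ^+ k.*2.+1 / (k.*2.+1)`!%:R <= expR x.
Proof.
move=> x0; apply: le_trans (series_exp_le n.*2 x0).
elim: n => [|n IH]; first by rewrite !big_ord0.
rewrite doubleS !big_ord_recr /= -addrA lerD// lerDr divr_ge0// exprn_ge0//.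
Qed.

Context {d} {T : measurableType d} (P : probability T R) (B Z : T -> R).

(** The partial sums of the cosine series of u Z are bounded by the exponential of |u Z|, which
    dominates uniformly in n. *)
Lemma cvg_Rint_cos_series (u : R) : measurable_fun setT B -> measurable_fun setT Z ->
  itb P setT (fun t => `|B t| * expR (`|u| * `|Z t|)) ->
  \int[P]_t (\sum_(k < n) B t * cos_coeff' (u * Z t) k) @[n --> \oo] -->
  \int[P]_t (B t * cos (u * Z t)).
Proof.
move=> mB mZ dom; apply: (Rint_dct measurableT (g := fun t => `|B t| * expR (`|u| * `|Z t|)) _ _ _ _).2 => //.
- move=> n; apply: measurable_sum => k; apply: measurable_funM => //.
  apply: measurable_funM => //; apply: measurable_funM => //; apply: measurable_funX.
  exact: measurable_funM.
- move=> t _; under eq_fun do rewrite -mulr_sumr; apply: cvgM; first exact: cvg_cst.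
  have := @cvg_cos_coeff' R (u * Z t); rewrite /series /=.
  by under [X in X @ _ --> _ -> _]eq_fun do rewrite big_mkord.
- move=> n t _; rewrite -mulr_sumr normrM ler_wpM2l//.
  rewrite (le_trans (ler_norm_sum _ _ _))// -normrM.
  apply: le_trans (series_exp_even_le n (normr_ge0 (u * Z t))); apply: ler_sum => k _.
  rewrite /cos_coeff' !normrM normrX normrX normrN1 expr1n mul1r.
  by rewrite [X in _ * X]ger0_norm ?invr_ge0// normrM.
Qed.

Lemma cvg_Rint_sin_series (u : R) : measurable_fun setT B -> measurable_fun setT Z ->
  itb P setT (fun t => `|B t| * expR (`|u| * `|Z t|)) ->
  \int[P]_t (\sum_(k < n) B t * sin_coeff' (u * Z t) k) @[n --> \oo] -->
  \int[P]_t (B t * sin (u * Z t)).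
Proof.
move=> mB mZ dom; apply: (Rint_dct measurableT (g := fun t => `|B t| * expR (`|u| * `|Z t|)) _ _ _ _).2 => //.
- move=> n; apply: measurable_sum => k; apply: measurable_funM => //.
  apply: measurable_funM => //; apply: measurable_funM => //; apply: measurable_funX.
  exact: measurable_funM.
- move=> t _; under eq_fun do rewrite -mulr_sumr; apply: cvgM; first exact: cvg_cst.
  have := @cvg_sin_coeff' R (u * Z t); rewrite /series /=.
  by under [X in X @ _ --> _ -> _]eq_fun do rewrite big_mkord.
- move=> n t _; rewrite -mulr_sumr normrM ler_wpM2l//.
  rewrite (le_trans (ler_norm_sum _ _ _))// -normrM.
  apply: le_trans (series_exp_odd_le n (normr_ge0 (u * Z t))); apply: ler_sum => k _.
  rewrite /sin_coeff' !normrM normrX normrX normrN1 expr1n mul1r.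
  by rewrite [X in _ * X]ger0_norm ?invr_ge0// normrM.
Qed.

End CosSeries.

(** * Gaussian variables given by their characteristic function *)

Section GaussianVariables.
Context {R : realType}.
Notation mu := (@lebesgue_measure R).
Notation gam := (normal_prob (0 : R) 1).

Lemma itb_cst {d} {T : measurableType d} (P : probability T R) (c : R) : itb P setT (fun=> c).
Proof. exact: finite_measure_integrable_cst. Qed.

Lemma Rint_cst {d} {T : measurableType d} (P : probability T R) (c : R) : \int[P]_t c = c.
Proof. by rewrite Rintegral_cst//= [X in fine X](@probability_setT _ _ _ P) mulr1. Qed.

Lemma cvg_exp_series (x : R) : \sum_(k < n) x ^+ k / k`!%:R @[n --> \oo] --> expR x.
Proof.
rewrite (_ : (fun n => _) = series (exp_coeff x)); first exact: is_cvg_series_exp_coeff.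
by apply/funext => n; rewrite /series /= big_mkord.
Qed.

Lemma cos_coeffM (u x : R) k :
  cos_coeff' (u * x) k = ((-1) ^+ k * u ^+ k.*2 / (k.*2)`!%:R) * x ^+ k.*2.
Proof. by rewrite /cos_coeff' exprMn -exprnP; ring. Qed.

Lemma sin_coeffM (u x : R) k :
  sin_coeff' (u * x) k = ((-1) ^+ k * u ^+ k.*2.+1 / (k.*2.+1)`!%:R) * x ^+ k.*2.+1.
Proof. by rewrite /sin_coeff' exprMn -exprnP; ring. Qed.

(** Termwise integration turns the even moments (2k)! / (2^k k!) into the exponential series of -
    u^2 / 2. *)
Lemma Rint_normal_cos (u : R) : \int[gam]_x cos (u * x) = expR (- u ^+ 2 / 2).
Proof.
have := @cvg_Rint_cos_series R _ _ gam (fun=> 1) (fun x => x) u.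
move=> /(_ (measurable_cst _) (@measurable_id _ _ _)).
under [X in itb _ _ X -> _]eq_fun do rewrite normr1 mul1r.
move=> /(_ (itb_normal_exp _)) h.
under [in LHS]eq_Rintegral do rewrite -[cos _]mul1r.
have h2 := @cvg_exp_series (- u ^+ 2 / 2). apply: (eq_cvg_unique h h2) => n.
under eq_Rintegral do under eq_bigr do rewrite mul1r cos_coeffM.
rewrite (Rint_sum measurableT); last by move=> k _; apply: itbZ => //; exact: itb_normal_pow.
apply: eq_bigr => k _.
rewrite RintZ//; last exact: itb_normal_pow.
rewrite -/(nmom _) nmom_even -mul2n exprM mulNr [in RHS]exprNn [in RHS]exprMn exprVn.
have f1 : (k`!%:R : R) != 0 by rewrite pnatr_eq0 -lt0n fact_gt0.
have f2 : ((2 * k)`!%:R : R) != 0 by rewrite pnatr_eq0 -lt0n fact_gt0.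
have f3 : (2 : R) ^+ k != 0 by rewrite expf_neq0.
by move: f3; move: (2 ^+ k) => z f3; field; rewrite f1 f2 f3.
Qed.

Lemma Rint_normal_sin (u : R) : \int[gam]_x sin (u * x) = 0.
Proof.
have := @cvg_Rint_sin_series R _ _ gam (fun=> 1) (fun x => x) u.
move=> /(_ (measurable_cst _) (@measurable_id _ _ _)).
under [X in itb _ _ X -> _]eq_fun do rewrite normr1 mul1r.
move=> /(_ (itb_normal_exp _)) h.
under [in LHS]eq_Rintegral do rewrite -[sin _]mul1r.
apply: (eq_cvg_unique h (cvg_cst (0 : R))) => n.
under eq_Rintegral do under eq_bigr do rewrite mul1r sin_coeffM.
rewrite (Rint_sum measurableT); last by move=> k _; apply: itbZ => //; exact: itb_normal_pow.
rewrite big1// => k _.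
by rewrite RintZ// -/(nmom _) ?nmom_odd ?mulr0//; exact: itb_normal_pow.
Qed.

Section Law.
Context {d} {T : measurableType d} (P : probability T R).

(** The same data as in [centered_gaussian_process], for one variable; the degenerate variance 0 is
    included. *)
Definition gvar (Z : T -> R) (v : R) := [/\ measurable_fun setT Z,
  forall u : R, \int[P]_t cos (u * Z t) = expR (- (u ^+ 2 * v) / 2) &
  forall u : R, \int[P]_t sin (u * Z t) = 0].

Variables (Z : T -> R) (v : R).
Hypothesis gZ : gvar Z v.

Lemma gvar_meas : measurable_fun setT Z. Proof. by case: gZ. Qed.

Lemma itb_cos (u : R) : itb P setT (fun t => cos (u * Z t)).
Proof.
apply: itb_le (itb_cst P 1) => //.
  apply: measurableT_comp; first exact: continuous_measurable_fun (@continuous_cos R).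
  by apply: measurable_funM => //; exact: gvar_meas.
by move=> t _; rewrite normr1 ler_norml cos_geN1 cos_le1.
Qed.

Lemma gvar_ge0 : 0 <= v.
Proof.
have [_ /(_ 1) h _] := gZ.
have : \int[P]_t cos (1 * Z t) <= \int[P]_t 1.
  by apply: le_Rint => //; [exact: itb_cos|exact: itb_cst].
rewrite Rint_cst h -[leRHS]expR0 ler_expR expr1n mul1r; lra.
Qed.

Lemma measurable_sqrt_scale (s : R) : measurable_fun setT (fun x : R => s * x).
Proof. exact: measurable_funM. Qed.

(** Z and sqrt v times a standard normal variable have the same cosine and sine transforms. *)
Lemma gvar_law (S : set R) : measurable S ->
  P (Z @^-1` S) = gam ((fun x => Num.sqrt v * x) @^-1` S).
Proof.
move=> mS; have [mZ hc hs] := gZ.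
have ms := measurable_sqrt_scale (Num.sqrt v).
have := @uniq_measurable R _ _ P Z (fun=> 1) _ _ gam (fun x => Num.sqrt v * x) (fun=> 1).
move=> /(_ mZ (itb_cst P 1) ms (itb_cst gam 1)).
have e1 u : \int[P]_t (1 * cos (u * Z t)) = \int[gam]_t (1 * cos (u * (Num.sqrt v * t))).
  under eq_Rintegral do rewrite mul1r.
  under [in RHS]eq_Rintegral do rewrite mul1r mulrA.
  by rewrite hc Rint_normal_cos exprMn sqr_sqrtr ?gvar_ge0.
have e2 u : \int[P]_t (1 * sin (u * Z t)) = \int[gam]_t (1 * sin (u * (Num.sqrt v * t))).
  under eq_Rintegral do rewrite mul1r.
  under [in RHS]eq_Rintegral do rewrite mul1r mulrA.
  by rewrite hs Rint_normal_sin.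
move=> /(_ e1 e2 S mS); rewrite /Rintegral.
have aux d0 (T0 : measurableType d0) (P0 : probability T0 R) (Z0 : T0 -> R) : measurable_fun setT Z0 ->
    (\int[P0]_x (1 * \1_S (Z0 x))%:E)%E = P0 (Z0 @^-1` S).
  move=> mZ0; under eq_integral do rewrite mul1r.
  rewrite (_ : (fun x => _) = (fun x => (\1_(Z0 @^-1` S) x)%:E)); last first.
    by apply/funext => x; rewrite !indicE.
  rewrite integral_indic ?setIT// -[X in measurable X]setTI; exact: mZ0.
rewrite !aux// => h; rewrite -[LHS]fineK ?fin_num_measure//; last first.
  by rewrite -[X in measurable X]setTI; exact: mZ.
by rewrite h fineK// fin_num_measure// -[X in measurable X]setTI; exact: ms.
Qed.

Lemma gvar_ge0_integral (f : R -> \bar R) : measurable_fun setT f -> (forall x, (0 <= f x)%E) ->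
  (\int[P]_t f (Z t) = \int[gam]_x f (Num.sqrt v * x)%R)%E.
Proof.
move=> mf f0; have [mZ _ _] := gZ.
have ms := measurable_sqrt_scale (Num.sqrt v).
transitivity (\int[pushforward P Z]_x f x)%E.
  by rewrite ge0_integral_pushforward//; move=> ? _; exact: f0.
transitivity (\int[pushforward gam (fun x => (Num.sqrt v * x)%R)]_x f x)%E; last first.
  by rewrite ge0_integral_pushforward//; move=> ? _; exact: f0.
by apply: eq_measure_integral => S mS _; exact: gvar_law.
Qed.

Lemma gvar_itb (f : R -> R) : measurable_fun setT f ->
  itb gam setT (fun x => f (Num.sqrt v * x)) -> itb P setT (fun t => f (Z t)).
Proof.
move=> mf /integrableP[_ h]; have [mZ _ _] := gZ; apply/integrableP; split.
  by apply/measurable_EFinP; exact: measurableT_comp.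
rewrite (gvar_ge0_integral (f := fun x => `|(f x)%:E|%E))//.
by apply: measurableT_comp => //; exact/measurable_EFinP.
Qed.

Lemma gvar_Rint (f : R -> R) : measurable_fun setT f ->
  itb gam setT (fun x => f (Num.sqrt v * x)) ->
  \int[P]_t f (Z t) = \int[gam]_x f (Num.sqrt v * x).
Proof.
move=> mf h; have hP := gvar_itb mf h; have [mZ _ _] := gZ.
have ms := measurable_sqrt_scale (Num.sqrt v).
have key (g : R -> R) : measurable_fun setT g -> (forall x, 0 <= g x) ->
    \int[P]_t g (Z t) = \int[gam]_x g (Num.sqrt v * x).
  move=> mg g0; rewrite /Rintegral (gvar_ge0_integral (f := fun x => (g x)%:E))//.
  exact/measurable_EFinP.
have mn : measurable_fun setT (fun x => `|f x|) by exact: measurableT_comp.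
have i1 : itb P setT (fun t => `|f (Z t)|) by exact: (integrable_norm hP).
have i2 : itb gam setT (fun x => `|f (Num.sqrt v * x)|) by exact: (integrable_norm h).
have -> : \int[P]_t f (Z t) = \int[P]_t (f (Z t) + `|f (Z t)|) - \int[P]_t `|f (Z t)|.
  by rewrite RintD// addrK.
rewrite (key (fun x => f x + `|f x|)) ?(key (fun x => `|f x|))//; last 2 first.
- exact: measurable_funD.
- by move=> x; have := ler_norm (- f x); rewrite normrN; lra.
by rewrite RintD// addrK.
Qed.

Lemma gvar_itb_pow m : itb P setT (fun t => Z t ^+ m).
Proof.
apply: (@gvar_itb (fun x => x ^+ m)) => //.
under [X in itb _ _ X]eq_fun do rewrite exprMn.
by apply: itbZ => //; exact: itb_normal_pow.
Qed.

Lemma gvar_Rint_pow m : \int[P]_t (Z t ^+ m) = Num.sqrt v ^+ m * nmom m.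
Proof.
rewrite (@gvar_Rint (fun x => x ^+ m))//.
  by under eq_Rintegral do rewrite exprMn; rewrite RintZ//; exact: itb_normal_pow.
under [X in itb _ _ X]eq_fun do rewrite exprMn.
by apply: itbZ => //; exact: itb_normal_pow.
Qed.

End Law.

(** Orthogonality to all powers kills the cosine and sine transforms of G under the normal law, by
    their power series; hence the signed measure with density G vanishes, and G vanishes almost
    everywhere. *)
Lemma normal_poly_complete (G : R -> R) : measurable_fun setT G ->
  itb gam setT (fun x => G x ^+ 2) ->
  (forall m, \int[gam]_x (G x * x ^+ m) = 0) -> \int[gam]_x (G x ^+ 2) = 0.
Proof.
move=> mG iG2 orth.
have iGe (u : R) : itb gam setT (fun x => `|G x| * expR (`|u| * `|x|)).
  apply: itb_le (itbD measurableT iG2 (itb_normal_exp (2 * `|u|))) => //.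
    apply: measurable_funM; first exact: measurableT_comp.
    by apply: measurableT_comp => //; apply: measurable_funM => //; exact: measurableT_comp.
  move=> x _; rewrite [leLHS]ger0_norm ?mulr_ge0 ?expR_ge0//.
  apply: le_trans (ler_norm _).
  rewrite -(real_normK (num_real (G x))) -mulrA mulr_natl mulr2n expRD.
  have := sqr_ge0 (`|G x| - expR (`|u| * `|x|)); have := sqr_ge0 (`|G x|).
  have := sqr_ge0 (expR (`|u| * `|x|)).
  by rewrite !expr2; nra.
have iGm m : itb gam setT (fun x => G x * x ^+ m).
  apply: itb_le (itbZ measurableT (m`!%:R) (iGe 1)) => //.
    by apply: measurable_funM.
  move=> x _; rewrite normrM normrX normr1 mul1r (le_trans _ (ler_norm _))//.
  by rewrite mulrCA ler_wpM2l// expr_le_exp.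
have c0 (u : R) : \int[gam]_x (G x * cos (u * x)) = 0.
  apply: (eq_cvg_unique (@cvg_Rint_cos_series R _ _ gam G (fun x => x) u mG (@measurable_id _ _ _) (iGe u)) (cvg_cst (0 : R))) => n.
  under eq_Rintegral do under eq_bigr do rewrite cos_coeffM mulrCA.
  rewrite (Rint_sum measurableT); last by move=> k _; apply: itbZ.
  by rewrite big1// => k _; rewrite RintZ// orth mulr0.
have s0 (u : R) : \int[gam]_x (G x * sin (u * x)) = 0.
  apply: (eq_cvg_unique (@cvg_Rint_sin_series R _ _ gam G (fun x => x) u mG (@measurable_id _ _ _) (iGe u)) (cvg_cst (0 : R))) => n.
  under eq_Rintegral do under eq_bigr do rewrite sin_coeffM mulrCA.
  rewrite (Rint_sum measurableT); last by move=> k _; apply: itbZ.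
  by rewrite big1// => k _; rewrite RintZ// orth mulr0.
have iG : itb gam setT G.
  have := iGm 0%N; apply: eq_ind; congr itb.
  by apply/funext => x; rewrite expr0 mulr1.
have zero (S : set R) : measurable S -> \int[gam]_x (G x * \1_S x) = 0.
  move=> mS.
  rewrite (@uniq_measurable R _ _ gam (fun x => x) G _ _ gam (fun x => x) (fun=> 0))//.
  - by under eq_Rintegral do rewrite mul0r; exact: Rint_cst.
  - exact: itb_cst.
  - by move=> u; rewrite c0; under eq_Rintegral do rewrite mul0r; rewrite Rint_cst.
  - by move=> u; rewrite s0; under eq_Rintegral do rewrite mul0r; rewrite Rint_cst.
have ae0 : ae_eq gam setT (EFin \o G) (cst 0%E).
  apply: integral_ae_eq => // E _ mE.
  rewrite integral0.
  have iGE : gam.-integrable E (EFin \o G) by exact: integrableS iG.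
  rewrite -[LHS]fineK; last exact: integrable_fin_num.
  congr (_%:E); transitivity (\int[gam]_(x in E) G x); first by [].
  transitivity (\int[gam]_x (G x * \1_E x)); last exact: zero.
  rewrite Rintegral_mkcond; apply: eq_Rintegral => x _.
  by rewrite patchE indicE; case: ifP; rewrite ?mulr1 ?mulr0.
rewrite /Rintegral (@ae_eq_integral _ _ _ gam setT (cst 0%E))//.
- by rewrite integral_cst//= mul0e.
- by apply/measurable_EFinP; apply: measurable_funX.
- by apply: filterS ae0 => x /= /[apply] [[->]]; rewrite expr0n.
Qed.

End GaussianVariables.

(** * Gaussian integration by parts and Wick powers *)

Section PolynomialDerivative.
Context {R : realType}.

Lemma dv_sum n (F : nat -> R -> R) (dF : nat -> R) (x : R) :
  (forall k, is_derive x 1 (F k) (dF k)) ->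
  is_derive x 1 (fun y => \sum_(k < n) F k y) (\sum_(k < n) dF k).
Proof.
move=> h; elim: n => [|n IH].
  by rewrite big_ord0; under eq_fun do rewrite big_ord0; exact: dv_cst.
by rewrite big_ord_recr/=; under eq_fun do rewrite big_ord_recr/=; exact: dv_add.
Qed.

Lemma dv_poly0 n (a : nat -> R) : is_derive (0 : R) 1 (fun x : R => \sum_(k < n.+2) a k * x ^+ k) (a 1%N).
Proof.
apply: (is_derive_eq (dv_sum n.+2 (F := fun k x => a k * x ^+ k) (dF := fun k => a k * (k%:R * 0 ^+ k.-1)) _)).
  by move=> k; derive_auto; ring.
rewrite !big_ord_recl /= mul0r mulr0 add0r expr0 mulr1 big1 ?addr0 ?mulr1// => k _.
by rewrite expr0n/= mulr0 mulr0.
Qed.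

(** The polarization arguments below need only the linear coefficient of a polynomial identity, and
    this is the derivative at 0. *)
Lemma coef1_unique n (a b : nat -> R) :
  (forall x : R, \sum_(k < n.+2) a k * x ^+ k = \sum_(k < n.+2) b k * x ^+ k) -> a 1%N = b 1%N.
Proof.
move=> /funext h; have ha := dv_poly0 n a; have hb := dv_poly0 n b.
by rewrite -(@derive_val _ _ _ _ _ _ _ ha) -(@derive_val _ _ _ _ _ _ _ hb) h.
Qed.

Lemma sum_delta (I : finType) (i : I) (F : I -> R) : \sum_j (j == i)%:R * F j = F i.
Proof. by rewrite (bigD1 i)//= eqxx mul1r big1 ?addr0// => j /negbTE ->; rewrite mul0r. Qed.

End PolynomialDerivative.

(** * Gaussian integration by parts for polynomials *)

Section GaussianVectors.
Context {R : realType} {d : measure_display} {T : measurableType d} (P : probability T R).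

(** Unlike square integrability, a class closed under products. *)
Definition amom (Z : T -> R) := measurable_fun setT Z /\ forall m, itb P setT (fun t => Z t ^+ m).

Lemma amom_itb Z : amom Z -> itb P setT Z.
Proof. by move=> [_ /(_ 1%N)]. Qed.

Lemma amom_mul Z W : amom Z -> amom W -> amom (fun t => Z t * W t).
Proof.
move=> [mZ hZ] [mW hW]; split; first exact: measurable_funM.
move=> m; apply: itb_le (itbD measurableT (hZ (2 * m)%N) (hW (2 * m)%N)) => //.
  by apply: measurable_funX; apply: measurable_funM.
move=> t _; apply: le_trans (ler_norm _); rewrite exprMn !exprM normrM ![_ ^+ 2 ^+ _]exprAC.
rewrite -(real_normK (num_real (Z t ^+ m))) -(real_normK (num_real (W t ^+ m))).
have := sqr_ge0 (`|Z t ^+ m| - `|W t ^+ m|); have := sqr_ge0 (`|Z t ^+ m|).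
by have := sqr_ge0 (`|W t ^+ m|); rewrite !expr2; nra.
Qed.

Lemma amom_cst c : amom (fun=> c).
Proof. by split => // m; exact: itb_cst. Qed.

Lemma amom_pow Z m : amom Z -> amom (fun t => Z t ^+ m).
Proof.
move=> hZ; elim: m => [|m IH]; first by under eq_fun do rewrite expr0; exact: amom_cst.
by under eq_fun do rewrite exprS; exact: amom_mul.
Qed.

Lemma gvar_amom Z v : gvar P Z v -> amom Z.
Proof. by move=> h; split; [exact: gvar_meas h|exact: gvar_itb_pow h]. Qed.

Context {I : finType} (L : I -> T -> R) (c : I -> I -> R).

(** Joint Gaussianity through all linear combinations. Symmetry of c is part of the definition
    because a quadratic form determines only the symmetric part of its matrix. *)
Definition gvec := (forall i j, c i j = c j i) /\ forall a : I -> R,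
  gvar P (fun t => \sum_i a i * L i t) (\sum_i \sum_j a i * a j * c i j).

Hypothesis gL : gvec.

Let comb (a : I -> R) (t : T) := \sum_i a i * L i t.
Let cv (i : I) (a : I -> R) := \sum_j a j * c i j.

Lemma comb_delta i : comb (fun j => (j == i)%:R) = L i.
Proof.
apply/funext => t; rewrite /comb (bigD1 i)//= eqxx mul1r big1 ?addr0// => j /negbTE ->.
by rewrite mul0r.
Qed.

Lemma comb_amom a : amom (comb a).
Proof. exact: gvar_amom (gL.2 a). Qed.

Lemma gvec_amom i : amom (L i).
Proof. by rewrite -comb_delta; exact: comb_amom. Qed.

Definition mono (s : seq I) (t : T) : R := \prod_(i <- s) L i t.

(* Formal derivative of [mono s] with respect to the variable [L j]. *)
Fixpoint dmono (j : I) (s : seq I) (t : T) : R :=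
  if s is i :: s' then (i == j)%:R * mono s' t + L i t * dmono j s' t else 0.

Lemma mono_cons i s t : mono (i :: s) t = L i t * mono s t.
Proof. by rewrite /mono big_cons. Qed.

Lemma mono_amom s : amom (mono s).
Proof.
elim: s => [|i s IH].
  by rewrite (_ : mono [::] = fun=> 1); [exact: amom_cst|apply/funext => t; rewrite /mono big_nil].
rewrite (_ : mono (i :: s) = fun t => L i t * mono s t).
  by apply: amom_mul => //; exact: gvec_amom.
by apply/funext => t; rewrite mono_cons.
Qed.

Lemma dmono_itb j s W : amom W -> itb P setT (fun t => dmono j s t * W t).
Proof.
elim: s W => [|i s IH] W hW /=; first by under [X in itb _ _ X]eq_fun do rewrite mul0r; exact: itb_cst.
under [X in itb _ _ X]eq_fun do rewrite mulrDl -mulrA [L i _ * _]mulrC -mulrA.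
apply: itbD => //.
  by apply: itbZ => //; apply: amom_itb; apply: amom_mul => //; exact: mono_amom.
by apply: IH; apply: amom_mul => //; exact: gvec_amom.
Qed.

Lemma Rint_binomial (U : T -> R) (Z W : T -> R) (n : nat) (x : R) :
  itb P setT (fun t => 0) -> (forall k l, itb P setT (fun t => U t * (Z t ^+ k * W t ^+ l))) ->
  \int[P]_t (U t * (Z t + x * W t) ^+ n) =
  \sum_(k < n.+1) ('C(n, k)%:R * \int[P]_t (U t * (Z t ^+ (n - k) * W t ^+ k))) * x ^+ k.
Proof.
move=> _ h; transitivity (\int[P]_t (\sum_(k < n.+1) ('C(n, k)%:R * x ^+ k) * (U t * (Z t ^+ (n - k) * W t ^+ k)))).
  apply: eq_Rintegral => t _; rewrite exprDn mulr_sumr; apply: eq_bigr => k _.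
  by rewrite exprMn -mulr_natr; ring.
rewrite (Rint_sum measurableT); last by move=> k _; exact: itbZ.
by apply: eq_bigr => k _; rewrite RintZ//; ring.
Qed.

(** Polarization: the mean of (Z + x L_i)^(m+1) depends only on the variance, a quadratic polynomial
    in x, and its linear coefficient is (m+1) E(L_i Z^m). For m + 1 even the square root of the
    variance disappears; for m + 1 odd all these moments vanish. *)
Lemma gvec_pow_ibp i a m :
  \int[P]_t (L i t * comb a t ^+ m) = m%:R * cv i a * \int[P]_t (comb a t ^+ m.-1).
Proof.
pose Z := comb a.
have hZ : amom Z by exact: comb_amom.
have hL := gvec_amom i.
pose v (b : I -> R) := \sum_i \sum_j b i * b j * c i j.
have hv x : v (fun j => a j + x * (j == i)%:R) = v a + (2 * cv i a) * x + c i i * x ^+ 2.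
  rewrite /v /cv.
  transitivity (\sum_k \sum_l (a k * a l * c k l + x * ((k == i)%:R * (a l * c k l)) +
      x * ((l == i)%:R * (a k * c k l)) + x ^+ 2 * ((k == i)%:R * ((l == i)%:R * c k l)))).
    by apply: eq_bigr => k _; apply: eq_bigr => l _; ring.
  under eq_bigr do rewrite !big_split/= -!mulr_sumr !sum_delta.
  rewrite !big_split/= -!mulr_sumr !sum_delta.
  rewrite [X in _ + x * X + _ = _](eq_bigr (fun j => a j * c i j)); last by move=> j _; rewrite gL.1.
  by ring.
have hc x t : comb (fun j => a j + x * (j == i)%:R) t = Z t + x * L i t.
  by rewrite -comb_delta /Z /comb mulr_sumr -big_split /=; apply: eq_bigr => j _; ring.
have E x : \int[P]_t (1 * (Z t + x * L i t) ^+ m.+1) =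
    Num.sqrt (v a + (2 * cv i a) * x + c i i * x ^+ 2) ^+ m.+1 * nmom m.+1.
  rewrite -hv -(gvar_Rint_pow (gL.2 _)); apply: eq_Rintegral => t _.
  by rewrite mul1r -hc.
have i1 k l : itb P setT (fun t => 1 * (Z t ^+ k * L i t ^+ l)).
  by apply: amom_itb; repeat (apply: amom_mul || apply: amom_pow || apply: amom_cst).
pose A k := 'C(m.+1, k)%:R * \int[P]_t (1 * (Z t ^+ (m.+1 - k) * L i t ^+ k)).
have hA : A 1%N = m.+1%:R * \int[P]_t (L i t * Z t ^+ m).
  by rewrite /A bin1 subn1 /=; congr (_ * _); apply: eq_Rintegral => t _; rewrite expr1; ring.
pose q x := v a + (2 * cv i a) * x + c i i * x ^+ 2.
have {}E x : \sum_(k < m.+2) A k * x ^+ k = Num.sqrt (q x) ^+ m.+1 * nmom m.+1.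
  by rewrite -E Rint_binomial//; exact: itb_cst.
have m0 : (m.+1%:R : R) != 0 by [].
apply: (mulfI m0); rewrite -hA (gvar_Rint_pow (gL.2 a)) -/(v a).
have := odd_double_half m; case: (odd m) => /= mE.
- move: E hA; rewrite -mE add1n -doubleS => E hA.
  have hd := dv_poly0 m./2.*2.+1 A.
  have hq : is_derive (0 : R) 1 (fun x => q x ^+ m./2.+1 * nmom m./2.+1.*2)
      (m./2.+1%:R * v a ^+ m./2 * (2 * cv i a) * nmom m./2.+1.*2).
    by rewrite /q; derive_auto; rewrite mulr0 expr0n/= mulr0 !addr0; ring.
  rewrite -(@derive_val _ _ _ _ _ _ _ hd).
  rewrite (_ : (fun x => _) = (fun x => q x ^+ m./2.+1 * nmom m./2.+1.*2)); last first.
    apply/funext => x; rewrite -doubleS E; congr (_ * _).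
    rewrite -mul2n exprM sqr_sqrtr// /q -hv; exact: gvar_ge0 (gL.2 _).
  rewrite (@derive_val _ _ _ _ _ _ _ hq) doubleS nmomS /= -[m./2.*2]mul2n exprM sqr_sqrtr; last first.
    exact: gvar_ge0 (gL.2 _).
  by rewrite mul2n -!natr1 -mul2n natrM; ring.
- rewrite add0n in mE.
  have -> : A 1%N = 0.
    apply: (@coef1_unique _ m A (fun=> 0)) => x; rewrite E -{2}mE nmom_odd mulr0 big1// => k _.
    by rewrite mul0r.
  case: m {E hA A m0} mE => [|m] mE; first by rewrite mul0r mul0r mulr0.
  rewrite /= (_ : nmom m = 0) ?mulr0//.
  by case: (m.+1./2) mE => [//|k]; rewrite doubleS => -[<-]; exact: nmom_odd.
Qed.

(** The power of a free combination makes the induction on s possible: replacing the combination by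
    itself plus x L_j, with exponent m + 1, and extracting the linear coefficient in x produces the
    additional factor L_j. *)
Lemma gvec_mono_ibp_aux s i a m :
  \int[P]_t (L i t * mono s t * comb a t ^+ m) =
  \sum_j c i j * \int[P]_t (dmono j s t * comb a t ^+ m) +
  m%:R * cv i a * \int[P]_t (mono s t * comb a t ^+ m.-1).
Proof.
elim: s i a m => [|j s IH] i a m.
  rewrite [X in _ = X + _]big1 ?add0r; last first.
    move=> j _; under eq_Rintegral do rewrite mul0r; by rewrite Rint_cst mulr0.
  under eq_Rintegral do rewrite /mono big_nil mulr1.
  under [in RHS]eq_Rintegral do rewrite /mono big_nil mul1r.
  exact: gvec_pow_ibp.
have hc x t : comb (fun l => a l + x * (l == j)%:R) t = comb a t + x * L j t.
  by rewrite -comb_delta /comb mulr_sumr -big_split /=; apply: eq_bigr => l _; ring.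
have hcv x : cv i (fun l => a l + x * (l == j)%:R) = cv i a + x * c i j.
  rewrite /cv (eq_bigr (fun l => a l * c i l + x * ((l == j)%:R * c i l))); last by move=> l _; ring.
  rewrite big_split/= -mulr_sumr; congr (_ + _ * _).
  by rewrite (bigD1 j)//= eqxx mul1r big1 ?addr0// => l /negbTE ->; rewrite mul0r.
have hL l := gvec_amom l; have hZ := comb_amom a; have hM := mono_amom s.
have i1 k l : itb P setT (fun t => L i t * mono s t * (comb a t ^+ k * L j t ^+ l)).
  by apply: amom_itb; repeat (apply: amom_mul || apply: amom_pow).
have i2 k l : itb P setT (fun t => mono s t * (comb a t ^+ k * L j t ^+ l)).
  by apply: amom_itb; repeat (apply: amom_mul || apply: amom_pow).
have i3 j' k l : itb P setT (fun t => dmono j' s t * (comb a t ^+ k * L j t ^+ l)).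
  by apply: dmono_itb; repeat (apply: amom_mul || apply: amom_pow).
have i0 := itb_cst P (0 : R).
(* Coefficients of x^k: [A1] on the left, [A2] from the derivatives of the monomial, [A3] and [A4]
   from the last term. The covariance factor of that term is affine in x; its linear part shifts the
   index by one in [A4]. *)
pose A1 k := 'C(m.+1, k)%:R * \int[P]_t (L i t * mono s t * (comb a t ^+ (m.+1 - k) * L j t ^+ k)).
pose A2 k := 'C(m.+1, k)%:R * \sum_l c i l * \int[P]_t (dmono l s t * (comb a t ^+ (m.+1 - k) * L j t ^+ k)).
pose A3 k := if (k < m.+1)%N then m.+1%:R * cv i a * ('C(m, k)%:R * \int[P]_t (mono s t * (comb a t ^+ (m - k) * L j t ^+ k))) else 0.
pose A4 k := if k is k'.+1 then m.+1%:R * c i j * ('C(m, k')%:R * \int[P]_t (mono s t * (comb a t ^+ (m - k') * L j t ^+ k'))) else 0.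
have key x : \sum_(k < m.+2) A1 k * x ^+ k = \sum_(k < m.+2) (A2 k + A3 k + A4 k) * x ^+ k.
  rewrite -Rint_binomial//.
  have := IH i (fun l => a l + x * (l == j)%:R) m.+1.
  under eq_Rintegral do rewrite hc.
  move=> ->; rewrite hcv /=.
  rewrite (eq_bigr (fun l => \sum_(k < m.+2) (c i l * ('C(m.+1, k)%:R * \int[P]_t (dmono l s t * (comb a t ^+ (m.+1 - k) * L j t ^+ k)))) * x ^+ k)); last first.
    move=> l _; under eq_Rintegral do rewrite hc.
    by rewrite Rint_binomial// mulr_sumr; apply: eq_bigr => k _; rewrite mulrA.
  rewrite exchange_big/=.
  under [X in _ + _ * X]eq_Rintegral do rewrite hc.
  rewrite [X in _ + _ * X]Rint_binomial//.
  under [RHS]eq_bigr do rewrite 2!mulrDl.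
  rewrite 2!big_split/= -addrA; congr (_ + _).
    by apply: eq_bigr => k _; rewrite /A2 mulr_sumr mulr_suml; apply: eq_bigr => l _; ring.
  have -> : \sum_(k < m.+2) A3 k * x ^+ k = \sum_(k < m.+1) A3 k * x ^+ k.
    by rewrite big_ord_recr/= {2}/A3 ltnn mul0r addr0.
  rewrite [X in _ = _ + X]big_ord_recl /A4 mul0r add0r.
  rewrite mulrDr mulrDl; congr (_ + _); rewrite mulr_sumr; apply: eq_bigr => k _.
    by rewrite /A3 ltn_ord; ring.
  by rewrite lift0 exprS; ring.
have m0 : (m.+1%:R : R) != 0 by [].
have hA1 : A1 1%N = m.+1%:R * \int[P]_t (L i t * mono (j :: s) t * comb a t ^+ m).
  rewrite /A1 bin1 subn1 /=; congr (_ * _); apply: eq_Rintegral => t _.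
  by rewrite mono_cons expr1; ring.
have hA4 : A4 1%N = m.+1%:R * (c i j * \int[P]_t (mono s t * comb a t ^+ m)).
  rewrite /A4 bin0 subn0 mul1r -mulrA; congr (_ * (_ * _)).
  by apply: eq_Rintegral => t _; rewrite expr0 mulr1.
have hA3 : A3 1%N = m.+1%:R * (m%:R * cv i a * \int[P]_t (mono (j :: s) t * comb a t ^+ m.-1)).
  rewrite /A3; case: ltnP => [m1|]; last by case: (m) => // _; rewrite !mul0r mulr0.
  rewrite bin1 subn1; transitivity (m.+1%:R * (m%:R * cv i a * \int[P]_t (mono s t * (comb a t ^+ m.-1 * L j t ^+ 1)))).
    by ring.
  congr (_ * (_ * _)); apply: eq_Rintegral => t _; rewrite mono_cons expr1; ring.
have hA2 : A2 1%N = m.+1%:R * \sum_l c i l * \int[P]_t (dmono l s t * (comb a t ^+ m * L j t)).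
  by rewrite /A2 bin1 subn1 /=; congr (_ * _); apply: eq_bigr.
have h1 : A1 1%N = A2 1%N + A3 1%N + A4 1%N by exact: (@coef1_unique R m A1 (fun k => A2 k + A3 k + A4 k) key).
move: h1; rewrite hA1 hA2 hA3 hA4 -!mulrDr => /(mulfI m0) ->.
rewrite addrAC; congr (_ + _).
have hD l : \int[P]_t (dmono l (j :: s) t * comb a t ^+ m) =
    (j == l)%:R * \int[P]_t (mono s t * comb a t ^+ m) + \int[P]_t (dmono l s t * (comb a t ^+ m * L j t)).
  rewrite -RintZ//; last by apply: amom_itb; apply: amom_mul => //; exact: amom_pow.
  rewrite -RintD//.
  - by apply: eq_Rintegral => t _; rewrite /=; ring.
  - by apply: itbZ => //; apply: amom_itb; apply: amom_mul => //; exact: amom_pow.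
  - by apply: dmono_itb; apply: amom_mul => //; exact: amom_pow.
under [RHS]eq_bigr do rewrite hD mulrDr.
rewrite big_split/= addrC; congr (_ + _).
rewrite -[LHS](@sum_delta _ _ j (fun l => c i l * \int[P]_t (mono s t * comb a t ^+ m))).
by apply: eq_bigr => l _; rewrite eq_sym; ring.
Qed.

Lemma gvec_mono_ibp i s :
  \int[P]_t (L i t * mono s t) = \sum_j c i j * \int[P]_t dmono j s t.
Proof.
have := gvec_mono_ibp_aux s i (fun=> 0) 0.
rewrite mul0r mul0r addr0.
under eq_Rintegral do rewrite expr0 mulr1.
by move=> ->; apply: eq_bigr => j _; congr (_ * _); apply: eq_Rintegral => t _; rewrite expr0 mulr1.
Qed.

(** Polynomials in the [L i] paired with their formal gradient. A relation and not a function,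
    because linearly dependent variables represent the same random variable by polynomials with
    different gradients. *)
Inductive pspan : (T -> R) -> (I -> T -> R) -> Prop :=
| pspan_mono x s : pspan (fun t => x * mono s t) (fun j t => x * dmono j s t)
| pspan_add F F' G G' : pspan F F' -> pspan G G' ->
    pspan (fun t => F t + G t) (fun j t => F' j t + G' j t).

Lemma pspan_eq F F' G G' : pspan F F' -> F = G -> F' = G' -> pspan G G'.
Proof. by move=> h <- <-. Qed.

Lemma mono_cat s u t : mono (s ++ u) t = mono s t * mono u t.
Proof. by rewrite /mono big_cat. Qed.

Lemma dmono_cat j s u t : dmono j (s ++ u) t = dmono j s t * mono u t + mono s t * dmono j u t.
Proof.
elim: s => [|i s IH] /=; first by rewrite mul0r add0r /mono big_nil mul1r.
by rewrite IH mono_cons mono_cat; ring.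
Qed.

Lemma pspan_mul F F' G G' : pspan F F' -> pspan G G' ->
  pspan (fun t => F t * G t) (fun j t => F' j t * G t + F t * G' j t).
Proof.
move=> hF hG; elim: hF => [x s|F1 F1' F2 F2' _ h1 _ h2].
  elim: hG => [y u|G1 G1' G2 G2' _ h1 _ h2].
    apply: (pspan_eq (pspan_mono (x * y) (s ++ u))).
      by apply/funext => t; rewrite mono_cat; ring.
    by apply/funext => j; apply/funext => t; rewrite dmono_cat; ring.
  apply: (pspan_eq (pspan_add h1 h2)); first by apply/funext => t; ring.
  by apply/funext => j; apply/funext => t; ring.
apply: (pspan_eq (pspan_add h1 h2)); first by apply/funext => t; ring.
by apply/funext => j; apply/funext => t; ring.
Qed.

Lemma pspan_cst x : pspan (fun=> x) (fun _ _ => 0).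
Proof.
apply: (pspan_eq (pspan_mono x [::])); first by apply/funext => t; rewrite /mono big_nil mulr1.
by apply/funext => j; apply/funext => t; rewrite /= mulr0.
Qed.

Lemma pspan_gen i : pspan (L i) (fun j _ => (i == j)%:R).
Proof.
apply: (pspan_eq (pspan_mono 1 [:: i])).
  by apply/funext => t; rewrite mono_cons /mono big_nil mulr1 mul1r.
by apply/funext => j; apply/funext => t; rewrite /= /mono big_nil mulr0 addr0 mulr1 mul1r.
Qed.

Lemma pspan_itb F F' : pspan F F' -> itb P setT F /\ forall j, itb P setT (F' j).
Proof.
elim => [x s|F1 F1' F2 F2' _ [h1 h1'] _ [h2 h2']]; split.
- by apply: itbZ => //; apply: amom_itb; exact: mono_amom.
- move=> j; apply: itbZ => //; have := dmono_itb j s (amom_cst 1).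
  by under [X in itb _ _ X]eq_fun do rewrite mulr1.
- exact: itbD.
- by move=> j; apply: itbD.
Qed.

Lemma pspan_genM_itb i F F' : pspan F F' -> itb P setT (fun t => L i t * F t).
Proof. by move=> /(pspan_mul (pspan_gen i)) /pspan_itb[]. Qed.

Lemma pspan_ibp i F F' : pspan F F' ->
  \int[P]_t (L i t * F t) = \sum_j c i j * \int[P]_t F' j t.
Proof.
elim => [x s|F1 F1' F2 F2' p1 h1 p2 h2].
  under eq_Rintegral do rewrite mulrCA.
  rewrite RintZ//; last first.
    by apply: amom_itb; apply: amom_mul; [exact: gvec_amom|exact: mono_amom].
  rewrite gvec_mono_ibp mulr_sumr; apply: eq_bigr => j _; rewrite RintZ//; first by ring.
  by have := dmono_itb j s (amom_cst 1); under [X in itb _ _ X]eq_fun do rewrite mulr1.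
under eq_Rintegral do rewrite mulrDr.
rewrite RintD//; [|exact: pspan_genM_itb p1|exact: pspan_genM_itb p2].
rewrite h1 h2 -big_split/=; apply: eq_bigr => j _.
by rewrite RintD ?mulrDr//; [have [] := pspan_itb p1|have [] := pspan_itb p2].
Qed.

End GaussianVectors.

(** * Wick powers and their fourth moments *)

Section WickPowers.
Context {R : realType}.

(* Hermite polynomials of variance v, i.e. v^(q/2) H_q(x / sqrt v), also for v = 0. *)
Fixpoint hv_pair (v : R) (q : nat) (x : R) : R * R :=
  if q is q'.+1 then
    ((hv_pair v q' x).2, x * (hv_pair v q' x).2 - q'.+1%:R * v * (hv_pair v q' x).1)
  else (1, x).
Definition hv v q x := (hv_pair v q x).1.

Lemma hv0 v x : hv v 0 x = 1. Proof. by []. Qed.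

Lemma hv1 v x : hv v 1 x = x. Proof. by []. Qed.

Lemma hvSS v q x : hv v q.+2 x = x * hv v q.+1 x - q.+1%:R * v * hv v q x.
Proof. by []. Qed.

Lemma hvS v q x : hv v q.+1 x = x * hv v q x - q%:R * v * hv v q.-1 x.
Proof. by case: q => [|q]; rewrite ?hvSS// hv1 hv0 mul0r mul0r subr0 mulr1. Qed.

Lemma hv_hermite q x : hv 1 q x = hermite q x.
Proof.
rewrite /hv /hermite; congr fst; elim: q => [//|q IH] /=.
by case: (hermite_pair q x) IH => a b ->; rewrite mulr1.
Qed.

Context {d : measure_display} {T : measurableType d} (P : probability T R).
Context {I : finType} (L : I -> T -> R) (c : I -> I -> R) (gL : gvec P L c).

Let h i q t := hv (c i i) q (L i t).

(** Appell property: the derivative of the Wick power of degree q is q times the one of degree q -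
    1. Two consecutive degrees are carried through the induction because the recursion has two
    terms. *)
Lemma pspan_hv i q : pspan L (h i q) (fun j t => (i == j)%:R * (q%:R * h i q.-1 t)).
Proof.
suff [] : pspan L (h i q) (fun j t => (i == j)%:R * (q%:R * h i q.-1 t)) /\
  pspan L (h i q.+1) (fun j t => (i == j)%:R * (q.+1%:R * h i q t)) by [].
elim: q => [|q [IH1 IH2]].
  split.
    apply: (pspan_eq (pspan_cst L 1)); first exact/funext.
    by apply/funext => j; apply/funext => t; rewrite mul0r mulr0.
  apply: (pspan_eq (pspan_gen L i)); first exact/funext.
  by apply/funext => j; apply/funext => t; rewrite /h hv0 !mulr1.
split => //.
apply: (pspan_eq (pspan_add (pspan_mul (pspan_gen L i) IH2)
   (pspan_mul (pspan_cst L (- (q.+1%:R * c i i))) IH1))).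
  by apply/funext => t; rewrite /h hvSS; ring.
apply/funext => j; apply/funext => t; rewrite -[q.+2%:R]natr1 /h /= !(hvS _ q).
by ring.
Qed.

Lemma pspan_l2 F F' : pspan L F F' -> measurable_fun setT F /\ itb P setT (fun t => F t ^+ 2).
Proof.
move=> p; split; first by have [/itb_meas] := pspan_itb gL p.
have [+ _] := pspan_itb gL (pspan_mul p p).
by under eq_fun do rewrite -expr2.
Qed.

Definition wick4 (i1 i2 i3 i4 : I) q1 q2 q3 q4 : R :=
  \int[P]_t (h i1 q1 t * (h i2 q2 t * (h i3 q3 t * h i4 q4 t))).

Lemma wick4_perm12 i1 i2 i3 i4 q1 q2 q3 q4 :
  wick4 i1 i2 i3 i4 q1 q2 q3 q4 = wick4 i2 i1 i3 i4 q2 q1 q3 q4.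
Proof. by apply: eq_Rintegral => t _; ring. Qed.

Lemma wick4_perm1324 i1 i2 i3 i4 q1 q2 q3 q4 :
  wick4 i1 i2 i3 i4 q1 q2 q3 q4 = wick4 i3 i4 i1 i2 q3 q4 q1 q2.
Proof. by apply: eq_Rintegral => t _; ring. Qed.

Lemma wick4_0000 i1 i2 i3 i4 : wick4 i1 i2 i3 i4 0 0 0 0 = 1.
Proof.
rewrite -[RHS](Rint_cst P 1); apply: eq_Rintegral => t _.
by rewrite /h !hv0 !mulr1.
Qed.

Lemma pspan_hv4 i1 i2 i3 i4 q1 q2 q3 q4 :
  exists F', pspan L (fun t => h i1 q1 t * (h i2 q2 t * (h i3 q3 t * h i4 q4 t))) F'.
Proof.
eexists; apply: pspan_mul; first exact: pspan_hv.
apply: pspan_mul; first exact: pspan_hv.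
by apply: pspan_mul; exact: pspan_hv.
Qed.

Lemma wick4_itb i1 i2 i3 i4 q1 q2 q3 q4 :
  itb P setT (fun t => h i1 q1 t * (h i2 q2 t * (h i3 q3 t * h i4 q4 t))).
Proof. by have [F' /(pspan_itb gL)[]] := pspan_hv4 i1 i2 i3 i4 q1 q2 q3 q4. Qed.

(** Integration by parts in the first factor. The contraction of that factor with itself is
    cancelled by the second term of the Wick recursion, so only contractions with the other three
    factors remain. *)
Lemma wick4_rec i1 i2 i3 i4 q1 q2 q3 q4 :
  wick4 i1 i2 i3 i4 q1.+1 q2 q3 q4 =
  q2%:R * c i1 i2 * wick4 i1 i2 i3 i4 q1 q2.-1 q3 q4 +
  q3%:R * c i1 i3 * wick4 i1 i2 i3 i4 q1 q2 q3.-1 q4 +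
  q4%:R * c i1 i4 * wick4 i1 i2 i3 i4 q1 q2 q3 q4.-1.
Proof.
have p := pspan_mul (pspan_hv i1 q1) (pspan_mul (pspan_hv i2 q2) (pspan_mul (pspan_hv i3 q3) (pspan_hv i4 q4))).
have := pspan_ibp gL i1 p.
have w := wick4_itb.
have E : \int[P]_t (L i1 t * (h i1 q1 t * (h i2 q2 t * (h i3 q3 t * h i4 q4 t)))) =
   wick4 i1 i2 i3 i4 q1.+1 q2 q3 q4 + q1%:R * c i1 i1 * wick4 i1 i2 i3 i4 q1.-1 q2 q3 q4.
  rewrite /wick4 -RintZ// -RintD//; last exact: itbZ.
  by apply: eq_Rintegral => t _; rewrite [in RHS]/h hvS /h; ring.
rewrite E => h0; apply: (@addIr _ (q1%:R * c i1 i1 * wick4 i1 i2 i3 i4 q1.-1 q2 q3 q4)).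
rewrite {}h0.
have D j : \int[P]_t ((i1 == j)%:R * (q1%:R * h i1 q1.-1 t) * (h i2 q2 t * (h i3 q3 t * h i4 q4 t)) +
   h i1 q1 t * ((i2 == j)%:R * (q2%:R * h i2 q2.-1 t) * (h i3 q3 t * h i4 q4 t) +
   h i2 q2 t * ((i3 == j)%:R * (q3%:R * h i3 q3.-1 t) * h i4 q4 t +
   h i3 q3 t * ((i4 == j)%:R * (q4%:R * h i4 q4.-1 t))))) =
   (j == i1)%:R * (q1%:R * wick4 i1 i2 i3 i4 q1.-1 q2 q3 q4) +
   (j == i2)%:R * (q2%:R * wick4 i1 i2 i3 i4 q1 q2.-1 q3 q4) +
   (j == i3)%:R * (q3%:R * wick4 i1 i2 i3 i4 q1 q2 q3.-1 q4) +
   (j == i4)%:R * (q4%:R * wick4 i1 i2 i3 i4 q1 q2 q3 q4.-1).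
  have z (x y : R) f : itb P setT f -> itb P setT (fun t => x * (y * f t)).
    by move=> hf; do 2 apply: itbZ => //.
  have Rz (x y : R) f : itb P setT f -> x * (y * \int[P]_t f t) = \int[P]_t (x * (y * f t)).
    by move=> hf; rewrite RintZ ?RintZ//; exact: itbZ.
  rewrite /wick4 !Rz// -RintD//; [|exact: z|exact: z].
  rewrite -RintD//; [|by apply: itbD => //; exact: z|exact: z].
  rewrite -RintD//; [|by apply: itbD => //; [apply: itbD => //; exact: z|exact: z]|exact: z].
  by apply: eq_Rintegral => t _; rewrite ![_ == j]eq_sym; ring.
under eq_bigr do rewrite D !mulrDr ![c i1 _ * (_ * _)]mulrCA.
by rewrite !big_split/= !sum_delta; ring.
Qed.

Lemma wick4_pair i j k l p q :
  wick4 i j k l p q 0 0 = (p == q)%:R * p`!%:R * c i j ^+ p.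
Proof.
elim: p q => [|p IH] [|q].
- by rewrite wick4_0000 fact0 !mul1r.
- by rewrite wick4_perm12 wick4_rec /= !mul0r !addr0.
- by rewrite wick4_rec /= !mul0r !addr0.
- rewrite wick4_rec /= !mul0r !addr0 IH eqSS; case: eqP => [->|_]; rewrite ?mul0r ?mulr0//.
  by rewrite factS natrM exprS; ring.
Qed.

Lemma Rint_hv2 i j p q : \int[P]_t (hv (c i i) p (L i t) * hv (c j j) q (L j t)) =
  (p == q)%:R * p`!%:R * c i j ^+ p.
Proof.
rewrite -(@wick4_pair i j i i); apply: eq_Rintegral => t _.
by rewrite /h !hv0 !mulr1.
Qed.

Lemma hv2_itb i j p q : itb P setT (fun t => hv (c i i) p (L i t) * hv (c j j) q (L j t)).
Proof.
have := wick4_itb i j i i p q 0 0; rewrite /h.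
by under eq_fun do rewrite !hv0 !mulr1.
Qed.

Section Bounds.
Variables (N : nat) (B : R).
Hypotheses (B1 : 1 <= B) (cB : forall k l, `|c k l| <= B) (N0 : (0 < N)%N).
Let M : R := N%:R * B.

Lemma wickM_ge1 : 1 <= M.
Proof. by rewrite /M (le_trans B1)// ler_peMl ?(le_trans ler01)// ler1n. Qed.

Let M0 : 0 <= M. Proof. exact: le_trans ler01 wickM_ge1. Qed.

Lemma wick_term_le (q : nat) (x W K : R) : `|x| <= B -> ((0 < q)%N -> `|W| <= K) -> 0 <= K ->
  `|q%:R * x * W| <= q%:R * B * K.
Proof.
move=> xB hW K0; case: q hW => [|q] hW; first by rewrite !mul0r normr0.
rewrite !normrM ger0_norm// -!mulrA ler_wpM2l// ler_pM//; exact: hW.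
Qed.

(** Each use of the recursion lowers the total degree and costs at most the remaining degree times
    [B], that is a factor [M]. *)
Lemma wick4_bound n i1 i2 i3 i4 q1 q2 q3 q4 :
  (q1 + q2 + q3 + q4 <= n)%N -> (n <= N)%N -> `|wick4 i1 i2 i3 i4 q1 q2 q3 q4| <= M ^+ n.
Proof.
elim: n i1 i2 i3 i4 q1 q2 q3 q4 => [|n IH] i1 i2 i3 i4 q1 q2 q3 q4 hq hn.
  move: hq; rewrite leqn0 !addn_eq0 => /andP[/andP[/andP[/eqP-> /eqP->] /eqP->] /eqP->].
  by rewrite wick4_0000 normr1.
have step j1 j2 j3 j4 p1 p2 p3 p4 : (p1.+1 + p2 + p3 + p4 <= n.+1)%N ->
    `|wick4 j1 j2 j3 j4 p1.+1 p2 p3 p4| <= M ^+ n.+1.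
  move=> hp; rewrite wick4_rec exprS.
  have Mn : 0 <= M ^+ n by exact: exprn_ge0.
  have t2 := @wick_term_le p2 (c j1 j2) (wick4 j1 j2 j3 j4 p1 p2.-1 p3 p4) _ (cB _ _) _ Mn.
  have t3 := @wick_term_le p3 (c j1 j3) (wick4 j1 j2 j3 j4 p1 p2 p3.-1 p4) _ (cB _ _) _ Mn.
  have t4 := @wick_term_le p4 (c j1 j4) (wick4 j1 j2 j3 j4 p1 p2 p3 p4.-1) _ (cB _ _) _ Mn.
  rewrite (le_trans (ler_normD _ _))// (@le_trans _ _ ((p2%:R + p3%:R + p4%:R) * B * M ^+ n))//.
    rewrite !mulrDl lerD//; [rewrite (le_trans (ler_normD _ _))// lerD//|].
    - by apply: t2 => p0; apply: IH; move: p0 hp hn; clear; lia.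
    - by apply: t3 => p0; apply: IH; move: p0 hp hn; clear; lia.
    - by apply: t4 => p0; apply: IH; move: p0 hp hn; clear; lia.
  rewrite ler_wpM2r// /M ler_wpM2r ?(le_trans ler01)// -!natrD ler_nat.
  by move: hp hn; clear; lia.
case: q1 hq => [|q1] hq; last exact: step.
case: q2 hq => [|q2] hq; last by rewrite wick4_perm12; apply: step; move: hq; clear; lia.
rewrite wick4_perm1324.
case: q3 hq => [|q3] hq; last by apply: step; move: hq; clear; lia.
case: q4 hq => [|q4] hq; last by rewrite wick4_perm12; apply: step; move: hq; clear; lia.
by rewrite wick4_0000 normr1 exprn_ege1// wickM_ge1.
Qed.

(** Contractions inside the first pair obey the same recursion in the fourth moment and in the
    product of second moments, so they cancel up to the inductive error; every contraction across
    the two pairs carries a factor e. *)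
Lemma wick4_decorrelation (e : R) n i1 i2 i3 i4 q1 q2 q3 q4 : 0 <= e ->
  `|c i1 i3| <= e -> `|c i1 i4| <= e -> `|c i2 i3| <= e -> `|c i2 i4| <= e ->
  (q1 + q2 <= n)%N -> (q1 + q2 + q3 + q4 <= N)%N ->
  `|wick4 i1 i2 i3 i4 q1 q2 q3 q4 -
     wick4 i1 i2 i3 i4 q1 q2 0 0 * wick4 i1 i2 i3 i4 0 0 q3 q4| <= n%:R * M ^+ n * M ^+ N * e.
Proof.
move=> e0; elim: n i1 i2 q1 q2 => [|n IH] i1 i2 q1 q2 e13 e14 e23 e24 hq hN.
  move: hq; rewrite leqn0 addn_eq0 => /andP[/eqP-> /eqP->].
  by rewrite wick4_0000 mul1r subrr normr0 !mul0r.
have step j1 j2 p1 p2 : `|c j1 i3| <= e -> `|c j1 i4| <= e -> `|c j2 i3| <= e -> `|c j2 i4| <= e ->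
   (p1.+1 + p2 <= n.+1)%N -> (p1.+1 + p2 + q3 + q4 <= N)%N ->
  `|wick4 j1 j2 i3 i4 p1.+1 p2 q3 q4 -
     wick4 j1 j2 i3 i4 p1.+1 p2 0 0 * wick4 j1 j2 i3 i4 0 0 q3 q4| <= n.+1%:R * M ^+ n.+1 * M ^+ N * e.
  move=> f13 f14 f23 f24 hp hpN; rewrite wick4_rec [wick4 _ _ _ _ p1.+1 p2 0 0]wick4_rec /= !mul0r !addr0.
  pose D := wick4 j1 j2 i3 i4 p1 p2.-1 q3 q4 - wick4 j1 j2 i3 i4 p1 p2.-1 0 0 * wick4 j1 j2 i3 i4 0 0 q3 q4.
  rewrite (_ : _ - _ = p2%:R * c j1 j2 * D + (q3%:R * c j1 i3 * wick4 j1 j2 i3 i4 p1 p2 q3.-1 q4 +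
     q4%:R * c j1 i4 * wick4 j1 j2 i3 i4 p1 p2 q3 q4.-1)); last by rewrite /D; ring.
  have K0 : 0 <= n%:R * M ^+ n * M ^+ N * e by rewrite !mulr_ge0// exprn_ge0.
  have MN : 0 <= M ^+ N by exact: exprn_ge0.
  have t2 : `|p2%:R * c j1 j2 * D| <= M * (n%:R * M ^+ n * M ^+ N * e).
    apply: (le_trans (@wick_term_le p2 (c j1 j2) D _ (cB _ _) _ K0)).
      by move=> p0; apply: IH => //; move: p0 hp hpN; clear; lia.
    by rewrite ler_wpM2r// /M ler_wpM2r ?(le_trans ler01)// ler_nat; move: hpN; clear; lia.
  have tt (q : nat) (x W : R) : `|x| <= e -> `|W| <= M ^+ N -> `|q%:R * x * W| <= q%:R * (M ^+ N * e).
    move=> hx hW; rewrite !normrM ger0_norm// -mulrA ler_wpM2l// mulrC ler_pM//.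
  have t3 : `|q3%:R * c j1 i3 * wick4 j1 j2 i3 i4 p1 p2 q3.-1 q4| <= q3%:R * (M ^+ N * e).
    by apply: tt => //; apply: wick4_bound => //; move: hpN; clear; lia.
  have t4 : `|q4%:R * c j1 i4 * wick4 j1 j2 i3 i4 p1 p2 q3 q4.-1| <= q4%:R * (M ^+ N * e).
    by apply: tt => //; apply: wick4_bound => //; move: hpN; clear; lia.
  have q34 : q3%:R * (M ^+ N * e) + q4%:R * (M ^+ N * e) <= M * (M ^+ N * e).
    rewrite -mulrDl ler_wpM2r ?mulr_ge0// -natrD /M (@le_trans _ _ (N%:R))//; last first.
      by rewrite ler_peMr.
    by rewrite ler_nat; move: hpN; clear; lia.
  have M1 : M ^+ n >= 1 by rewrite exprn_ege1// wickM_ge1.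
  have last_le : M * (M ^+ N * e) <= M * (M ^+ n * (M ^+ N * e)).
    by rewrite ler_wpM2l// ler_peMl// mulr_ge0.
  rewrite (le_trans (ler_normD _ _))//.
  have := ler_normD (q3%:R * c j1 i3 * wick4 j1 j2 i3 i4 p1 p2 q3.-1 q4) (q4%:R * c j1 i4 * wick4 j1 j2 i3 i4 p1 p2 q3 q4.-1).
  rewrite -natr1 exprS.
  rewrite (_ : _ * _ * _ * e = M * (n%:R * M ^+ n * M ^+ N * e) + M * (M ^+ n * (M ^+ N * e))); last by ring.
  lra.
case: q1 hq hN => [|q1] hq hN; last exact: step.
case: q2 hq hN => [|q2] hq hN.
  rewrite wick4_0000 mul1r subrr normr0 !mulr_ge0//; exact: exprn_ge0.
rewrite wick4_perm12 [wick4 _ _ _ _ 0 q2.+1 0 0]wick4_perm12 [wick4 i1 i2 _ _ 0 0 _ _]wick4_perm12.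
by apply: step => //; move: hq hN; clear; lia.
Qed.

End Bounds.

End WickPowers.

(** * Hermite expansions *)

Section SquareIntegrable.
Context {R : realType} {d : measure_display} {T : measurableType d}
  (P : {measure set T -> \bar R}).

Definition l2 (f : T -> R) := measurable_fun setT f /\ itb P setT (fun t => f t ^+ 2).

Lemma l2_mul f g : l2 f -> l2 g -> itb P setT (fun t => f t * g t).
Proof.
move=> [mf hf] [mg hg]; apply: itb_le (itbD measurableT hf hg) => //.
  exact: measurable_funM.
move=> t _; apply: le_trans (ler_norm _); rewrite normrM.
rewrite -(real_normK (num_real (f t))) -(real_normK (num_real (g t))).
have := sqr_ge0 (`|f t| - `|g t|); have := sqr_ge0 `|f t|; have := sqr_ge0 `|g t|.
by rewrite !expr2; nra.
Qed.

Lemma l2D f g : l2 f -> l2 g -> l2 (fun t => f t + g t).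
Proof.
move=> hf hg; split; first by apply: measurable_funD; [exact: hf.1|exact: hg.1].
under [X in itb _ _ X]eq_fun do rewrite sqrrD -mulr_natl.
by apply: itbD => //; [apply: itbD => //; [exact: hf.2|apply: itbZ => //; exact: l2_mul]|exact: hg.2].
Qed.

Lemma l2Z a f : l2 f -> l2 (fun t => a * f t).
Proof.
move=> hf; split; first by apply: measurable_funM => //; exact: hf.1.
by under [X in itb _ _ X]eq_fun do rewrite exprMn; apply: itbZ => //; exact: hf.2.
Qed.

Lemma l2N f : l2 f -> l2 (fun t => - f t).
Proof. by move=> /(l2Z (-1)); under eq_fun do rewrite mulN1r. Qed.

Lemma l2B f g : l2 f -> l2 g -> l2 (fun t => f t - g t).
Proof. by move=> hf hg; apply: l2D => //; exact: l2N. Qed.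

Lemma l20 : l2 (fun=> 0).
Proof. by split => //; under [X in itb _ _ X]eq_fun do rewrite expr0n; exact: itb0. Qed.

Lemma l2_sum I (s : seq I) (Q : pred I) (F : I -> T -> R) :
  (forall i, Q i -> l2 (F i)) -> l2 (fun t => \sum_(i <- s | Q i) F i t).
Proof.
move=> h; elim: s => [|a s IH]; first by under eq_fun do rewrite big_nil; exact: l20.
under eq_fun do rewrite big_cons.
by case: (boolP (Q a)) => // /h ha; exact: l2D.
Qed.

Definition nrm2 (f : T -> R) := \int[P]_t (f t ^+ 2).

Lemma nrm2_ge0 f : 0 <= nrm2 f.
Proof. by apply: Rintegral_ge0 => t _; exact: sqr_ge0. Qed.

Lemma nrm2Z a f : l2 f -> nrm2 (fun t => a * f t) = a ^+ 2 * nrm2 f.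
Proof.
move=> hf; rewrite /nrm2; under eq_Rintegral do rewrite exprMn.
by rewrite RintZ//; exact: hf.2.
Qed.

Lemma nrm2N f : nrm2 (fun t => - f t) = nrm2 f.
Proof. by apply: eq_Rintegral => t _; rewrite sqrrN. Qed.

Lemma nrm2D_le (e : R) f g : 0 < e -> l2 f -> l2 g ->
  nrm2 (fun t => f t + g t) <= (1 + e) * nrm2 f + (1 + e^-1) * nrm2 g.
Proof.
move=> e0 hf hg; rewrite /nrm2 -!RintZ//; [|exact: hg.2|exact: hf.2].
rewrite -RintD//; [|apply: itbZ => //; exact: hf.2|apply: itbZ => //; exact: hg.2].
apply: le_Rint => //.
- exact: (l2D hf hg).2.
- by apply: itbD => //; apply: itbZ => //; [exact: hf.2|exact: hg.2].
move=> t _; rewrite -subr_ge0 (_ : _ - _ = e * (f t - e^-1 * g t) ^+ 2).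
  by rewrite mulr_ge0 ?sqr_ge0// ltW.
by field; rewrite gt_eqF.
Qed.

Lemma nrm2_sum_le (n : nat) (F : 'I_n -> T -> R) (K : R) :
  (forall i, l2 (F i)) -> (forall i, nrm2 (F i) <= K) ->
  nrm2 (fun t => \sum_i F i t) <= n%:R ^+ 2 * K.
Proof.
move=> h hK; apply: (@le_trans _ _ (\int[P]_t (n%:R * \sum_i F i t ^+ 2))).
  apply: le_Rint => //; first exact: (l2_sum _ (fun i _ => h i)).2.
    by apply: itbZ => //; apply: itb_sum => // i _; exact: (h i).2.
  move=> t _; have key : forall m (u : 'I_m -> R), (\sum_i u i) ^+ 2 <= m%:R * \sum_i u i ^+ 2.
    elim=> [|m IH] u; first by rewrite !big_ord0 expr0n mul0r.
    rewrite !big_ord_recl; have := IH (fun i => u (lift ord0 i)).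
    set S := \sum_(i < m) _; set S2 := \sum_(i < m) u (lift ord0 i) ^+ 2 => h1.
    have h2 : 2 * u ord0 * S <= m%:R * u ord0 ^+ 2 + S2.
      rewrite /S /S2 mulr_sumr (_ : m%:R * u ord0 ^+ 2 = \sum_(i < m) u ord0 ^+ 2); last first.
        by rewrite sumr_const card_ord mulr_natl.
      rewrite -big_split/=; apply: ler_sum => i _.
      by have := sqr_ge0 (u ord0 - u (lift ord0 i)); rewrite !expr2; nra.
    by rewrite -natr1; move: h1 h2; rewrite !expr2; nra.
  exact: key.
rewrite RintZ//; last by apply: itb_sum => // i _; exact: (h i).2.
rewrite (Rint_sum measurableT); last by move=> i _; exact: (h i).2.
rewrite expr2 -mulrA ler_wpM2l//.
by rewrite (le_trans (ler_sum _ (fun i _ => hK i)))// sumr_const card_ord mulr_natl.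
Qed.

Lemma nrm2_gram I (s : seq I) (F : I -> T -> R) : (forall i, l2 (F i)) ->
  nrm2 (fun t => \sum_(i <- s) F i t) = \sum_(i <- s) \sum_(j <- s) \int[P]_t (F i t * F j t).
Proof.
move=> h; rewrite /nrm2; under eq_Rintegral do rewrite expr2 big_distrlr/=.
rewrite (Rint_sum measurableT); last by move=> i _; apply: itb_sum => // j _; exact: l2_mul.
by apply: eq_bigr => i _; rewrite (Rint_sum measurableT)// => j _; exact: l2_mul.
Qed.

Lemma Rint_mul_le (e : R) f g : 0 < e -> l2 f -> l2 g ->
  `|\int[P]_t (f t * g t)| <= e * nrm2 f + e^-1 * nrm2 g.
Proof.
move=> e0 hf hg; rewrite /nrm2 -!RintZ//; [|exact: hg.2|exact: hf.2].
rewrite -RintD//; [|apply: itbZ => //; exact: hf.2|apply: itbZ => //; exact: hg.2].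
apply: Rint_norm_le => //; first exact: l2_mul.
  by apply: itbD => //; apply: itbZ => //; [exact: hf.2|exact: hg.2].
move=> t _; rewrite normrM -(real_normK (num_real (f t))) -(real_normK (num_real (g t))).
have E : e * `|f t| ^+ 2 + e^-1 * `|g t| ^+ 2 - 2 * (`|f t| * `|g t|) = e * (`|f t| - e^-1 * `|g t|) ^+ 2.
  by field; rewrite gt_eqF.
have := mulr_ge0 (ltW e0) (sqr_ge0 (`|f t| - e^-1 * `|g t|)); rewrite -E.
have := mulr_ge0 (normr_ge0 (f t)) (normr_ge0 (g t)); lra.
Qed.

End SquareIntegrable.

(** The bound on the integrals also yields integrability of the limit. It is used where that
    integrability is the point: for the sum of the Hermite series and for the singular density. *)
Lemma fatou_le {R : realType} {d : measure_display} {T : measurableType d}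
    (mu : {measure set T -> \bar R}) (D : set T) (mD : measurable D)
    (f_ : nat -> T -> R) (f : T -> R) (K : R) :
  (forall n, measurable_fun D (f_ n)) -> (forall n t, D t -> 0 <= f_ n t) ->
  (forall t, D t -> f_ n t @[n --> \oo] --> f t) -> (forall n, itb mu D (f_ n)) ->
  (\forall n \near \oo, \int[mu]_(t in D) f_ n t <= K) ->
  itb mu D f /\ \int[mu]_(t in D) f t <= K.
Proof.
move=> mf f0 cf jf hK.
have mF : measurable_fun D f by exact: (@measurable_fun_cvg _ _ _ _ f_).
have F0 t : D t -> 0 <= f t.
  by move=> Dt; apply: (cvg_ge_near (cf t Dt)); apply: nearW => n; exact: f0.
have h : (\int[mu]_(t in D) (f t)%:E <= K%:E)%E.
  have := @fatou _ _ _ mu D mD (fun n t => (f_ n t)%:E).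
  move=> /(_ (fun n => (measurable_EFinP _ _).2 (mf n)) (fun n t Dt => (f0 n t Dt : (0 <= (f_ n t)%:E)%E))).
  rewrite (eq_integral (fun t => (f t)%:E)); last first.
    move=> t /set_mem Dt.
    have ce : (f_ n t)%:E @[n --> \oo] --> (f t)%:E by apply: cvg_EFin; [exact: nearW|exact: cf].
    by rewrite is_cvg_limn_einfE ?(cvg_lim _ ce)//; apply: cvgP ce.
  move=> /le_trans; apply.
  rewrite limn_einf_lim; apply: lime_le; first exact: is_cvg_einfs.
  apply: filterS hK => n hn; apply: (@le_trans _ _ (\int[mu]_(t in D) (f_ n t)%:E)%E).
    by apply: ereal_inf_lbound; exists n => //=.
  by rewrite -EFin_Rint// lee_fin.
have jF : itb mu D f.
  apply/integrableP; split; first exact/measurable_EFinP.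
  rewrite (eq_integral (fun t => (f t)%:E)); last by move=> t /set_mem Dt; rewrite /= ger0_norm ?F0.
  exact: le_lt_trans h (ltry _).
by split => //; rewrite -lee_fin EFin_Rint.
Qed.

Section HermiteExpansion.
Context {R : realType}.
Notation gam := (normal_prob (0 : R) 1).

(** Makes the Wick calculus available for the Hermite polynomials under the standard normal law. *)
Lemma gvec_normal : gvec gam (fun (_ : 'I_1) (x : R) => x) (fun _ _ => 1).
Proof.
split => // a; rewrite !big_ord1 mulr1; split.
- by under eq_fun do rewrite big_ord1; exact: measurable_funM.
- move=> u; under eq_Rintegral do rewrite big_ord1 mulrA.
  by rewrite Rint_normal_cos exprMn expr2.
- by move=> u; under eq_Rintegral do rewrite big_ord1 mulrA; exact: Rint_normal_sin.
Qed.

Lemma hermite_l2 q : l2 gam (hermite q : R -> R).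
Proof.
have := hv2_itb gvec_normal ord0 ord0 q q; under eq_fun do rewrite !hv_hermite -expr2.
split => //; have := hv2_itb gvec_normal ord0 ord0 q 0.
by under eq_fun do rewrite hv_hermite hv0 mulr1; move=> /itb_meas.
Qed.

Lemma hermite_orth p q : \int[gam]_x (hermite p x * hermite q x) = (p == q)%:R * p`!%:R.
Proof.
have := Rint_hv2 gvec_normal ord0 ord0 p q; rewrite expr1n mulr1 => <-.
by apply: eq_Rintegral => x _; rewrite !hv_hermite.
Qed.

Lemma hermiteS q (x : R) : hermite q.+1 x = x * hermite q x - q%:R * hermite q.-1 x.
Proof. by rewrite -!hv_hermite hvS mulr1. Qed.

(** Induction on two consecutive degrees. The growth sqrt(q!) is matched to the decay assumed of the
    coefficients, so that the Hermite series converges pointwise. *)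
Lemma hermite_abs_le q (x : R) : `|hermite q x| <= Num.sqrt q`!%:R * (1 + `|x|) ^+ q.
Proof.
suff [] : `|hermite q x| <= Num.sqrt q`!%:R * (1 + `|x|) ^+ q /\
  `|hermite q.+1 x| <= Num.sqrt q.+1`!%:R * (1 + `|x|) ^+ q.+1 by [].
have x0 := normr_ge0 x.
elim: q => [|q [IH1 IH2]].
  rewrite -!hv_hermite hv0 hv1 fact0 sqrtr1 expr0 expr1 mulr1 mul1r normr1; split => //; lra.
split=> //; rewrite hermiteS /=.
rewrite (le_trans (ler_normB _ _))// !normrM [`|_%:R|]ger0_norm//.
have sq2 : Num.sqrt (q.+2`!%:R : R) = Num.sqrt q.+2%:R * Num.sqrt (q.+1`!%:R : R).
  by rewrite factS natrM sqrtrM.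
have sq1 : Num.sqrt (q.+1`!%:R : R) = Num.sqrt q.+1%:R * Num.sqrt (q`!%:R : R).
  by rewrite factS natrM sqrtrM.
have a1 : 1 <= Num.sqrt (q.+2%:R : R) by rewrite -[leLHS]sqrtr1 ler_wsqrtr// ler1n.
have a2 : Num.sqrt (q.+1%:R : R) <= Num.sqrt q.+2%:R by rewrite ler_wsqrtr// ler_nat.
have a3 : q.+1%:R = Num.sqrt (q.+1%:R : R) * Num.sqrt q.+1%:R by rewrite -expr2 sqr_sqrtr.
have b1 : `|x| * `|hermite q.+1 x| <= Num.sqrt q.+2%:R * (`|x| * (Num.sqrt q.+1`!%:R * (1 + `|x|) ^+ q.+1)).
  apply: (@le_trans _ _ (`|x| * (Num.sqrt q.+1`!%:R * (1 + `|x|) ^+ q.+1))); first by rewrite ler_wpM2l.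
  by rewrite ler_peMl// !mulr_ge0 ?sqrtr_ge0// exprn_ge0// addr_ge0.
have b2 : q.+1%:R * `|hermite q x| <= Num.sqrt q.+2%:R * (Num.sqrt q.+1`!%:R * (1 + `|x|) ^+ q.+1).
  apply: (@le_trans _ _ (q.+1%:R * (Num.sqrt q`!%:R * (1 + `|x|) ^+ q))); first by rewrite ler_wpM2l.
  have p0 : 0 <= (1 + `|x|) ^+ q by rewrite exprn_ge0 ?addr_ge0.
  rewrite {1}a3 sq1 exprS -!mulrA ler_pM ?sqrtr_ge0 ?mulr_ge0 ?sqrtr_ge0//.
  by do 2 rewrite ler_wpM2l ?sqrtr_ge0//; rewrite ler_peMl// lerDl.
rewrite sq2 [(1 + `|x|) ^+ q.+2]exprS.
rewrite (_ : _ * _ = Num.sqrt q.+2%:R * (`|x| * (Num.sqrt q.+1`!%:R * (1 + `|x|) ^+ q.+1)) +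
  Num.sqrt q.+2%:R * (Num.sqrt q.+1`!%:R * (1 + `|x|) ^+ q.+1)); first exact: lerD.
by ring.
Qed.

Section Expansion.
Variables (G : R -> R) (cf : nat -> R).
Hypotheses (lG : l2 gam G) (cfE : forall q, cf q = \int[gam]_x (G x * hermite q x)).
Hypothesis cfdec : forall lam : R, 0 < lam -> exists C : R, forall q,
  `|cf q| <= C * Num.sqrt q`!%:R * expR (- (lam * q%:R)).

Definition hpart (Q : nat) (x : R) : R := \sum_(q < Q) cf q / q`!%:R * hermite q x.

Lemma hpart_l2 Q : l2 gam (hpart Q).
Proof. by apply: l2_sum => q _; apply: l2Z; exact: hermite_l2. Qed.

(** The rate ln(2z + 1) is chosen so that z times its negative exponential is at most 1/2. *)
Lemma cf_geometric (z : R) : 0 < z -> exists C : R, 0 <= C /\ forall q, `|cf q| / Num.sqrt q`!%:R * z ^+ q <= C * 2^-1 ^+ q.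
Proof.
move=> z0; have z1 : 0 < 2 * z + 1 by rewrite ltr_wpDl// mulr_ge0// ltW.
have lz : 0 < ln (2 * z + 1) by rewrite ln_gt0// ltrDr mulr_gt0.
have [C hC] := cfdec lz.
have sq (q : nat) : 0 < Num.sqrt (q`!%:R : R) by rewrite sqrtr_gt0 ltr0n fact_gt0.
have C0 : 0 <= C.
  have := hC 0%N; rewrite fact0 sqrtr1 mulr1 mulr0 oppr0 expR0 mulr1; exact: le_trans.
exists C; split => // q; have hq := hC q.
have e1 : expR (- (ln (2 * z + 1) * q%:R)) = (2 * z + 1)^-1 ^+ q.
  by rewrite -mulNr mulrC expRM_natl expRN lnK.
rewrite e1 in hq.
apply: (@le_trans _ _ (C * (2 * z + 1)^-1 ^+ q * z ^+ q)).
  by rewrite ler_wpM2r ?exprn_ge0 ?(ltW z0)// ler_pdivrMr// mulrAC.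
rewrite -mulrA -exprMn ler_wpM2l// lerXn2r ?nnegrE ?mulr_ge0 ?invr_ge0 ?(ltW z0) ?(ltW z1)//.
by rewrite mulrC ler_pdivrMr//; lra.
Qed.

Lemma geometric_sum_le Q n : \sum_(Q <= q < Q + n) (2^-1 : R) ^+ q <= 2 * 2^-1 ^+ Q.
Proof.
suff : \sum_(Q <= q < Q + n) (2^-1 : R) ^+ q = 2 * 2^-1 ^+ Q - 2 * 2^-1 ^+ (Q + n).
  move=> ->; rewrite gerBl mulr_ge0// exprn_ge0//.
elim: n => [|n IH]; first by rewrite addn0 big_geq// subrr.
rewrite addnS big_nat_recr ?leq_addr//= IH exprS; lra.
Qed.

Lemma hpartB Q n (x : R) : hpart (Q + n) x - hpart Q x = \sum_(Q <= q < Q + n) cf q / q`!%:R * hermite q x.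
Proof.
rewrite /hpart -!(big_mkord xpredT (fun q => cf q / q`!%:R * hermite q x)).
by rewrite (big_cat_nat (leq0n Q) (leq_addr n Q))/= addrAC subrr add0r.
Qed.

Lemma hpart_cvg (x : R) : cvg (hpart ^~ x @ \oo).
Proof.
have z0 : 0 < 1 + `|x| by rewrite ltr_pwDl.
have [C [C0 hC]] := cf_geometric z0.
pose u q := cf q / q`!%:R * hermite q x.
suff : cvg (series u @ \oo).
  by rewrite (_ : hpart ^~ x = series u)//; apply/funext => n; rewrite /series /= big_mkord.
apply: normed_cvg.
apply: (@series_le_cvg R _ (fun q => C * 2^-1 ^+ q)).
- by move=> n; exact: normr_ge0.
- by move=> n; rewrite mulr_ge0// exprn_ge0.
- move=> q; apply: le_trans (hC q); rewrite /= /u !normrM normfV [`|_%:R|]ger0_norm//.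
  have sq : 0 < Num.sqrt (q`!%:R : R) by rewrite sqrtr_gt0 ltr0n fact_gt0.
  have E : (q`!%:R : R) = Num.sqrt q`!%:R * Num.sqrt q`!%:R by rewrite -expr2 sqr_sqrtr.
  rewrite {1}E invfM -!mulrA ler_wpM2l// ler_wpM2l ?invr_ge0 ?(ltW sq)//.
  by rewrite mulrC ler_pdivrMr// mulrC hermite_abs_le.
- have := @is_cvg_geometric_series R C 2^-1; rewrite /geometric; apply.
  by rewrite ger0_norm ?invr_ge0// invf_lt1// ltr1n.
Qed.

Lemma nrm2_hpartB Q n : nrm2 gam (fun x => hpart (Q + n) x - hpart Q x) =
  \sum_(Q <= q < Q + n) cf q ^+ 2 / q`!%:R.
Proof.
rewrite (_ : (fun x => _) = (fun x => \sum_(q <- index_iota Q (Q + n)) cf q / q`!%:R * hermite q x)); last first.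
  by apply/funext => x; rewrite hpartB.
rewrite (@nrm2_gram _ _ _ gam nat _ (fun q x => cf q / q`!%:R * hermite q x)); last first.
  by move=> q; apply: l2Z; exact: hermite_l2.
rewrite big_seq [RHS]big_seq; apply: eq_bigr => q qi.
have f0 : (q`!%:R : R) != 0 by rewrite pnatr_eq0 -lt0n fact_gt0.
rewrite (bigD1_seq q) ?iota_uniq//= big1 ?addr0 => [|p pq].
  under eq_Rintegral do rewrite mulrACA.
  rewrite RintZ//; last by apply: l2_mul; exact: hermite_l2.
  by rewrite hermite_orth eqxx/= mul1r; field.
under eq_Rintegral do rewrite mulrACA.
rewrite RintZ//; last by apply: l2_mul; exact: hermite_l2.
by rewrite hermite_orth eq_sym (negbTE pq) !mul0r mulr0.
Qed.

Lemma cf2_tail : exists C : R, 0 <= C /\ forall Q n, \sum_(Q <= q < Q + n) cf q ^+ 2 / q`!%:R <= C * 2^-1 ^+ Q.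
Proof.
have [C [C0 hC]] := @cf_geometric 1 ltr01.
exists (C ^+ 2 * 2); split => [|Q n]; first by rewrite mulr_ge0// sqr_ge0.
apply: (@le_trans _ _ (\sum_(Q <= q < Q + n) C ^+ 2 * 2^-1 ^+ q)); last first.
  by rewrite -mulr_sumr -mulrA ler_wpM2l ?sqr_ge0// geometric_sum_le.
apply: ler_sum => q _; have := hC q; rewrite expr1n mulr1 => h.
have E : (q`!%:R : R) = Num.sqrt q`!%:R ^+ 2 by rewrite sqr_sqrtr.
rewrite E -exprVn -exprMn -(real_normK (num_real (_ * _))) normrM [`|_^-1|]ger0_norm ?invr_ge0 ?sqrtr_ge0//.
apply: (@le_trans _ _ ((C * 2^-1 ^+ q) ^+ 2)).
  by rewrite lerXn2r// nnegrE ?mulr_ge0 ?invr_ge0 ?sqrtr_ge0 ?exprn_ge0.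
rewrite exprMn ler_wpM2l ?sqr_ge0// -exprM muln2 -addnn exprD ler_piMl ?exprn_ge0//.
by rewrite exprn_ile1// ?invr_ge0// invf_le1// ler1n.
Qed.

Let Gt (x : R) := lim (hpart ^~ x @ \oo).

Let Gt_cvg x : hpart ^~ x @ \oo --> Gt x. Proof. exact: hpart_cvg. Qed.

Let Gt_meas : measurable_fun setT Gt.
Proof. by apply: (@measurable_fun_cvg _ _ _ _ hpart) => [n|x _]; [exact: (hpart_l2 n).1|exact: Gt_cvg]. Qed.

Let Gt_tail : exists C : R, 0 <= C /\ forall Q, l2 gam (fun x => Gt x - hpart Q x) /\
  nrm2 gam (fun x => Gt x - hpart Q x) <= C * 2^-1 ^+ Q.
Proof.
have [C [C0 hC]] := cf2_tail; exists C; split => // Q.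
have mQ := (hpart_l2 Q).1.
have lQ n : l2 gam (fun x => hpart (Q + n) x - hpart Q x) by apply: l2B; exact: hpart_l2.
have [] := @fatou_le R _ _ gam _ measurableT (fun n x => (hpart (Q + n) x - hpart Q x) ^+ 2)
  (fun x => (Gt x - hpart Q x) ^+ 2) (C * 2^-1 ^+ Q).
- by move=> n; apply: measurable_funX; exact: (lQ n).1.
- by move=> n t _; exact: sqr_ge0.
- move=> x _; rewrite expr2; under eq_fun do rewrite expr2.
  have h : hpart (Q + n) x - hpart Q x @[n --> \oo] --> Gt x - hpart Q x.
    apply: cvgB; last exact: cvg_cst.
    rewrite (_ : (fun n => _) = (fun n => hpart (n + Q)%N x)); last by apply/funext => n; rewrite addnC.
    by apply: (cvg_comp _ (hpart ^~ x) (cvg_addnr Q)); exact: Gt_cvg.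
  exact: cvgM.
- by move=> n; exact: (lQ n).2.
- by apply: nearW => n; rewrite -/(nrm2 _ _) nrm2_hpartB.
by move=> h1 h2; split => //; split => //; exact: measurable_funB.
Qed.

(** The pointwise sum [Gt] of the series supplies the candidate limit. Its difference with G is
    orthogonal to all Hermite polynomials, hence to all powers, hence zero almost everywhere. *)
Lemma hermite_expansion : nrm2 gam (fun x => G x - hpart Q x) @[Q --> \oo] --> (0 : R).
Proof.
have [C [C0 hC]] := Gt_tail.
have lGt : l2 gam Gt.
  have := l2D (hC 0%N).1 (hpart_l2 0); by under eq_fun do rewrite subrK.
pose D x := G x - Gt x.
have lD : l2 gam D by exact: l2B.
(* For Q > q the partial sum has the same coefficient of degree q as G, so only the tail of the
   series contributes; the weight e absorbs the fixed norm of the Hermite polynomial while Q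
   grows. *)
have DH q : \int[gam]_x (D x * hermite q x) = 0.
  have key (e : R) : 0 < e -> `|\int[gam]_x (D x * hermite q x)| <= e * q`!%:R.
    move=> e0.
    have h Q : (q < Q)%N -> `|\int[gam]_x (D x * hermite q x)| <= e * q`!%:R + e^-1 * (C * 2^-1 ^+ Q).
      move=> qQ.
      have f0 : (q`!%:R : R) != 0 by rewrite pnatr_eq0 -lt0n fact_gt0.
      have iGH : itb gam setT (fun x => G x * hermite q x) by apply: l2_mul => //; exact: hermite_l2.
      have iQH : itb gam setT (fun x => hpart Q x * hermite q x).
        by apply: l2_mul; [exact: hpart_l2|exact: hermite_l2].
      have iTH : itb gam setT (fun x => (Gt x - hpart Q x) * hermite q x).
        by apply: l2_mul; [exact: (hC Q).1|exact: hermite_l2].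
      have QH : \int[gam]_x (hpart Q x * hermite q x) = cf q.
        under eq_Rintegral do rewrite mulr_suml.
        under eq_Rintegral do under eq_bigr do rewrite -mulrA.
        rewrite (Rint_sum measurableT); last first.
          by move=> p _; apply: itbZ => //; apply: l2_mul; exact: hermite_l2.
        rewrite (bigD1 (Ordinal qQ))//= big1 ?addr0 => [|p pq].
          rewrite RintZ//; last by apply: l2_mul; exact: hermite_l2.
          by rewrite hermite_orth eqxx mul1r divfK.
        rewrite RintZ//; last by apply: l2_mul; exact: hermite_l2.
        by rewrite hermite_orth -val_eqE/= in pq *; rewrite (negbTE pq) mul0r mulr0.
      have E : \int[gam]_x (D x * hermite q x) = - \int[gam]_x (hermite q x * (Gt x - hpart Q x)).
        transitivity (\int[gam]_x (G x * hermite q x) - \int[gam]_x (hpart Q x * hermite q x) -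
           \int[gam]_x ((Gt x - hpart Q x) * hermite q x)).
          rewrite -RintB// -RintB//; last exact: itbB.
          by apply: eq_Rintegral => x _; rewrite /D; ring.
        rewrite QH -cfE subrr sub0r; congr (- _); by apply: eq_Rintegral => x _; rewrite mulrC.
      rewrite E normrN (le_trans (Rint_mul_le e0 (hermite_l2 q) (hC Q).1))//.
      rewrite [X in e * X + _](_ : _ = q`!%:R); last first.
        by rewrite /nrm2; under eq_Rintegral do rewrite expr2; rewrite hermite_orth eqxx mul1r.
      by rewrite lerD2l ler_wpM2l ?invr_ge0 ?(ltW e0)//; exact: (hC Q).2.
    have hl : e * q`!%:R + e^-1 * (C * 2^-1 ^+ Q) @[Q --> \oo] --> e * q`!%:R.
      apply: cvg_to_eq (_ : _ --> e * q`!%:R + e^-1 * (C * 0)) _; last by rewrite !mulr0 addr0.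
      apply: cvgD; first exact: cvg_cst.
      apply: cvgM; first exact: cvg_cst.
      apply: cvgM; first exact: cvg_cst.
      by apply: cvg_expr; rewrite ger0_norm ?invr_ge0// invf_lt1// ltr1n.
    apply: (cvg_ge_near hl); exists q.+1 => // Q /= qQ; exact: h.
  apply/eqP; rewrite -normr_le0; apply/ler_addgt0Pl => e e0; rewrite addr0.
  have f0 : 0 < (q`!%:R : R) by rewrite ltr0n fact_gt0.
  by rewrite (le_trans (key _ (divr_gt0 e0 f0)))// divfK// gt_eqF.
pose idL := fun (_ : 'I_1) (x : measurableTypeR R) => (x : R).
have lpow k q : l2 gam (fun x => x ^+ k * hermite q x).
  have : exists F', pspan idL (fun x : R => x ^+ k * hv 1 q x) F'.
    elim: k => [|k [F' IH]].
      have -> : (fun x : R => x ^+ 0 * hv 1 q x) = (fun x : R => hv 1 q x) by apply/funext => x; rewrite mul1r.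
      by eexists; exact: (pspan_hv idL (fun _ _ => 1) ord0 q).
    have -> : (fun x : R => x ^+ k.+1 * hv 1 q x) = (fun x : R => x * (x ^+ k * hv 1 q x)) by apply/funext => x; rewrite exprS mulrA.
    by eexists; apply: pspan_mul IH; exact: (pspan_gen idL ord0).
  move=> [F' /(pspan_l2 gvec_normal)]; rewrite /l2.
  by under [X in measurable_fun _ X]eq_fun do rewrite hv_hermite; under [X in itb _ _ X]eq_fun do rewrite hv_hermite.
(* The recursion trades one power of x for the neighbouring degrees q + 1 and q - 1. *)
have Dpow k q : \int[gam]_x (D x * (x ^+ k * hermite q x)) = 0.
  elim: k q => [|k IH] q.
    by rewrite -[RHS](DH q); apply: eq_Rintegral => x _; rewrite expr0 mul1r.
  transitivity (\int[gam]_x (D x * (x ^+ k * hermite q.+1 x)) + q%:R * \int[gam]_x (D x * (x ^+ k * hermite q.-1 x))).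
    rewrite -RintZ//; last exact: l2_mul.
    rewrite -RintD//; [|exact: l2_mul|by apply: itbZ => //; exact: l2_mul].
    by apply: eq_Rintegral => x _; rewrite hermiteS exprS; ring.
  by rewrite !IH mulr0 addr0.
have D0 : nrm2 gam D = 0.
  apply: normal_poly_complete; [exact: lD.1|exact: lD.2|move=> m].
  by rewrite -[RHS](Dpow m 0%N); apply: eq_Rintegral => x _; rewrite /hermite /= mulr1.
have hub Q : nrm2 gam (fun x => G x - hpart Q x) <= 2 * (C * 2^-1 ^+ Q).
  have := nrm2D_le ltr01 lD (hC Q).1; rewrite D0 mulr0 add0r invr1.
  rewrite (_ : (fun t => D t + _) = (fun x => G x - hpart Q x)); last first.
    by apply/funext => x; rewrite /D; ring.
  by move=> /le_trans; apply; rewrite ler_wpM2l//; exact: (hC Q).2.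
apply: (@squeeze_cvgr _ _ _ _ (fun=> 0) (fun Q => 2 * (C * 2^-1 ^+ Q))).
- by apply: nearW => Q; rewrite nrm2_ge0 hub.
- exact: cvg_cst.
- apply: cvg_to_eq (_ : _ --> 2 * (C * 0)) _; last by rewrite !mulr0.
  apply: cvgM; first exact: cvg_cst.
  apply: cvgM; first exact: cvg_cst.
  by apply: cvg_expr; rewrite ger0_norm ?invr_ge0// invf_lt1// ltr1n.
Qed.

Section HermiteRest.
Context {d : measure_display} {T : measurableType d} (P : probability T R).
Context {n : nat} (L : 'I_n -> T -> R) (c : 'I_n -> 'I_n -> R).
Hypotheses (gL : gvec P L c) (c1 : forall i, c i i = 1).

Lemma gvec_gvar i : gvar P (L i) 1.
Proof.
have := gL.2 (fun j => (j == i)%:R); rewrite comb_delta.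
rewrite (_ : \sum_j _ = 1)//.
under eq_bigr => j _ do under eq_bigr => k _ do rewrite -mulrA.
by under eq_bigr do rewrite -mulr_sumr sum_delta; rewrite sum_delta c1.
Qed.

Lemma gvec_l2 i (F : R -> R) : l2 gam F -> l2 P (fun t => F (L i t)) /\
  nrm2 P (fun t => F (L i t)) = nrm2 gam F.
Proof.
move=> [mF iF]; have mF2 : measurable_fun setT (fun x => F x ^+ 2) by exact: measurable_funX.
have gi := gvec_gvar i; have h : itb gam setT (fun x => F (Num.sqrt 1 * x) ^+ 2).
  by under eq_fun do rewrite sqrtr1 mul1r.
split; last first.
  rewrite /nrm2 (gvar_Rint gi mF2 h); apply: eq_Rintegral => x _.
  by rewrite sqrtr1 mul1r.
split; last exact: (gvar_itb gi mF2 h).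
by apply: measurableT_comp => //; exact: (gvar_meas gi).
Qed.

Lemma hermite_comb_nrm2 (a : 'I_n -> R) (b : nat -> R) Q :
  nrm2 P (fun t => \sum_(q < Q) b q * \sum_i a i * hermite q (L i t)) =
  \sum_(q < Q) b q ^+ 2 * q`!%:R * \sum_i \sum_j a i * a j * c i j ^+ q.
Proof.
have lH i q : l2 P (fun t => hermite q (L i t)) by apply: (gvec_l2 i _).1; exact: hermite_l2.
have lS q : l2 P (fun t => \sum_i a i * hermite q (L i t)) by apply: l2_sum => i _; exact: l2Z.
have cross p q : \int[P]_t ((\sum_i a i * hermite p (L i t)) * (\sum_i a i * hermite q (L i t))) =
    (p == q)%:R * p`!%:R * \sum_i \sum_j a i * a j * c i j ^+ p.
  under eq_Rintegral do rewrite big_distrlr/=.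
  rewrite (Rint_sum measurableT); last first.
    by move=> i _; apply: itb_sum => // j _; apply: l2_mul; exact: l2Z.
  rewrite mulr_sumr; apply: eq_bigr => i _.
  rewrite (Rint_sum measurableT); last by move=> j _; apply: l2_mul; exact: l2Z.
  rewrite mulr_sumr; apply: eq_bigr => j _.
  under eq_Rintegral do rewrite mulrACA.
  rewrite RintZ//; last exact: l2_mul.
  have := Rint_hv2 gL i j p q; rewrite !c1 => h.
  under eq_Rintegral do rewrite -!hv_hermite.
  by rewrite h mulrCA.
rewrite (@nrm2_gram _ _ _ P _ _ (fun (q : 'I_Q) t => b q * \sum_i a i * hermite q (L i t))); last first.
  by move=> q; exact: l2Z.
apply: eq_bigr => q _.
have E (p : 'I_Q) : \int[P]_t (b q * (\sum_i a i * hermite q (L i t)) * (b p * \sum_i a i * hermite p (L i t))) =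
   (p == q)%:R * (b q * b p * q`!%:R * \sum_i \sum_j a i * a j * c i j ^+ q).
  under eq_Rintegral do rewrite mulrACA.
  by rewrite RintZ ?cross//; [rewrite -val_eqE/= eq_sym; ring|exact: l2_mul].
by under eq_bigr do rewrite E; rewrite (sum_delta q (fun p => b q * b p * _ * _)) expr2.
Qed.

(** Truncation at Q splits the sum into the degrees below Q other than q0, controlled by
    orthogonality of the degrees, and a tail that vanishes as Q grows because n and the weights are
    fixed. The factor 2 is the price of this splitting. *)
Lemma hermite_rest_le (a : 'I_n -> R) (q0 : nat) (Bnd : R) :
  (forall Q, \sum_(q < Q) (val q != q0)%:R * (cf q ^+ 2 / q`!%:R) * \sum_i \sum_j a i * a j * c i j ^+ q <= Bnd) ->
  nrm2 P (fun t => \sum_i a i * (G (L i t) - cf q0 / q0`!%:R * hermite q0 (L i t))) <= 2 * Bnd.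
Proof.
move=> hB.
pose b q := (q != q0)%:R * (cf q / q`!%:R).
pose A Q t := \sum_(q < Q) b q * \sum_i a i * hermite q (L i t).
pose E Q t := \sum_i a i * (G (L i t) - hpart Q (L i t)).
have lH i q : l2 P (fun t => hermite q (L i t)) by apply: (gvec_l2 i _).1; exact: hermite_l2.
have lA Q : l2 P (A Q) by apply: l2_sum => q _; apply: l2Z; apply: l2_sum => i _; exact: l2Z.
have lGQ Q : l2 gam (fun x => G x - hpart Q x) by apply: l2B => //; exact: hpart_l2.
have lGQL Q i : l2 P (fun t => G (L i t) - hpart Q (L i t)) by exact: (gvec_l2 i (lGQ Q)).1.
have lE Q : l2 P (E Q) by apply: l2_sum => i _; exact: l2Z.
have nA Q : nrm2 P (A Q) <= Bnd.
  rewrite hermite_comb_nrm2 (le_trans _ (hB Q))//; apply: ler_sum => q _.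
  have f0 : (q`!%:R : R) != 0 by rewrite pnatr_eq0 -lt0n fact_gt0.
  rewrite le_eqVlt (_ : _ * q`!%:R = (val q != q0)%:R * (cf q ^+ 2 / q`!%:R)) ?eqxx//.
  rewrite /b; case: (_ != _); rewrite ?mul0r ?expr0n ?mul0r//= !mul1r; by field.
pose S := \sum_i a i ^+ 2.
have nE Q : nrm2 P (E Q) <= n%:R ^+ 2 * (S * nrm2 gam (fun x => G x - hpart Q x)).
  apply: nrm2_sum_le => i; first exact: l2Z.
  rewrite nrm2Z// (gvec_l2 i (lGQ Q)).2 ler_wpM2r ?nrm2_ge0//.
  by rewrite /S (bigD1 i)//= lerDl sumr_ge0// => j _; exact: sqr_ge0.
have hl : 2 * Bnd + 2 * (n%:R ^+ 2 * (S * nrm2 gam (fun x => G x - hpart Q x))) @[Q --> \oo] --> 2 * Bnd.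
  apply: cvg_to_eq (_ : _ --> 2 * Bnd + 2 * (n%:R ^+ 2 * (S * 0))) _; last by rewrite !mulr0 addr0.
  apply: cvgD; first exact: cvg_cst.
  do 3 (apply: cvgM; first exact: cvg_cst).
  exact: hermite_expansion.
apply: (cvg_ge_near hl); exists q0.+1 => // Q /= qQ.
rewrite (_ : (fun t => _) = (fun t => A Q t + E Q t)).
  have := nrm2D_le ltr01 (lA Q) (lE Q); rewrite invr1 => /le_trans; apply.
  by apply: lerD; rewrite ler_wpM2l// ?addr_ge0.
apply/funext => t; rewrite /A /E.
under [X in _ = X + _]eq_bigr do rewrite mulr_sumr.
rewrite exchange_big -big_split/=; apply: eq_bigr => i _.
rewrite /hpart [X in _ = X + _](bigD1 (Ordinal qQ))//= [X in _ = _ + a i * (G _ - X)](bigD1 (Ordinal qQ))//= /b eqxx !mul0r add0r.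
rewrite [X in _ = X + _](_ : _ = a i * \sum_(q < Q | q != Ordinal qQ) cf q / q`!%:R * hermite q (L i t)); first by ring.
rewrite mulr_sumr; apply: eq_bigr => q /eqP qne.
by rewrite (_ : (_ != _) = true) ?mul1r 1?mulrCA//; apply/eqP => h; apply: qne; exact/val_inj.
Qed.

End HermiteRest.

End Expansion.

End HermiteExpansion.

(** * Positive definite kernels *)

Section Kernels.
Context {R : realType}.
Implicit Types k B : int -> R.

Definition qf n (a : 'I_n -> R) (t : 'I_n -> int) k := \sum_i \sum_l a i * a l * k (t i - t l).

Definition psd k := forall n (a : 'I_n -> R) t, 0 <= qf a t k.

Lemma qfD n (a : 'I_n -> R) t k1 k2 : qf a t (fun h => k1 h + k2 h) = qf a t k1 + qf a t k2.
Proof.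
rewrite /qf -big_split; apply: eq_bigr => i _; rewrite -big_split; apply: eq_bigr => l _.
by rewrite mulrDr.
Qed.

Lemma qfZ n (a : 'I_n -> R) t c k : qf a t (fun h => c * k h) = c * qf a t k.
Proof.
rewrite /qf mulr_sumr; apply: eq_bigr => i _; rewrite mulr_sumr; apply: eq_bigr => l _.
by rewrite mulrCA.
Qed.

Lemma qfB n (a : 'I_n -> R) t k1 k2 : qf a t (fun h => k1 h - k2 h) = qf a t k1 - qf a t k2.
Proof.
by rewrite -[- qf a t k2]mulN1r -qfZ -qfD; congr qf; apply/funext => h; rewrite mulN1r.
Qed.

Lemma qf_abs_le n (a : 'I_n -> R) t k K : (forall h, `|k h| <= K h) ->
  `|qf a t k| <= qf (fun i => `|a i|) t K.
Proof.
move=> h; rewrite (le_trans (ler_norm_sum _ _ _))//; apply: ler_sum => i _.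
rewrite (le_trans (ler_norm_sum _ _ _))//; apply: ler_sum => l _.
by rewrite !normrM ler_wpM2l// mulr_ge0.
Qed.

(* A kernel that preserves positive semidefiniteness under pointwise multiplication
   (Schur's theorem for the kernels met below, without proving it in general). *)
Definition mpsd k := forall k', psd k' -> psd (fun h => k h * k' h).

Lemma psd1 : psd (fun=> 1).
Proof.
move=> n a t; rewrite (_ : qf a t _ = (\sum_i a i) ^+ 2) ?sqr_ge0//.
rewrite expr2 big_distrlr /qf; apply: eq_bigr => i _; apply: eq_bigr => l _.
by rewrite mulr1.
Qed.

Lemma mpsd_psd k : mpsd k -> psd k.
Proof. by move=> /(_ _ psd1); under eq_fun do rewrite mulr1. Qed.

Lemma mpsd1 : mpsd (fun=> 1).
Proof. by move=> k' h; under eq_fun do rewrite mul1r. Qed.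

Lemma mpsdD k1 k2 : mpsd k1 -> mpsd k2 -> mpsd (fun h => k1 h + k2 h).
Proof.
move=> h1 h2 k' hk n a t; under eq_fun do rewrite mulrDl.
by rewrite qfD addr_ge0//; [exact: h1|exact: h2].
Qed.

Lemma mpsdZ c k : 0 <= c -> mpsd k -> mpsd (fun h => c * k h).
Proof.
move=> c0 h1 k' hk n a t; under eq_fun do rewrite -mulrA.
by rewrite qfZ mulr_ge0//; exact: h1.
Qed.

Lemma mpsdM k1 k2 : mpsd k1 -> mpsd k2 -> mpsd (fun h => k1 h * k2 h).
Proof. by move=> h1 h2 k' hk; under eq_fun do rewrite -mulrA; apply: h1; exact: h2. Qed.

(* Holds for [k = rF F] and [B = rF G] as soon as [`|F| <= G], and is stable under products. *)
Definition adom k B := mpsd (fun h => B h - k h) /\ mpsd (fun h => B h + k h).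

Lemma adom_eq k B k' B' : adom k B -> k =1 k' -> B =1 B' -> adom k' B'.
Proof. by move=> h /funext <- /funext <-. Qed.

Lemma mpsd_adom k : mpsd k -> adom k k.
Proof.
move=> hk; split; last exact: mpsdD.
have := mpsdZ (lexx 0) hk; rewrite (_ : (fun h => _) = (fun h => k h - k h))//.
by apply/funext => h; rewrite mul0r subrr.
Qed.

Lemma adomD k1 k2 B1 B2 : adom k1 B1 -> adom k2 B2 ->
  adom (fun h => k1 h + k2 h) (fun h => B1 h + B2 h).
Proof.
move=> [h1 h2] [h3 h4]; split.
  by have := mpsdD h1 h3; rewrite (_ : (fun h => _) = (fun h => B1 h + B2 h - (k1 h + k2 h)))//; apply/funext => h; ring.
by have := mpsdD h2 h4; rewrite (_ : (fun h => _) = (fun h => B1 h + B2 h + (k1 h + k2 h)))//; apply/funext => h; ring.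
Qed.

Lemma adomZ c k B : 0 <= c -> adom k B -> adom (fun h => c * k h) (fun h => c * B h).
Proof.
move=> c0 [/(mpsdZ c0) h1 /(mpsdZ c0) h2]; split.
  by under eq_fun do rewrite -mulrBr.
by under eq_fun do rewrite -mulrDr.
Qed.

(** Twice B1 B2 - k1 k2 is (B1 - k1)(B2 + k2) + (B1 + k1)(B2 - k2), and similarly for the sum:
    products of kernels that preserve semidefiniteness. *)
Lemma adomM k1 k2 B1 B2 : adom k1 B1 -> adom k2 B2 ->
  adom (fun h => k1 h * k2 h) (fun h => B1 h * B2 h).
Proof.
move=> [h1 h2] [h3 h4]; have c0 : 0 <= 2^-1 :> R by rewrite invr_ge0.
split.
  have := mpsdZ c0 (mpsdD (mpsdM h1 h4) (mpsdM h2 h3)).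
  by rewrite (_ : (fun h => _) = (fun h => B1 h * B2 h - k1 h * k2 h))//; apply/funext => h; field.
have := mpsdZ c0 (mpsdD (mpsdM h1 h3) (mpsdM h2 h4)).
by rewrite (_ : (fun h => _) = (fun h => B1 h * B2 h + k1 h * k2 h))//; apply/funext => h; field.
Qed.

Lemma adomX k B q : adom k B -> adom (fun h => k h ^+ q) (fun h => B h ^+ q).
Proof.
move=> hk; elim: q => [|q IH]; first by apply: mpsd_adom; exact: mpsd1.
by under eq_fun do rewrite exprS; under [X in adom _ X]eq_fun do rewrite exprS; exact: adomM.
Qed.

(** Telescoping: k1^(q+1) - k2^(q+1) = k1^q (k1 - k2) + (k1^q - k2^q) k2. *)
Lemma adom_exprB k1 k2 B D q : adom k1 B -> adom k2 B -> adom (fun h => k1 h - k2 h) D ->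
  adom (fun h => k1 h ^+ q - k2 h ^+ q) (fun h => q%:R * (D h * B h ^+ q.-1)).
Proof.
move=> h1 h2 h3; elim: q => [|q IH].
  apply: adom_eq (adomZ (lexx 0) (mpsd_adom mpsd1)) _ _ => h /=; last by rewrite !mul0r.
  by rewrite subrr mul0r.
apply: adom_eq (adomD (adomM (adomX q h1) h3) (adomM IH h2)) _ _ => h /=.
  by rewrite !exprS; ring.
case: q {IH} => [|q] /=; first by rewrite expr0; ring.
by rewrite -[in RHS]natr1 exprS; ring.
Qed.

Lemma adom_qf n (a : 'I_n -> R) t k B : adom k B -> `|qf a t k| <= qf a t B.
Proof.
move=> [/mpsd_psd/(_ n a t) + /mpsd_psd/(_ n a t)]; rewrite qfB qfD ler_norml => h1 h2.
by apply/andP; split; lra.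
Qed.

Notation mu := (@lebesgue_measure R).
Notation Ipi := `[(- pi)%R, pi%R]%classic.

(** The covariance function with spectral density [F]; it is [autocov F] up to unfolding. *)
Definition rF (F : R -> R) (h : int) : R := \int[mu]_(x in Ipi) (cos (x * h%:~R) * F x).

Lemma mIpi : measurable (Ipi : set (measurableTypeR R)). Proof. exact: measurable_itv. Qed.
Hint Resolve mIpi : core.

Lemma itb_bounded_mul F (u : R -> R) c : measurable_fun setT u -> (forall x, `|u x| <= c) ->
  itb mu Ipi F -> itb mu Ipi (fun x => u x * F x).
Proof.
move=> mu' bu iF; apply: itb_le (itbZ mIpi c iF) => //.
  by apply: measurable_funM; [exact: measurable_funTS|exact: itb_meas iF].
move=> x _; rewrite !normrM ler_wpM2r// (le_trans (bu x))//; exact: ler_norm.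
Qed.

Lemma itb_cosF F (h : R) : itb mu Ipi F -> itb mu Ipi (fun x => cos (x * h) * F x).
Proof.
apply: (@itb_bounded_mul _ _ 1) => [|x]; last by rewrite ler_norml cos_geN1 cos_le1.
by apply: continuous_measurable_fun; cont_auto.
Qed.

Definition cos2 n (a : 'I_n -> R) (t : 'I_n -> int) (x : R) :=
  (\sum_i a i * cos (x * (t i)%:~R)) ^+ 2 + (\sum_i a i * sin (x * (t i)%:~R)) ^+ 2.

Lemma qf_cos n (a : 'I_n -> R) t x : qf a t (fun h => cos (x * h%:~R)) = cos2 a t x.
Proof.
rewrite /cos2 !expr2 !big_distrlr /= -big_split; apply: eq_bigr => i _.
rewrite -big_split/=; apply: eq_bigr => l _.
by rewrite rmorphB mulrBr cosB; ring.
Qed.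

Lemma qf_rF n (a : 'I_n -> R) t F : itb mu Ipi F ->
  itb mu Ipi (fun x => cos2 a t x * F x) /\
  qf a t (rF F) = \int[mu]_(x in Ipi) (cos2 a t x * F x).
Proof.
move=> iF.
have E x : cos2 a t x * F x = \sum_i \sum_l a i * a l * (cos (x * (t i - t l)%:~R) * F x).
  rewrite -qf_cos /qf mulr_suml; apply: eq_bigr => i _; rewrite mulr_suml.
  by apply: eq_bigr => l _; rewrite mulrA.
have j i l : itb mu Ipi (fun x => a i * a l * (cos (x * (t i - t l)%:~R) * F x)).
  by apply: itbZ => //; exact: itb_cosF.
split.
  by under [X in itb _ _ X]eq_fun do rewrite E; do 2 apply: itb_sum => // ? _.
under eq_Rintegral do rewrite E.
rewrite (Rint_sum mIpi); last by move=> i _; apply: itb_sum.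
apply: eq_bigr => i _; rewrite (Rint_sum mIpi)//; apply: eq_bigr => l _.
by rewrite RintZ//; exact: itb_cosF.
Qed.

Lemma rFD F1 F2 : itb mu Ipi F1 -> itb mu Ipi F2 ->
  rF (fun x => F1 x + F2 x) = fun h => rF F1 h + rF F2 h.
Proof.
move=> i1 i2; apply/funext => h; rewrite /rF -RintD//; [|exact: itb_cosF|exact: itb_cosF].
by apply: eq_Rintegral => x _; rewrite mulrDr.
Qed.

Lemma rFZ c F : itb mu Ipi F -> rF (fun x => c * F x) = fun h => c * rF F h.
Proof.
move=> i1; apply/funext => h; rewrite /rF -RintZ//; last exact: itb_cosF.
by apply: eq_Rintegral => x _; rewrite mulrCA.
Qed.

Lemma rFB F1 F2 : itb mu Ipi F1 -> itb mu Ipi F2 ->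
  rF (fun x => F1 x - F2 x) = fun h => rF F1 h - rF F2 h.
Proof.
move=> i1 i2; apply/funext => h; rewrite /rF -RintB//; [|exact: itb_cosF|exact: itb_cosF].
by apply: eq_Rintegral => x _; rewrite mulrBr.
Qed.

Lemma rF_even F h : rF F (- h) = rF F h.
Proof. by apply: eq_Rintegral => x _; rewrite rmorphN mulrN cosN. Qed.

(** At a fixed frequency x, the form of cos(x h) k'(h) is the sum of two forms of k', with weights
    a_i cos(x t_i) and a_i sin(x t_i). Integration against F >= 0 keeps the sign. *)
Lemma mpsd_rF F : itb mu Ipi F -> (forall x, x \in Ipi -> 0 <= F x) -> mpsd (rF F).
Proof.
move=> iF F0 k' hk n a t.
rewrite (_ : qf a t _ = \int[mu]_(x in Ipi) (qf a t (fun h => cos (x * h%:~R) * k' h) * F x)).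
  apply: Rintegral_ge0 => x /mem_set xI; rewrite mulr_ge0 ?F0//.
  have := addr_ge0 (hk n (fun i => a i * cos (x * (t i)%:~R)) t) (hk n (fun i => a i * sin (x * (t i)%:~R)) t).
  rewrite /qf -big_split/=; under eq_bigr do rewrite -big_split/=.
  congr (_ <= _); apply: eq_bigr => i _; apply: eq_bigr => l _.
  by rewrite rmorphB mulrBr cosB; ring.
have E x : qf a t (fun h => cos (x * h%:~R) * k' h) * F x =
    \sum_i \sum_l (a i * a l * k' (t i - t l)) * (cos (x * (t i - t l)%:~R) * F x).
  rewrite /qf mulr_suml; apply: eq_bigr => i _; rewrite mulr_suml.
  by apply: eq_bigr => l _; ring.
under eq_Rintegral do rewrite E.
have j i l : itb mu Ipi (fun x => (a i * a l * k' (t i - t l)) * (cos (x * (t i - t l)%:~R) * F x)).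
  by apply: itbZ => //; exact: itb_cosF.
rewrite (Rint_sum mIpi); last by move=> i _; apply: itb_sum.
apply: eq_bigr => i _; rewrite (Rint_sum mIpi)//; apply: eq_bigr => l _.
by rewrite RintZ; [rewrite /rF; ring|exact: mIpi|exact: itb_cosF].
Qed.

Lemma adom_rF f F : itb mu Ipi f -> itb mu Ipi F -> (forall x, x \in Ipi -> `|f x| <= F x) ->
  adom (rF f) (rF F).
Proof.
move=> jf jF h; split.
  rewrite -rFB//; apply: mpsd_rF; first exact: itbB.
  by move=> x xI; have := h x xI; rewrite ler_norml => /andP[]; lra.
rewrite -rFD//; apply: mpsd_rF; first exact: itbD.
by move=> x xI; have := h x xI; rewrite ler_norml => /andP[]; lra.
Qed.

Lemma sin_nat_pi (n : nat) : sin (pi * n%:R) = 0 :> R.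
Proof.
elim: n => [|n IH]; first by rewrite mulr0 sin0.
by rewrite -natr1 mulrDr mulr1 sinD IH sinpi mulr0 mul0r addr0.
Qed.

Lemma rF1 h : rF (fun=> 1) h = (h == 0)%:R * (2 * pi).
Proof.
have p0 : 0 < pi :> R := pi_gt0 R.
case: eqP => [->|/eqP h0]; rewrite ?mul1r ?mul0r /rF.
  have dF (x : R) : - pi <= x <= pi -> is_derive x 1 (fun y : R => y) (cos (x * 0%:~R) * 1).
    by move=> _; derive_auto; rewrite mulr0 cos0 mulr1.
  rewrite (Rint_ftc _ dF) ?opprK ?mulr_natl//; first lra.
  by apply: continuous_subspaceT; cont_auto.
have hr : (h%:~R : R) != 0 by rewrite intr_eq0.
have spi : sin (pi * h%:~R) = 0 :> R.
  case: h h0 hr => n _ _; first exact: sin_nat_pi.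
  by rewrite NegzE rmorphN mulrN sinN sin_nat_pi oppr0.
have dF (x : R) : - pi <= x <= pi -> is_derive x 1 (fun y : R => h%:~R^-1 * sin (y * h%:~R)) (cos (x * h%:~R) * 1).
  by move=> _; derive_auto; field.
rewrite (Rint_ftc _ dF); [|lra|by apply: continuous_subspaceT; cont_auto].
by rewrite mulNr sinN spi oppr0 mulr0 subrr.
Qed.

End Kernels.
#[global] Hint Resolve mIpi : core.

(** * Fractional densities and their covariances *)

Section RealPowers.
Context {R : realType}.
Implicit Types x y a b : R.

Lemma powRD_gt0 x a b : 0 < x -> x `^ (a + b) = x `^ a * x `^ b.
Proof. by move=> x0; rewrite powRD//; apply/implyP => _; rewrite gt_eqF. Qed.

Lemma le_powRN a x y : 0 <= a -> 0 < x -> x <= y -> y `^ (- a) <= x `^ (- a).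
Proof.
move=> a0 x0 xy; have y0 := lt_le_trans x0 xy.
rewrite !powRN lef_pV2 ?posrE ?powR_gt0// ge0_ler_powR// nnegrE ltW//.
Qed.

Lemma powR_div x y a : 0 <= x -> 0 < y -> x `^ a = (x / y) `^ a * y `^ a.
Proof.
move=> x0 y0; rewrite -powRM ?(ltW y0)//; last by rewrite mulr_ge0// invr_ge0 ltW.
by rewrite divfK// gt_eqF.
Qed.

Lemma powR_exprn x a n : (x `^ a) ^+ n = x `^ (a * n%:R).
Proof. by rewrite powRrM powR_mulrn// powR_ge0. Qed.

Lemma exprn_powR x a n : 0 <= x -> (x ^+ n) `^ a = (x `^ a) ^+ n.
Proof. by move=> x0; rewrite powR_exprn mulrC powRrM powR_mulrn. Qed.

Lemma powR_expR x a : 0 < x -> x `^ a = expR (a * ln x).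
Proof. by move=> x0; rewrite /powR gt_eqF. Qed.

Lemma powR_sqr x a : x != 0 -> `|x| `^ (2 * a) = (x ^+ 2) `^ a.
Proof. by move=> x0; rewrite powRrM -[in RHS]real_normK ?num_real// -powR_mulrn. Qed.

Lemma cvg_powR (u : nat -> R) (l : R) a : 0 < l -> u @ \oo --> l ->
  u n `^ a @[n --> \oo] --> l `^ a.
Proof.
move=> l0 hu; apply: (cvg_comp _ (fun z : R => z `^ a) hu).
have h : is_derive l 1 (fun z : R => z `^ a) (a * l `^ (a - 1) * 1) by exact: dv_powR.
exact: (dv_continuous h).
Qed.

Lemma cvg_powRN0 a : 0 < a -> n.+1%:R `^ (- a) @[n --> \oo] --> (0 : R).
Proof.
move=> a0; apply/cvgr0Pnorm_le => eps e0.
have M0 : 0 < eps `^ (- a^-1) by exact: powR_gt0.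
near=> n; rewrite ger0_norm ?powR_ge0//.
have h : eps `^ (- a^-1) <= n.+1%:R.
  apply: (@le_trans _ _ n%:R); last by rewrite ler_nat.
  near: n; exact: nbhs_infty_ger.
rewrite (le_trans (le_powRN (ltW a0) M0 h))// -powRrM mulrNN mulVf ?gt_eqF//.
by rewrite powRr1 ?(ltW e0).
Unshelve. all: by end_near.
Qed.

Lemma cvg_exprn (u : nat -> R) (l : R) q : u @ \oo --> l -> u n ^+ q @[n --> \oo] --> l ^+ q.
Proof.
move=> h; elim: q => [|q IH]; first by under eq_fun do rewrite expr0; rewrite expr0; exact: cvg_cst.
by rewrite exprS; under eq_fun do rewrite exprS; exact: cvgM.
Qed.

Lemma cvg0_le (u v : nat -> R) : (forall n, `|u n| <= v n) -> v @ \oo --> 0 -> u @ \oo --> 0.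
Proof.
move=> h hv; apply/cvgr0Pnorm_le => eps e0.
by have /cvgr0Pnorm_le/(_ _ e0) := hv; apply: filterS => n; apply: le_trans; exact: le_trans (h n) (ler_norm _).
Qed.

(* Bernoulli's inequality: e^t >= e^{at}(1 + (1-a)t) and 1 >= e^{at}(1 - at). *)
Lemma powR_bernoulli y a : 0 < y -> 0 <= a <= 1 -> y `^ a <= 1 + a * (y - 1).
Proof.
move=> y0 /andP[a0 a1]; rewrite powR_expR//; set t := ln y.
have -> : y = expR t by rewrite lnK// posrE.
have e1 : expR (a * t) * (1 + (1 - a) * t) <= expR t.
  have -> : expR t = expR (a * t) * expR ((1 - a) * t) by rewrite -expRD; congr expR; ring.
  by rewrite ler_wpM2l ?expR_ge0// expR_ge1Dx.
have e2 : expR (a * t) * (1 - a * t) <= 1.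
  rewrite -[leRHS](_ : expR (a * t) * expR (- (a * t)) = 1); last by rewrite -expRD subrr expR0.
  by rewrite ler_wpM2l ?expR_ge0// expR_ge1Dx.
have := ler_wpM2l a0 e1; have a1' : 0 <= 1 - a by lra.
by have := ler_wpM2l a1' e2; lra.
Qed.

End RealPowers.

(** * Elementary bounds for the sine *)

Section SineBounds.
Context {R : realType}.
Implicit Types x y : R.

Lemma dv_mono (f F : R -> R) (a b : R) : a <= b ->
  (forall x, a <= x <= b -> is_derive x 1 F (f x)) ->
  (forall x, a <= x <= b -> 0 <= f x) -> F a <= F b.
Proof.
move=> ab dF f0; rewrite -subr_ge0.
have [| |c + ->] := @MVT_segment R F f a b ab.
- by move=> x; rewrite in_itv/= => /andP[/ltW h1 /ltW h2]; apply: dF; rewrite h1.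
- by apply: derivable_within_continuous => x; rewrite in_itv/= => /dF[].
by rewrite in_itv/= => /f0 c0; rewrite mulr_ge0// subr_ge0.
Qed.

Lemma mulr_cos_le_sin y : 0 <= y <= pi / 2 -> y * cos y <= sin y.
Proof.
move=> /andP[y0 yp]; rewrite -subr_ge0.
have -> : 0 = sin 0 - 0 * cos 0 :> R by rewrite sin0 mul0r subrr.
apply: (@dv_mono (fun x => x * sin x) (fun x => sin x - x * cos x)) => // x /andP[x0 xy].
  by derive_auto; ring.
by rewrite mulr_ge0// sin_ge0_pi// x0/=; have := pi_gt0 R; lra.
Qed.

Lemma sqr_sin_ge y : `|y| <= pi / 2 -> y * cos y * sin y <= sin y ^+ 2.
Proof.
move=> yp; rewrite expr2; have [y0|/ltW y0] := leP 0 y.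
  rewrite ger0_norm// in yp; rewrite ler_wpM2r ?mulr_cos_le_sin ?y0//.
  by rewrite sin_ge0_pi// y0/=; have := pi_gt0 R; lra.
rewrite ler0_norm// in yp.
have := @mulr_cos_le_sin (- y); have := @sin_ge0_pi R (- y).
rewrite cosN sinN => h1 h2.
have {}h1 : 0 <= - sin y by apply: h1; have := pi_gt0 R; lra.
have {}h2 : - y * cos y <= - sin y by apply: h2; lra.
by have := ler_wpM2r h1 h2; rewrite !mulNr !mulrN !opprK.
Qed.

Lemma sin_le_id y : 0 <= y -> sin y <= y.
Proof.
move=> y0; rewrite -subr_ge0 (_ : 0 = 0 - sin 0 :> R); last by rewrite sin0 subrr.
apply: (@dv_mono (fun x => 1 - cos x) (fun x => x - sin x)) => // x _.
Qed.

Lemma cos_ge_sqr y : 0 <= y -> 1 - y ^+ 2 / 2 <= cos y.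
Proof.
move=> y0; rewrite -subr_ge0 (_ : 0 = cos 0 - (1 - 0 ^+ 2 / 2) :> R); last first.
  by rewrite cos0 expr0n/= mul0r subr0 subrr.
apply: (@dv_mono (fun x => x - sin x) (fun x => cos x - (1 - x ^+ 2 / 2))) => // x /andP[x0 _].
  by derive_auto; field.
by rewrite subr_ge0 sin_le_id.
Qed.

(** The constant 1/3 comes from sin z >= z - z^3 / 6 and pi / 2 <= 2. *)
Lemma abs_sin_ge y : `|y| <= pi / 2 -> `|y| / 3 <= `|sin y|.
Proof.
have aux (z : R) : 0 <= z -> z <= pi / 2 -> z / 3 <= sin z.
  move=> z0 zp; have h : z - z ^+ 3 / 6 <= sin z.
    rewrite -subr_ge0 (_ : 0 = sin 0 - (0 - 0 ^+ 3 / 6) :> R); last first.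
      by rewrite sin0 expr0n/= mul0r subr0 subrr.
    apply: (@dv_mono (fun x => cos x - (1 - x ^+ 2 / 2)) (fun x => sin x - (x - x ^+ 3 / 6))) => // x /andP[x0 _].
      by derive_auto; field.
    by rewrite subr_ge0 cos_ge_sqr.
  have /andP[_ p2] := pihalf_02 R; apply: le_trans h.
  have z2 : z ^+ 2 <= 2 ^+ 2 by rewrite lerXn2r// ?nnegrE//; lra.
  have := ler_wpM2l z0 z2; rewrite -exprS; lra.
have [y0|/ltW y0] := leP 0 y.
  by rewrite [`|y|]ger0_norm// => yp; rewrite (le_trans (aux y y0 yp))// ler_norm.
rewrite -[`|sin y|]normrN -sinN [`|y|]ler0_norm// => yp.
by rewrite (le_trans (aux (- y) _ yp)) ?ler_norm ?oppr_ge0.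
Qed.

End SineBounds.

(** * The density |1 - e^{-ix}|^{-2e}: integrability, recursion and asymptotics *)

Section FarimaDensity.
Context {R : realType}.
Notation mu := (@lebesgue_measure R).
Notation Ipi := `[(- pi)%R, pi%R]%classic.
Implicit Types (e x eta : R).

(** A smooth signed version of |1 - e^{-ix}|. *)
Definition sn x : R := 2 * sin (x / 2).
(* The value of [phi] at the zeros of [sn] is 0, since [0 `^ a = 0] for [a != 0]. *)
Definition phi e x : R := `|sn x| `^ (- (2 * e)).

Lemma sn_sqr x : sn x ^+ 2 = 2 - 2 * cos x.
Proof. by rewrite {2}(splitr x) cosD -!expr2 cos2sin2 /sn exprMn; ring. Qed.

Lemma phi_ge0 e x : 0 <= phi e x. Proof. exact: powR_ge0. Qed.

Lemma phiE e x : sn x != 0 -> phi e x = (sn x ^+ 2) `^ (- e).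
Proof. by move=> s0; rewrite /phi -mulrN powR_sqr. Qed.

Lemma phi_sn0 e x : 0 < e -> sn x = 0 -> phi e x = 0.
Proof. by move=> e0 s0; rewrite /phi s0 normr0 powR0// oppr_eq0 mulf_neq0 ?gt_eqF. Qed.

Lemma abs_sn_le2 x : `|sn x| <= 2.
Proof. by rewrite normrM ger0_norm// ler_piMr// ler_norml sin_geN1 sin_le1. Qed.

Lemma sn_ge x : `|x| <= pi -> `|x| / 3 <= `|sn x|.
Proof.
move=> xp; have := @abs_sin_ge R (x / 2); rewrite !normrM normfV [`|2|]ger0_norm// => h.
by have := h (ler_wpM2r (_ : 0 <= 2^-1) xp); lra.
Qed.

Lemma sn_cont : continuous sn. Proof. by rewrite /sn; cont_auto. Qed.

Lemma phi_mul a b x : a + b != 0 -> phi a x * phi b x = phi (a + b) x.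
Proof.
move=> ab; rewrite /phi; have [->|s0] := eqVneq `|sn x| 0.
  rewrite -powRD; last first.
    by apply/implyP; rewrite -opprD -mulrDr oppr_eq0 mulf_eq0 (negbTE ab) orbF pnatr_eq0.
  by rewrite -opprD -mulrDr.
by rewrite -powRD ?s0 ?implybT// -opprD -mulrDr.
Qed.

(* Smooth regularization of phi e, also equal to it (to 0) at the singularity. *)
Definition reg e m eta x := (sn x ^+ 2) ^+ m * (sn x ^+ 2 + eta) `^ (- e - m%:R).

Lemma reg_ge0 e m eta x : 0 <= reg e m eta x.
Proof. by rewrite mulr_ge0 ?powR_ge0// exprn_ge0// sqr_ge0. Qed.

Lemma reg_le_pow e m eta x : 0 <= e -> 0 < eta -> reg e m eta x <= (sn x ^+ 2 + eta) `^ (- e).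
Proof.
move=> e0 h0; have p : 0 < sn x ^+ 2 + eta by rewrite ltr_wpDl// sqr_ge0.
rewrite /reg powRD_gt0// [_ `^ (- m%:R)]powRN powR_mulrn ?(ltW p)// mulrCA.
rewrite ler_piMr ?powR_ge0// ler_pdivrMr ?exprn_gt0// mul1r lerXn2r ?nnegrE ?sqr_ge0 ?(ltW p)//.
by rewrite lerDl ltW.
Qed.

Lemma reg_le e m eta x : 0 <= e -> (0 < m)%N -> 0 < eta -> reg e m eta x <= phi e x.
Proof.
move=> e0 m0 h0; have [s0|s0] := eqVneq (sn x) 0.
  by rewrite /reg s0 expr0n/= expr0n gtn_eqF// mul0r phi_ge0.
rewrite (le_trans (reg_le_pow _ _ _ _))// phiE//.
have s1 : 0 < sn x ^+ 2 by rewrite exprn_even_gt0//= s0.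
by apply: le_powRN => //; rewrite lerDl ltW.
Qed.

Lemma cvg_reg e m x : 0 < e -> (0 < m)%N -> reg e m n.+1%:R^-1 x @[n --> \oo] --> phi e x.
Proof.
move=> e0 m0; have [s0|s0] := eqVneq (sn x) 0.
  rewrite phi_sn0//; under eq_fun do rewrite /reg s0 expr0n/= expr0n gtn_eqF// mul0r.
  exact: cvg_cst.
have s1 : 0 < sn x ^+ 2 by rewrite exprn_even_gt0//= s0.
rewrite phiE// (_ : (sn x ^+ 2) `^ (- e) = (sn x ^+ 2) ^+ m * (sn x ^+ 2 + 0) `^ (- e - m%:R)).
  apply: cvgM; first exact: cvg_cst.
  apply: cvg_powR; first by rewrite addr0.
  by apply: cvgD; [exact: cvg_cst|exact: cvg_harmonic].
rewrite addr0 powRD_gt0// [_ `^ (- m%:R)]powRN powR_mulrn ?(ltW s1)// mulrCA divff ?mulr1//.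
by rewrite expf_neq0// gt_eqF.
Qed.

Lemma continuous_itb (f : R -> R) : continuous f -> itb mu Ipi f.
Proof. by move=> h; apply: itb_continuous; exact: continuous_subspaceT. Qed.

Let npi : - pi < pi :> R. Proof. by have := pi_gt0 R; lra. Qed.

(** With s = [sn x], the derivative of x (s^2 + eta)^(-e) is at least (1 - 2e) times the regularized
    density, because x s cos(x/2) <= s^2; the boundary terms add up to at most 2 pi. The bound is
    uniform in eta. *)
Lemma Rint_reg_le e eta : 0 <= e < 2^-1 -> 0 < eta ->
  \int[mu]_(x in Ipi) reg e 1 eta x <= 2 * pi / (1 - 2 * e).
Proof.
move=> /andP[e0 e1] h0; have p x : 0 < sn x ^+ 2 + eta by rewrite ltr_wpDl// sqr_ge0.
have e2 : 0 < 1 - 2 * e by lra.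
pose f x := (sn x ^+ 2 + eta) `^ (- e) + x * (- e * (sn x ^+ 2 + eta) `^ (- e - 1) * (2 * sn x * cos (x / 2))).
have dF x : - pi <= x <= pi -> is_derive x 1 (fun y => y * (sn y ^+ 2 + eta) `^ (- e)) (f x).
  move=> _; rewrite /sn; derive_auto; first exact: p.
  by rewrite /f /sn; field.
have cf : continuous f.
  by rewrite /f /sn; cont_auto; exact: p.
have creg : continuous (reg e 1 eta) by rewrite /reg /sn; cont_auto; exact: p.
have Ef : \int[mu]_(x in Ipi) f x <= 2 * pi.
  rewrite (Rint_ftc npi dF); last exact: continuous_subspaceT.
  have E x : sn (- x) ^+ 2 = sn x ^+ 2 by rewrite /sn mulNr sinN mulrN sqrrN.
  apply: (@le_trans _ _ (2 * pi * (sn pi ^+ 2 + eta) `^ (- e))); first by rewrite E; lra.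
  rewrite ler_piMr ?mulr_ge0 ?pi_ge0//.
  have p4 : 1 <= sn pi ^+ 2 + eta.
    by rewrite sn_sqr cospi; lra.
  rewrite powRN invf_le1 ?powR_gt0//.
  by have := ge0_ler_powR e0 (_ : 1 \in Num.nneg) (_ : _ \in Num.nneg) p4; rewrite powR1; apply; rewrite nnegrE ?ler01// ltW.
rewrite ler_pdivlMr// mulrC -RintZ//; last exact: continuous_itb.
apply: le_trans Ef; apply: le_Rint => //.
- by apply: itbZ => //; exact: continuous_itb.
- exact: continuous_itb.
move=> x; rewrite /= in_itv/= => xp.
have hx : x * (2 * sn x * cos (x / 2)) <= 2 * sn x ^+ 2.
  have := @sqr_sin_ge R (x / 2); rewrite /sn normrM (@ger0_norm _ 2^-1)// ler_wpM2r ?ler_norml// => /(_ isT).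
  by rewrite exprMn; lra.
have rl := @reg_le_pow e 1 eta x e0 h0.
have P0 : 0 <= (sn x ^+ 2 + eta) `^ (- e - 1) by exact: powR_ge0.
rewrite /f; have := ler_wpM2l (mulr_ge0 e0 P0) hx.
by move: rl; rewrite /reg expr1; lra.
Qed.

Lemma itb_phi e : 0 < e < 2^-1 -> itb mu Ipi (phi e).
Proof.
move=> /andP[e0 e1].
have creg n : continuous (reg e 1 n.+1%:R^-1).
  have p x : 0 < sn x ^+ 2 + n.+1%:R^-1 by rewrite ltr_wpDl ?sqr_ge0// invr_gt0.
  by rewrite /reg /sn; cont_auto; exact: p.
have [] // := @fatou_le _ _ _ mu Ipi mIpi (fun n => reg e 1 n.+1%:R^-1) (phi e) (2 * pi / (1 - 2 * e)).
- by move=> n; apply: measurable_funTS; exact: continuous_measurable_fun.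
- by move=> n x _; exact: reg_ge0.
- by move=> x _; exact: cvg_reg.
- by move=> n; exact: continuous_itb.
- by apply: nearW => n; apply: Rint_reg_le; rewrite ?invr_gt0// ltW.
Qed.

Definition rho e := rF (phi e).

Lemma cos_half_pi (n : nat) : cos ((n.+1%:R - 2^-1) * pi) = 0 :> R.
Proof.
by rewrite mulrBl [2^-1 * _]mulrC [_ * pi]mulrC cosB cos_pihalf sin_nat_pi mulr0 mul0r addr0.
Qed.

(* The recursion is the integral of the derivative of s^{1-2e} cos((k-1/2)x), s = 2 sin(x/2). *)
Lemma rho_rec e (n : nat) : 0 < e < 2^-1 ->
  (n.+1%:R - e) * rho e n.+1%:Z = (n%:R + e) * rho e n%:Z.
Proof.
move=> he; have /andP[e0 e1] := he; pose kk : R := n.+1%:R - 2^-1.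
pose f eta x := cos (x / 2) * cos (kk * x) * (3 * reg e 1 eta x - 2 * (e + 1) * reg e 2 eta x)
  - kk * sin (kk * x) * (sn x * reg e 1 eta x).
have p eta x : 0 < eta -> 0 < sn x ^+ 2 + eta by move=> h; rewrite ltr_wpDl// sqr_ge0.
(* The odd function s^3 (s^2 + eta)^(-e-1) is a smooth substitute for s |s|^(-2e). The boundary
   terms vanish because the cosine has half-integer frequency. *)
have dF eta x : 0 < eta -> is_derive x 1 (fun y => sn y ^+ 3 * (sn y ^+ 2 + eta) `^ (- e - 1) * cos (kk * y)) (f eta x).
  move=> h0; rewrite /sn; derive_auto; first exact: p.
  rewrite /f /reg /= (_ : - e - 1 - 1 = - e - 2%:R); last by ring.
  by rewrite /sn; field.
have cf eta : 0 < eta -> continuous (f eta).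
  by move=> h0; rewrite /f /reg /sn; cont_auto; exact: p.
have If eta : 0 < eta -> \int[mu]_(x in Ipi) f eta x = 0.
  move=> h0; rewrite (Rint_ftc npi (fun x _ => dF eta x h0)); last exact/continuous_subspaceT/cf.
  by rewrite mulrN cosN /kk cos_half_pi !mulr0 subrr.
pose fl x := (n.+1%:R - e) * (cos (x * (n.+1%:Z)%:~R) * phi e x) - (n%:R + e) * (cos (x * (n%:Z)%:~R) * phi e x).
pose K : R := 3 + 2 * (e + 1) + `|kk| * 2.
have [] := @Rint_dct _ _ _ mu Ipi mIpi (fun m => f m.+1%:R^-1) fl (fun x => K * phi e x).
- by move=> m; apply: measurable_funTS; apply: continuous_measurable_fun; apply: cf; rewrite invr_gt0.
- move=> x _.
  have c1 := @cvg_reg e 1 x e0 isT; have c2 := @cvg_reg e 2 x e0 isT.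
  apply: cvg_to_eq (_ : _ --> cos (x / 2) * cos (kk * x) * (3 * phi e x - 2 * (e + 1) * phi e x)
     - kk * sin (kk * x) * (sn x * phi e x)) _.
    apply: cvgB; (apply: cvgM; first exact: cvg_cst).
      by apply: cvgB; (apply: cvgM; first exact: cvg_cst).
    by apply: cvgM; first exact: cvg_cst.
  have c3 : cos (x * n.+1%:R) = cos (kk * x) * cos (x / 2) - sin (kk * x) * sin (x / 2).
    by rewrite -cosD; congr cos; rewrite /kk; field.
  have c4 : cos (x * n%:R) = cos (kk * x) * cos (x / 2) + sin (kk * x) * sin (x / 2).
    by rewrite -cosB; congr cos; rewrite /kk -[n.+1%:R]natr1; field.
  by rewrite /fl -!pmulrn c3 c4 /kk /sn -[n.+1%:R]natr1; field.
- by apply: itbZ => //; exact: itb_phi.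
- move=> m x _; set eta := _^-1; have h0 : 0 < eta by rewrite invr_gt0.
  have r1 := @reg_le e 1 eta x (ltW e0) isT h0; have r2 := @reg_le e 2 eta x (ltW e0) isT h0.
  have g1 := @reg_ge0 e 1 eta x; have g2 := @reg_ge0 e 2 eta x.
  have bc (z : R) : `|cos z| <= 1 by rewrite ler_norml cos_geN1 cos_le1.
  have bs (z : R) : `|sin z| <= 1 by rewrite ler_norml sin_geN1 sin_le1.
  rewrite /f /K [leRHS]mulrDl (le_trans (ler_normB _ _))// lerD//.
    rewrite normrM -[leRHS]mul1r; apply: ler_pM => //.
      by rewrite normrM -[1]mulr1; apply: ler_pM.
    have k0 : 0 <= 2 * (e + 1) by lra.
    have := ler_wpM2l k0 r2; have := mulr_ge0 k0 g2; have := mulr_ge0 k0 (phi_ge0 e x).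
    by rewrite ler_norml => ? ? ?; apply/andP; split; lra.
  rewrite normrM [`|kk * _|]normrM -[leLHS]mulrA -[leRHS]mulrA ler_wpM2l// -[leRHS]mul1r; apply: ler_pM => //.
  by rewrite normrM (ger0_norm g1); apply: ler_pM => //; exact: abs_sn_le2.
move=> _; under eq_fun do rewrite If ?invr_gt0//.
move=> h; have E : \int[mu]_(x in Ipi) fl x = 0.
  by apply: (eq_cvg_unique h (_ : (fun=> 0) @ \oo --> (0 : R))) => //; exact: cvg_cst.
have ic h' : itb mu Ipi (fun x => cos (x * h') * phi e x) by apply: itb_cosF; exact: itb_phi.
move: E; rewrite RintB//; [|exact: itbZ|exact: itbZ].
by rewrite !RintZ// => /eqP; rewrite subr_eq0 => /eqP.
Qed.

(** The density dominates a multiple of 2 - 2 cos x, whose integral is explicit. *)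
Lemma rho0_gt0 e : 0 < e < 2^-1 -> 0 < rho e 0.
Proof.
move=> he; have /andP[e0 e1] := he.
pose c : R := 2 `^ (- (2 * e)) / 4; have c0 : 0 < c by rewrite divr_gt0// powR_gt0.
have i1 h : itb mu Ipi (fun x => cos (x * h) * 1).
  by apply: itb_cosF; apply: continuous_itb => x; exact: cvg_cst.
have -> : rho e 0 = \int[mu]_(x in Ipi) phi e x.
  by apply: eq_Rintegral => x _; rewrite mulr0 cos0 mul1r.
apply: (@lt_le_trans _ _ (\int[mu]_(x in Ipi) (c * (2 * (cos (x * (0 : int)%:~R) * 1) - 2 * (cos (x * (1 : int)%:~R) * 1))))).
  rewrite RintZ//; last by apply: itbB => //; apply: itbZ.
  rewrite RintB//; [|exact: itbZ|exact: itbZ].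
  rewrite !RintZ// -!/(rF _ _) !rF1 eqxx/= mul0r mulr0 subr0 mul1r.
  by rewrite !mulr_gt0// pi_gt0.
apply: le_Rint => //; [by apply: itbZ => //; apply: itbB => //; apply: itbZ|exact: itb_phi|].
move=> x _; rewrite !mulr1 mulr0 cos0 mulr1 -sn_sqr.
have [s0|s0] := eqVneq (sn x) 0; first by rewrite s0 expr0n/= mulr0 phi_ge0.
have s1 : 0 < `|sn x| by rewrite normr_gt0.
apply: (@le_trans _ _ (2 `^ (- (2 * e)))).
  rewrite /c -mulrA ler_piMr ?powR_ge0// mulrC ler_pdivrMr// mul1r -real_normK ?num_real//.
  have := abs_sn_le2 x; move: (`|sn x|) (normr_ge0 (sn x)) => y; rewrite expr2; nra.
by rewrite /phi le_powRN ?abs_sn_le2// mulr_ge0// ltW.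
Qed.

Section Asymptotics.
Variable e : R.
Hypothesis he : 0 < e < 2^-1.
Let e0 : 0 < e. Proof. by case/andP: he. Qed.
Let e1 : e < 2^-1. Proof. by case/andP: he. Qed.
Let a := 1 - 2 * e.
Let a01 : 0 <= a <= 1. Proof. by rewrite /a; move: e0 e1 => ? ?; lra. Qed.
Let r (n : nat) := rho e n%:Z.

Let rS n : r n.+1 = (n%:R + e) / (n.+1%:R - e) * r n.
Proof.
have n0 := ler0n R n.
have p : n.+1%:R - e != 0 :> R by rewrite gt_eqF// -natr1; move: e0 e1 => ? ?; lra.
by have := rho_rec n he; rewrite -/(r _) -/(r _) => h; rewrite mulrAC -h mulrC mulKf.
Qed.

Lemma rho_gt0 n : 0 < rho e n%:Z.
Proof.
rewrite -/(r n); elim: n => [|n IH]; first exact: rho0_gt0.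
have n0 := ler0n R n.
by rewrite rS mulr_gt0// divr_gt0// -?natr1; move: e0 e1 => ? ?; lra.
Qed.

Let u n := r n * n.+1%:R `^ a.

Let u_decr n : u n.+1 <= u n.
Proof.
have n0 := ler0n R n; have n1 : 0 < n.+1%:R :> R by [].
rewrite /u rS.
rewrite (@powR_div R n.+2%:R n.+1%:R)//.
have rn := rho_gt0 n; rewrite -/(r n) in rn.
rewrite mulrA ler_wpM2r ?powR_ge0// mulrAC ler_piMl ?(ltW rn)//.
have hb := @powR_bernoulli R (n.+2%:R / n.+1%:R) a (divr_gt0 _ _) a01.
have p : 0 < n.+1%:R - e :> R by rewrite -natr1; move: e0 e1 => ? ?; lra.
have q : 0 < n%:R + e by move: e0 => ?; lra.
rewrite mulrAC ler_pdivrMr// mul1r -ler_pdivlMl// (le_trans (hb _ _))//.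
rewrite mulrC ler_pdivlMl// mulrC.
have -> : n.+2%:R / n.+1%:R = 1 + n.+1%:R^-1 :> R by rewrite -[n.+2%:R]natr1 mulrDl divff ?gt_eqF// mul1r.
have le1 : n.+1%:R^-1 * (n%:R + e) <= 1 :> R.
  by rewrite mulrC ler_pdivrMr// mul1r -natr1; move: e1 => ?; lra.
have := ler_wpM2l (proj1 (andP a01)) le1.
by move: (n.+1%:R^-1) => i; rewrite /a -natr1; lra.
Qed.

Lemma rho_nat_le n : rho e n%:Z <= rho e 0 * n.+1%:R `^ (- a).
Proof.
have h : u n <= r 0%N.
  elim: n => [|n IH]; first by rewrite /u powR1 mulr1.
  exact: le_trans (u_decr n) IH.
rewrite powRN ler_pdivlMr ?powR_gt0//.
Qed.

Let v n := r n * (n%:R - e) `^ a.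

Let v_incr n : v n.+1 <= v n.+2.
Proof.
have n0 := ler0n R n.
rewrite /v (rS n.+1).
have p : 0 < n.+2%:R - e :> R by rewrite -!natr1; move: e0 e1 => ? ?; lra.
have p1 : 0 < n.+1%:R - e :> R by rewrite -!natr1; move: e0 e1 => ? ?; lra.
have rn := rho_gt0 n.+1; rewrite -/(r n.+1) in rn.
rewrite (@powR_div R (n.+1%:R - e) (n.+2%:R - e)) ?(ltW p1)//.
rewrite mulrA ler_wpM2r ?powR_ge0// mulrC ler_wpM2r ?(ltW rn)//.
rewrite (le_trans (powR_bernoulli (divr_gt0 p1 p) a01))//.
rewrite le_eqVlt; apply/orP; left; apply/eqP.
rewrite /a -[n.+2%:R]natr1; field; move: p; rewrite -[n.+2%:R]natr1; move/lt0r_neq0.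
by rewrite nat1r.
Qed.

(** The recursion and Bernoulli's inequality make [u] decreasing and [v] increasing, the latter only
    from n = 1 on since n - e is negative at 0. As v stays below u, the limit of u is positive. *)
Lemma rho_cvg : exists l : R, 0 < l /\ rho e n%:Z * n.+1%:R `^ a @[n --> \oo] --> l.
Proof.
have v1 n : v 1%N <= v n.+1 by elim: n => // n /le_trans; apply; exact: v_incr.
have vpos : 0 < v 1%N by rewrite /v mulr_gt0 ?rho_gt0// powR_gt0//; move: e1 => ?; lra.
have vu n : v n.+1 <= u n.+1.
  rewrite /u /v ler_wpM2l ?(ltW (rho_gt0 _))//.
  have n0 := ler0n R n.
  by apply: ge0_ler_powR; rewrite ?nnegrE ?(proj1 (andP a01))// -?natr1; move: e0 e1 => ? ?; lra.
have ul n : v 1%N <= u n.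
  apply: (@le_trans _ _ (u n.+1)); last exact: u_decr.
  by rewrite (le_trans (v1 n)).
have cu : cvgn u.
  apply: nonincreasing_is_cvgn; last by exists (v 1%N) => _ [n _ <-].
  by apply/nonincreasing_seqP => n; exact: u_decr.
exists (limn u); split; last exact: cu.
by apply: lt_le_trans vpos _; apply: limr_ge => //; apply: nearW.
Qed.

End Asymptotics.


Lemma rho_absz e h : rho e h = rho e (`|h|%N)%:Z.
Proof.
by case: h => n //; rewrite NegzE /rho rF_even.
Qed.

Lemma rho_abs_le e h : 0 < e < 2^-1 -> `|rho e h| <= rho e 0 * `|h|%N.+1%:R `^ (- (1 - 2 * e)).
Proof.
by move=> he; rewrite rho_absz ger0_norm ?rho_nat_le// ltW// rho_gt0.
Qed.

End FarimaDensity.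

(** * Quadratic forms of long-memory kernels *)

Section ToeplitzSums.
Context {R : realType}.
Implicit Types (kap b : nat -> R).

Lemma sum_indicator_le1 (m c : nat) (F : 'I_m -> nat) : injective F ->
  \sum_(l < m) (F l == c)%:R <= 1 :> R.
Proof.
move=> iF; rewrite -natr_sum -[leRHS]/(1%:R) ler_nat.
have [/existsP[l0 /eqP h0]|/existsPn h] := boolP [exists l, F l == c].
  rewrite (bigD1 l0)//= h0 eqxx big1// => l ll0.
  by case: eqP => // h; case/eqP: ll0; apply: iF; rewrite h h0.
by rewrite big1// => l _; rewrite (negbTE (h l)).
Qed.

(** For fixed i, a distance u is attained by at most two indices l, one on each side. *)
Lemma toeplitz_sum_le (m : nat) kap : (forall u, 0 <= kap u) ->
  \sum_(i < m) \sum_(l < m) kap `|i%:Z - l%:Z|%N <= m%:R * (2 * \sum_(u < m) kap u).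
Proof.
move=> k0; apply: (@le_trans _ _ (\sum_(i < m) 2 * \sum_(u < m) kap u)); last first.
  by rewrite sumr_const card_ord [leRHS]mulr_natl.
apply: ler_sum => i _.
pose Y : R := \sum_(l < m) \sum_(u < m) kap u * ((l + u == i)%N%:R + (val l == (val i + u)%N)%:R).
have h1 : \sum_(l < m) kap `|i%:Z - l%:Z|%N <= Y.
  apply: ler_sum => l _.
  have hu : (`|i%:Z - l%:Z| < m)%N by move: (ltn_ord i) (ltn_ord l); clear; lia.
  rewrite (bigD1 (Ordinal hu))//= -[leLHS]addr0 lerD//; last first.
    by apply: sumr_ge0 => u _; rewrite mulr_ge0// addr_ge0.
  rewrite ler_peMr// -natrD ler1n.
  have [h|h] := leqP l i.
    by rewrite (_ : (l + _)%N == i = true)//; move: h; clear; lia.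
  by rewrite addnC (_ : (\val l == _) = true)//; apply/eqP; move: h; rewrite /=; clear; lia.
apply: (le_trans h1); rewrite /Y exchange_big mulr_sumr; apply: ler_sum => u _ /=.
rewrite -mulr_sumr mulrC ler_wpM2r// big_split/= mulr2n lerD//.
  by apply: (@sum_indicator_le1 _ _ (fun l : 'I_m => (l + u)%N)) => x y /addIn /val_inj.
by apply: (@sum_indicator_le1 _ _ (fun l : 'I_m => val l)); exact: val_inj.
Qed.

(** Comparison with the integral of t^(-g), done as an induction whose step is Bernoulli's
    inequality. *)
Lemma sum_powRN_le (g : R) m : 0 <= g < 1 ->
  \sum_(u < m) u.+1%:R `^ (- g) <= m%:R `^ (1 - g) / (1 - g).
Proof.
move=> /andP[g0 g1]; have g2 : 0 < 1 - g by lra.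
elim: m => [|m IH]; first by rewrite big_ord0 divr_ge0 ?powR_ge0 ?ltW.
rewrite big_ord_recr/= (le_trans (lerD IH (lexx _)))// ler_pdivlMr// mulrDl divfK ?gt_eqF//.
have m0 : 0 < m.+1%:R :> R by [].
rewrite (@powR_div _ m%:R m.+1%:R)// -[X in _ + X * _](_ : m.+1%:R^-1 * m.+1%:R `^ (1 - g) = _); last first.
  by rewrite powRD_gt0// powRr1 ?ltW// mulKf// gt_eqF.
set p := _ `^ (1 - g); have p0 : 0 <= m.+1%:R `^ (1 - g) :> R by exact: powR_ge0.
rewrite -[leRHS]mul1r mulrAC -mulrDl ler_wpM2r// {}/p.
have [->|mn] := posnP m.
  by rewrite mul0r powR0 ?gt_eqF// add0r invr1 mul1r; lra.
have bern := @powR_bernoulli R (m%:R / m.+1%:R) (1 - g) (divr_gt0 _ m0) _.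
rewrite (le_trans (lerD (bern _ _) (lexx _)))//; first by rewrite ltr0n.
  by lra.
rewrite -subr_ge0 (_ : _ - _ = 0)//; field.
by rewrite nat1r gt_eqF.
Qed.

End ToeplitzSums.

(** * Weights of size 2^{j (gg/2 - 1)} on O(2^j) points *)

Section ScaledWeights.
Context {R : realType}.
Variables (m : nat -> nat) (a : nat -> nat -> R) (C gg : R).
Hypotheses (C1 : 1 <= C) (gg01 : 0 < gg < 1).
Hypothesis mC : forall j, (m j)%:R <= C * 2 ^+ j.
Hypothesis aC : forall j (i : 'I_(m j)), `|a j i| <= C * (2 ^+ j) `^ (gg / 2 - 1).

Let p2 (j : nat) : 0 < 2 ^+ j :> R. Proof. by rewrite exprn_gt0. Qed.
Let C0 : 0 < C. Proof. exact: lt_le_trans ltr01 C1. Qed.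

(** Majorant of the quadratic forms. The size of the weights is the one for which the kernel u^(-gg)
    gives a bounded sum, neither vanishing nor growing with j. *)
Definition tz (j : nat) (kap : nat -> R) : R :=
  \sum_(i < m j) \sum_(l < m j) `|a j i| * `|a j l| * kap `|i%:Z - l%:Z|%N.

Lemma tz_le j kap : (forall u, 0 <= kap u) ->
  tz j kap <= 2 * C ^+ 3 * (2 ^+ j) `^ (gg - 1) * \sum_(u < m j) kap u.
Proof.
move=> k0; apply: (@le_trans _ _ ((C * (2 ^+ j) `^ (gg / 2 - 1)) ^+ 2 * \sum_(i < m j) \sum_(l < m j) kap `|i%:Z - l%:Z|%N)).
  rewrite /tz mulr_sumr; apply: ler_sum => i _; rewrite mulr_sumr; apply: ler_sum => l _.
  by rewrite ler_wpM2r// expr2; apply: ler_pM.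
have s0 : 0 <= \sum_(u < m j) kap u by apply: sumr_ge0.
rewrite (le_trans (ler_wpM2l (sqr_ge0 _) (toeplitz_sum_le _ k0)))//.
rewrite exprMn powR_exprn.
rewrite (_ : (gg / 2 - 1) * 2%:R = (gg - 1) + (- 1)); last by field.
rewrite (@powRD_gt0 _ _ (gg - 1) (- 1))// powRN powRr1 ?(ltW (p2 j))// [leLHS]mulrA [X in X <= _]mulrA; apply: ler_wpM2r => //.
rewrite [leLHS](_ : _ = 2 * (C ^+ 2 * (2 ^+ j) `^ (gg - 1)) * ((m j)%:R / 2 ^+ j)); last by ring.
rewrite [leRHS](_ : _ = 2 * (C ^+ 2 * (2 ^+ j) `^ (gg - 1)) * C); last by ring.
rewrite ler_wpM2l ?ler_pdivrMr//.
by rewrite !mulr_ge0 ?powR_ge0 ?exprn_ge0 ?(ltW C0).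
Qed.

Lemma tz_mono j k1 k2 : (forall u, k1 u <= k2 u) -> tz j k1 <= tz j k2.
Proof.
by move=> h; apply: ler_sum => i _; apply: ler_sum => l _; rewrite ler_wpM2l// mulr_ge0.
Qed.

Lemma tzZ j c kap : tz j (fun u => c * kap u) = c * tz j kap.
Proof.
rewrite /tz mulr_sumr; apply: eq_bigr => i _; rewrite mulr_sumr.
by apply: eq_bigr => l _; rewrite mulrCA.
Qed.

Lemma tzD j k1 k2 : tz j (fun u => k1 u + k2 u) = tz j k1 + tz j k2.
Proof.
rewrite /tz -big_split; apply: eq_bigr => i _; rewrite -big_split.
by apply: eq_bigr => l _; rewrite mulrDr.
Qed.

Lemma tz_ge0 j kap : (forall u, 0 <= kap u) -> 0 <= tz j kap.
Proof. by move=> k0; do 2 apply: sumr_ge0 => ? _; rewrite mulr_ge0// mulr_ge0. Qed.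

Lemma tz_pow_le (g : R) j : 0 <= g < 1 ->
  tz j (fun u => u.+1%:R `^ (- g)) <= 2 * C ^+ 4 / (1 - g) * (2 ^+ j) `^ (gg - g).
Proof.
move=> g01; have /andP[g0 g1] := g01; have g2 : 0 < 1 - g by lra.
rewrite (le_trans (tz_le _ _))//.
have h : \sum_(u < m j) u.+1%:R `^ (- g) <= C * (2 ^+ j) `^ (1 - g) / (1 - g).
  rewrite (le_trans (sum_powRN_le _ g01))// ler_wpM2r ?invr_ge0 ?(ltW g2)//.
  apply: (@le_trans _ _ ((C * 2 ^+ j) `^ (1 - g))).
    by apply: ge0_ler_powR; rewrite ?nnegrE ?(ltW g2)// mulr_ge0 ?(ltW C0) ?(ltW (p2 j)).
  rewrite powRM ?(ltW C0) ?(ltW (p2 j))// ler_wpM2r ?powR_ge0// -[leRHS](powRr1 (ltW C0)).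
  by apply: ler_powR => //; lra.
rewrite (le_trans (ler_wpM2l _ h))//; first by rewrite !mulr_ge0 ?powR_ge0 ?exprn_ge0 ?(ltW C0).
rewrite (_ : gg - g = (gg - 1) + (1 - g)); last by ring.
by rewrite [in leRHS]powRD_gt0// le_eqVlt; apply/orP; left; apply/eqP; field; rewrite gt_eqF.
Qed.

(** Finitely many lags contribute O(2^{j (gg - 1)}), which vanishes since gg < 1; beyond them b is
    small and multiplies a sum that is bounded at the critical exponent. *)
Lemma tz_cvg0 (b : nat -> R) : (forall u, 0 <= b u) -> b @ \oo --> 0 ->
  tz j (fun u => b u * u.+1%:R `^ (- gg)) @[j --> \oo] --> 0.
Proof.
move=> b0 hb; have /andP[g0 g1] := gg01; have g2 : 0 < 1 - gg by lra.
pose K := 2 * C ^+ 4 / (1 - gg).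
have K0 : 0 <= K by rewrite divr_ge0 ?(ltW g2)// mulr_ge0// exprn_ge0// ltW.
have T0 j : 0 <= tz j (fun u => b u * u.+1%:R `^ (- gg)).
  by apply: tz_ge0 => u; rewrite mulr_ge0// powR_ge0.
have lim0 (c : R) : c * (2 ^+ j) `^ (gg - 1) @[j --> \oo] --> 0.
  apply: cvg_to_eq (_ : _ --> c * 0) _; last by rewrite mulr0.
  apply: cvgM; first exact: cvg_cst.
  rewrite (_ : (fun j => _) = (fun j => (2 `^ (gg - 1)) ^+ j)); last first.
    by apply/funext => j; rewrite exprn_powR.
  apply: cvg_expr; rewrite ger0_norm ?powR_ge0//.
  have := @gt0_ltr_powR R (1 - gg) g2 1 2; rewrite !nnegrE ler01 ler0n powR1 ltr1n => /(_ isT isT isT) h.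
  by rewrite -opprB powRN invf_lt1// (lt_trans ltr01).
apply/cvgr0Pnorm_le => eps e0.
have K1 : 0 < 2 * (K + 1) by lra.
have /cvgr0Pnorm_le/(_ _ (divr_gt0 e0 K1)) [U _ hU] := hb.
have /cvgr0Pnorm_le/(_ (eps / 2)) := lim0 (2 * C ^+ 3 * \sum_(u < U) b u).
rewrite divr_gt0// => /(_ isT) hj; near=> j.
rewrite ger0_norm//.
set e1 := eps / (2 * (K + 1)).
apply: (@le_trans _ _ (tz j (fun u => e1 * u.+1%:R `^ (- gg) + (u < U)%:R * b u))).
  apply: tz_mono => u; case: (ltnP u U) => h /=.
    rewrite mul1r -[leLHS]add0r lerD ?mulr_ge0 ?powR_ge0 ?divr_ge0 ?(ltW e0) ?invr_ge0 ?(ltW K1)//.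
    rewrite ler_piMr// powRN invf_le1 ?powR_gt0//.
    have := @ge0_ler_powR R gg (ltW g0) 1 u.+1%:R; rewrite powR1; apply; rewrite ?nnegrE//.
    by rewrite ler1n.
  rewrite mul0r addr0 ler_wpM2r ?powR_ge0//.
  by have := hU u h; rewrite ger0_norm.
rewrite tzD tzZ (splitr eps) lerD//.
  apply: (@le_trans _ _ (e1 * K)).
    rewrite ler_wpM2l ?divr_ge0 ?(ltW e0)//; first lra.
    have := @tz_pow_le gg j; rewrite subrr powRr0 mulr1; apply; lra.
  rewrite /e1 mulrAC ler_pdivrMr// -mulrA mulKf// mulrDr mulr1 lerDl; exact: ltW.
apply: le_trans (_ : 2 * C ^+ 3 * (\sum_(u < U) b u) * (2 ^+ j) `^ (gg - 1) <= _); last first.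
  by apply: le_trans (ler_norm _) _; near: j.
rewrite (le_trans (tz_le _ _))// => [u|]; first by rewrite mulr_ge0.
rewrite [leRHS]mulrAC ler_wpM2l ?mulr_ge0 ?powR_ge0 ?exprn_ge0 ?(ltW C0)//.
pose F u := (u < U)%:R * b u.
have F0 u : 0 <= F u by rewrite mulr_ge0.
rewrite -/(F _) [leRHS](_ : _ = \sum_(u < U) F u); last first.
  by apply: eq_bigr => u _; rewrite /F ltn_ord mul1r.
rewrite -!(big_mkord xpredT F); have [h|h] := leqP (m j) U.
  by rewrite (big_cat_nat (leq0n _) h)//= lerDl sumr_ge0.
rewrite (big_cat_nat (leq0n _) (ltnW h))//= gerDl big_nat big1// => u /andP[h' _].
by rewrite /F ltnNge h' mul0r.
Unshelve. all: by [lra|end_near].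
Qed.

Lemma abs_weights_le j : \sum_(i < m j) `|a j i| <= C ^+ 2 * (2 ^+ j) `^ (gg / 2).
Proof.
apply: (@le_trans _ _ (\sum_(i < m j) C * (2 ^+ j) `^ (gg / 2 - 1))); first exact: ler_sum.
rewrite sumr_const card_ord -[_ *+ m j]mulr_natl (le_trans (ler_wpM2r (_ : 0 <= _) (mC j)))//.
  by rewrite mulr_ge0 ?powR_ge0// ltW.
rewrite (_ : (2 ^+ j) `^ (gg / 2) = 2 ^+ j * (2 ^+ j) `^ (gg / 2 - 1)); last first.
  by rewrite -{2}(powRr1 (ltW (p2 j))) -powRD_gt0// subrKC.
by rewrite expr2; lra.
Qed.

End ScaledWeights.

(** * Comparison of the covariance of X with explicit kernels *)

Section SpectralKernels.
Context {R : realType}.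
Notation mu := (@lebesgue_measure R).
Notation Ipi := `[(- pi)%R, pi%R]%classic.
Variables (d : R) (fs : R -> R) (B : R).
Hypotheses (hd : 0 < d < 2^-1) (mfs : measurable_fun setT fs) (fs0 : forall x, 0 <= fs x).
Hypotheses (fsB : forall x, fs x <= B) (cfs : {for 0, continuous fs}) (fs0_gt0 : 0 < fs 0).

Definition fden x := phi d x * fs x.
Definition cov := rF fden.

Let B0 : 0 < B. Proof. exact: lt_le_trans fs0_gt0 (fsB 0). Qed.
Let iphi : itb mu Ipi (phi d). Proof. exact: itb_phi. Qed.
Let a1 := 1 - 2 * d.
Let a1_gt0 : 0 < a1. Proof. by rewrite /a1; move: hd => /andP[? ?]; lra. Qed.

Lemma fden_ge0 x : 0 <= fden x. Proof. by rewrite mulr_ge0 ?phi_ge0. Qed.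

Lemma itb_fden_mul (u : R -> R) c : measurable_fun setT u -> (forall x, `|u x| <= c) ->
  itb mu Ipi (fun x => u x * fden x).
Proof.
move=> mu' bu; rewrite (_ : (fun x => _) = (fun x => (u x * fs x) * phi d x)); last first.
  by apply/funext => x; rewrite /fden; ring.
apply: (@itb_bounded_mul _ _ _ (c * B)) => //; first exact: measurable_funM.
move=> x; rewrite normrM; apply: ler_pM => //; rewrite ger0_norm//.
Qed.

Lemma itb_fden : itb mu Ipi fden.
Proof.
rewrite (_ : fden = fun x => 1 * fden x); last by apply/funext => x; rewrite mul1r.
by apply: (@itb_fden_mul (fun=> 1) 1) => // x; rewrite normr1.
Qed.

Lemma adom_fden_mul (u : R -> R) : measurable_fun setT u -> (forall x, `|u x| <= 1) ->
  adom (rF (fun x => u x * fden x)) (fun h => B * rho d h).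
Proof.
move=> mu' bu; rewrite -(rFZ B iphi).
apply: adom_rF => [||x _]; [exact: itb_fden_mul bu|exact: itbZ|].
rewrite normrM (ger0_norm (fden_ge0 x)) /fden (le_trans (ler_piMl _ (bu x)))//; first exact: fden_ge0.
by rewrite mulrC ler_wpM2r ?phi_ge0.
Qed.

Lemma adom_cov : adom cov (fun h => B * rho d h).
Proof.
have := @adom_fden_mul (fun=> 1); rewrite (_ : (fun x => 1 * fden x) = fden).
  by apply => // x; rewrite normr1.
by apply/funext => x; rewrite mul1r.
Qed.

(** Near frequency 0 continuity of [fs] gives the factor eps; away from 0 the singular factor is
    bounded. The price is a constant spectral density, that is a white noise, whose covariance lives
    at lag 0. *)
Lemma fden_near0 (eps : R) : 0 < eps -> exists2 Ce : R, 0 <= Ce &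
  forall x, x \in Ipi -> `|fden x - fs 0 * phi d x| <= eps * phi d x + Ce.
Proof.
move=> e0; have /cvgrPdist_le/(_ _ e0) := cfs.
move=> /nbhs_ballP[eta /= eta0 heta].
have e3 : 0 < eta / 3 by rewrite divr_gt0.
exists (2 * B * (eta / 3) `^ (- (2 * d))); first by rewrite !mulr_ge0 ?powR_ge0 ?(ltW B0).
move=> x; rewrite inE/= in_itv/= => xp.
rewrite /fden [fs 0 * _]mulrC -mulrBr normrM (ger0_norm (phi_ge0 _ _)).
have [xe|xe] := ltP `|x| eta.
  rewrite (le_trans (_ : _ <= eps * phi d x)) ?lerDl ?mulr_ge0 ?powR_ge0 ?(ltW B0)//.
  rewrite mulrC ler_wpM2r ?phi_ge0// distrC; apply: heta.
  by rewrite /ball/= sub0r normrN.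
rewrite (le_trans (_ : _ <= 2 * B * (eta / 3) `^ (- (2 * d)))) ?lerDr ?mulr_ge0 ?phi_ge0 ?(ltW e0)//.
rewrite mulrC; apply: ler_pM; rewrite ?phi_ge0//.
  have h1 := fs0 x; have h2 := fsB x; have h3 := fsB 0; have h4 := fs0 0.
  by rewrite ler_norml; apply/andP; split; lra.
apply: le_powRN => //; first by rewrite mulr_ge0// ltW//; case/andP: hd.
apply: le_trans (sn_ge _); first by rewrite ler_wpM2r.
by rewrite ler_norml.
Qed.

Lemma adom_near0 (eps : R) : 0 < eps -> exists2 Ce : R, 0 <= Ce &
  adom (fun h => cov h - fs 0 * rho d h) (fun h => eps * rho d h + Ce * (h == 0)%:R).
Proof.
move=> e0; have [Ce Ce0 hC] := fden_near0 e0.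
exists (Ce * (2 * pi)); first by rewrite !mulr_ge0 ?pi_ge0.
have i1 : itb mu Ipi (fun=> 1) by apply: continuous_itb => x; exact: cvg_cst.
have icst : itb mu Ipi (fun x => Ce * 1) by exact: itbZ.
have := @adom_rF _ (fun x => fden x - fs 0 * phi d x) (fun x => eps * phi d x + Ce * 1).
rewrite rFB ?rFD ?rFZ//; [|exact: itbZ|exact: itb_fden|exact: itbZ].
move=> h; apply: adom_eq (h _ _ _) _ _ => [||x xI|k|k].
- by apply: itbB => //; [exact: itb_fden|exact: itbZ].
- by apply: itbD => //; exact: itbZ.
- by rewrite mulr1; exact: hC.
- by [].
- by rewrite /= rF1 /rho; ring.
Qed.

Variables (m w : nat -> nat) (a : nat -> nat -> R) (C : R) (q0 : nat).
Let gg := q0%:R * a1.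
Hypotheses (C1 : 1 <= C) (q00 : (0 < q0)%N) (gg1 : gg < 1).
Hypothesis mC : forall j, (m j)%:R <= C * 2 ^+ j.
Hypothesis aC : forall j (i : 'I_(m j)), `|a j i| <= C * (2 ^+ j) `^ (gg / 2 - 1).

Let gg0 : 0 < gg. Proof. by rewrite mulr_gt0// ltr0n. Qed.
Let gg01 : 0 < gg < 1. Proof. by rewrite gg0. Qed.

Definition tpos j (k : int) (i : 'I_(m j)) : int := (2 ^ j)%N%:Z * k - (i%:Z - (w j)%:Z).
Notation qfa j k kap := (qf (fun i : 'I_(m j) => a j i) (@tpos j k) kap).

Lemma tposB j k (i l : 'I_(m j)) : tpos k i - tpos k l = l%:Z - i%:Z.
Proof. by rewrite /tpos; ring. Qed.

Lemma qfa_stat j k kap : qfa j k kap = qfa j 0 kap.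
Proof. by apply: eq_bigr => i _; apply: eq_bigr => l _; rewrite !tposB. Qed.

Lemma qfa_le j k (kap : int -> R) (K : nat -> R) : (forall h, `|kap h| <= K `|h|%N) ->
  `|qfa j k kap| <= tz m a j K.
Proof.
move=> h; rewrite (le_trans (qf_abs_le _ _ h))//; apply: ler_sum => i _; apply: ler_sum => l _.
by rewrite tposB -abszN opprB.
Qed.

(** For q > q0 the kernel decays at least like u^(-gg) u^(-(1-2d)), and the second factor tends to
    0. Only the constant depends on q, geometrically, and the decay of the Hermite coefficients will
    absorb it. *)
Lemma cov_rest_le : exists2 tau : nat -> R, tau @ \oo --> 0 & forall q j k, (q0 < q)%N ->
  `|qfa j k (fun h => cov h ^+ q)| <= (B * rho d 0) ^+ q * tau j.
Proof.
exists (fun j => tz m a j (fun u => u.+1%:R `^ (- a1) * u.+1%:R `^ (- gg))).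
  by apply: (tz_cvg0 C1 gg01 mC aC) => [u|]; [exact: powR_ge0|exact: cvg_powRN0].
move=> q j k qq; rewrite (le_trans (adom_qf _ _ (adomX q adom_cov)))//.
apply: le_trans (ler_norm _) _; rewrite -tzZ; apply: qfa_le => h.
have r0 : 0 <= rho d 0 by rewrite ltW// rho0_gt0.
rewrite normrX normrM (ger0_norm (ltW B0)).
apply: (@le_trans _ _ ((B * (rho d 0 * `|h|%N.+1%:R `^ (- a1))) ^+ q)).
  rewrite lerXn2r ?nnegrE ?mulr_ge0 ?powR_ge0 ?(ltW B0)//.
  by rewrite ler_wpM2l ?(ltW B0)// rho_abs_le.
rewrite mulrA exprMn ler_wpM2l ?exprn_ge0 ?mulr_ge0 ?(ltW B0)//.
rewrite powR_exprn -powRD_gt0// !mulNr; apply: ler_powR; first by rewrite ler1n.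
rewrite /gg -opprD lerN2 [q0%:R * _]mulrC -[X in X + _]mulr1 -mulrDr ler_wpM2l ?(ltW a1_gt0)//.
by rewrite nat1r ler_nat.
Qed.

Lemma cov_main_cvg (V : R) : qfa j 0 (rho ((1 - gg) / 2)) @[j --> \oo] --> V ->
  exists2 c : R, 0 < c & qfa j 0 (fun h => cov h ^+ q0) @[j --> \oo] --> c * V.
Proof.
move=> hV; set de := (1 - gg) / 2; have hde : 0 < de < 2^-1 by rewrite /de; move: gg0 gg1 => ? ?; lra.
have [ld [ld0 hld]] := rho_cvg hd; have [lde [lde0 hlde]] := rho_cvg hde.
pose c' := ld ^+ q0 / lde; have c'0 : 0 < c' by rewrite divr_gt0// exprn_gt0.
exists (fs 0 ^+ q0 * c'); first by rewrite mulr_gt0// exprn_gt0.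
have r0 : 0 < rho d 0 by rewrite rho0_gt0.
(* Both kernels decay like [u ^ (- gg)], and [c'] is the ratio of their constants. *)
have s1 : qfa j 0 (fun h => rho d h ^+ q0 - c' * rho de h) @[j --> \oo] --> 0.
  pose b u := `|rho d u%:Z ^+ q0 - c' * rho de u%:Z| * u.+1%:R `^ gg.
  have hb : b @ \oo --> 0.
    have E u : b u = `|(rho d u%:Z * u.+1%:R `^ a1) ^+ q0 - c' * (rho de u%:Z * u.+1%:R `^ (1 - 2 * de))|.
      rewrite exprMn powR_exprn [a1 * _]mulrC -/gg [c' * (_ * _)]mulrA.
      rewrite (_ : 1 - 2 * de = gg); last by rewrite /de; field.
      by rewrite -mulrBl normrM (ger0_norm (powR_ge0 _ _)).
    rewrite (funext E).
    rewrite -(normr0 R); apply: cvg_norm.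
    apply: cvg_to_eq (_ : _ --> ld ^+ q0 - c' * lde) _; last by rewrite /c' divfK ?subrr// gt_eqF.
    by apply: cvgB; [exact: cvg_exprn|apply: cvgM; first exact: cvg_cst].
  have := tz_cvg0 C1 gg01 mC aC (fun u => mulr_ge0 (normr_ge0 _) (powR_ge0 _ _)) hb.
  apply: cvg0_le => j /=; apply: qfa_le => h.
  by rewrite (rho_absz d h) (rho_absz de h) /b powRN mulfK ?gt_eqF ?powR_gt0.
have s2 : qfa j 0 (fun h => rho d h ^+ q0) @[j --> \oo] --> c' * V.
  apply: cvg_to_eq (_ : _ --> 0 + c' * V) _; last by rewrite add0r.
  rewrite (_ : (fun j => _) = (fun j => qfa j 0 (fun h => rho d h ^+ q0 - c' * rho de h) + c' * qfa j 0 (rho de))); last first.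
    by apply/funext => j; rewrite -qfZ -qfD; congr qf; apply/funext => h; rewrite subrK.
  by apply: cvgD => //; apply: cvgM; first exact: cvg_cst.
(* In the order on forms, the replacement costs eps times the form of rho_d^q0, which converges and
   hence is bounded, plus a kernel supported at lag 0, which the scaled weights send to 0. *)
have s3 : qfa j 0 (fun h => cov h ^+ q0 - (fs 0 * rho d h) ^+ q0) @[j --> \oo] --> 0.
  pose D := q0%:R * B ^+ q0.-1.
  have D0 : 0 <= D by rewrite mulr_ge0// exprn_ge0// ltW.
  have bd (eps : R) : 0 < eps -> exists2 u : nat -> R, u @ \oo --> 0 & forall j,
      `|qfa j 0 (fun h => cov h ^+ q0 - (fs 0 * rho d h) ^+ q0)| <= eps * D * qfa j 0 (fun h => rho d h ^+ q0) + u j.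
    move=> e0; have [Ce Ce0 hA] := adom_near0 e0.
    have dk0 : adom (fun h => fs 0 * rho d h) (fun h => B * rho d h).
      rewrite -!(rFZ _ iphi); apply: adom_rF => [||x _]; [exact: itbZ|exact: itbZ|].
      by rewrite ger0_norm ?mulr_ge0 ?phi_ge0// ler_wpM2r ?phi_ge0.
    have hX := adom_exprB q0 adom_cov dk0 hA.
    exists (fun j => Ce * D * rho d 0 ^+ q0.-1 * tz m a j (fun u => (u == 0)%N%:R * u.+1%:R `^ (- gg))).
      apply: cvg_to_eq (_ : _ --> Ce * D * rho d 0 ^+ q0.-1 * 0) _; last by rewrite mulr0.
      apply: cvgM; first exact: cvg_cst.
      apply: (tz_cvg0 C1 gg01 mC aC); first by move=> u; exact: ler0n.
      apply: cvg_near_cst; exists 1%N => // -[]//.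
    move=> j; rewrite (le_trans (adom_qf _ _ hX))//.
    have -> : (fun h => q0%:R * ((eps * rho d h + Ce * (h == 0)%:R) * (B * rho d h) ^+ q0.-1)) =
       (fun h => eps * D * rho d h ^+ q0 + Ce * D * rho d 0 ^+ q0.-1 * (h == 0)%:R).
      apply/funext => h; rewrite exprMn /D -[in RHS](prednK q00) exprS.
      by case: eqP => [->|_]; rewrite ?mulr0 ?mulr1/= ?(prednK q00); ring.
    rewrite qfD !qfZ lerD2l ler_wpM2l ?mulr_ge0 ?exprn_ge0 ?(ltW r0) ?(ltW B0)//.
    apply: le_trans (ler_norm _) _; apply: qfa_le => h.
    by case: h => [[|n]|n] /=; rewrite ?normr0 ?mul0r// normr1 powR1 mul1r.
  have [K hK] : exists K, forall j, qfa j 0 (fun h => rho d h ^+ q0) <= K.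
    have [K [_ hK]] := cvg_seq_bounded (cvgP _ s2).
    by exists (K + 1) => j; apply: le_trans (ler_norm _) _; apply: (hK (K + 1)) => //; rewrite ltrDl.
  apply/cvgr0Pnorm_le => eps e0.
  have K1 : 0 < `|K| + 1 by rewrite ltr_wpDl.
  have D1 : 0 < D + 1 by rewrite ltr_wpDl.
  have [|u hu hub] := bd (eps / 2 / ((D + 1) * (`|K| + 1))); first by rewrite !divr_gt0// mulr_gt0.
  have /cvgr0Pnorm_le/(_ (eps / 2)) := hu; rewrite divr_gt0// => /(_ isT); apply: filterS => j hj.
  rewrite (le_trans (hub j))// [leRHS](splitr eps) lerD ?(le_trans (ler_norm _) hj)//.
  rewrite (@le_trans _ _ (eps / 2 / ((D + 1) * (`|K| + 1)) * ((D + 1) * (`|K| + 1))))//; last first.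
    by rewrite divfK// gt_eqF// mulr_gt0.
  rewrite -[leLHS]mulrA ler_wpM2l ?divr_ge0 ?mulr_ge0 ?(ltW e0) ?(ltW D1) ?(ltW K1)//.
  apply: (@le_trans _ _ (D * (`|K| + 1))); last by rewrite ler_wpM2r ?(ltW K1)// lerDl.
  by rewrite ler_wpM2l// (le_trans (hK j))// (le_trans (ler_norm _))// lerDl.
rewrite -mulrA; apply: cvg_to_eq (_ : _ --> 0 + fs 0 ^+ q0 * (c' * V)) _; last by rewrite add0r.
rewrite (_ : (fun j => _) = (fun j => qfa j 0 (fun h => cov h ^+ q0 - (fs 0 * rho d h) ^+ q0) +
    fs 0 ^+ q0 * qfa j 0 (fun h => rho d h ^+ q0))); last first.
  apply/funext => j; rewrite -qfZ -qfD; congr qf; apply/funext => h.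
  by rewrite exprMn subrK.
by apply: cvgD => //; apply: cvgM; first exact: cvg_cst.
Qed.

End SpectralKernels.

(** * Law of large numbers for the squares *)

Section Smoothing.
Context {R : realType}.
Notation mu := (@lebesgue_measure R).
Notation Ipi := `[(- pi)%R, pi%R]%classic.
Implicit Types (L : nat) (x : R).

(* The flag [b] selects the moving average over [-L, L] or the identity, so that smoothed and
   original variables form a single Gaussian family. *)
Definition avgw L (b : bool) (k : 'I_(L.*2.+1)) : R :=
  if b then (L.*2.+1)%:R^-1 else (k == L :> nat)%:R.
Definition off L (k : 'I_(L.*2.+1)) : int := k%:Z - L%:Z.
(** The normalized Dirichlet kernel, transfer function of the moving average. *)
Definition bhat L x : R := \sum_k avgw true k * cos (x * (@off L k)%:~R).

Lemma off_rev L k : @off L (rev_ord k) = - off k.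
Proof. by rewrite /off /=; move: (ltn_ord k); clear; lia. Qed.

Lemma avgw_rev L b k : @avgw L b (rev_ord k) = avgw b k.
Proof.
rewrite /avgw; case: b => //; congr (nat_of_bool _)%:R.
by rewrite /=; move: (ltn_ord k); clear; lia.
Qed.

(** The window is symmetric about 0, so its transfer function is real. *)
Lemma avgw_sum_sin L b x : \sum_k avgw b k * sin (x * (@off L k)%:~R) = 0.
Proof.
set S := \sum_k _; suff : S = - S by move=> h; lra.
rewrite {1}/S (reindex_inj rev_ord_inj)/= -sumrN; apply: eq_bigr => k _.
by rewrite avgw_rev off_rev rmorphN mulrN sinN mulrN.
Qed.

Lemma avgw_sum_cos L b x : \sum_k avgw b k * cos (x * (@off L k)%:~R) = bhat L x ^+ b.
Proof.
case: b => //; have hL : (L < L.*2.+1)%N by lia.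
rewrite (bigD1 (Ordinal hL))//= big1 ?addr0 => [|k kL].
  by rewrite eqxx mul1r /off /= subrr mulr0 cos0.
rewrite /avgw; case: eqP => [h|]; last by rewrite mul0r.
by case/eqP: kL; exact/val_inj.
Qed.

Lemma avgw_ge0 L b k : 0 <= @avgw L b k.
Proof. by rewrite /avgw; case: b; rewrite ?invr_ge0 ?ler0n. Qed.

Lemma avgw_sum1 L b : \sum_k @avgw L b k = 1.
Proof.
have h := avgw_sum_cos L b 0; transitivity (\sum_k avgw b k * cos (0 * (@off L k)%:~R)).
  by apply: eq_bigr => k _; rewrite mul0r cos0 mulr1.
rewrite h; suff -> : bhat L 0 = 1 by rewrite expr1n.
rewrite /bhat; under eq_bigr do rewrite mul0r cos0 mulr1.
by rewrite /avgw sumr_const card_ord -[_ *+ _]mulr_natr mulVf// pnatr_eq0.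
Qed.

Lemma bhat_abs_le1 L x : `|bhat L x| <= 1.
Proof.
rewrite -(avgw_sum1 L true) (le_trans (ler_norm_sum _ _ _))//; apply: ler_sum => k _.
rewrite normrM (ger0_norm (avgw_ge0 _ _)) ler_piMr ?avgw_ge0//.
by rewrite ler_norml cos_geN1 cos_le1.
Qed.

Lemma bhat_cont L : continuous (bhat L).
Proof.
move=> x; apply: dv_continuous.
apply: (@dv_sum _ _ (fun k y => (L.*2.+1)%:R^-1 * cos (y * (k%:Z - L%:Z)%:~R))).
Qed.

Lemma bhat_meas L n : measurable_fun setT (fun x => bhat L x ^+ n).
Proof. by apply: measurable_funX; apply: continuous_measurable_fun; exact: bhat_cont. Qed.

Lemma bhatX_abs_le1 L n x : `|bhat L x ^+ n| <= 1.
Proof. by rewrite normrX exprn_ile1// bhat_abs_le1. Qed.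

Lemma abs_sin_mul_le (n : nat) x : `|sin (n%:R * x)| <= n%:R * `|sin x|.
Proof.
elim: n => [|n IH]; first by rewrite !mul0r sin0 normr0.
rewrite -natr1 mulrDl mul1r sinD (le_trans (ler_normD _ _))// [leRHS]mulrDl mul1r lerD// normrM.
  by rewrite (le_trans _ IH)// ler_piMr// ler_norml cos_geN1 cos_le1.
by rewrite ler_piMl// ler_norml cos_geN1 cos_le1.
Qed.

Lemma sqr_le_powR (z kappa : R) : 0 <= z <= 1 -> 0 < kappa <= 2 -> z ^+ 2 <= z `^ kappa.
Proof.
move=> /andP[z0 z1] /andP[k0 k2]; have [->|zn] := eqVneq z 0.
  by rewrite expr0n powR_ge0.
have zp : 0 < z by rewrite lt_neqAle eq_sym zn.
rewrite -powR_mulrn// !powR_expR// ler_expR.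
have : ln z <= 0 by rewrite ln_le0.
by nra.
Qed.

(** From 1 - cos y = 2 sin(y/2)^2 <= 2 |sin(y/2)|^kappa. The exponent is left free because the
    gained factor |sn|^kappa must not use up the whole singularity of the density. *)
Lemma one_minus_bhat L x (kappa : R) : 0 < kappa <= 2 ->
  `|1 - bhat L x| <= 2 * L%:R `^ kappa * `|sn x| `^ kappa.
Proof.
move=> kk; have /andP[k0 _] := kk.
rewrite -{1}(avgw_sum1 L true) -sumrB (le_trans (ler_norm_sum _ _ _))//.
rewrite -[leRHS]mul1r -[X in X * _](avgw_sum1 L true) mulr_suml; apply: ler_sum => k _.
rewrite -[X in X - _]mulr1 -mulrBr normrM (ger0_norm (avgw_ge0 _ _)) ler_wpM2l ?avgw_ge0//.
set y := x * _; have -> : 1 - cos y = 2 * sin (y / 2) ^+ 2.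
  by have := sn_sqr y; rewrite /sn exprMn => h; lra.
rewrite normrM ger0_norm// -mulrA ler_wpM2l// normrX.
apply: le_trans (sqr_le_powR _ kk) _.
  by rewrite normr_ge0/= ler_norml sin_geN1 sin_le1.
rewrite -powRM//; apply: ge0_ler_powR; rewrite ?nnegrE ?mulr_ge0// ?(ltW k0)//.
have -> : `|sin (y / 2)| = `|sin (`|off k|%N%:R * (x / 2))|.
  have -> : y / 2 = (off k)%:~R * (x / 2) by rewrite /y; ring.
  case: (off k) => n //; rewrite NegzE abszN rmorphN mulNr sinN normrN.
  by [].
rewrite (le_trans (abs_sin_mul_le _ _))//; apply: ler_pM => //.
  by rewrite ler_nat /off; move: (ltn_ord k); clear; lia.
by rewrite /sn normrM ger0_norm// ler_peMl// ler1n.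
Qed.

Lemma avgw_conv L (F : R -> R) (b b' : bool) (h : int) : itb mu Ipi F ->
  \sum_k \sum_l @avgw L b k * @avgw L b' l * rF F (h + off k - off l) =
  rF (fun x => bhat L x ^+ (b + b') * F x) h.
Proof.
move=> iF.
have key x : \sum_k \sum_l @avgw L b k * @avgw L b' l * cos (x * (h + off k - off l)%:~R) =
    cos (x * h%:~R) * bhat L x ^+ (b + b').
  have E k l : @avgw L b k * @avgw L b' l * cos (x * (h + off k - off l)%:~R) =
     cos (x * h%:~R) * ((avgw b k * cos (x * (off k)%:~R)) * (avgw b' l * cos (x * (off l)%:~R)) +
                        (avgw b k * sin (x * (off k)%:~R)) * (avgw b' l * sin (x * (off l)%:~R))) -
     sin (x * h%:~R) * ((avgw b k * sin (x * (off k)%:~R)) * (avgw b' l * cos (x * (off l)%:~R)) -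
                        (avgw b k * cos (x * (off k)%:~R)) * (avgw b' l * sin (x * (off l)%:~R))).
    rewrite (_ : x * (h + off k - off l)%:~R = x * h%:~R + x * (off k)%:~R - x * (off l)%:~R); last first.
      by rewrite rmorphB rmorphD; ring.
    by rewrite cosB cosD sinD; ring.
  transitivity (cos (x * h%:~R) * ((\sum_k avgw b k * cos (x * (@off L k)%:~R)) * (\sum_l avgw b' l * cos (x * (@off L l)%:~R)) +
     (\sum_k avgw b k * sin (x * (@off L k)%:~R)) * (\sum_l avgw b' l * sin (x * (@off L l)%:~R))) -
     sin (x * h%:~R) * ((\sum_k avgw b k * sin (x * (@off L k)%:~R)) * (\sum_l avgw b' l * cos (x * (@off L l)%:~R)) -
     (\sum_k avgw b k * cos (x * (@off L k)%:~R)) * (\sum_l avgw b' l * sin (x * (@off L l)%:~R)))).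
    rewrite !big_distrlr/= -big_split/= -sumrB !mulr_sumr -sumrB; apply: eq_bigr => k _.
    rewrite -big_split/= -sumrB !mulr_sumr -sumrB; apply: eq_bigr => l _; exact: E.
  by rewrite !avgw_sum_sin !avgw_sum_cos !mul0r !mulr0 subr0 addr0 mulr0 subr0 exprD.
have j (k l : 'I_(L.*2.+1)) : itb mu Ipi (fun x => avgw b k * avgw b' l * (cos (x * (h + off k - off l)%:~R) * F x)).
  by apply: itbZ => //; exact: itb_cosF.
transitivity (\int[mu]_(x in Ipi) \sum_k \sum_l @avgw L b k * @avgw L b' l * (cos (x * (h + off k - off l)%:~R) * F x)).
  rewrite (Rint_sum mIpi); last by move=> k _; apply: itb_sum.
  apply: eq_bigr => k _; rewrite (Rint_sum mIpi)//; apply: eq_bigr => l _.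
  by rewrite RintZ//; exact: itb_cosF.
apply: eq_Rintegral => x _; rewrite mulrA -key mulr_suml; apply: eq_bigr => k _.
by rewrite mulr_suml; apply: eq_bigr => l _; rewrite mulrA.
Qed.

Lemma avgw_conv_le L (F : R -> R) (h : int) (K : R) : itb mu Ipi F ->
  (forall k l : 'I_(L.*2.+1), `|rF F (h + off k - off l)| <= K) ->
  `|rF (fun x => bhat L x ^+ 2 * F x) h| <= K.
Proof.
move=> iF hK; rewrite -(avgw_conv L true true h iF).
rewrite (le_trans (ler_norm_sum _ _ _))// -[K]mul1r -[X in X * _](avgw_sum1 L true) mulr_suml.
apply: ler_sum => k _; rewrite (le_trans (ler_norm_sum _ _ _))// -[K]mul1r -[X in X * K](avgw_sum1 L true).
rewrite mulr_suml mulr_sumr; apply: ler_sum => l _.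
by rewrite !normrM !(ger0_norm (avgw_ge0 _ _)) -mulrA ler_wpM2l ?avgw_ge0// ler_wpM2l ?avgw_ge0.
Qed.

Lemma itb_bhat_mul L n (F : R -> R) : itb mu Ipi F -> itb mu Ipi (fun x => bhat L x ^+ n * F x).
Proof. by move=> iF; apply: itb_bounded_mul iF; [exact: bhat_meas|exact: bhatX_abs_le1]. Qed.

Lemma rF_abs_le (F G : R -> R) h : itb mu Ipi F -> itb mu Ipi G ->
  (forall x, x \in Ipi -> `|F x| <= G x) -> `|rF F h| <= \int[mu]_(x in Ipi) G x.
Proof.
move=> iF iG FG; apply: Rint_norm_le => //; first exact: itb_cosF.
move=> x /mem_set xI; rewrite normrM (le_trans _ (FG x xI))// ler_piMl//.
by rewrite ler_norml cos_geN1 cos_le1.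
Qed.

Lemma Rint_rF0 (F : R -> R) : \int[mu]_(x in Ipi) F x = rF F 0.
Proof. by apply: eq_Rintegral => x _; rewrite mulr0 cos0 mul1r. Qed.

(** The left side is the variance of an average of 2L + 1 values with covariance rho_d, and long
    memory makes it of order (2L + 1)^(-(1-2d)). *)
Lemma Rint_bhat_phi L (d : R) : 0 < d < 2^-1 ->
  \int[mu]_(x in Ipi) (bhat L x ^+ 2 * phi d x) <= rho d 0 / d * (L.*2.+1)%:R `^ (- (1 - 2 * d)).
Proof.
move=> hd; have /andP[d0 d1] := hd; rewrite Rint_rF0 -(avgw_conv L true true 0 (itb_phi hd)) /avgw.
set n := L.*2.+1; have n0 : 0 < n%:R :> R by [].
have r0 := rho0_gt0 hd.
apply: (@le_trans _ _ (n%:R ^- 2 * (rho d 0 * \sum_(k < n) \sum_(l < n) `|k%:Z - l%:Z|%N.+1%:R `^ (- (1 - 2 * d))))).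
  rewrite !mulr_sumr; apply: ler_sum => k _; rewrite !mulr_sumr; apply: ler_sum => l _.
  rewrite -expr2 -exprVn ler_wpM2l ?exprn_ge0 ?invr_ge0// (le_trans (ler_norm _))//.
  rewrite (_ : 0 + off k - off l = k%:Z - l%:Z); last by rewrite /off; ring.
  exact: rho_abs_le.
have h := @toeplitz_sum_le R n (fun u => u.+1%:R `^ (- (1 - 2 * d))) (fun u => powR_ge0 _ _).
have h2 := @sum_powRN_le R (1 - 2 * d) n.
have {}h2 := h2 _; have g01 : 0 <= 1 - 2 * d < 1 by apply/andP; split; lra.
have {}h := le_trans h (ler_wpM2l (ler0n _ n) (ler_wpM2l (ler0n _ 2) (h2 g01))).
apply: (le_trans (ler_wpM2l _ (ler_wpM2l (ltW r0) h))); first by rewrite invr_ge0 exprn_ge0.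
rewrite (_ : 1 - (1 - 2 * d) = 2 * d); last by ring.
rewrite (_ : - (1 - 2 * d) = 2 * d - 1); last by ring.
rewrite [_ `^ (2 * d - 1)]powRD_gt0// powRN powRr1 ?(ltW n0)//.
rewrite le_eqVlt; apply/orP; left; apply/eqP; field.
by rewrite !gt_eqF.
Qed.

Lemma Rint_bhat_sqr L : \int[mu]_(x in Ipi) (bhat L x ^+ 2 * 1) <= 2 * pi / (L.*2.+1)%:R.
Proof.
have i1 : itb mu Ipi (fun=> 1) by apply: continuous_itb => x; exact: cvg_cst.
rewrite Rint_rF0 -(avgw_conv L true true 0 i1) /avgw; set n := L.*2.+1.
under eq_bigr do under eq_bigr do rewrite rF1.
have E (k : 'I_n) : \sum_(l < n) n%:R^-1 * n%:R^-1 * ((0 + off k - off l == 0)%:R * (2 * pi)) = n%:R^-1 * n%:R^-1 * (2 * pi) :> R.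
  rewrite (bigD1 k)//= big1 ?addr0 => [|l lk].
    by rewrite add0r subrr eqxx mul1r.
  case: eqP => [h|_]; last by rewrite mul0r mulr0.
  case/eqP: lk; apply: val_inj; have : off k = off l by apply/eqP; rewrite -subr_eq0 -h add0r.
  by rewrite /off => /addIr [].
under eq_bigr do rewrite E.
rewrite sumr_const card_ord -[_ *+ _]mulr_natl le_eqVlt; apply/orP; left; apply/eqP.
by rewrite -mulrA mulVKf 1?mulrC// pnatr_eq0.
Qed.

End Smoothing.

(** * Weak law for arrays decorrelating at large lags *)

Section WeakLaw.
Context {R : realType} {d : measure_display} {T : measurableType d} (P : probability T R).

(** Homogeneity of Wick powers, used to bring the small smoothed covariances to order one. *)
Lemma hv_scale (s v : R) q x : hv (s ^+ 2 * v) q (s * x) = s ^+ q * hv v q x.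
Proof.
suff [] : hv (s ^+ 2 * v) q (s * x) = s ^+ q * hv v q x /\
  hv (s ^+ 2 * v) q.+1 (s * x) = s ^+ q.+1 * hv v q.+1 x by [].
elim: q => [|q [IH1 IH2]]; first by rewrite !hv0 !hv1 mulr1.
by split => //; rewrite !hvSS IH1 IH2 !exprS; ring.
Qed.

Lemma gvec_scale (I : finType) (L : I -> T -> R) (c : I -> I -> R) (s : R) :
  gvec P L c -> gvec P (fun i t => s * L i t) (fun i j => s ^+ 2 * c i j).
Proof.
move=> [cC hg]; split => [i j|a]; first by rewrite cC.
have := hg (fun i => s * a i).
rewrite (_ : (fun t => _) = (fun t => \sum_i a i * (s * L i t))); last first.
  by apply/funext => t; apply: eq_bigr => i _; ring.
rewrite (_ : \sum_i _ = \sum_i \sum_j a i * a j * (s ^+ 2 * c i j))//.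
by apply: eq_bigr => i _; apply: eq_bigr => j _; ring.
Qed.

(** Expanding both squares makes their covariance a fourfold weighted sum of the differences bounded
    in the hypothesis. *)
Lemma wick_square_cov (I : finType) (L : I -> T -> R) (c : I -> I -> R) (n q : nat)
    (a : 'I_n -> R) (u v : 'I_n -> I) (K : R) :
  gvec P L c ->
  (forall i1 i2 i3 i4, `|wick4 P L c (u i1) (u i2) (v i3) (v i4) q q q q -
     wick4 P L c (u i1) (u i2) (v i3) (v i4) q q 0 0 *
     wick4 P L c (u i1) (u i2) (v i3) (v i4) 0 0 q q| <= K) ->
  let U t := \sum_i a i * hv (c (u i) (u i)) q (L (u i) t) in
  let V t := \sum_i a i * hv (c (v i) (v i)) q (L (v i) t) in
  [/\ itb P setT (fun t => U t ^+ 2), itb P setT (fun t => V t ^+ 2),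
      itb P setT (fun t => U t ^+ 2 * V t ^+ 2) &
  `|\int[P]_t (U t ^+ 2 * V t ^+ 2) - \int[P]_t (U t ^+ 2) * \int[P]_t (V t ^+ 2)|
    <= (\sum_i `|a i|) ^+ 4 * K].
Proof.
move=> gL hK U V.
pose h i t := hv (c i i) q (L i t).
pose A (p : 'I_n * 'I_n) := a p.1 * a p.2.
have UE (w : 'I_n -> I) t : (\sum_i a i * h (w i) t) ^+ 2 = \sum_p A p * (h (w p.1) t * h (w p.2) t).
  rewrite expr2 big_distrlr /= pair_big/=; apply: eq_bigr => p _; rewrite /A; ring.
have i2 (w : 'I_n -> I) p : itb P setT (fun t => h (w p.1) t * h (w p.2) t) by exact: hv2_itb.
have i4 p p' : itb P setT (fun t => (h (u p.1) t * h (u p.2) t) * (h (v p'.1) t * h (v p'.2) t)).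
  have := wick4_itb gL (u p.1) (u p.2) (v p'.1) (v p'.2) q q q q.
  by under eq_fun do rewrite mulrA.
have iU2 (w : 'I_n -> I) : itb P setT (fun t => (\sum_i a i * h (w i) t) ^+ 2).
  by under [X in itb _ _ X]eq_fun do rewrite UE; apply: itb_sum => // p _; exact: itbZ.
have U2V2 t : U t ^+ 2 * V t ^+ 2 = \sum_p \sum_p' A p * A p' * ((h (u p.1) t * h (u p.2) t) * (h (v p'.1) t * h (v p'.2) t)).
  rewrite (UE u) (UE v) big_distrlr/=; apply: eq_bigr => p _; apply: eq_bigr => p' _; ring.
have iUV : itb P setT (fun t => U t ^+ 2 * V t ^+ 2).
  under [X in itb _ _ X]eq_fun do rewrite U2V2.
  by apply: itb_sum => // p _; apply: itb_sum => // p' _; exact: itbZ.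
split; [exact: iU2|exact: iU2|exact: iUV|].
have EU (w : 'I_n -> I) : \int[P]_t ((\sum_i a i * h (w i) t) ^+ 2) = \sum_p A p * \int[P]_t (h (w p.1) t * h (w p.2) t).
  under eq_Rintegral do rewrite UE.
  by rewrite (Rint_sum measurableT); [apply: eq_bigr => p _; rewrite RintZ|move=> p _; exact: itbZ].
under eq_Rintegral do rewrite U2V2.
rewrite (Rint_sum measurableT); last by move=> p _; apply: itb_sum => // p' _; exact: itbZ.
rewrite (EU u) (EU v) big_distrlr/= -sumrB.
apply: (@le_trans _ _ (\sum_p \sum_p' `|A p| * `|A p'| * K)); last first.
  rewrite le_eqVlt; apply/orP; left; apply/eqP.
  have -> : (\sum_i `|a i|) ^+ 4 = (\sum_p `|A p|) * (\sum_p `|A p|).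
    have -> : \sum_p `|A p| = (\sum_i `|a i|) * (\sum_i `|a i|).
      by rewrite big_distrlr /= pair_big/=; apply: eq_bigr => p _; rewrite /A normrM.
    by rewrite !exprS; ring.
  rewrite big_distrlr/= mulr_suml; apply: eq_bigr => p _.
  by rewrite mulr_suml.
rewrite (le_trans (ler_norm_sum _ _ _))//; apply: ler_sum => p _.
rewrite (Rint_sum measurableT); last by move=> p' _; exact: itbZ.
rewrite -sumrB (le_trans (ler_norm_sum _ _ _))//; apply: ler_sum => p' _.
rewrite RintZ// [X in _ - X]mulrACA -mulrBr !normrM ler_wpM2l ?mulr_ge0//.
have := hK p.1 p.2 p'.1 p'.2; congr (`|_ - _ * _| <= _); apply: eq_Rintegral => t _.
- by rewrite mulrA.
- by rewrite !hv0 !mulr1.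
- by rewrite !hv0 !mul1r.
Qed.

(** Pairs at lag less than D number at most 2 D n and contribute K each; all other pairs contribute
    at most e. Division by n^2 gives the bound. *)
Lemma weak_law (Z : nat -> T -> R) (n D : nat) (K e : R) : (0 < n)%N -> 0 <= K -> 0 <= e ->
  (forall k, l2 P (Z k)) ->
  (forall k l, `|\int[P]_t (Z k t * Z l t) - \int[P]_t Z k t * \int[P]_t Z l t| <= K) ->
  (forall k l, (D <= `|k%:Z - l%:Z|)%N ->
     `|\int[P]_t (Z k t * Z l t) - \int[P]_t Z k t * \int[P]_t Z l t| <= e) ->
  nrm2 P (fun t => n%:R^-1 * \sum_(k < n) (Z k t - \int[P]_t Z k t)) <= 2 * (D%:R * K / n%:R + e).
Proof.
move=> n0 K0 e0 lZ hK he; have nR : 0 < n%:R :> R by rewrite ltr0n.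
pose ez k := \int[P]_t Z k t.
have lC c : l2 P (fun=> c) by split => //; exact: itb_cst.
have iZ k : itb P setT (Z k).
  by have := l2_mul (lZ k) (lC 1); under eq_fun do rewrite mulr1.
have lD k : l2 P (fun t => Z k t - ez k) by exact: l2B.
rewrite nrm2Z; last exact: l2_sum.
rewrite (@nrm2_gram _ _ _ P _ _ (fun (k : 'I_n) t => Z k t - ez k))//.
have E (k l : nat) : \int[P]_t ((Z k t - ez k) * (Z l t - ez l)) = \int[P]_t (Z k t * Z l t) - ez k * ez l.
  transitivity (\int[P]_t (Z k t * Z l t - (ez k * Z l t + (ez l * Z k t - ez k * ez l)))).
    by apply: eq_Rintegral => t _; ring.
  rewrite RintB//; [|exact: l2_mul|by apply: itbD => //; [exact: itbZ|apply: itbB => //; [exact: itbZ|exact: itb_cst]]].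
  rewrite RintD//; [|exact: itbZ|by apply: itbB => //; [exact: itbZ|exact: itb_cst]].
  rewrite RintB//; [|exact: itbZ|exact: itb_cst].
  by rewrite (Rint_cst P (ez k * ez l)) !RintZ// -/(ez k) -/(ez l); ring.
pose kap (u : nat) := if (u < D)%N then K else e.
have k0 u : 0 <= kap u by rewrite /kap; case: ifP.
apply: (@le_trans _ _ (n%:R^-1 ^+ 2 * (n%:R * (2 * \sum_(u < n) kap u)))).
  rewrite ler_wpM2l ?sqr_ge0// (le_trans _ (toeplitz_sum_le n k0))//.
  apply: ler_sum => k _; apply: ler_sum => l _; rewrite E (le_trans (ler_norm _))//.
  rewrite /kap; case: ltnP => h; [exact: hK|exact: he].
have hs : \sum_(u < n) kap u <= D%:R * K + n%:R * e.
  apply: (@le_trans _ _ (\sum_(u < n) ((u < D)%N%:R * K + e))).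
    by apply: ler_sum => u _; rewrite /kap; case: ifP; rewrite ?mul1r ?mul0r ?lerDl ?add0r.
  rewrite big_split/= -mulr_suml sumr_const card_ord -[_ *+ n]mulr_natl lerD2r ler_wpM2r//.
  rewrite -natr_sum ler_nat (_ : (\sum_(i < n) (i < D)%N)%N = minn n D) ?geq_minr//.
  elim: (n) => [|m IH]; first by rewrite big_ord0 min0n.
  by rewrite big_ord_recr/= IH; clear; lia.
have := ler_wpM2l (_ : 0 <= n%:R^-1 ^+ 2 * (n%:R * 2)) hs.
rewrite mulr_ge0 ?sqr_ge0 ?mulr_ge0 ?ler0n// => /(_ isT).
rewrite (_ : n%:R^-1 ^+ 2 * (n%:R * 2) * (D%:R * K + n%:R * e) = 2 * (D%:R * K / n%:R + e)).
  by apply: le_trans; rewrite !mulrA.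
by field; rewrite gt_eqF.
Qed.

Lemma Rint_abs_le (f : T -> R) (e : R) : 0 < e -> l2 P f ->
  \int[P]_t `|f t| <= e + e^-1 * nrm2 P f.
Proof.
move=> e0 lf; have lC : l2 P (fun=> 1) by split => //; exact: itb_cst.
have lfn : l2 P (fun t => `|f t|).
  split; first by apply: measurableT_comp => //; exact: lf.1.
  by under [X in itb _ _ X]eq_fun do rewrite real_normK ?num_real//; exact: lf.2.
have := Rint_mul_le e0 lC lfn; rewrite /nrm2.
under eq_Rintegral do rewrite mul1r; under [\int[P]_t 1 ^+ 2]eq_Rintegral do rewrite expr1n.
rewrite Rint_cst mulr1; under [X in _ + _ * X]eq_Rintegral do rewrite real_normK ?num_real//.
by move=> /(le_trans (ler_norm _)).
Qed.

Lemma Rint_sqrB_le (f g : T -> R) (e : R) : 0 < e -> l2 P f -> l2 P g ->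
  \int[P]_t `|f t ^+ 2 - g t ^+ 2| <= (1 + e^-1) * nrm2 P (fun t => f t - g t) + e * nrm2 P f.
Proof.
move=> e0 lf lg; have lD2 := (l2B lf lg).2; have lf2 := lf.2; rewrite /nrm2 -!RintZ//.
have i1 : itb P setT (fun t => f t ^+ 2 - g t ^+ 2) by apply: itbB => //; exact: lg.2.
rewrite -RintD//; [|exact: itbZ|exact: itbZ].
apply: le_Rint => //.
- exact: (integrable_norm i1).
- by apply: itbD => //; exact: itbZ.
move=> t _; set D := f t - g t; have -> : g t = f t - D by rewrite /D; ring.
have s1 := mulr_ge0 (ltW e0) (sqr_ge0 (f t - e^-1 * D)).
have s2 := mulr_ge0 (ltW e0) (sqr_ge0 (f t + e^-1 * D)).
have E1 : e * (f t - e^-1 * D) ^+ 2 = e * f t ^+ 2 + e^-1 * D ^+ 2 - 2 * f t * D by field; rewrite gt_eqF.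
have E2 : e * (f t + e^-1 * D) ^+ 2 = e * f t ^+ 2 + e^-1 * D ^+ 2 + 2 * f t * D by field; rewrite gt_eqF.
have s3 := sqr_ge0 D; rewrite E1 in s1; rewrite E2 in s2.
by rewrite ler_norml; apply/andP; split; move: s1 s2 s3; rewrite !expr2; lra.
Qed.

End WeakLaw.

(** * Covariances of the smoothed process *)

Section SmoothedCovariance.
Context {R : realType}.
Notation mu := (@lebesgue_measure R).
Notation Ipi := `[(- pi)%R, pi%R]%classic.
Variables (d : R) (fs : R -> R) (B : R).
Hypotheses (hd : 0 < d < 2^-1) (mfs : measurable_fun setT fs) (fs0 : forall x, 0 <= fs x).
Hypotheses (fsB : forall x, fs x <= B) (cfs : {for 0, continuous fs}) (fs0_gt0 : 0 < fs 0).

Let B0 : 0 < B. Proof. exact: lt_le_trans fs0_gt0 (fsB 0). Qed.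
Let iphi : itb mu Ipi (phi d). Proof. exact: itb_phi. Qed.
Let ifden : itb mu Ipi (fden d fs). Proof. exact: (itb_fden hd mfs fs0 fsB). Qed.
Let rho0 : 0 < rho d 0. Proof. exact: rho0_gt0. Qed.
Let d0 : 0 < d. Proof. by case/andP: hd. Qed.
Let d1 : d < 2^-1. Proof. by case/andP: hd. Qed.

(* [b] is the number of smoothed arguments of the covariance. *)
Definition covS L (b : nat) := rF (fun x => bhat L x ^+ b * fden d fs x).

Lemma covS0 L : covS L 0 = cov d fs.
Proof. by rewrite /covS /cov; congr rF; apply/funext => x; rewrite mul1r. Qed.

Lemma adom_covS L b : adom (covS L b) (fun h => B * rho d h).
Proof. by apply: adom_fden_mul => //; [exact: bhat_meas|exact: bhatX_abs_le1]. Qed.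

(** The factor |1 - bhat| <= 2 L^kap |sn|^kap turns the density with exponent d into the one with
    exponent d - kap / 2, hence a faster decay of covariances at the cost of L^kap. *)
Lemma adom_covSB L b (kap : R) : 0 < kap < 2 * d ->
  adom (fun h => covS L b h - covS L b.+1 h) (fun h => 2 * B * L%:R `^ kap * rho (d - kap / 2) h).
Proof.
move=> /andP[k0 k1]; have hd' : 0 < d - kap / 2 < 2^-1 by apply/andP; split; move: d1; lra.
have ib b' : itb mu Ipi (fun x => bhat L x ^+ b' * fden d fs x) by exact: itb_bhat_mul.
rewrite /covS -rFB// -(rFZ _ (itb_phi hd')).
apply: adom_rF => [||x _]; [exact: itbB|by apply: itbZ => //; exact: itb_phi|].
rewrite -mulrBl exprS -[X in X - _]mul1r -mulrBl normrM [`|_ * _ ^+ b|]normrM -mulrA.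
have E : phi (d - kap / 2) x = `|sn x| `^ kap * phi d x.
  rewrite (_ : d - kap / 2 = - (kap / 2) + d); last by ring.
  rewrite -phi_mul; last by rewrite gt_eqF// addrC; case/andP: hd'.
  by rewrite /phi; congr (_ `^ _ * _); field.
have hk : 0 < kap <= 2 by rewrite k0/=; move: d1; lra.
rewrite E (ger0_norm (fden_ge0 _ fs0 _)) /fden.
apply: (@le_trans _ _ (2 * L%:R `^ kap * `|sn x| `^ kap * (phi d x * B))).
  apply: ler_pM => //; first by rewrite mulr_ge0// mulr_ge0 ?phi_ge0.
    exact: one_minus_bhat.
  apply: (@le_trans _ _ (phi d x * fs x)); last by rewrite ler_wpM2l ?phi_ge0.
  by rewrite ler_piMl ?mulr_ge0 ?phi_ge0// bhatX_abs_le1.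
by rewrite le_eqVlt; apply/orP; left; apply/eqP; ring.
Qed.

Lemma covS2_le L h : `|covS L 2 h| <= B * (rho d 0 / d * (L.*2.+1)%:R `^ (- (1 - 2 * d))).
Proof.
have ib : itb mu Ipi (fun x => bhat L x ^+ 2 * phi d x) by exact: itb_bhat_mul.
apply: (@le_trans _ _ (\int[mu]_(x in Ipi) (B * (bhat L x ^+ 2 * phi d x)))).
  apply: rF_abs_le => [||x _]; [exact: itb_bhat_mul|exact: itbZ|].
  rewrite ger0_norm ?(mulr_ge0 (sqr_ge0 _) (fden_ge0 _ fs0 _))// /fden [leRHS]mulrCA ler_wpM2l ?sqr_ge0//.
  by rewrite mulrC ler_wpM2r ?phi_ge0.
by rewrite RintZ// ler_wpM2l ?(ltW B0)// Rint_bhat_phi.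
Qed.

(** The part fs(0) phi has pointwise decay, and smoothing averages it over lags of size at least |h|
    - 2L. The remaining part is controlled only by its total spectral mass after smoothing, which is
    eps times the natural variance scale plus a white-noise term. *)
Lemma covS2_far (eps : R) : 0 < eps -> exists2 Ce : R, 0 <= Ce & forall L h, (L.*2 <= `|h|)%N ->
  `|covS L 2 h| <= fs 0 * (rho d 0 * (`|h| - L.*2).+1%:R `^ (- (1 - 2 * d))) +
     eps * (rho d 0 / d * (L.*2.+1)%:R `^ (- (1 - 2 * d))) + Ce * (2 * pi / (L.*2.+1)%:R).
Proof.
move=> e0; have [Ce Ce0 hC] := fden_near0 hd fs0 fsB cfs fs0_gt0 e0; exists Ce => // L h hL.
have i1 : itb mu Ipi (fun=> 1) by apply: continuous_itb => x; exact: cvg_cst.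
have ib : itb mu Ipi (fun x => bhat L x ^+ 2 * phi d x) by exact: itb_bhat_mul.
have ib1 : itb mu Ipi (fun x => bhat L x ^+ 2 * 1) by exact: itb_bhat_mul.
have ibf : itb mu Ipi (fun x => bhat L x ^+ 2 * fden d fs x) by exact: itb_bhat_mul.
have -> : covS L 2 h = fs 0 * rF (fun x => bhat L x ^+ 2 * phi d x) h +
    rF (fun x => bhat L x ^+ 2 * fden d fs x - fs 0 * (bhat L x ^+ 2 * phi d x)) h.
  by rewrite rFB ?rFZ//; [rewrite subrKC|exact: itbZ].
rewrite (le_trans (ler_normD _ _))// -addrA lerD//.
  rewrite normrM (ger0_norm (ltW fs0_gt0)) ler_wpM2l ?(ltW fs0_gt0)//.
  apply: avgw_conv_le => // k l; rewrite (le_trans (rho_abs_le _ hd))// ler_wpM2l ?(ltW rho0)//.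
  apply: le_powRN => //; first by move: d1; lra.
  by rewrite ler_nat /off; move: hL (ltn_ord k) (ltn_ord l); clear; lia.
apply: (@le_trans _ _ (\int[mu]_(x in Ipi) (eps * (bhat L x ^+ 2 * phi d x) + Ce * (bhat L x ^+ 2 * 1)))).
  apply: rF_abs_le => [||x xI].
  - by apply: itbB => //; exact: itbZ.
  - by apply: itbD => //; exact: itbZ.
  rewrite (_ : _ - _ = bhat L x ^+ 2 * (fden d fs x - fs 0 * phi d x)); last by ring.
  rewrite normrM (ger0_norm (sqr_ge0 _)) (le_trans (ler_wpM2l (sqr_ge0 _) (hC x xI)))//.
  by rewrite le_eqVlt; apply/orP; left; apply/eqP; ring.
rewrite RintD//; [|exact: itbZ|exact: itbZ].
by rewrite !RintZ// lerD// ler_wpM2l ?(ltW e0)// ?Rint_bhat_phi ?Rint_bhat_sqr.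
Qed.

Variables (m w : nat -> nat) (a : nat -> nat -> R) (C : R) (q0 : nat).
Let gg := q0%:R * (1 - 2 * d).
Let de := (1 - gg) / 2.
Hypotheses (C1 : 1 <= C) (q00 : (0 < q0)%N) (gg1 : gg < 1).
Hypothesis mC : forall j, (m j)%:R <= C * 2 ^+ j.
Hypothesis aC : forall j (i : 'I_(m j)), `|a j i| <= C * (2 ^+ j) `^ (gg / 2 - 1).

(** The combination k0 - 2 k1 + k2 is the kernel of the variance of an original minus a smoothed
    Hermite sum. Each difference costs L^de and improves the decay to u^(-(gg + de)), whose form is
    of order 2^{-j de}. The choice kap = de is admissible: gg >= 1 - 2d gives de <= d, and gg + de <
    1. *)
Lemma smoothing_kernel_le : exists2 K : R, 0 <= K & forall L j k,
  qf (fun i : 'I_(m j) => a j i) (@tpos m w j k)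
    (fun h => (covS L 0 h ^+ q0 - covS L 1 h ^+ q0) - (covS L 1 h ^+ q0 - covS L 2 h ^+ q0))
  <= K * (L%:R / 2 ^+ j) `^ de.
Proof.
have a1 : 0 < 1 - 2 * d by move: d1; lra.
have gg0 : 0 < gg by rewrite mulr_gt0// ltr0n.
have gga : 1 - 2 * d <= gg by rewrite ler_peMl ?(ltW a1)// ler1n.
have de0 : 0 < de by rewrite /de; move: gg1; lra.
have hde : 0 < de < 2 * d by rewrite de0 /de/=; move: gga d0; lra.
have g' : 0 <= gg + de < 1 by apply/andP; split; move: gg0 de0 gg1; rewrite /de; lra.
have hd' : 0 < d - de / 2 < 2^-1 by apply/andP; split; move: hde d1 => /andP[? ?]; lra.
pose r' := rho (d - de / 2) 0; have r'0 : 0 < r' by exact: rho0_gt0.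
pose D := q0%:R * (2 * B) * B ^+ q0.-1 * r' * rho d 0 ^+ q0.-1.
have D0 : 0 <= D.
  apply: mulr_ge0; last exact: exprn_ge0 _ (ltW rho0).
  apply: mulr_ge0; last exact: ltW.
  apply: mulr_ge0; last exact: exprn_ge0 _ (ltW B0).
  exact: mulr_ge0 (ler0n _ _) (mulr_ge0 (ler0n _ 2) (ltW B0)).
exists (2 * D * (2 * C ^+ 4 / (1 - (gg + de)))).
  apply: mulr_ge0; first exact: mulr_ge0 (ler0n _ 2) D0.
  apply: divr_ge0; first exact: mulr_ge0 (ler0n _ 2) (exprn_ge0 _ (le_trans ler01 C1)).
  by rewrite subr_ge0 ltW//; case/andP: g'.
move=> L j k; pose Lk := L%:R `^ de : R.
have one b : `|qf (fun i : 'I_(m j) => a j i) (@tpos m w j k) (fun h => covS L b h ^+ q0 - covS L b.+1 h ^+ q0)| <=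
    Lk * (D * (2 * C ^+ 4 / (1 - (gg + de)) * (2 ^+ j) `^ (gg - (gg + de)))).
  rewrite (le_trans (adom_qf _ _ (adom_exprB q0 (adom_covS L b) (adom_covS L b.+1) (adom_covSB L b hde))))//.
  rewrite (le_trans (ler_norm _))//.
  apply: le_trans (_ : Lk * (D * tz m a j (fun u => u.+1%:R `^ (- (gg + de)))) <= _); last first.
    by rewrite ler_wpM2l ?powR_ge0// ler_wpM2l// (tz_pow_le C1 mC aC).
  rewrite -!tzZ; apply: qfa_le => h.
  have h1 := rho_abs_le h hd'; have h2 := rho_abs_le h hd; rewrite -/r' in h1.
  set u := `|h|%N.+1%:R in h1 h2 *.
  have u0 : 0 < u :> R by [].
  have A0 : 0 <= 2 * B * L%:R `^ de by exact: mulr_ge0 (mulr_ge0 (ler0n _ 2) (ltW B0)) (powR_ge0 _ _).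
  rewrite normrM (ger0_norm (ler0n R q0)) normrM [`|_ * rho (_ - _) h|]normrM (ger0_norm A0).
  rewrite normrX [`|B * _|]normrM (ger0_norm (ltW B0)).
  apply: (@le_trans _ _ (q0%:R * ((2 * B * L%:R `^ de * (r' * u `^ (- (1 - 2 * (d - de / 2))))) *
     (B * (rho d 0 * u `^ (- (1 - 2 * d)))) ^+ q0.-1))).
    rewrite ler_wpM2l//; apply: ler_pM => //.
    - exact: mulr_ge0 A0 (normr_ge0 _).
    - exact: exprn_ge0 (mulr_ge0 (ltW B0) (normr_ge0 _)).
    - exact: ler_wpM2l.
    - by rewrite lerXn2r ?nnegrE ?mulr_ge0 ?powR_ge0 ?(ltW B0) ?(ltW rho0)// ler_wpM2l// ltW.
  have -> : u `^ (- (gg + de)) = u `^ (- (1 - 2 * (d - de / 2))) * (u `^ (- (1 - 2 * d))) ^+ q0.-1.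
    rewrite powR_exprn -powRD_gt0//; congr (_ `^ _).
    by rewrite /gg -[in LHS](prednK q00) -[q0.-1.+1%:R]natr1; field.
  rewrite le_eqVlt; apply/orP; left; apply/eqP.
  by rewrite /D /Lk !exprMn; ring.
rewrite qfB (le_trans (ler_norm _))// (le_trans (ler_normB _ _))// (le_trans (lerD (one 0%N) (one 1%N)))//.
rewrite (_ : gg - (gg + de) = - de); last by ring.
have p2 : 0 < (2 ^+ j) `^ de :> R by rewrite powR_gt0// exprn_gt0.
rewrite powRN /Lk (@powR_div _ L%:R (2 ^+ j)) ?exprn_gt0//.
move: (_ `^ de) p2 ((L%:R / 2 ^+ j) `^ de) (2 * C ^+ 4 / _) => p p0 x y.
by rewrite le_eqVlt; apply/orP; left; apply/eqP; field; rewrite gt_eqF.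
Qed.

End SmoothedCovariance.

(** * Gaussian families drawn from the process *)

Section GaussianProcess.
Context {R : realType} {dsp : measure_display} {T : measurableType dsp} (P : probability T R).
Variables (X : int -> T -> R) (r : int -> R) (gX : centered_gaussian_process P X r).

Lemma gauss_comb (J : finType) (s : J -> int) (b : J -> R) :
  gvar P (fun t => \sum_p b p * X (s p) t) (\sum_p \sum_p' b p * b p' * r (s p - s p')).
Proof.
have [mX hX] := gX.
have E t : \sum_p b p * X (s p) t = \sum_(i < #|J|) b (enum_val i) * X (s (enum_val i)) t.
  by rewrite -(big_enum_val (A := J) (fun p => b p * X (s p) t)).
have Ev : \sum_p \sum_p' b p * b p' * r (s p - s p') =
   \sum_(i < #|J|) \sum_(l < #|J|) b (enum_val i) * b (enum_val l) * r (s (enum_val i) - s (enum_val l)).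
  rewrite -(big_enum_val (A := J) (fun p => \sum_(l < #|J|) b p * b (enum_val l) * r (s p - s (enum_val l)))).
  apply: eq_bigr => p _; by rewrite -(big_enum_val (A := J) (fun p' => b p * b p' * r (s p - s p'))).
rewrite Ev; split.
- under eq_fun do rewrite E; apply: measurable_sum => i; exact: measurable_funM.
- move=> u; have [h _] := hX #|J| (fun i => s (enum_val i)) (fun i => b (enum_val i)) u.
  by under eq_Rintegral do rewrite E; rewrite /Rintegral h.
- move=> u; have [_ h] := hX #|J| (fun i => s (enum_val i)) (fun i => b (enum_val i)) u.
  by under eq_Rintegral do rewrite E; rewrite /Rintegral h.
Qed.

Definition smX L (b : bool) (s : int) (t : T) := \sum_k @avgw R L b k * X (s + off k) t.

Lemma smX_false L s : smX L false s = X s.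
Proof.
apply/funext => t; have hL : (L < L.*2.+1)%N by lia.
rewrite /smX (bigD1 (Ordinal hL))//= big1 ?addr0 => [|k kL].
  by rewrite eqxx mul1r /off /= subrr addr0.
rewrite /avgw; case: eqP => [h|]; last by rewrite mul0r.
by case/eqP: kL; exact/val_inj.
Qed.

Lemma gvec_smX (F : R -> R) (I : finType) L (s : I -> int) (sg : I -> bool) :
  r = rF F -> itb (@lebesgue_measure R) `[(- pi)%R, pi%R]%classic F ->
  gvec P (fun i => smX L (sg i) (s i)) (fun i j => rF (fun x => bhat L x ^+ (sg i + sg j) * F x) (s i - s j)).
Proof.
move=> rE iF; split => [i j|a]; first by rewrite addnC -opprB rF_even.
have := @gauss_comb (I * 'I_(L.*2.+1))%type (fun p => s p.1 + off p.2) (fun p => a p.1 * avgw (sg p.1) p.2).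
rewrite (_ : (fun t => _) = (fun t => \sum_i a i * smX L (sg i) (s i) t)); last first.
  apply/funext => t; rewrite -(pair_bigA _ (fun i k => a i * avgw (sg i) k * X (s i + off k) t))/=.
  by apply: eq_bigr => i _; rewrite mulr_sumr; apply: eq_bigr => k _; rewrite mulrA.
rewrite (_ : \sum_p _ = \sum_i \sum_j a i * a j * rF (fun x => bhat L x ^+ (sg i + sg j) * F x) (s i - s j))//.
transitivity (\sum_i \sum_(k < L.*2.+1) \sum_j \sum_(l < L.*2.+1)
    a i * avgw (sg i) k * (a j * avgw (sg j) l) * r (s i + off k - (s j + off l))).
  rewrite [RHS]pair_bigA /=; apply: eq_bigr => p _; rewrite [RHS]pair_bigA /=.
  by apply: eq_bigr => p' _.
apply: eq_bigr => i _; rewrite exchange_big; apply: eq_bigr => j _ /=.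
rewrite -avgw_conv// mulr_sumr; apply: eq_bigr => k _; rewrite mulr_sumr.
apply: eq_bigr => l _; rewrite rE (_ : s i + off k - (s j + off l) = s i - s j + off k - off l); last by ring.
by ring.
Qed.

End GaussianProcess.

Section HermiteComb.
Context {R : realType} {dsp : measure_display} {T : measurableType dsp} (P : probability T R).

Lemma hv_comb_nrm2 (I : finType) (L : I -> T -> R) (c : I -> I -> R) (q : nat) (a : I -> R) :
  gvec P L c ->
  l2 P (fun t => \sum_i a i * hv (c i i) q (L i t)) /\
  nrm2 P (fun t => \sum_i a i * hv (c i i) q (L i t)) =
  q`!%:R * \sum_i \sum_j a i * a j * c i j ^+ q.
Proof.
move=> gL.
have lh i : l2 P (fun t => hv (c i i) q (L i t)) by have [] := pspan_l2 gL (pspan_hv L c i q).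
split; first by apply: l2_sum => i _; exact: l2Z.
rewrite (@nrm2_gram _ _ _ P _ _ (fun i t => a i * hv (c i i) q (L i t))); last by move=> i; exact: l2Z.
rewrite mulr_sumr; apply: eq_bigr => i _; rewrite mulr_sumr; apply: eq_bigr => j _.
under eq_Rintegral do rewrite mulrACA.
by rewrite RintZ//; [rewrite (Rint_hv2 gL) eqxx mul1r mulrCA|exact: l2_mul].
Qed.

End HermiteComb.

(** * Reduction to the smoothed rank-q0 term and its decorrelation *)

Section LawOfLargeNumbers.
Context {R : realType} {dsp : measure_display} {T : measurableType dsp} (P : probability T R).
Notation mu := (@lebesgue_measure R).
Notation Ipi := `[(- pi)%R, pi%R]%classic.
Notation gam := (normal_prob (0 : R) 1).
Variables (d : R) (fs : R -> R) (B : R).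
Hypotheses (hd : 0 < d < 2^-1) (mfs : measurable_fun setT fs) (fs0 : forall x, 0 <= fs x).
Hypotheses (fsB : forall x, fs x <= B) (cfs : {for 0, continuous fs}) (fs0_gt0 : 0 < fs 0).
Variables (m w : nat -> nat) (a : nat -> nat -> R) (C : R) (q0 : nat).
Let a1 := 1 - 2 * d.
Let gg := q0%:R * a1.
Let de := (1 - gg) / 2.
Hypotheses (C1 : 1 <= C) (q00 : (0 < q0)%N) (gg1 : gg < 1).
Hypothesis mC : forall j, (m j)%:R <= C * 2 ^+ j.
Hypothesis aC : forall j (i : 'I_(m j)), `|a j i| <= C * (2 ^+ j) `^ (gg / 2 - 1).
Variable X : int -> T -> R.
Hypotheses (gX : centered_gaussian_process P X (cov d fs)) (cov1 : cov d fs 0 = 1).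

Notation tp j k := (@tpos m w j k).
Notation qfa j k kap := (qf (fun i : 'I_(m j) => a j i) (tp j k) kap).
Let B0 : 0 < B. Proof. exact: lt_le_trans fs0_gt0 (fsB 0). Qed.
Let ifden : itb mu Ipi (fden d fs). Proof. exact: (itb_fden hd mfs fs0 fsB). Qed.
Let rho0 : 0 < rho d 0. Proof. exact: rho0_gt0. Qed.
Let d0 : 0 < d. Proof. by case/andP: hd. Qed.
Let d1 : d < 2^-1. Proof. by case/andP: hd. Qed.
Let a1_gt0 : 0 < a1. Proof. by rewrite /a1; move: d1; lra. Qed.
Let gg0 : 0 < gg. Proof. by rewrite mulr_gt0// ltr0n. Qed.
Let C0 : 0 < C. Proof. exact: lt_le_trans ltr01 C1. Qed.

Lemma gvec_X (I : finType) (s : I -> int) :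
  gvec P (fun i => X (s i)) (fun i j => cov d fs (s i - s j)).
Proof.
have := gvec_smX gX 0 s (fun=> false) erefl ifden.
rewrite (_ : (fun i => _) = (fun i => X (s i))); last by apply/funext => i; rewrite smX_false.
rewrite (_ : (fun i j => _) = (fun i j => cov d fs (s i - s j)))//.
by apply/funext => i; apply/funext => j; rewrite -(covS0 d fs 0).
Qed.

Definition Wm j k t : R := \sum_(i < m j) a j i * hermite q0 (X (tp j k i) t).

Lemma Wm_nrm2 j k : l2 P (Wm j k) /\
  nrm2 P (Wm j k) = q0`!%:R * qfa j 0 (fun h => cov d fs h ^+ q0).
Proof.
have := hv_comb_nrm2 q0 (fun i : 'I_(m j) => a j i) (gvec_X (tp j k)).
rewrite (_ : (fun t => _) = Wm j k); last first.
  by apply/funext => t; apply: eq_bigr => i _; rewrite subrr cov1 hv_hermite.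
by rewrite -(qfa_stat m w a j k).
Qed.

Definition smv L := covS d fs L 2 0.
(** The Wick power is taken at the smoothed variance, so that covariances are again pure q0-th
    powers of the covariances of the underlying field. *)
Definition Ws L j k t : R := \sum_(i < m j) a j i * hv (smv L) q0 (smX X L true (tp j k i) t).

Lemma smoothing_error : exists2 K : R, 0 <= K & forall L j k, l2 P (Ws L j k) /\
  nrm2 P (fun t => Wm j k t - Ws L j k t) <= K * (L%:R / 2 ^+ j) `^ de.
Proof.
have [K K0 hK] := smoothing_kernel_le hd mfs fs0 fsB fs0_gt0 w C1 q00 gg1 mC aC.
exists (q0`!%:R * K); first by rewrite mulr_ge0.
move=> L j k.
have g2 := gvec_smX gX L (fun p : 'I_(m j) * bool => tp j k p.1) (fun p => p.2) erefl ifden.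
split.
  have := (hv_comb_nrm2 q0 (fun i : 'I_(m j) => a j i) (gvec_smX gX L (tp j k) (fun=> true) erefl ifden)).1.
  rewrite (_ : (fun t => _) = Ws L j k)//.
  by apply/funext => t; apply: eq_bigr => i _; rewrite subrr.
(* The difference of the two sums is one sum over the index set doubled by the smoothing flag, with
   sign - 1 on the smoothed copy. *)
have := (hv_comb_nrm2 q0 (fun p : 'I_(m j) * bool => a j p.1 * (-1) ^+ p.2) g2).2.
rewrite (_ : (fun t => _) = (fun t => Wm j k t - Ws L j k t)); last first.
  apply/funext => t; rewrite -(pair_bigA _ (fun (i : 'I_(m j)) (b : bool) => a j i * (-1) ^+ b *
     hv (covS d fs L (b + b) (tp j k i - tp j k i)) q0 (smX X L b (tp j k i) t)))/= -sumrB.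
  apply: eq_bigr => i _; rewrite big_bool/= smX_false subrr covS0 cov1 hv_hermite /smv.
  by rewrite expr1 expr0; ring.
move=> ->; rewrite -mulrA ler_wpM2l//; apply: le_trans (hK L j k).
rewrite le_eqVlt; apply/orP; left; apply/eqP.
rewrite -(pair_bigA _ (fun (i : 'I_(m j)) (b : bool) => \sum_(p : 'I_(m j) * bool)
   a j i * (-1) ^+ b * (a j p.1 * (-1) ^+ p.2) * covS d fs L (b + p.2) (tp j k i - tp j k p.1) ^+ q0))/=.
apply: eq_bigr => i _; rewrite big_bool/=.
rewrite -!(pair_bigA _ (fun (l : 'I_(m j)) (b' : bool) =>
   a j i * (-1) ^+ _ * (a j l * (-1) ^+ b') * covS d fs L (_ + b') (tp j k i - tp j k l) ^+ q0))/=.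
rewrite -big_split/=; apply: eq_bigr => l _; rewrite !big_bool/= !expr1 !expr0.
by ring.
Qed.

Section Rest.
Variables (G : R -> R) (cf : nat -> R).
Hypotheses (lG : l2 gam G) (cfE : forall q, cf q = \int[gam]_x (G x * hermite q x)).
Hypothesis cfdec : forall lam : R, 0 < lam -> exists C : R, forall q,
  `|cf q| <= C * Num.sqrt q`!%:R * expR (- (lam * q%:R)).
Hypothesis cf_rank : forall q, (q < q0)%N -> cf q = 0.

Definition W0 j k t : R := \sum_(i < m j) a j i * G (X (tp j k i) t).
Definition b0 := cf q0 / q0`!%:R.

Lemma W0_l2 j k : l2 P (W0 j k).
Proof.
apply: l2_sum => i _; apply: l2Z.
by apply: (gvec_l2 (gvec_X (tp j k)) _ i lG).1 => l; rewrite subrr.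
Qed.

Lemma rest_error : exists2 tau : nat -> R, tau @ \oo --> 0 &
  forall j k, nrm2 P (fun t => W0 j k t - b0 * Wm j k t) <= tau j.
Proof.
have [tau tau0 htau] := cov_rest_le hd mfs fs0 fsB fs0_gt0 w C1 q00 gg1 mC aC.
(* Since z^2 exceeds B rho_d(0), a geometric bound on |c_q| / sqrt(q!) against z^q absorbs the
   constants (B rho_d(0))^q. *)
pose z := 1 + B * rho d 0; have br0 : 0 < B * rho d 0 by rewrite mulr_gt0.
have z0 : 0 < z by rewrite /z addr_gt0.
have [K [K0 hK]] := cf_geometric cfdec z0.
exists (fun j => 2 * (K ^+ 2 * 2 * `|tau j|)).
  apply: cvg_to_eq (_ : _ --> 2 * (K ^+ 2 * 2 * `|0|)) _; last by rewrite normr0 !mulr0.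
  apply: cvgM; first exact: cvg_cst.
  apply: cvgM; first exact: cvg_cst.
  exact: cvg_norm.
move=> j k.
rewrite (_ : (fun t => _) = (fun t => \sum_(i < m j) a j i * (G (X (tp j k i) t) - cf q0 / q0`!%:R * hermite q0 (X (tp j k i) t)))); last first.
  apply/funext => t; rewrite /W0 /Wm mulr_sumr -sumrB; apply: eq_bigr => i _; rewrite /b0; ring.
apply: (hermite_rest_le lG cfE cfdec (gvec_X (tp j k))) => [i|Q]; first by rewrite subrr.
apply: (@le_trans _ _ (\sum_(q < Q) K ^+ 2 * `|tau j| * 2^-1 ^+ q)); last first.
  rewrite -mulr_sumr [K ^+ 2 * 2 * _]mulrAC ler_wpM2l//.
    by rewrite mulr_ge0// sqr_ge0.
  have := @geometric_sum_le R 0 Q; rewrite add0n expr0 mulr1.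
  by rewrite (big_mkord xpredT (fun q => (2^-1 : R) ^+ q)).
apply: ler_sum => q _.
have rhs0 : 0 <= K ^+ 2 * `|tau j| * 2^-1 ^+ q by rewrite !mulr_ge0 ?sqr_ge0 ?exprn_ge0 ?invr_ge0.
case: (ltngtP q q0) => [h|h|qE]; last by rewrite !mul0r.
  by rewrite cf_rank// expr0n/= mul0r mulr0 mul0r.
rewrite mul1r; have hq := htau _ j k h.
have f0 : 0 <= cf q ^+ 2 / q`!%:R by rewrite divr_ge0 ?sqr_ge0.
apply: (@le_trans _ _ (cf q ^+ 2 / q`!%:R * ((B * rho d 0) ^+ q * `|tau j|))).
  rewrite ler_wpM2l// (le_trans (ler_norm _))// (le_trans hq)// ler_wpM2l ?ler_norm//.
  by rewrite exprn_ge0// ltW.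
rewrite [leLHS]mulrA [leRHS]mulrAC ler_wpM2r//.
have E : (q`!%:R : R) = Num.sqrt q`!%:R ^+ 2 by rewrite sqr_sqrtr.
apply: (@le_trans _ _ ((`|cf q| / Num.sqrt q`!%:R * z ^+ q) ^+ 2)).
  rewrite [leRHS]exprMn [(_ / _) ^+ 2]exprMn real_normK ?num_real// exprVn -E -exprM mulnC exprM ler_wpM2l//.
  rewrite lerXn2r ?nnegrE ?sqr_ge0 ?(ltW br0)//.
  by rewrite /z sqrrD expr1n; have := sqr_ge0 (B * rho d 0); move: br0; rewrite !expr2; lra.
apply: (@le_trans _ _ ((K * 2^-1 ^+ q) ^+ 2)).
  rewrite lerXn2r ?nnegrE ?mulr_ge0 ?exprn_ge0 ?invr_ge0 ?sqrtr_ge0 ?(ltW z0)//.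
rewrite exprMn ler_wpM2l ?sqr_ge0// -exprM muln2 -addnn exprD ler_piMl ?exprn_ge0 ?invr_ge0//.
by rewrite exprn_ile1// ?invr_ge0// invf_le1// ler1n.
Qed.

End Rest.

Definition covW L j k k' := \int[P]_t (Ws L j k t ^+ 2 * Ws L j k' t ^+ 2) -
  \int[P]_t (Ws L j k t ^+ 2) * \int[P]_t (Ws L j k' t ^+ 2).

(** With n = 2L + 1, scaling the smoothed variables by n^(a1/2) brings their covariances to order
    one, where the decorrelation bound applies. Undoing the scaling gives n^(-2 gg), the weights
    give 2^{2 j gg}, and only the ratio 2^j / n is left. *)
Lemma covW_le L j k k' (Bn e : R) : 1 <= Bn -> 0 <= e <= Bn ->
  (forall h, (L.*2.+1)%:R `^ a1 * `|covS d fs L 2 h| <= Bn) ->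
  (forall i l, (L.*2.+1)%:R `^ a1 * `|covS d fs L 2 (tp j k i - tp j k' l)| <= e) ->
  itb P setT (fun t => Ws L j k t ^+ 2 * Ws L j k' t ^+ 2) /\
  `|covW L j k k'| <= C ^+ 8 * (2 ^+ j / (L.*2.+1)%:R) `^ (2 * gg) *
    ((2 * q0)%:R * ((4 * q0)%:R * Bn) ^+ (2 * q0) * ((4 * q0)%:R * Bn) ^+ (4 * q0) * e).
Proof.
move=> Bn1 /andP[e0 eB] hB he.
set n := (L.*2.+1)%:R : R; have n0 : 0 < n by rewrite ltr0n.
pose s := n `^ (a1 / 2); have s0 : 0 < s by exact: powR_gt0.
have s2 : s ^+ 2 = n `^ a1 by rewrite powR_exprn divfK.
pose ps (p : 'I_(m j) * bool) := tp j (if p.2 then k' else k) p.1.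
have g1 := gvec_scale s (gvec_smX gX L ps (fun=> true) erefl ifden).
set c := (fun i j => s ^+ 2 * _) in g1.
have cE p p' : c p p' = n `^ a1 * covS d fs L 2 (ps p - ps p') by rewrite /c s2.
have cB p p' : `|c p p'| <= Bn by rewrite cE normrM ger0_norm ?powR_ge0.
pose u (i : 'I_(m j)) := (i, false); pose v (i : 'I_(m j)) := (i, true).
have cuv i l : `|c (u i) (v l)| <= e by rewrite cE normrM ger0_norm ?powR_ge0//; exact: he.
pose K := (2 * q0)%:R * ((4 * q0)%:R * Bn) ^+ (2 * q0) * ((4 * q0)%:R * Bn) ^+ (4 * q0) * e.
have [|iU iV iUV hUV] := @wick_square_cov _ _ _ P _ _ c (m j) q0 (fun i => a j i) u v K g1.
  move=> i1 i2 i3 i4.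
  apply: (wick4_decorrelation g1 Bn1 cB) => //; first by rewrite muln_gt0.
  - by rewrite mul2n addnn.
  - by rewrite !addnn -!mul2n; move: q0; clear; lia.
pose S := n `^ a1 ^+ q0; have S0 : 0 < S by rewrite exprn_gt0// powR_gt0.
have EW kk (b : bool) t : (if b then k' else k) = kk ->
    (\sum_(i < m j) a j i * hv (c (i, b) (i, b)) q0 (s * smX X L true (ps (i, b)) t)) ^+ 2 = S * Ws L j kk t ^+ 2.
  move=> hkk; rewrite /S -s2 -exprM mulnC exprM -exprMn; congr (_ ^+ 2).
  rewrite /Ws mulr_sumr; apply: eq_bigr => i _.
  rewrite /c subrr -/(covS d fs L 2) -/(smv L) hv_scale /ps /= hkk.
  by rewrite mulrCA.
have EU t := EW k false t erefl; have EV t := EW k' true t erefl.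
have eU : \int[P]_t (Ws L j k t ^+ 2) = S^-1 * \int[P]_t ((\sum_(i < m j) a j i * hv (c (u i) (u i)) q0 (s * smX X L true (ps (u i)) t)) ^+ 2).
  by rewrite -RintZ//; apply: eq_Rintegral => t _; rewrite EU mulKf// gt_eqF.
have eV : \int[P]_t (Ws L j k' t ^+ 2) = S^-1 * \int[P]_t ((\sum_(i < m j) a j i * hv (c (v i) (v i)) q0 (s * smX X L true (ps (v i)) t)) ^+ 2).
  by rewrite -RintZ//; apply: eq_Rintegral => t _; rewrite EV mulKf// gt_eqF.
have eUVt t : Ws L j k t ^+ 2 * Ws L j k' t ^+ 2 = S^-1 ^+ 2 *
   ((\sum_(i < m j) a j i * hv (c (u i) (u i)) q0 (s * smX X L true (ps (u i)) t)) ^+ 2 *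
    (\sum_(i < m j) a j i * hv (c (v i) (v i)) q0 (s * smX X L true (ps (v i)) t)) ^+ 2).
  by rewrite EU EV; field; rewrite gt_eqF.
split; first by under [X in itb _ _ X]eq_fun do rewrite eUVt; exact: itbZ.
rewrite /covW eU eV; under eq_Rintegral do rewrite eUVt.
rewrite RintZ// mulrACA -expr2 -mulrBr normrM ger0_norm ?exprn_ge0 ?invr_ge0 ?(ltW S0)//.
apply: (le_trans (ler_wpM2l _ hUV)); first by rewrite exprn_ge0 ?invr_ge0 ?(ltW S0).
have K0 : 0 <= K.
  have M0 : 0 <= (4 * q0)%:R * Bn by exact: mulr_ge0 (ler0n _ _) (le_trans ler01 Bn1).
  by apply: mulr_ge0 => //; apply: mulr_ge0; [apply: mulr_ge0 => //|]; exact: exprn_ge0.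
rewrite [leLHS]mulrA -/K ler_wpM2r//.
have hw := abs_weights_le C1 mC aC j.
apply: (@le_trans _ _ (S^-1 ^+ 2 * (C ^+ 2 * (2 ^+ j) `^ (gg / 2)) ^+ 4)).
  rewrite ler_wpM2l ?exprn_ge0 ?invr_ge0 ?(ltW S0)// lerXn2r ?nnegrE ?sumr_ge0//.
  by rewrite mulr_ge0 ?powR_ge0// exprn_ge0// ltW.
have ES : S ^+ 2 = n `^ (2 * gg) by rewrite /S -exprM powR_exprn /gg natrM; congr (_ `^ _); ring.
have EP : ((2 ^+ j) `^ (gg / 2)) ^+ 4 = (2 ^+ j / n) `^ (2 * gg) * n `^ (2 * gg) :> R.
  by rewrite powR_exprn -powR_div ?exprn_ge0//; congr (_ `^ _); field.
rewrite exprVn ES exprMn EP -exprM -powRN; have p0 : n `^ (2 * gg) != 0 by rewrite gt_eqF// powR_gt0.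
rewrite powRN le_eqVlt; apply/orP; left; apply/eqP; field; exact: p0.
Qed.

(** With half-width 2^(j-l) the ratio of 2^j to the window length is at most 2^l, so that for fixed
    l all bounds are uniform in j. *)
Lemma Ws_decorrelation (l : nat) : exists2 K : R, 0 <= K &
  (forall j, (l <= j)%N -> forall k k', itb P setT (fun t => Ws (2 ^ (j - l)) j k t ^+ 2 * Ws (2 ^ (j - l)) j k' t ^+ 2)
     /\ `|covW (2 ^ (j - l)) j k k'| <= K) /\
  (forall e : R, 0 < e -> exists D J : nat, forall j, (J <= j)%N -> forall k k',
    (D <= `|k - k'|)%N -> `|covW (2 ^ (j - l)) j k k'| <= e).
Proof.
pose Bn := 1 + B * (rho d 0 / d).
have Bn1 : 1 <= Bn by rewrite lerDl mulr_ge0 ?divr_ge0 ?(ltW B0) ?(ltW d0) ?(ltW rho0).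
have hB L h : (L.*2.+1)%:R `^ a1 * `|covS d fs L 2 h| <= Bn.
  have n0 : 0 < (L.*2.+1)%:R `^ a1 :> R by rewrite powR_gt0.
  rewrite mulrC -ler_pdivlMr// (le_trans (covS2_le hd mfs fs0 fsB fs0_gt0 L h))//.
  rewrite -/a1 powRN mulrA ler_wpM2r ?invr_ge0 ?(ltW n0)// /Bn; lra.
pose M := (2 * q0)%:R * ((4 * q0)%:R * Bn) ^+ (2 * q0) * ((4 * q0)%:R * Bn) ^+ (4 * q0).
have M0 : 0 <= M.
  have h : 0 <= (4 * q0)%:R * Bn by exact: mulr_ge0 (ler0n _ _) (le_trans ler01 Bn1).
  by apply: mulr_ge0; [apply: mulr_ge0 => //|]; exact: exprn_ge0.
pose C2 := C ^+ 8 * (2 ^+ l) `^ (2 * gg).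
have C20 : 0 <= C2 by rewrite mulr_ge0 ?powR_ge0// exprn_ge0// ltW.
have Lge j : (l <= j)%N -> 2 ^+ j <= 2 ^+ l * (2 ^ (j - l)).*2.+1%:R :> R.
  move=> lj; rewrite -{1}(subnKC lj) exprD ler_wpM2l ?exprn_ge0// -natrX ler_nat.
  by rewrite -addnn; move: (2 ^ _)%N; clear; lia.
have key j k k' e : (l <= j)%N -> 0 <= e <= Bn ->
    (forall i i', ((2 ^ (j - l)).*2.+1)%:R `^ a1 * `|covS d fs (2 ^ (j - l)) 2 (tp j k i - tp j k' i')| <= e) ->
    itb P setT (fun t => Ws (2 ^ (j - l)) j k t ^+ 2 * Ws (2 ^ (j - l)) j k' t ^+ 2) /\
    `|covW (2 ^ (j - l)) j k k'| <= C2 * (M * e).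
  move=> lj he h; have [i1 h1] := covW_le Bn1 he (hB _) h; split => //.
  have ee0 : 0 <= e by case/andP: he.
  rewrite (le_trans h1)// -/M ler_wpM2r ?(mulr_ge0 M0)//.
  rewrite /C2 ler_wpM2l ?exprn_ge0 ?(ltW C0)//.
  apply: ge0_ler_powR; rewrite ?nnegrE ?divr_ge0 ?exprn_ge0//; first by rewrite mulr_ge0// ltW.
  by rewrite ler_pdivrMr// Lge.
exists (C2 * (M * Bn)); first exact: mulr_ge0 C20 (mulr_ge0 M0 (le_trans ler01 Bn1)).
split.
  by move=> j lj k k'; apply: key => //; rewrite lexx (le_trans ler01 Bn1).
move=> e e0.
(* The minimum meets the requirement of [key] that the level be at most [Bn]. *)
pose e1 := Num.min Bn (e / (C2 * M + 1)).
have CM1 : 0 < C2 * M + 1 by rewrite ltr_wpDl// mulr_ge0.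
have e10 : 0 < e1 by rewrite lt_min divr_gt0// (lt_le_trans ltr01 Bn1).
have CMe : C2 * (M * e1) <= e.
  rewrite mulrA (@le_trans _ _ ((C2 * M + 1) * e1))//; first by rewrite ler_wpM2r ?(ltW e10)// lerDl.
  by rewrite mulrC -ler_pdivlMr// ge_min lexx orbT.
have e30 : 0 < e1 / 3 / (rho d 0 / d) by rewrite !divr_gt0.
have [Ce Ce0 hfar] := covS2_far hd mfs fs0 fsB cfs fs0_gt0 e30.
pose F := fs 0 * rho d 0; have F0 : 0 < F by rewrite mulr_gt0.
(* ratio beyond which the long-memory part is below [e1 / 3] *)
pose De := (e1 / 3 / F) `^ (- a1^-1); have De0 : 0 < De by rewrite powR_gt0// !divr_gt0.
have cv : Ce * (2 * pi) * n.+1%:R `^ (- (1 - a1)) @[n --> \oo] --> 0.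
  apply: cvg_to_eq (_ : _ --> Ce * (2 * pi) * 0) _; last by rewrite mulr0.
  by apply: cvgM; [exact: cvg_cst|apply: cvg_powRN0; rewrite /a1; move: d0; lra].
have /cvgr0Pnorm_le/(_ (e1 / 3)) := cv; rewrite divr_gt0// => /(_ isT) [J1 _ hJ1].
(* At this lag the blocks are (C + 2 + 3 De) 2^j apart: C 2^j covers the filter length, 2 the two
   half-windows of length at most 2^j, and 3 De the required multiple of the window length, which is
   at most 3 times 2^j. *)
pose D := (Num.bound (C + 2 + 3 * De)).+1.
exists D, (l + J1)%N => j jJ k k' kk.
have lj : (l <= j)%N by apply: leq_trans jJ; rewrite leq_addr.
apply: le_trans CMe; apply: (key j k k' e1 lj _ _).2.
  by rewrite (ltW e10) ge_min lexx.
move=> i i'; set L := (2 ^ (j - l))%N; set n := (L.*2.+1)%:R : R.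
have n0 : 0 < n by rewrite ltr0n.
have na : 0 < n `^ a1 by exact: powR_gt0.
set h := tp j k i - tp j k' i'.
have L1 : (1 <= L)%N by rewrite expn_gt0.
have Lj : (L <= 2 ^ j)%N by rewrite leq_exp2l// leq_subr.
have hh : (2 ^ j * `|k - k'| <= `|h| + m j)%N.
  rewrite /h /tpos; move: (ltn_ord i) (ltn_ord i'); set p := (2 ^ j)%N.
  rewrite (_ : p%:Z * k - (i%:Z - (w j)%:Z) - (p%:Z * k' - (i'%:Z - (w j)%:Z)) = p%:Z * (k - k') + (i'%:Z - i%:Z)); last by ring.
  rewrite -[X in (X * _)%N]absz_nat -abszM; move: (p%:Z * (k - k')) => x; clear; lia.
have bigD : (C + 2 + 3 * De) * 2 ^+ j <= (`|h| + m j)%:R.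
  apply: (@le_trans _ _ ((2 ^ j * `|k - k'|)%N%:R)); last by rewrite ler_nat.
  rewrite natrM natrX mulrC ler_wpM2l ?exprn_ge0//.
  apply: (@le_trans _ _ D%:R); last by rewrite ler_nat.
  have pos : 0 <= C + 2 + 3 * De by move: C0 De0; lra.
  have := archi_boundP pos; rewrite /D -natr1; lra.
have bigh : (2 + 3 * De) * 2 ^+ j <= `|h|%N%:R.
  by move: bigD (mC j); rewrite natrD; lra.
have Lr : L%:R <= 2 ^+ j :> R by rewrite -natrX ler_nat.
have pj : 0 < 2 ^+ j :> R by rewrite exprn_gt0.
have hL : (L.*2 <= `|h|)%N.
  rewrite -(ler_nat R) (le_trans _ bigh)// -mul2n natrM mulrDl.
  have := mulr_gt0 De0 pj; lra.
have rat : De * n <= (`|h| - L.*2).+1%:R.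
  rewrite -natr1 natrB// -mul2n natrM /n -natr1 -mul2n natrM.
  have L1r : 1 <= L%:R :> R by rewrite ler1n.
  have k1 : De * (2 * L%:R + 1) <= 3 * De * 2 ^+ j.
    rewrite [3 * De]mulrC -mulrA ler_wpM2l ?(ltW De0)//; lra.
  move: bigh; rewrite mulrDl; lra.
rewrite mulrC -ler_pdivlMr// (le_trans (hfar L h hL))// -/a1 -/n ler_pdivlMr// [leLHS]mulrDl [X in X + _ <= _]mulrDl.
rewrite [leRHS](_ : _ = e1 / 3 + e1 / 3 + e1 / 3); last by field.
rewrite lerD//; first rewrite lerD//.
- rewrite mulrA -/F -mulrA mulrC -ler_pdivlMr//.
  rewrite powRN mulrC -[leLHS]invrK invfM invrK -/n [X in X^-1]mulrC.
  have -> : (`|h| - L.*2).+1%:R `^ a1 / n `^ a1 = ((`|h| - L.*2).+1%:R / n) `^ a1 :> R.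
    by rewrite [in LHS](powR_div a1 (ler0n _ _) n0) mulfK// gt_eqF.
  rewrite -powRN; apply: (@le_trans _ _ (De `^ (- a1))).
    by apply: le_powRN; rewrite ?(ltW a1_gt0)// ler_pdivlMr.
  by rewrite /De -powRrM mulrNN mulVf ?gt_eqF// powRr1// !divr_ge0 ?(ltW e10) ?(ltW F0).
- have rd0 : rho d 0 / d != 0 by rewrite gt_eqF// divr_gt0.
  have na0 : n `^ a1 != 0 by rewrite gt_eqF.
  by rewrite powRN [X in X * _ <= _]mulrA (divfK rd0) (divfK na0).
- have -> : Ce * (2 * pi / n) * n `^ a1 = Ce * (2 * pi) * n `^ (- (1 - a1)).
    by rewrite opprB (@powRD_gt0 _ n a1 (- 1))// powRN powRr1 ?(ltW n0)//; ring.
  apply: le_trans (ler_norm _) _; apply: (hJ1 L.*2).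
  rewrite /= -addnn (leq_trans _ (leq_addr _ _))// /L.
  apply: leq_trans (ltnW (ltn_expl (j - l) (ltnSn 1))).
  by rewrite leq_subRL.
Qed.

End LawOfLargeNumbers.

(** * Convergence in L1 of the normalized empirical variances *)

Section QuadraticMeans.
Context {R : realType} {dsp : measure_display} {T : measurableType dsp} (P : probability T R).
Notation gam := (normal_prob (0 : R) 1).
Variables (d : R) (fs : R -> R) (B : R).
Hypotheses (hd : 0 < d < 2^-1) (mfs : measurable_fun setT fs) (fs0 : forall x, 0 <= fs x).
Hypotheses (fsB : forall x, fs x <= B) (cfs : {for 0, continuous fs}) (fs0_gt0 : 0 < fs 0).
Variables (m w : nat -> nat) (a : nat -> nat -> R) (C : R) (q0 : nat).
Let gg := q0%:R * (1 - 2 * d).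
Let de := (1 - gg) / 2.
Hypotheses (C1 : 1 <= C) (q00 : (0 < q0)%N) (gg1 : gg < 1).
Hypothesis mC : forall j, (m j)%:R <= C * 2 ^+ j.
Hypothesis aC : forall j (i : 'I_(m j)), `|a j i| <= C * (2 ^+ j) `^ (gg / 2 - 1).
Variable X : int -> T -> R.
Hypotheses (gX : centered_gaussian_process P X (cov d fs)) (cov1 : cov d fs 0 = 1).
Variables (G : R -> R) (cf : nat -> R).
Hypotheses (lG : l2 gam G) (cfE : forall q, cf q = \int[gam]_x (G x * hermite q x)).
Hypothesis cfdec : forall lam : R, 0 < lam -> exists C : R, forall q,
  `|cf q| <= C * Num.sqrt q`!%:R * expR (- (lam * q%:R)).
Hypotheses (cf_rank : forall q, (q < q0)%N -> cf q = 0) (cfq0 : cf q0 != 0).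
Variable V : R.
Hypotheses (V0 : 0 < V)
  (hV : qf (fun i : 'I_(m j) => a j i) (@tpos m w j 0) (rho de) @[j --> \oo] --> V).

Let Y j k := W0 m w a X G j k.

(** The order of choices matters: l is fixed by the smoothing error, which depends only on the ratio
    2^{-l}; then the decorrelation lag and the minimal scale; then the number of terms. Stationarity
    makes every estimate independent of [k0]. *)
Lemma quadratic_mean_cvg : exists2 V2 : R, 0 < V2 & forall e : R, 0 < e ->
  exists J n0 : nat, forall j n (k0 : int), (J <= j)%N -> (n0 <= n)%N ->
  itb P setT (fun t => n%:R^-1 * (\sum_(k < n) Y j (k0 + k%:Z) t ^+ 2) - V2) /\
  \int[P]_t `|n%:R^-1 * (\sum_(k < n) Y j (k0 + k%:Z) t ^+ 2) - V2| <= e.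
Proof.
have [cc cc0 hcc] := cov_main_cvg hd mfs fs0 fsB cfs fs0_gt0 C1 q00 gg1 mC aC hV.
set b := b0 q0 cf; have bn0 : b != 0.
  by rewrite /b /b0 mulf_neq0// invr_eq0 pnatr_eq0 -lt0n fact_gt0.
have b20 : 0 < b ^+ 2 by rewrite exprn_even_gt0//= bn0.
have qf0 : 0 < q0`!%:R :> R by rewrite ltr0n fact_gt0.
pose V2 := b ^+ 2 * (q0`!%:R * (cc * V)).
have V20 : 0 < V2 by exact: mulr_gt0 b20 (mulr_gt0 qf0 (mulr_gt0 cc0 V0)).
exists V2 => // e e0.
pose wm j k t := b * Wm m w a q0 X j k t.
pose ws L j k t := b * Ws d fs m w a q0 X L j k t.
have lY j k : l2 P (Y j k) by exact: (W0_l2 hd mfs fs0 fsB m w a gX cov1 lG).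
have lM j k : l2 P (Wm m w a q0 X j k) by exact: (Wm_nrm2 hd mfs fs0 fsB m w a q0 gX cov1 j k).1.
have lwm j k : l2 P (wm j k) by exact: l2Z.
have nwm j k : nrm2 P (wm j k) = b ^+ 2 * (q0`!%:R * qf (fun i : 'I_(m j) => a j i) (@tpos m w j 0) (fun h => cov d fs h ^+ q0)).
  by rewrite nrm2Z// (Wm_nrm2 hd mfs fs0 fsB m w a q0 gX cov1 j k).2.
have hV2 : b ^+ 2 * (q0`!%:R * qf (fun i : 'I_(m j) => a j i) (@tpos m w j 0) (fun h => cov d fs h ^+ q0)) @[j --> \oo] --> V2.
  by do 2 (apply: cvgM; first exact: cvg_cst).
have [tau tau0 htau] := rest_error hd mfs fs0 fsB fs0_gt0 w C1 q00 gg1 mC aC gX cov1 lG cfE cfdec cf_rank.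
have [K K0 hK] := smoothing_error hd mfs fs0 fsB fs0_gt0 w C1 q00 gg1 mC aC gX cov1.
have lS L j k : l2 P (Ws d fs m w a q0 X L j k) by exact: (hK L j k).1.
have lws L j k : l2 P (ws L j k) by exact: l2Z.
have de0 : 0 < de by rewrite /de; move: gg1; lra.
(* The four errors will be 2, 2, 2 and 3 times [e1]. The weight [eta] keeps eta times the second
   moment below [e1] once that moment is at most V2 + 1. *)
pose e1 := e / 16; have e10 : 0 < e1 by rewrite divr_gt0.
pose eta := e1 / (V2 + 1); have V21 : 0 < V2 + 1 by rewrite addr_gt0.
have eta0 : 0 < eta by rewrite divr_gt0.
have ei0 : 0 < 1 + eta^-1 by rewrite addr_gt0// invr_gt0.
have cl : (1 + eta^-1) * (b ^+ 2 * (K * (2 `^ (- de)) ^+ l)) @[l --> \oo] --> 0.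
  apply: cvg_to_eq (_ : _ --> (1 + eta^-1) * (b ^+ 2 * (K * 0))) _; last by rewrite !mulr0.
  do 3 (apply: cvgM; first exact: cvg_cst).
  apply: cvg_expr; rewrite ger0_norm ?powR_ge0// powRN invf_lt1 ?powR_gt0//.
  by have := @gt0_ltr_powR R de de0 1 2; rewrite !nnegrE ler01 ler0n powR1 ltr1n => /(_ isT isT isT).
have /cvgr0Pnorm_le/(_ _ e10) [l _ /(_ l (leqnn l)) hl] := cl.
rewrite /= in hl.
have [KD KD0 [hKD hD]] := Ws_decorrelation hd mfs fs0 fsB cfs fs0_gt0 w C1 q00 mC aC gX l.
pose L j := (2 ^ (j - l))%N.
have /cvgrPdist_le/(_ 1 ltr01) [J1 _ hJ1] := hV2.
have /cvgrPdist_le/(_ _ e10) [J2 _ hJ2] := hV2.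
have ct : (1 + eta^-1) * tau j @[j --> \oo] --> 0.
  by apply: cvg_to_eq (_ : _ --> (1 + eta^-1) * 0) _; [apply: cvgM => //; exact: cvg_cst|rewrite mulr0].
have /cvgr0Pnorm_le/(_ _ e10) [J3 _ hJ3] := ct.
have wmb j k : (J1 <= j)%N -> eta * nrm2 P (wm j k) <= e1.
  move=> jJ; rewrite /eta mulrAC ler_pdivrMr// ler_wpM2l ?(ltW e10)// nwm.
  by have := hJ1 j jJ; rewrite ler_norml => /andP[+ _]; lra.
have errY j k : (J1 <= j)%N -> (J3 <= j)%N -> \int[P]_t `|wm j k t ^+ 2 - Y j k t ^+ 2| <= 2 * e1.
  move=> j1 j3; rewrite (le_trans (Rint_sqrB_le eta0 (lwm j k) (lY j k)))//.
  rewrite [leRHS]mulr_natl mulr2n lerD ?wmb// (le_trans _ (hJ3 j j3))// (le_trans _ (ler_norm _))//.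
  rewrite ler_wpM2l ?(ltW ei0)// (le_trans _ (htau j k))// -nrm2N.
  by rewrite le_eqVlt; apply/orP; left; apply/eqP; congr nrm2; apply/funext => t; rewrite opprB.
have errS j k : (J1 <= j)%N -> (l <= j)%N -> \int[P]_t `|wm j k t ^+ 2 - ws (L j) j k t ^+ 2| <= 2 * e1.
  move=> j1 jl; rewrite (le_trans (Rint_sqrB_le eta0 (lwm j k) (lws _ j k)))//.
  rewrite [leRHS]mulr_natl mulr2n lerD ?wmb// (le_trans _ hl)// (le_trans _ (ler_norm _))//.
  rewrite ler_wpM2l ?(ltW ei0)//.
  rewrite (_ : (fun t => _) = (fun t => b * (Wm m w a q0 X j k t - Ws d fs m w a q0 X (L j) j k t))); last first.
    by apply/funext => t; rewrite mulrBr.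
  rewrite nrm2Z; last exact: l2B.
  rewrite ler_wpM2l ?sqr_ge0// (le_trans (hK _ _ _).2)// ler_wpM2l//.
  rewrite (_ : (L j)%:R / 2 ^+ j = (2 ^+ l)^-1); last first.
    by rewrite /L natrX -{2}(subnK jl) exprD invfM mulrA divff ?mul1r.
  have pV (x : R) : 2^-1 `^ x = 2 `^ (- x) :> R by rewrite -mulN1r powRrM (powR_inv1 (ler0n R 2)).
  by rewrite -exprVn exprn_powR ?invr_ge0// pV.
(* Chosen so that a squared norm of at most 4 [e2] gives an L1 norm of at most e1 + 4 e2 / e1 = 2
   e1. *)
pose e2 := e1 ^+ 2 / 4; have e20 : 0 < e2 by rewrite divr_gt0// exprn_gt0.
have b40 : 0 < b ^+ 4 by rewrite exprn_even_gt0//= bn0.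
have [|D [J4 hJ4]] := hD (e2 / b ^+ 4); first by rewrite divr_gt0.
pose nb := (Num.bound (D%:R * (b ^+ 4 * KD) / e2)).+1.
exists (maxn (maxn J1 J2) (maxn (maxn J3 J4) l)), nb => j n k0.
rewrite !geq_max => /andP[/andP[j1 j2] /andP[/andP[j3 j4] jl]] nn.
have n0 : (0 < n)%N by apply: leq_trans nn.
have nR : 0 < n%:R :> R by rewrite ltr0n.
pose Z (k : nat) t := ws (L j) j (k0 + k%:Z) t ^+ 2.
have iZ2 k k' : itb P setT (fun t => Z k t * Z k' t).
  rewrite /Z /ws; have [h _] := hKD j jl (k0 + k%:Z) (k0 + k'%:Z).
  under [X in itb _ _ X]eq_fun do rewrite !exprMn mulrACA.
  exact: itbZ.
have iZ k : itb P setT (Z k) by exact: (lws (L j) j _).2.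
have lZ k : l2 P (Z k).
  by split; [exact: itb_meas (iZ k)|under [X in itb _ _ X]eq_fun do rewrite expr2; exact: iZ2].
have cZ k k' : \int[P]_t (Z k t * Z k' t) - \int[P]_t Z k t * \int[P]_t Z k' t =
    b ^+ 4 * covW P d fs m w a q0 X (L j) j (k0 + k%:Z) (k0 + k'%:Z).
  rewrite /covW mulrBr -(RintZ measurableT _ (hKD j jl _ _).1).
  have -> : b ^+ 4 * (\int[P]_t Ws d fs m w a q0 X (L j) j (k0 + k%:Z) t ^+ 2 * \int[P]_t Ws d fs m w a q0 X (L j) j (k0 + k'%:Z) t ^+ 2) =
     (b ^+ 2 * \int[P]_t Ws d fs m w a q0 X (L j) j (k0 + k%:Z) t ^+ 2) * (b ^+ 2 * \int[P]_t Ws d fs m w a q0 X (L j) j (k0 + k'%:Z) t ^+ 2).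
    by ring.
  rewrite -(RintZ measurableT (b ^+ 2) (lS (L j) j (k0 + k%:Z)).2) -(RintZ measurableT (b ^+ 2) (lS (L j) j (k0 + k'%:Z)).2).
  by congr (_ - _ * _); apply: eq_Rintegral => t _; rewrite /Z /ws; ring.
have wl := @weak_law _ _ _ P Z n D (b ^+ 4 * KD) e2 n0 _ (ltW e20) lZ _ _.
have {}wl : nrm2 P (fun t => n%:R^-1 * \sum_(k < n) (Z k t - \int[P]_t Z k t)) <= 4 * e2.
  apply: (le_trans (wl _ _ _)).
  - by rewrite mulr_ge0// ltW.
  - move=> k k'; rewrite cZ normrM ger0_norm ?(ltW b40)// ler_wpM2l ?(ltW b40)//.
    exact: (hKD j jl _ _).2.
  - move=> k k' kk; rewrite cZ normrM ger0_norm ?(ltW b40)// mulrC -ler_pdivlMr//.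
    apply: hJ4 => //; move: kk; clear; lia.
  rewrite (_ : 4 * e2 = 2 * (e2 + e2)); last by ring.
  rewrite ler_wpM2l// lerD2r ler_pdivrMr// [e2 * _]mulrC -ler_pdivrMr//.
  have pos : 0 <= D%:R * (b ^+ 4 * KD) / e2 by rewrite divr_ge0 ?(ltW e20)// mulr_ge0// mulr_ge0// ltW.
  have := archi_boundP pos; move/ltW/le_trans; apply.
  by rewrite ler_nat; apply: leq_trans nn.
pose F t := n%:R^-1 * \sum_(k < n) (Z k t - \int[P]_t Z k t).
have lF : l2 P F.
  apply: l2Z; apply: l2_sum => k _; apply: l2B => //.
  by split => //; exact: itb_cst.
have EF : \int[P]_t `|F t| <= 2 * e1.
  apply: (le_trans (Rint_abs_le e10 lF)).
  rewrite (_ : 2 * e1 = e1 + e1^-1 * (4 * e2)); last by rewrite /e2; field; rewrite gt_eqF.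
  by rewrite lerD2l ler_wpM2l ?invr_ge0 ?(ltW e10).
have iY k : itb P setT (fun t => Y j (k0 + k%:Z) t ^+ 2) by exact: (lY _ _).2.
have iM k : itb P setT (fun t => wm j (k0 + k%:Z) t ^+ 2) by exact: (lwm _ _).2.
have iS : itb P setT (fun t => n%:R^-1 * (\sum_(k < n) Y j (k0 + k%:Z) t ^+ 2) - V2).
  apply: itbB => //; last exact: itb_cst.
  by apply: itbZ => //; apply: itb_sum => // k _; exact: (lY _ _).2.
split; first exact: iS.
pose D1 (k : nat) t := wm j (k0 + k%:Z) t ^+ 2 - Y j (k0 + k%:Z) t ^+ 2.
pose D2 (k : nat) t := wm j (k0 + k%:Z) t ^+ 2 - Z k t.
have iD1 k : itb P setT (D1 k) by exact: itbB.
have iD2 k : itb P setT (D2 k) by exact: itbB.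
have iA (f : T -> R) : itb P setT f -> itb P setT (fun t => `|f t|) by move=> h; exact: (integrable_norm h).
have EZ k : `|\int[P]_t Z k t - V2| <= 3 * e1.
  have -> : \int[P]_t Z k t - V2 = - (\int[P]_t D2 k t) + (nrm2 P (wm j (k0 + k%:Z)) - V2).
    by rewrite /D2 RintB// /nrm2; ring.
  rewrite (le_trans (ler_normD _ _))// (_ : 3 * e1 = 2 * e1 + e1); last by ring.
  rewrite lerD//.
    rewrite normrN (le_trans _ (errS j (k0 + k%:Z) j1 jl))//.
    exact: (Rint_norm_le measurableT (iD2 k) (iA _ (iD2 k)) (fun t _ => lexx _)).
  by rewrite distrC nwm; exact: hJ2.
have isum (H : nat -> T -> R) : (forall k, itb P setT (H k)) -> itb P setT (fun t => n%:R^-1 * \sum_(k < n) H k t).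
  by move=> h; apply: itbZ => //; apply: itb_sum => // k _.
have avg (u : nat -> R) c : (forall k, u k <= c) -> n%:R^-1 * \sum_(k < n) u k <= c.
  move=> h; rewrite mulrC ler_pdivrMr// (le_trans (ler_sum _ (fun (k : 'I_n) _ => h k)))//.
  by rewrite sumr_const card_ord [leRHS]mulr_natr.
have avgI (H : nat -> T -> R) c : (forall k, itb P setT (H k)) -> (forall k, \int[P]_t H k t <= c) ->
    \int[P]_t (n%:R^-1 * \sum_(k < n) H k t) <= c.
  move=> h1 h2; rewrite RintZ//; last by apply: itb_sum => // k _.
  by rewrite (Rint_sum measurableT)//; exact: (avg (fun k => \int[P]_t H k t)).
(* In order: terms other than rank q0, smoothing, fluctuation of the smoothed squares, bias of their
   mean. *)
pose bnd t := n%:R^-1 * (\sum_(k < n) `|D1 k t|) + (n%:R^-1 * (\sum_(k < n) `|D2 k t|) + (`|F t| + 3 * e1)).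
have iF : itb P setT (fun t => `|F t|).
  apply: iA; apply: (isum (fun k t => Z k t - \int[P]_t Z k t)) => k; apply: itbB => //; exact: itb_cst.
have i1 : itb P setT (fun t => n%:R^-1 * (\sum_(k < n) `|D1 k t|)) by apply: (isum (fun k t => `|D1 k t|)) => k; exact: iA.
have i2 : itb P setT (fun t => n%:R^-1 * (\sum_(k < n) `|D2 k t|)) by apply: (isum (fun k t => `|D2 k t|)) => k; exact: iA.
have i3 : itb P setT (fun t => `|F t| + 3 * e1) by apply: itbD => //; exact: itb_cst.
apply: (@le_trans _ _ (\int[P]_t bnd t)).
  apply: le_Rint => //; [exact: iA|by apply: itbD => //; exact: itbD|].
  move=> t _.
  have -> : n%:R^-1 * (\sum_(k < n) Y j (k0 + k%:Z) t ^+ 2) - V2 =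
     - (n%:R^-1 * \sum_(k < n) D1 k t) + (n%:R^-1 * (\sum_(k < n) D2 k t) + (F t + n%:R^-1 * (\sum_(k < n) (\int[P]_t Z k t - V2)))).
    rewrite /F /D1 /D2 !sumrB sumr_const card_ord -[V2 *+ n]mulr_natl; field; rewrite gt_eqF//.
  have na (H : nat -> R) : `|n%:R^-1 * \sum_(k < n) H k| <= n%:R^-1 * \sum_(k < n) `|H k|.
    by rewrite normrM ger0_norm ?invr_ge0 ?(ltW nR)// ler_wpM2l ?invr_ge0 ?(ltW nR)// ler_norm_sum.
  rewrite (le_trans (ler_normD _ _))// lerD//; first by rewrite normrN; exact: (na (D1 ^~ t)).
  rewrite (le_trans (ler_normD _ _))// lerD//; first exact: (na (D2 ^~ t)).
  rewrite (le_trans (ler_normD _ _))// lerD2l (le_trans (na (fun k => \int[P]_t Z k t - V2)))//.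
  exact: (avg (fun k => `|\int[P]_t Z k t - V2|)).
rewrite /bnd RintD//; last exact: itbD.
rewrite RintD// RintD//; last exact: itb_cst.
rewrite Rint_cst.
have a1 := avgI (fun k t => `|D1 k t|) (2 * e1) (fun k => iA _ (iD1 k)) (fun k => errY j _ j1 j3).
have a2 := avgI (fun k t => `|D2 k t|) (2 * e1) (fun k => iA _ (iD2 k)) (fun k => errS j _ j1 jl).
by move: a1 a2 EF; rewrite /e1; move: e0; lra.
Qed.

End QuadraticMeans.

(** * Filters *)

Section LineIntegrals.
Context {R : realType}.
Notation mu := (@lebesgue_measure R).
Notation Ipi := `[(- pi)%R, pi%R]%classic.

Lemma continuous_at_powR (a l : R) : 0 < l -> {for l, continuous (fun z : R => z `^ a)}.
Proof. by move=> l0; apply: (dv_continuous (dv_powR a l0 (dv_id l))). Qed.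


(** The multiple p^-1 of Lebesgue measure, pushed forward by y -> y / p, agrees with Lebesgue
    measure on half-open intervals, hence on all Borel sets. *)
Lemma itb_scale (p : R) (f : R -> R) : 0 < p -> measurable_fun setT f -> (forall x, 0 <= f x) ->
  itb mu setT f -> itb mu setT (fun y => p^-1 * f (y / p)) /\
  \int[mu]_y (p^-1 * f (y / p)) = \int[mu]_x f x.
Proof.
move=> p0 mf f0 jf.
have ip0 : 0 <= p^-1 by rewrite invr_ge0 ltW.
pose k := NngNum ip0.
have mphi : measurable_fun setT (fun y : measurableTypeR R => y / p : measurableTypeR R).
  exact: measurable_funM.
have mff : measurable_fun setT (fun y : R => f (y / p)).
  by apply: measurableT_comp => //; exact: measurable_funM.
have E : (\int[mu]_x (f x)%:E = \int[mu]_y (p^-1 * f (y / p))%:E)%E.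
  transitivity (\int[pushforward (mscale k mu) (fun y : measurableTypeR R => (y / p)%R : measurableTypeR R)]_x (f x)%:E)%E.
    apply: eq_measure_integral => A mA _.
    apply: lebesgue_measure_unique => // _ [[u v]] _ <-.
    transitivity ((p^-1)%:E * mu ((fun y : R => (y / p)%R) @^-1` `]u, v]%classic))%E; last by [].
    rewrite (_ : _ @^-1` _ = [set` `]u * p, v * p]%R]); last first.
      apply/seteqP; split => y /=; rewrite !in_itv/= ltr_pdivlMr// ler_pdivrMr//.
    rewrite !lebesgue_measure_itv/= !lte_fin ltr_pM2r//; case: ifP => uv; last by rewrite mule0.
    by rewrite -!EFinB -EFinM -mulrBl mulrC mulfK// gt_eqF.
  rewrite ge0_integral_pushforward//=; last 2 first.
  - exact/measurable_EFinP.
  - by move=> y _; rewrite lee_fin.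
  rewrite preimage_setT ge0_integral_mscale//=; last 2 first.
  - exact/measurable_EFinP.
  - by move=> y _; rewrite lee_fin.
  rewrite -ge0_integralZl_EFin//.
  - by move=> y _; rewrite lee_fin.
  - exact/measurable_EFinP.
have nn y : 0 <= p^-1 * f (y / p) by rewrite mulr_ge0.
split; last by rewrite /Rintegral -E.
apply/integrableP; split; first by apply/measurable_EFinP; exact: measurable_funM.
under eq_integral do rewrite /= ger0_norm//.
rewrite -E; have /integrableP[_] := jf.
by under eq_integral do rewrite /= ger0_norm//.
Qed.

Definition decay (al : R) (y : R) : R := (1 + `|y|) `^ (- al).

Let pos1 (y : R) : 0 < 1 + `|y|. Proof. by rewrite ltr_pwDl. Qed.

Lemma decay_gt0 al y : 0 < decay al y. Proof. exact: powR_gt0. Qed.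

Lemma decay_continuous al : continuous (decay al).
Proof.
move=> y; have h : {for y, continuous (fun z : R => 1 + `|z|)}.
  by apply: cvgD; [exact: cvg_cst|exact: norm_continuous].
apply: (@continuous_comp _ _ _ (fun z : R => 1 + `|z|) (fun z : R => z `^ (- al)) y h).
exact: continuous_at_powR.
Qed.

Lemma itb_decay al : 1 < al -> itb mu setT (decay al).
Proof.
move=> al1; have b0 : 0 < al - 1 by rewrite subr_gt0.
have d0 y : 0 <= decay al y by rewrite ltW// decay_gt0.
apply/integrableP; split.
  by apply/measurable_EFinP; apply: continuous_measurable_fun; exact: decay_continuous.
under eq_integral do rewrite /= ger0_norm//.
rewrite ge0_symfun_integralT//; [|exact: decay_continuous|by move=> y /=; rewrite /decay normrN].
rewrite (_ : [set x | (0 <= x)%R] = `[0%R, +oo[%classic); last first.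
  by apply/seteqP; split => y /=; rewrite in_itv/= andbT.
pose F (y : R) := - (al - 1)^-1 * (1 + y) `^ (- (al - 1)).
have dF (y : R) : 0 <= y -> is_derive y 1 F (decay al y).
  move=> y0; rewrite /F; derive_auto; first lra.
  rewrite /decay ger0_norm// add0r mulr1 (_ : - (al - 1) - 1 = - al); last by ring.
  by rewrite mul0r add0r mulrA mulrNN mulVf ?gt_eqF// mul1r.
rewrite (@ge0_continuous_FTC2y _ _ F 0 0)//.
- by rewrite -EFinB -EFinM ltry.
- by apply: continuous_subspaceT; exact: decay_continuous.
- rewrite /F -(mulr0 (- (al - 1)^-1)); apply: cvgM; first exact: cvg_cst.
  apply/cvgr0Pnorm_le => eps e0.
  near=> y; have y0 : 0 <= y by near: y; exact: nbhs_pinfty_ge.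
  have M0 : 0 < eps `^ (- (al - 1)^-1) by exact: powR_gt0.
  rewrite ger0_norm ?powR_ge0//.
  have h : eps `^ (- (al - 1)^-1) <= 1 + y.
    apply: (@le_trans _ _ y); last by rewrite lerDr.
    near: y; exact: nbhs_pinfty_ge.
  rewrite (le_trans (le_powRN (ltW b0) M0 h))// -powRrM mulrNN mulVf ?gt_eqF//.
  by rewrite powRr1 ?(ltW e0).
- by move=> y /ltW /dF[].
- by apply: cvg_at_right_filter; exact: (dv_continuous (dF 0 (lexx 0))).
- move=> y; rewrite in_itv/= andbT => /ltW y0; have h := dF y y0.
  by rewrite derive1E derive_val.
Unshelve. all: by end_near.
Qed.

Definition onD (D : set R) (f : R -> R) (x : R) : R := \1_D x * f x.

Lemma onD_patch (D : set R) (f : R -> R) : f \_ D = onD D f.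
Proof. by apply/funext => x; rewrite /patch /onD indicE; case: ifP; rewrite ?mul1r ?mul0r. Qed.

Lemma itb_onD (D : set (measurableTypeR R)) (f : R -> R) : measurable D ->
  itb mu D f <-> itb mu setT (onD D f).
Proof.
move=> mD; rewrite /itb integrable_mkcond// -onD_patch.
by rewrite (_ : (EFin \o f) \_ D = EFin \o (f \_ D))// restrict_EFin.
Qed.

Lemma Rint_onD (D : set (measurableTypeR R)) (f : R -> R) :
  \int[mu]_(x in D) f x = \int[mu]_x onD D f x.
Proof. by rewrite Rintegral_mkcond onD_patch. Qed.

Lemma Rint_decay_le (al p : R) : 1 < al -> 0 < p ->
  itb mu Ipi (fun x => decay al (p * x)) /\
  \int[mu]_(x in Ipi) decay al (p * x) <= p^-1 * \int[mu]_y decay al y.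
Proof.
move=> al1 p0; have ip : 0 < p^-1 by rewrite invr_gt0.
have [h1 h2] := itb_scale ip (continuous_measurable_fun (@decay_continuous al)) (fun y => ltW (decay_gt0 al y)) (itb_decay al1).
rewrite !invrK in h1 h2.
have h3 : itb mu setT (fun y => decay al (p * y)).
  have := itbZ measurableT p^-1 h1; under eq_fun do rewrite mulKf ?gt_eqF// mulrC.
  by [].
have h4 : itb mu Ipi (fun x => decay al (p * x)) by apply: integrableS h3.
have i1 := (itb_onD _ mIpi).1 h4; have i2 := itbZ measurableT p^-1 h1.
split => //; rewrite -h2 -RintZ// Rint_onD; apply: (le_Rint measurableT i1 i2).
move=> x _; rewrite mulKf ?gt_eqF// [x * p]mulrC /onD ler_piMl ?(ltW (decay_gt0 _ _))//.
Qed.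

End LineIntegrals.

Section FilterArrays.
Context {R : realType}.
Notation mu := (@lebesgue_measure R).
Notation Ipi := `[(- pi)%R, pi%R]%classic.
Implicit Types (h y : nat -> R) (x : R).

Definition cums h (i : nat) : R := \sum_(l < i.+1) h l.

Lemma abel_sum h y n :
  \sum_(i < n) h i * y i = \sum_(i < n) cums h i * (y i - y i.+1) + (\sum_(i < n) h i) * y n.
Proof.
elim: n => [|n IH]; first by rewrite !big_ord0 mul0r addr0.
rewrite !big_ord_recr/= IH {3}/cums big_ord_recr/=; ring.
Qed.

Variables (n w : nat).
Definition fcos h x : R := \sum_(i < n) h i * cos (x * (i%:Z - w%:Z)%:~R).
Definition fsin h x : R := \sum_(i < n) h i * sin (x * (i%:Z - w%:Z)%:~R).
(** Squared modulus of the transfer function, the form in which the filter enters variances; the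
    sign of the sine part is immaterial. *)
Definition ft2 h x : R := fcos h x ^+ 2 + fsin h x ^+ 2.

Lemma ft2_ge0 h x : 0 <= ft2 h x. Proof. by rewrite addr_ge0 ?sqr_ge0. Qed.

Lemma ft2_at0 h : ft2 h 0 = (\sum_(i < n) h i) ^+ 2.
Proof.
rewrite /ft2 /fcos /fsin.
under eq_bigr do rewrite mul0r cos0 mulr1; under [X in _ + X ^+ 2]eq_bigr do rewrite mul0r sin0 mulr0.
by rewrite big1_eq expr0n addr0.
Qed.

Lemma fcos_continuous h : continuous (fcos h).
Proof.
move=> x; pose F (i : nat) (y : R) := h i * cos (y * (i%:Z - w%:Z)%:~R).
have dF i : is_derive x 1 (F i) (h i * (- sin (x * (i%:Z - w%:Z)%:~R) * (i%:Z - w%:Z)%:~R)).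
  by rewrite /F; derive_auto; ring.
exact: (dv_continuous (dv_sum n dF)).
Qed.

Lemma fsin_continuous h : continuous (fsin h).
Proof.
move=> x; pose F (i : nat) (y : R) := h i * sin (y * (i%:Z - w%:Z)%:~R).
have dF i : is_derive x 1 (F i) (h i * (cos (x * (i%:Z - w%:Z)%:~R) * (i%:Z - w%:Z)%:~R)).
  by rewrite /F; derive_auto; ring.
exact: (dv_continuous (dv_sum n dF)).
Qed.

Lemma ft2_continuous h : continuous (ft2 h).
Proof.
move=> x; rewrite /ft2; under eq_fun do rewrite !expr2.
by apply: cvgD; apply: cvgM; (exact: fcos_continuous || exact: fsin_continuous).
Qed.

(** Summation by parts factors 1 - e^{-ix} out of the transfer function, the coefficients being
    replaced by their partial sums. *)
Lemma ft2_cums h x : \sum_(i < n) h i = 0 -> ft2 h x = sn x ^+ 2 * ft2 (cums h) x.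
Proof.
move=> h0; have th i : x * (i.+1%:Z - w%:Z)%:~R = x * (i%:Z - w%:Z)%:~R + x.
  by rewrite -addn1 PoszD !rmorphB rmorphD /=; ring.
rewrite {1}/ft2.
have -> : fcos h x = (1 - cos x) * fcos (cums h) x + sin x * fsin (cums h) x.
  rewrite /fcos (abel_sum h (fun i => cos (x * (i%:Z - w%:Z)%:~R))) h0 mul0r addr0.
  rewrite /fsin !mulr_sumr -big_split/=; apply: eq_bigr => i _.
  by rewrite th cosD; ring.
have -> : fsin h x = (1 - cos x) * fsin (cums h) x - sin x * fcos (cums h) x.
  rewrite /fsin (abel_sum h (fun i => sin (x * (i%:Z - w%:Z)%:~R))) h0 mul0r addr0.
  rewrite /fcos !mulr_sumr -sumrB/=; apply: eq_bigr => i _.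
  by rewrite th sinD; ring.
rewrite sn_sqr /ft2; have := cos2Dsin2 x.
set c := cos x; set s := sin x; set F := fcos _ _; set G := fsin _ _ => cs.
have -> : ((1 - c) * F + s * G) ^+ 2 + ((1 - c) * G - s * F) ^+ 2 = (1 - 2 * c + (c ^+ 2 + s ^+ 2)) * (F ^+ 2 + G ^+ 2) by ring.
by rewrite cs; ring.
Qed.

Lemma sn2_ge x : `|x| <= pi -> x ^+ 2 <= 9 * sn x ^+ 2.
Proof.
move=> /sn_ge h; rewrite -(real_normK (num_real x)) -(real_normK (num_real (sn x))).
have h' : `|x| <= 3 * `|sn x| by lra.
have := lerXn2r 2 (normr_ge0 x : `|x| \is Num.nneg) (mulr_ge0 (ler0n _ 3) (normr_ge0 (sn x)) : 3 * `|sn x| \is Num.nneg) h'.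
by rewrite exprMn; lra.
Qed.

Section VanishingMoments.
Variables (h : nat -> R) (D : R) (M K : nat).
Hypotheses (D0 : 0 <= D) (KM : (K < M)%N).
Hypothesis hD : forall x, - pi <= x <= pi -> ft2 h x <= D * (x ^+ 2) ^+ M.

Lemma ft2_iter_le h' k x : (forall z, ft2 h z = (sn z ^+ 2) ^+ k * ft2 h' z) -> (k <= M)%N ->
  x != 0 -> `|x| <= pi -> ft2 h' x <= D * 9 ^+ k * (x ^+ 2) ^+ (M - k).
Proof.
move=> hk kM x0 xp; have xp' : - pi <= x <= pi by rewrite -ler_norml.
have x2 : 0 < x ^+ 2 by rewrite exprn_even_gt0.
have s2 := sn2_ge xp.
have xk : 0 < (x ^+ 2) ^+ k by rewrite exprn_gt0.
rewrite -(ler_pM2l xk) (@le_trans _ _ (9 ^+ k * (D * (x ^+ 2) ^+ M)))//; last first.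
  by rewrite -[in leLHS](subnKC kM) exprD; lra.
apply: (@le_trans _ _ ((9 * sn x ^+ 2) ^+ k * ft2 h' x)).
  by rewrite ler_wpM2r ?ft2_ge0// lerXn2r ?nnegrE ?(ltW x2) ?(le_trans (ltW x2) s2).
by rewrite exprMn -mulrA -hk ler_wpM2l ?exprn_ge0// hD.
Qed.

(** The squared sum is the value at 0 of the reduced transfer function, which is continuous and
    still vanishes there to order M - k > 0; the limit is taken along 1 / (q + 1), where division by
    x is allowed. *)
Lemma zero_sum h' k : (forall z, ft2 h z = (sn z ^+ 2) ^+ k * ft2 h' z) -> (k < M)%N ->
  \sum_(i < n) h' i = 0.
Proof.
move=> hk kM; apply/eqP; rewrite -(sqrf_eq0 (\sum_(i < n) h' i)) -ft2_at0 eq_le ft2_ge0 andbT.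
pose u (q : nat) : R := q.+1%:R^-1.
have u0 : u @ \oo --> 0 by exact: cvg_harmonic.
have c1 : ft2 h' (u q) @[q --> \oo] --> ft2 h' 0.
  by apply: (cvg_comp _ (ft2 h') u0); exact: ft2_continuous.
apply: (ler_cvg_to c1 (_ : (fun q => D * 9 ^+ k * u q) @ \oo --> 0)).
  by rewrite -(mulr0 (D * 9 ^+ k)); apply: cvgM => //; exact: cvg_cst.
apply: nearW => q; have uq : 0 < u q by rewrite invr_gt0.
have uq1 : u q <= 1 by rewrite invf_le1// ler1n.
have up : `|u q| <= pi.
  by rewrite gtr0_norm// (le_trans uq1)//; have := pihalf_ge1 R; lra.
rewrite (le_trans (ft2_iter_le hk (ltnW kM) _ up)) ?gt_eqF// ler_wpM2l ?mulr_ge0 ?exprn_ge0//.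
rewrite -exprM -[leRHS]expr1 ler_wiXn2l// ?(ltW uq)//.
by rewrite mulnC muln_gt0 subn_gt0 kM.
Qed.

(** Each zero sum permits one more summation by parts, and the reduced filter, with one order of
    vanishing less, has zero sum again as long as k < M. *)
Lemma vanishing_moments k : (k <= K)%N ->
  (forall x, ft2 h x = (sn x ^+ 2) ^+ k * ft2 (iter k cums h) x) /\
  \sum_(i < n) iter k cums h i = 0.
Proof.
elim: k => [|k IH] kK.
  have e x : ft2 h x = (sn x ^+ 2) ^+ 0 * ft2 (iter 0 cums h) x by rewrite mul1r.
  by split => //; apply: (zero_sum e); exact: leq_ltn_trans KM.
have [h1 h2] := IH (ltnW kK).
have e x : ft2 h x = (sn x ^+ 2) ^+ k.+1 * ft2 (iter k.+1 cums h) x.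
  by rewrite h1 (ft2_cums _ h2) [_ ^+ k.+1]exprSr mulrA.
by split => //; apply: (zero_sum e); exact: leq_ltn_trans KM.
Qed.

Lemma filter_iter_bdiff (y : int -> R) (s : int) k : (k <= K.+1)%N ->
  \sum_(i < n) h i * y (s - (i%:Z - w%:Z)) =
  \sum_(i < n) iter k cums h i * iter k (@bdiff R) y (s - (i%:Z - w%:Z)).
Proof.
elim: k => [//|k IH] kK; rewrite IH ?(ltnW kK)//.
rewrite (abel_sum (iter k cums h) (fun i => iter k (@bdiff R) y (s - (i%:Z - w%:Z)))).
rewrite (vanishing_moments (kK : (k <= K)%N)).2 mul0r addr0; apply: eq_bigr => i _.
rewrite /= /bdiff; congr (_ * (_ - iter k _ y _)).
by rewrite -addn1 PoszD; ring.
Qed.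

End VanishingMoments.

Lemma filter_inversion h (i : 'I_n) : 2 * pi * h i =
  \int[mu]_(x in Ipi) (fcos h x * cos (x * (i%:Z - w%:Z)%:~R) + fsin h x * sin (x * (i%:Z - w%:Z)%:~R)).
Proof.
have i1 : itb mu Ipi (fun=> 1) by apply: continuous_itb => x; exact: cvg_cst.
have E x : fcos h x * cos (x * (i%:Z - w%:Z)%:~R) + fsin h x * sin (x * (i%:Z - w%:Z)%:~R) =
    \sum_(l < n) h l * (cos (x * (l%:Z - i%:Z)%:~R) * 1).
  rewrite /fcos /fsin !mulr_suml -big_split/=; apply: eq_bigr => l _.
  rewrite (_ : l%:Z - i%:Z = (l%:Z - w%:Z) - (i%:Z - w%:Z)); last by ring.
  by rewrite [in RHS]rmorphB mulrBr cosB; ring.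
under eq_Rintegral do rewrite E.
rewrite (Rint_sum mIpi); last by move=> l _; apply: itbZ => //; exact: itb_cosF.
rewrite (bigD1 i)//= big1 ?addr0 => [|l li].
  by rewrite RintZ//; [rewrite -/(rF _ _) rF1 subrr eqxx mul1r mulrC|exact: itb_cosF].
rewrite RintZ//; last exact: itb_cosF.
rewrite -/(rF _ _) rF1; case: eqP => [/eqP|_]; last by rewrite mul0r mulr0.
by rewrite subr_eq0 => /eqP[e]; case/eqP: li; exact/val_inj.
Qed.

(** Fourier inversion, and the Cauchy-Schwarz inequality in the plane for the cosine and sine
    parts. *)
Lemma filter_coef_le h (Bd : R -> R) (i : 'I_n) : itb mu Ipi Bd ->
  (forall x, x \in Ipi -> 0 <= Bd x /\ ft2 h x <= Bd x ^+ 2) ->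
  `|h i| <= (2 * pi)^-1 * \int[mu]_(x in Ipi) Bd x.
Proof.
move=> iB hB; have p0 : 0 < 2 * pi :> R by rewrite mulr_gt0// pi_gt0.
rewrite ler_pdivlMl// -[X in X * _](gtr0_norm p0) -normrM filter_inversion.
apply: Rint_norm_le => //.
  apply: continuous_itb => x.
  have hc : continuous (fun x : R => cos (x * (i%:Z - w%:Z)%:~R)) by cont_auto.
  have hs : continuous (fun x : R => sin (x * (i%:Z - w%:Z)%:~R)) by cont_auto.
  apply: cvgD; apply: cvgM;
    by [exact: fcos_continuous|exact: fsin_continuous|exact: hc|exact: hs].
move=> x /mem_set xI; have [b0 hb] := hB x xI.
rewrite -(ler_pXn2r (ltn0Sn 1)) ?nnegrE// (le_trans _ hb)// real_normK ?num_real// /ft2.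
set c := cos _; set s := sin _; have cs : c ^+ 2 + s ^+ 2 = 1 by rewrite cos2Dsin2.
set F := fcos _ _; set G := fsin _ _.
have := sqr_ge0 (F * s - G * c).
have -> : (F * s - G * c) ^+ 2 = (F ^+ 2 + G ^+ 2) * (c ^+ 2 + s ^+ 2) - (F * c + G * s) ^+ 2 by ring.
by rewrite cs mulr1 subr_ge0.
Qed.

End FilterArrays.

Section Modulus.
Context {R : realType}.
Implicit Types a b : R.

Lemma cmod_ge0 a b : 0 <= cmod a b. Proof. exact: sqrtr_ge0. Qed.

Lemma cmod_sqr a b : cmod a b ^+ 2 = a ^+ 2 + b ^+ 2.
Proof. by rewrite sqr_sqrtr// addr_ge0 ?sqr_ge0. Qed.

Lemma cmodC a b a' b' : cmod (a - a') (b - b') = cmod (a' - a) (b' - b).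
Proof. by rewrite /cmod -(sqrrN (a - a')) -(sqrrN (b - b')) !opprB. Qed.

Lemma cmod_le_add a b a' b' : cmod a b <= cmod a' b' + cmod (a - a') (b - b').
Proof.
set u := cmod _ _; set v := cmod a' _; set z := cmod (a - _) _.
have [u0 v0 z0] : [/\ 0 <= u, 0 <= v & 0 <= z] by split; exact: cmod_ge0.
rewrite -(ler_pXn2r (ltn0Sn 1)) ?nnegrE ?addr_ge0// sqrrD.
rewrite /u /v /z !cmod_sqr -/v -/z.
suff h : a' * (a - a') + b' * (b - b') <= v * z.
  rewrite -mulr_natl; have := h; set q := v * z; move: q => q; lra.
apply: (le_trans (ler_norm _)).
rewrite -(ler_pXn2r (ltn0Sn 1)) ?nnegrE ?mulr_ge0// real_normK ?num_real// exprMn.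
rewrite /v /z !cmod_sqr; set s := a - a'; set t := b - b'.
rewrite -subr_ge0.
have -> : (a' ^+ 2 + b' ^+ 2) * (s ^+ 2 + t ^+ 2) - (a' * s + b' * t) ^+ 2 =
  (a' * t - b' * s) ^+ 2 by ring.
exact: sqr_ge0.
Qed.

Lemma cmod_dist a b a' b' : `|cmod a b - cmod a' b'| <= cmod (a - a') (b - b').
Proof.
have h1 := cmod_le_add a b a' b'; have := cmod_le_add a' b' a b.
by rewrite cmodC ler_norml => h2; apply/andP; split; lra.
Qed.

End Modulus.

(** * Wavelet filters: reduced coefficients and limiting variance *)

Section WaveletFilters.
Context {R : realType}.
Notation mu := (@lebesgue_measure R).
Notation Ipi := `[(- pi)%R, pi%R]%classic.
Variables (A alpha C de : R) (g : nat -> int -> R) (M K : nat).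
Hypotheses (A0 : 0 < A) (al1 : 1 < alpha) (C0 : 0 <= C) (de01 : 0 < de < 2^-1).
Hypothesis KM : K%:R + de <= M%:R.
Hypothesis gC : forall (j : nat) (l : R), - pi <= l <= pi ->
  cmod (ghat_re A g j l) (ghat_im A g j l)
  <= C * 2 `^ (j%:R / 2) * `|2 ^+ j * l| ^+ M * (1 + 2 ^+ j * `|l|) `^ (- alpha - M%:R).

Definition flen j := (win A j).*2.+1.
Definition filt j (i : nat) : R := g j (i%:Z - (win A j)%:Z).
Notation h j := (filt j).
Notation ft j := (ft2 (flen j) (win A j)).
Notation p j := (2 ^+ j : R).
Notation s j := (2 `^ (j%:R / 2) : R).

Let p0 j : 0 < p j. Proof. exact: exprn_gt0. Qed.
Let s0 j : 0 < s j. Proof. exact: powR_gt0. Qed.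

Lemma half_pow_sqr j : s j ^+ 2 = p j.
Proof. by rewrite powR_exprn divfK// powR_mulrn. Qed.

Lemma flen_le j : (flen j)%:R <= (2 * A + 5) * p j.
Proof.
have /andP[_ h] := ceil_itv (A * p j); have /andP[h' _] := ceil_itv (A * p j).
have Ap : 0 < A * p j by exact: mulr_gt0.
have e : (win A j)%:R = (Num.ceil (A * p j))%:~R :> R.
  rewrite /win -[LHS]/((Posz _)%:~R) gez0_abs//.
  by rewrite -(ler_int R) (le_trans _ h)// ltW.
have p1 : 1 <= p j by rewrite exprn_ege1// ler1n.
rewrite /flen -addn1 natrD -muln2 natrM e mulrDl.
by move: h'; rewrite rmorphB/= => h'; lra.
Qed.

Lemma cmod_ghat j (x : R) : cmod (ghat_re A g j x) (ghat_im A g j x) ^+ 2 = ft j (h j) x.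
Proof. by rewrite cmod_sqr /ghat_im sqrrN. Qed.

Lemma ft_le j (x : R) : `|x| <= pi ->
  ft j (h j) x <= (C * s j * `|p j * x| ^+ M * (1 + `|p j * x|) `^ (- alpha - M%:R)) ^+ 2.
Proof.
rewrite ler_norml => /(gC j); have e : `|p j * x| = p j * `|x| by rewrite normrM (gtr0_norm (p0 j)).
rewrite -e => hx; rewrite -cmod_ghat lerXn2r ?nnegrE ?cmod_ge0//.
  by rewrite mulr_ge0 ?powR_ge0// mulr_ge0 ?exprn_ge0// mulr_ge0 ?powR_ge0.
Qed.

Let KltM : (K < M)%N.
Proof. by case/andP: de01 => h _; rewrite -(ltr_nat R) (lt_le_trans _ KM)// ltrDl. Qed.

Lemma ft_le_pow j (x : R) : - pi <= x <= pi -> ft j (h j) x <= (C * s j * p j ^+ M) ^+ 2 * (x ^+ 2) ^+ M.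
Proof.
rewrite -ler_norml => /(ft_le j) hx; rewrite (le_trans hx)// !(exprMn 2).
have E : (`|p j * x| ^+ M) ^+ 2 = (p j ^+ M) ^+ 2 * (x ^+ 2) ^+ M.
  by rewrite normrM (gtr0_norm (p0 j)) exprMn exprMn (exprAC _ M 2 : (`|x| ^+ M) ^+ 2 = _) real_normK ?num_real.
rewrite E.
have D0 : 0 <= C ^+ 2 * s j ^+ 2 by rewrite mulr_ge0 ?sqr_ge0.
have F0 : 0 <= C ^+ 2 * s j ^+ 2 * ((p j ^+ M) ^+ 2 * (x ^+ 2) ^+ M).
  by apply: mulr_ge0 => //; apply: mulr_ge0; rewrite ?sqr_ge0// exprn_ge0// sqr_ge0.
apply: (le_trans (ler_piMr F0 _)); last by rewrite !mulrA.
rewrite expr_le1 ?powR_ge0// -[leRHS](powRr0 (1 + `|p j * x|)) ler_powR ?lerDl//.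
by rewrite -opprD oppr_le0 addr_ge0// ltW// (lt_trans ltr01).
Qed.

(* Coefficients of the filter polynomial divided by [(1 - z) ^ K]. *)
Definition fred j := iter K cums (h j).


Lemma ft_fred j (x : R) : ft j (h j) x = (sn x ^+ 2) ^+ K * ft j (fred j) x.
Proof.
have H z : - pi <= z <= pi -> ft j (h j) z <= (C * s j * p j ^+ M) ^+ 2 * (z ^+ 2) ^+ M by exact: ft_le_pow.
exact: (vanishing_moments (sqr_ge0 _) KltM H (leqnn K)).1.
Qed.

Lemma sum_fred j : \sum_(i < flen j) fred j i = 0.
Proof.
have H z : - pi <= z <= pi -> ft j (h j) z <= (C * s j * p j ^+ M) ^+ 2 * (z ^+ 2) ^+ M by exact: ft_le_pow.
exact: (vanishing_moments (sqr_ge0 _) KltM H (leqnn K)).2.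
Qed.

Lemma wcoef_fred (y : int -> R) j k : wcoef A g y j k =
  \sum_(i < flen j) fred j i * iter K (@bdiff R) y ((2 ^ j)%N%:Z * k - (i%:Z - (win A j)%:Z)).
Proof.
have H z : - pi <= z <= pi -> ft j (h j) z <= (C * s j * p j ^+ M) ^+ 2 * (z ^+ 2) ^+ M by exact: ft_le_pow.
exact: (filter_iter_bdiff (sqr_ge0 _) KltM H y ((2 ^ j)%N%:Z * k) (leqW (leqnn K))).
Qed.

(** Away from 0 the factor |sn x|^K is divided out with |x| <= 3 |sn x|, and u^M <= u^K (1 + u)^M
    leaves the decay of order alpha. At 0 the value is the square of a vanishing sum. *)
Lemma ft_fred_le j (x : R) : `|x| <= pi ->
  ft j (fred j) x <= (C * 3 ^+ K * s j * p j ^+ K * decay alpha (p j * x)) ^+ 2.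
Proof.
move=> xp; have [->|x0] := eqVneq x 0; first by rewrite ft2_at0 sum_fred expr0n sqr_ge0.
have x2 : 0 < (x ^+ 2) ^+ K by rewrite exprn_gt0// exprn_even_gt0.
have c9 : 0 < 9 ^+ K :> R by rewrite exprn_gt0.
rewrite -(ler_pM2l x2) (@le_trans _ _ (9 ^+ K * ft j (h j) x))//.
  rewrite ft_fred mulrA -exprMn ler_wpM2r ?ft2_ge0// lerXn2r ?nnegrE ?sqr_ge0// ?sn2_ge//.
  by rewrite mulr_ge0 ?sqr_ge0.
apply: (le_trans (ler_wpM2l (ltW c9) (ft_le j xp))).
have E9 : 9 ^+ K = (3 ^+ K) ^+ 2 :> R by rewrite exprAC; congr (_ ^+ K); ring.
have EK : (x ^+ 2) ^+ K = (`|x| ^+ K) ^+ 2 by rewrite [RHS]exprAC (real_normK (num_real x)).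
rewrite E9 EK -!exprMn; set u := `|p j * x|; have u0 : 0 <= u by exact: normr_ge0.
have u1 : 0 < 1 + u by rewrite ltr_pwDl.
have c3 : 0 <= 3 ^+ K * (C * s j) by rewrite mulr_ge0 ?exprn_ge0// mulr_ge0// ltW.
have B0 : 0 <= `|x| ^+ K * (C * 3 ^+ K * s j * p j ^+ K * decay alpha (p j * x)).
  rewrite mulr_ge0 ?exprn_ge0// mulr_ge0 ?(ltW (decay_gt0 _ _))// mulr_ge0 ?exprn_ge0 ?(ltW (p0 j))//.
  by rewrite mulr_ge0 ?(ltW (s0 j))// mulr_ge0 ?exprn_ge0.
rewrite lerXn2r ?nnegrE//.
  by rewrite mulr_ge0 ?exprn_ge0// mulr_ge0 ?powR_ge0// mulr_ge0 ?exprn_ge0// mulr_ge0// ltW.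
have -> : `|x| ^+ K * (C * 3 ^+ K * s j * p j ^+ K * decay alpha (p j * x)) =
    3 ^+ K * (C * s j) * (u ^+ K * (1 + u) `^ (- alpha)).
  by rewrite /u normrM (gtr0_norm (p0 j)) exprMn /decay normrM (gtr0_norm (p0 j)); ring.
have -> : 3 ^+ K * (C * s j * u ^+ M * (1 + u) `^ (- alpha - M%:R)) =
    3 ^+ K * (C * s j) * (u ^+ M * (1 + u) `^ (- alpha - M%:R)) by ring.
rewrite ler_wpM2l// powRD_gt0// [(1 + u) `^ (- alpha) * _]mulrC mulrA ler_wpM2r ?powR_ge0//.
rewrite powRN powR_mulrn ?(ltW u1)// -ler_pdivlMr ?invr_gt0 ?exprn_gt0// invrK.
rewrite -[in leLHS](subnKC (ltnW KltM)) exprD ler_wpM2l ?exprn_ge0//.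
apply: (@le_trans _ _ ((1 + u) ^+ (M - K))).
  by rewrite lerXn2r ?nnegrE ?(ltW u1)// lerDr.
by rewrite ler_weXn2l ?leq_subr// lerDl.
Qed.

Let Ial := \int[mu]_y decay alpha y.

(** A coefficient is at most the mean modulus of the transfer function; the dilation by 2^j in its
    bound contributes the factor 2^{-j}. *)
Lemma fred_le j (i : 'I_(flen j)) : `|fred j i| <= C * 3 ^+ K * Ial * (s j * p j ^+ K / p j).
Proof.
pose c := C * 3 ^+ K * s j * p j ^+ K.
have c0 : 0 <= c.
  by rewrite /c mulr_ge0 ?exprn_ge0 ?(ltW (p0 j))// mulr_ge0 ?(ltW (s0 j))// mulr_ge0 ?exprn_ge0.
have [i1 i2] := Rint_decay_le al1 (p0 j).
have iB := itbZ mIpi c i1.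
have H := @filter_coef_le _ (flen j) (win A j) (fred j) _ i iB.
apply: (le_trans (H _)) => [x|].
  rewrite inE/= in_itv/= -ler_norml => xp; split; last exact: ft_fred_le.
  by rewrite mulr_ge0 ?(ltW (decay_gt0 _ _)).
rewrite (RintZ mIpi c i1); set I1 := \int[mu]_(x in _) _ in i2 *.
have I10 : 0 <= I1 by apply: Rintegral_ge0 => x _; exact: ltW (decay_gt0 _ _).
have q1 : (2 * pi)^-1 <= 1 :> R.
  by rewrite invf_le1; [have := pihalf_ge1 R; lra|apply: mulr_gt0 => //; exact: pi_gt0].
apply: (le_trans (ler_piMl (mulr_ge0 c0 I10) q1)); apply: (le_trans (ler_wpM2l c0 i2)).
by rewrite /c le_eqVlt; apply/orP; left; apply/eqP; rewrite /Ial; ring.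
Qed.

(** The weights of G(X) in the renormalized coefficient 2^{-j d0} W_{j,k}. *)
Definition fnorm j (i : nat) : R := p j `^ (- (K%:R + de)) * fred j i.

Lemma fnorm_le j (i : 'I_(flen j)) :
  `|fnorm j i| <= C * 3 ^+ K * Ial * p j `^ (- de - 2^-1).
Proof.
rewrite normrM (gtr0_norm (powR_gt0 _ (p0 j))).
rewrite (le_trans (ler_wpM2l (powR_ge0 _ _) (fred_le i)))//.
rewrite mulrCA ler_wpM2l//.
  by rewrite mulr_ge0 ?mulr_ge0 ?exprn_ge0// /Ial Rintegral_ge0// => y _; exact: ltW (decay_gt0 _ _).
have -> : s j = p j `^ (2^-1).
  by rewrite -[p j]powR_mulrn// -powRrM.
rewrite -[(p j)^-1](@powR_inv1) ?(ltW (p0 j))// -[p j ^+ K](@powR_mulrn) ?(ltW (p0 j))//.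
rewrite -!powRD_gt0// le_eqVlt; apply/orP; left; apply/eqP; congr (_ `^ _).
have t : 2^-1 + 2^-1 = 1 :> R by lra.
lra.
Qed.

Variables (Phi : nat -> R -> R) (gre gim : R -> R).
Hypothesis gnz : exists l, gre l != 0 \/ gim l != 0.
Hypothesis gcv : forall B eps : R, 0 < eps -> \forall j \near \oo, forall l : R, `|l| <= B ->
  cmod (resc_re A g Phi j l - gre l) (resc_im A g Phi j l - gim l) <= eps.

Notation d0 := (K%:R + de).
Let ga (y : R) : R := cmod (gre y) (gim y).
Let rj (j : nat) (y : R) : R := (p j)^-1 * ft j (h j) (y / p j).
(** The integrand of the renormalized variance after the substitution x = y / 2^j. *)
Let fj (j : nat) (y : R) : R := \1_Ipi (y / p j) * (rj j y * (p j * `|sn (y / p j)|) `^ (- (2 * d0))).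

Let d0_gt0 : 0 < d0.
Proof. by case/andP: de01 => e0 _; rewrite ltr_wpDl. Qed.

Let rj_ge0 j (y : R) : 0 <= rj j y.
Proof. by rewrite mulr_ge0 ?ft2_ge0// invr_ge0 ltW. Qed.

Lemma cmod_resc_sqr j (y : R) : cmod (resc_re A g Phi j y) (resc_im A g Phi j y) ^+ 2 = rj j y.
Proof.
rewrite cmod_sqr /rj -cmod_ghat cmod_sqr /resc_re /resc_im.
have -> : (p j)^-1 = 2 `^ (- (j%:R / 2)) ^+ 2 * (cos (Phi j y) ^+ 2 + sin (Phi j y) ^+ 2).
  by rewrite cos2Dsin2 mulr1 powRN exprVn half_pow_sqr.
ring.
Qed.

Lemma cmod_resc j (y : R) : cmod (resc_re A g Phi j y) (resc_im A g Phi j y) = Num.sqrt (rj j y).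
Proof. by rewrite -cmod_resc_sqr sqrtr_sqr ger0_norm// cmod_ge0. Qed.

Lemma cmod_resc_near (B eps : R) : 0 < eps -> \forall j \near \oo, forall l : R, `|l| <= B ->
  `|Num.sqrt (rj j l) - ga l| <= eps.
Proof.
move=> e0; apply: filterS (gcv B e0) => j hj l lB.
by rewrite -cmod_resc (le_trans (cmod_dist _ _ _ _))// hj.
Qed.

Let rj_cvg (y : R) : rj j y @[j --> \oo] --> ga y ^+ 2.
Proof.
have h : Num.sqrt (rj j y) @[j --> \oo] --> ga y.
  apply/cvgrPdist_le => eps e0; near=> j; rewrite distrC.
  by near: j; have := cmod_resc_near `|y| e0; apply: filterS => j; exact.
have E j : rj j y = Num.sqrt (rj j y) ^+ 2 by rewrite sqr_sqrtr.
by under eq_fun do rewrite E; exact: cvg_exprn.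
Unshelve. all: by end_near.
Qed.

(** The bound on the filters has order M > 0 at the origin and passes to the limit. This keeps 0 out
    of the interval on which the limiting integrand is bounded below, where the negative power of
    |y| would take the value 0. *)
Let ga0 : ga 0 = 0.
Proof.
apply/eqP; rewrite -(sqrf_eq0 (ga 0)); apply/eqP.
have c0 : (fun=> 0 : R) @ \oo --> (0 : R) by exact: cvg_cst.
apply: (eq_cvg_unique (@rj_cvg 0) c0) => j.
apply/eqP; rewrite eq_le rj_ge0 andbT /rj mul0r -[leRHS](mulr0 (p j)^-1).
rewrite ler_wpM2l ?invr_ge0 ?(ltW (p0 j))// (le_trans (ft_le j _)) ?normr0 ?pi_ge0//.
have M0 : (M == 0)%N = false by case: (M) KltM.
by rewrite mulr0 normr0 expr0n M0 mulr0 mul0r expr0n.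
Qed.

Let sn0 : sn (0 : R) = 0. Proof. by rewrite /sn mul0r sin0 mulr0. Qed.

Let ip_cvg : (p j)^-1 @[j --> \oo] --> (0 : R).
Proof.
under eq_fun do rewrite -exprVn.
by apply: cvg_expr; rewrite gtr0_norm ?invr_gt0// invf_lt1 ?ltr1n.
Qed.

Let small_near (y e : R) : 0 < e -> \forall j \near \oo, `|y / p j| <= e.
Proof.
move=> e0; have h : y / p j @[j --> \oo] --> (0 : R).
  by rewrite -(mulr0 y); apply: cvgM => //; exact: cvg_cst.
by move/cvgr0Pnorm_le : h => /(_ _ e0).
Qed.

Lemma scaled_sn_cvg (y : R) : p j * `|sn (y / p j)| @[j --> \oo] --> `|y|.
Proof.
have E j : p j * `|sn (y / p j)| = p j * 2 * `|sin (`|y| / p j / 2)|.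
  rewrite /sn normrM (gtr0_norm (ltr0n _ 2)) mulrA; congr (_ * _).
  by have [y0|y0] := leP 0 y; rewrite ?(ger0_norm y0)// (ltr0_norm y0) !mulNr sinN normrN.
have Z j : p j * 2 * (`|y| / p j / 2) = `|y| by field; rewrite gt_eqF.
have cz : `|y| / p j / 2 @[j --> \oo] --> (0 : R).
  apply: (cvg_to_eq (l := `|y| * 0 / 2)); last by rewrite mulr0 mul0r.
  by apply: cvgM; [apply: cvgM => //|]; exact: cvg_cst.
have cc : `|y| * cos (`|y| / p j / 2) @[j --> \oo] --> `|y|.
  apply: (cvg_to_eq (l := `|y| * cos 0)); last by rewrite cos0 mulr1.
  apply: cvgM; first exact: cvg_cst.
  by apply: (@cvg_comp _ _ _ _ cos _ _ _ cz); exact: continuous_cos.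
apply: (squeeze_cvgr _ cc (cvg_cst `|y|)).
have := small_near y (pi_gt0 R); apply: filterS => j hj.
have z0 : 0 <= `|y| / p j / 2 by rewrite divr_ge0// divr_ge0// ltW.
have zp : `|y| / p j / 2 <= pi / 2.
  by rewrite ler_wpM2r//; move: hj; rewrite normrM normfV (gtr0_norm (p0 j)).
have p2 : 0 <= p j * 2 by rewrite mulr_ge0// ltW.
have s1 : 0 <= sin (`|y| / p j / 2) by rewrite sin_ge0_pi// z0/=; have := pi_gt0 R; lra.
rewrite E (ger0_norm s1).
have h1 := mulr_cos_le_sin (introT andP (conj z0 zp)).
have h2 := sin_le_id z0.
by have := ler_wpM2l p2 h1; have := ler_wpM2l p2 h2; rewrite Z mulrA Z => -> ->.
Qed.

Let fj_cvg (y : R) : fj j y @[j --> \oo] --> ga y ^+ 2 * `|y| `^ (- (2 * d0)).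
Proof.
have e0 : - (2 * d0) != 0 by rewrite oppr_eq0 mulf_neq0// gt_eqF.
have [->|y0] := eqVneq y 0.
  under eq_fun do rewrite /fj mul0r sn0 normr0 mulr0 powR0// !mulr0.
  by rewrite normr0 powR0// mulr0; exact: cvg_cst.
have ci : \1_Ipi (y / p j) @[j --> \oo] --> (1 : R).
  apply: cvg_near_cst; have := small_near y (pi_gt0 R); apply: filterS => j hj.
  by rewrite indicE mem_set//= in_itv/= -ler_norml.
rewrite -[X in _ --> X]mul1r; apply: cvgM => //; apply: cvgM; first exact: rj_cvg.
by apply: cvg_powR; [rewrite normr_gt0|exact: scaled_sn_cvg].
Qed.

Lemma fj_meas j : measurable_fun setT (fj j).
Proof.
have my : measurable_fun setT (fun y : R => y / p j) by exact: measurable_funM.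
apply: measurable_funM.
  by apply: (@measurableT_comp _ _ _ _ _ _ (\1_Ipi : R -> R)) => //; exact: measurable_indic.
apply: measurable_funM.
  apply: measurable_funM => //; apply: (@measurableT_comp _ _ _ _ _ _ (ft j (h j))) => //.
  by apply: continuous_measurable_fun; exact: ft2_continuous.
apply: (@measurableT_comp _ _ _ _ _ _ (fun y => y `^ (- (2 * d0)))); first exact: measurable_powR.
apply: measurable_funM => //; apply: measurableT_comp => //.
by apply: (measurableT_comp _ my); apply: continuous_measurable_fun; exact: sn_cont.
Qed.

(** The exponent 2M - 2 d0 of |y| is nonnegative because M >= K + delta, so |y| may be replaced by 1
    + |y|; the exponents then add up to - 2 alpha - 2 d0 <= - alpha. *)
Lemma fj_le j (y : R) : `|fj j y| <= C ^+ 2 * 3 `^ (2 * d0) * decay alpha y.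
Proof.
have c0 : 0 <= C ^+ 2 * 3 `^ (2 * d0) by rewrite mulr_ge0 ?sqr_ge0 ?powR_ge0.
have D0 : 0 <= C ^+ 2 * 3 `^ (2 * d0) * decay alpha y.
  by rewrite mulr_ge0// ltW// decay_gt0.
rewrite /fj indicE; case: (boolP (y / p j \in _)) => [|_]; last by rewrite mul0r normr0.
rewrite inE/= in_itv/= -ler_norml mul1r => yp.
have pj : p j * (y / p j) = y by rewrite mulrCA divff ?mulr1 ?gt_eqF.
have [->|y0] := eqVneq y 0.
  rewrite mul0r sn0 normr0 mulr0 powR0 ?mulr0 ?normr0//; last by rewrite oppr_eq0 mulf_neq0// gt_eqF.
  by rewrite mulr_ge0// ltW// decay_gt0.
have ya : 0 < `|y| by rewrite normr_gt0.
have u1 : 0 < 1 + `|y| by rewrite ltr_pwDl.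
rewrite ger0_norm; last by rewrite mulr_ge0 ?powR_ge0.
have h1 : rj j y <= (C * `|y| ^+ M * (1 + `|y|) `^ (- alpha - M%:R)) ^+ 2.
  rewrite /rj ler_pdivrMl// (le_trans (ft_le j yp))// pj -half_pow_sqr -(exprMn 2).
  by rewrite le_eqVlt; apply/orP; left; apply/eqP; congr (_ ^+ 2); ring.
have h2 : (p j * `|sn (y / p j)|) `^ (- (2 * d0)) <= (`|y| / 3) `^ (- (2 * d0)).
  apply: le_powRN; [by rewrite mulr_ge0// ltW|by rewrite divr_gt0|].
  rewrite -[in leLHS]pj normrM (gtr0_norm (p0 j)) -mulrA ler_wpM2l ?(ltW (p0 j))//.
  exact: sn_ge.
apply: (le_trans (ler_pM (rj_ge0 j y) (powR_ge0 _ _) h1 h2)).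
rewrite powRM ?normr_ge0// ?invr_ge0//.
have -> : 3^-1 `^ (- (2 * d0)) = 3 `^ (2 * d0) :> R.
  by rewrite -[3^-1](@powR_inv1 _ 3)// -powRrM mulN1r opprK.
have -> : (C * `|y| ^+ M * (1 + `|y|) `^ (- alpha - M%:R)) ^+ 2 =
    C ^+ 2 * `|y| `^ (2 * M%:R) * (1 + `|y|) `^ (2 * (- alpha - M%:R)).
  rewrite !(exprMn 2) -[`|y| ^+ M]powR_mulrn// !powR_exprn.
  by rewrite (mulrC M%:R) (mulrC (- alpha - _)).
rewrite [leLHS](_ : _ = C ^+ 2 * 3 `^ (2 * d0) *
   ((`|y| `^ (2 * M%:R) * `|y| `^ (- (2 * d0))) * (1 + `|y|) `^ (2 * (- alpha - M%:R)))); last by ring.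
rewrite -powRD_gt0// ler_wpM2l//.
apply: (@le_trans _ _ ((1 + `|y|) `^ (2 * M%:R - 2 * d0) * (1 + `|y|) `^ (2 * (- alpha - M%:R)))).
  rewrite ler_wpM2r ?powR_ge0// ge0_ler_powR ?nnegrE ?(ltW u1)// ?lerDr//.
  by have := KM; lra.
rewrite -powRD_gt0// /decay ler_powR ?lerDl//.
by have := d0_gt0; have := al1; lra.
Qed.

(** The K factors |1 - e^{-ix}|^2 removed from the filter are absorbed by the density, whose
    exponent passes from de to K + de. *)
Lemma qf_fj j : qf (fun i : 'I_(flen j) => fnorm j i) (@tpos flen (win A) j 0) (rho de) =
  \int[mu]_y fj j y.
Proof.
set a := (fun i : 'I_(flen j) => fnorm j i); set t := @tpos _ _ _ _.
have [i1 e] := qf_rF a t (itb_phi de01); rewrite /rho e.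
pose F (x : R) : R := ft j (h j) x * phi d0 x.
pose c := p j `^ (- (2 * d0)).
have c0 : 0 < c by exact: powR_gt0.
have cE : p j `^ (- d0) ^+ 2 = c by rewrite powR_exprn /c; congr (_ `^ _); ring.
have E x : cos2 a t x * phi de x = c * F x.
  have -> : cos2 a t x = c * ft j (fred j) x.
    rewrite /cos2 /ft2 mulrDr -cE -!(exprMn 2) /fcos /fsin !mulr_sumr; congr (_ + _).
      by congr (_ ^+ 2); apply: eq_bigr => i _; rewrite /a /fnorm /t /tpos mulr0 sub0r rmorphN mulrN cosN mulrA.
    rewrite -sqrrN -sumrN; congr (_ ^+ 2); apply: eq_bigr => i _.
    by rewrite /a /fnorm /t /tpos mulr0 sub0r rmorphN mulrN sinN mulrN opprK mulrA.
  rewrite -mulrA; congr (c * _); rewrite /F ft_fred.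
  have [s1|s1] := eqVneq (sn x) 0.
    by rewrite !phi_sn0 ?mulr0//; case/andP: de01.
  have k0 : (sn x ^+ 2) ^+ K != 0 by rewrite !expf_neq0.
  rewrite !phiE// opprD powRD_gt0; last by rewrite exprn_even_gt0.
  rewrite [_ `^ (- K%:R)]powRN (powR_mulrn _ (sqr_ge0 _)).
  by rewrite mulrACA mulfV// mul1r.
have iF : itb mu Ipi F.
  have := itbZ mIpi c^-1 i1; under [X in itb _ _ X]eq_fun do rewrite E mulKf ?gt_eqF//.
  by [].
under eq_Rintegral do rewrite E.
rewrite (RintZ mIpi c iF) Rint_onD.
have iFT := (itb_onD _ mIpi).1 iF.
have F0 x : 0 <= onD Ipi F x.
  by rewrite /onD indicE mulr_ge0// mulr_ge0 ?ft2_ge0 ?phi_ge0.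
have [j1 j2] := itb_scale (p0 j) (itb_meas iFT) F0 iFT.
rewrite -j2 -(RintZ measurableT c j1); apply: eq_Rintegral => y _.
rewrite /fj /rj /onD /F /phi powRM ?normr_ge0 ?(ltW (p0 j))// -/c; ring.
Qed.

Lemma qf_fnorm_cvg : exists2 V : R, 0 < V &
  qf (fun i : 'I_(flen j) => fnorm j i) (@tpos flen (win A) j 0) (rho de) @[j --> \oo] --> V.
Proof.
pose f (y : R) : R := ga y ^+ 2 * `|y| `^ (- (2 * d0)).
have iD := itbZ measurableT (C ^+ 2 * 3 `^ (2 * d0)) (itb_decay al1).
have [i1 c1] := @Rint_dct _ (measurableTypeR R) R mu setT measurableT fj f _
  (fun j => @fj_meas j) (fun y _ => @fj_cvg y) iD (fun j y _ => fj_le j y).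
exists (\int[mu]_y f y); last by under eq_fun do rewrite qf_fj.
have f0 y : 0 <= f y by rewrite mulr_ge0 ?sqr_ge0 ?powR_ge0.
have [l0 hl0] := gnz; set N0 := ga l0.
have N00 : 0 < N0.
  rewrite sqrtr_gt0 lt_neqAle addr_ge0 ?sqr_ge0// andbT eq_sym paddr_eq0 ?sqr_ge0// !sqrf_eq0.
  by case: hl0 => /negbTE->; rewrite ?andbF.
(* The limit modulus inherits positivity around l0 from one prelimit function, continuous and
   uniformly close to it on a bounded interval. Two approximations and one modulus of continuity
   lose at most three quarters of [N0]. *)
have N4 : 0 < N0 / 4 by rewrite divr_gt0.
have [j _ hj] := cmod_resc_near (`|l0| + 1) N4; have {}hj := hj j (leqnn j).
have cs : {for l0, continuous (fun y => Num.sqrt (rj j y))}.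
  have cr : {for l0, continuous (rj j)}.
    have cy : {for l0, continuous (fun y : R => y / p j)} by apply: cvgM => //; exact: cvg_cst.
    apply: cvgM; first exact: cvg_cst.
    by apply: (@continuous_comp _ _ _ _ (ft j (h j)) _ cy); exact: ft2_continuous.
  by apply: (@continuous_comp _ _ _ _ Num.sqrt _ cr); exact: sqrt_continuous.
have /cvgrPdist_le/(_ _ N4) /nbhs_ballP[r0 /= r00 hr] := cs.
pose r := Num.min (r0 / 2) 1.
have r1 : 0 < r by rewrite lt_min ltr01 divr_gt0.
have rr0 : r < r0 by apply: (@le_lt_trans _ _ (r0 / 2)); [rewrite ge_min lexx|lra].
pose c := (N0 / 4) ^+ 2 * (`|l0| + 1) `^ (- (2 * d0)).
have c0 : 0 < c by rewrite mulr_gt0 ?exprn_gt0 ?powR_gt0// ltr_pwDr.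
pose J := `[l0 - r, l0 + r]%classic : set (measurableTypeR R).
have hJ y : J y -> c <= f y.
  rewrite /J/= in_itv/= => /andP[ya yb].
  have yr : `|l0 - y| <= r by rewrite ler_norml; apply/andP; split; lra.
  have yl : `|y| <= `|l0| + 1.
    have : `|y| <= `|l0| + `|y - l0| by rewrite -[in leLHS](subrK l0 y) addrC ler_normD.
    by rewrite distrC => yl; apply: (le_trans yl); rewrite lerD2l (le_trans yr)// ge_min lexx orbT.
  have l1 : `|l0| <= `|l0| + 1 by rewrite lerDl.
  have hA := hj l0 l1; have hB := hj y yl.
  have hC : `|Num.sqrt (rj j l0) - Num.sqrt (rj j y)| <= N0 / 4.
    by apply: hr; rewrite /ball/= (le_lt_trans yr).
  have gay : N0 / 4 <= ga y.
    move: hA hB hC; rewrite -/N0 !ler_norml => /andP[? ?] /andP[? ?] /andP[? ?]; lra.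
  have y0 : 0 < `|y|.
    rewrite normr_gt0; apply/eqP => y0; move: gay; rewrite y0 ga0 leNgt N4//.
  rewrite /c /f ler_pM ?sqr_ge0 ?powR_ge0//.
    by rewrite lerXn2r ?nnegrE ?(ltW N4)// cmod_ge0.
  by apply: le_powRN => //; rewrite mulr_ge0// ltW.
have mJ : measurable J by exact: measurable_itv.
have iJ : itb mu J (fun=> c).
  by apply: itb_continuous => *; exact: cst_continuous.
have iJf : itb mu J f by apply: integrableS i1.
have h1 : \int[mu]_(y in J) c <= \int[mu]_(y in J) f y.
  exact: (le_Rint mJ iJ iJf hJ).
have h2 : \int[mu]_(y in J) f y <= \int[mu]_y f y.
  rewrite Rint_onD; apply: (le_Rint measurableT ((itb_onD _ mJ).1 iJf) i1).
  by move=> y _; rewrite /onD indicE; case: (_ \in _); rewrite ?mul1r ?mul0r.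
apply: (lt_le_trans _ (le_trans h1 h2)).
have ab : l0 - r < l0 + r by lra.
have dc (x : R) : l0 - r <= x <= l0 + r -> is_derive x 1 (fun y : R => c * y) c.
  by move=> _; derive_auto; ring.
have cc : {within `[l0 - r, l0 + r], continuous (fun=> c)} by move=> *; exact: cst_continuous.
rewrite /J (Rint_ftc ab dc cc) -mulrBr mulr_gt0//; lra.
Qed.

End WaveletFilters.

(** * Log-regression *)

Section FromTheProcess.
Context {R : realType} {dsp : measure_display} {T : measurableType dsp} (P : probability T R).
Notation gam := (normal_prob (0 : R) 1).

Lemma spec_density_fden (d : R) fs : spec_density d fs = fden d fs.
Proof.
by apply/funext => x; rewrite /spec_density /fden /phi /abs_one_minus_exp /sn normrM ger0_norm.
Qed.

Lemma autocov_cov (d : R) fs : autocov (spec_density d fs) = cov d fs.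
Proof. by rewrite spec_density_fden. Qed.

Variables (X : int -> T -> R) (r : int -> R).
Hypotheses (gX : centered_gaussian_process P X r) (r0 : r 0 = 1).

Lemma gvar_X0 : gvar P (X 0) 1.
Proof.
have [mX h] := gX; have Z1 (f : T -> R) t : \sum_(i < 1) f t = f t by rewrite big_ord1.
split; first exact: mX.
  move=> u; have [+ _] := h 1%N (fun=> 0) (fun=> 1) u.
  rewrite /= !big_ord1 subrr r0 !mulr1 => e; rewrite /Rintegral.
  under eq_integral do (rewrite -[X 0 _]mul1r -(Z1 (fun t => 1 * X 0 t))); by rewrite e.
move=> u; have [_] := h 1%N (fun=> 0) (fun=> 1) u.
rewrite /= => e; rewrite /Rintegral.
under eq_integral do (rewrite -[X 0 _]mul1r -(Z1 (fun t => 1 * X 0 t))); by rewrite e.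
Qed.

Variable G : R -> R.
Hypotheses (mG : measurable_fun setT G) (iG : P.-integrable setT (fun w => (G (X 0 w) ^+ 2)%:E)).

Lemma l2_of_X0 : l2 gam G.
Proof.
split=> //; apply/integrableP; split.
  by apply/measurable_EFinP; exact: measurable_funX.
have mG2 : measurable_fun setT (fun x => `|(G x ^+ 2)%:E|%E).
  by apply: measurableT_comp => //; apply/measurable_EFinP; exact: measurable_funX.
have /integrableP[_] := iG.
rewrite (gvar_ge0_integral gvar_X0 mG2)//.
by rewrite sqrtr1; under [X in (X < _)%E -> _]eq_integral do rewrite mul1r.
Qed.

Lemma hcoef_gauss q : hcoef P (X 0) G q = \int[gam]_x (G x * hermite q x).
Proof.
have ml := l2_of_X0.
have h : itb gam setT (fun x => G (Num.sqrt 1 * x) * hermite q (Num.sqrt 1 * x)).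
  under [X in itb _ _ X]eq_fun do rewrite sqrtr1 mul1r.
  by apply: l2_mul => //; exact: hermite_l2.
have mGH : measurable_fun setT (fun x => G x * hermite q x).
  apply: measurable_funM => //; exact: (hermite_l2 q).1.
have := gvar_Rint gvar_X0 mGH h; rewrite /hcoef /Rintegral => ->.
by under eq_integral do rewrite sqrtr1 !mul1r.
Qed.

End FromTheProcess.

(** * From empirical variances to the estimator *)

Section LogRegression.
Context {R : realType} {dsp : measure_display} {T : measurableType dsp} (P : probability T R).

Lemma markov_le (S : set T) (f : T -> R) (e : R) : 0 < e -> measurable S -> itb P setT f ->
  (forall t, S t -> e <= `|f t|) -> (P S <= (e^-1 * \int[P]_t `|f t|)%:E)%E.
Proof.
move=> e0 mS jf hS.
have mf : measurable_fun setT (EFin \o f) by apply/measurable_EFinP; exact: itb_meas jf.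
have h := @le_integral_abse _ _ _ P setT measurableT _ _ mf e0.
have jn : itb P setT (fun t => `|f t|) by exact: (integrable_norm jf).
rewrite EFinM (EFin_Rint measurableT jn) lee_pdivlMl//; apply: le_trans h; apply: lee_wpmul2l.
  by rewrite lee_fin ltW.
apply: le_measure; rewrite ?inE//; last by move=> t /hS; rewrite /= lee_fin.
by apply: emeasurable_fun_c_infty => //; exact: measurableT_comp.
Qed.

Variables (p : nat) (wt : nat -> R) (d0 V : R).
Hypotheses (V0 : 0 < V) (w0 : \sum_(i < p.+1) wt i = 0).
Hypothesis w1 : \sum_(i < p.+1) i%:R * wt i = (2 * ln 2)^-1.

Lemma ln_two_gt0 : 0 < ln 2 :> R. Proof. by rewrite ln_gt0// ltr1n. Qed.

(* The weights annihilate the constant [ln V + 2 j d0 ln 2] and turn the slope [2 d0 ln 2] into [d0]. *)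
Lemma log_regression (eps : R) : 0 < eps -> exists2 e, 0 < e & forall (j : nat) (s : nat -> R),
  (forall i, (i < p.+1)%N -> `|((2 ^+ (j + i)) `^ (- d0)) ^+ 2 * s i - V| < e) ->
  `|\sum_(i < p.+1) wt i * ln (s i) - d0| <= eps.
Proof.
move=> eps0; pose W := 1 + \sum_(i < p.+1) `|wt i|.
have W0 : 0 < W by rewrite ltr_pwDl// sumr_ge0.
have eW : 0 < eps / W by rewrite divr_gt0.
have cl : {for V, continuous (@ln R)} by exact: continuous_ln.
have /cvgrPdist_le/(_ _ eW) /nbhs_ballP[r /= r0 hr] := cl.
(* The bound by [V] keeps the normalized variances positive, so that the logarithm of the product
   splits. *)
exists (Num.min r V) => [|j s hs]; first by rewrite lt_min r0.
pose q i := ((2 ^+ (j + i)) `^ (- d0)) ^+ 2 : R.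
have q0 i : 0 < q i by rewrite exprn_gt0// powR_gt0// exprn_gt0.
have lq i : ln (q i) = - (2 * d0 * (j + i)%:R * ln 2).
  rewrite /q powR_exprn ln_powR -powR_mulrn// ln_powR; ring.
have hz i : (i < p.+1)%N -> 0 < q i * s i /\ `|ln (q i * s i) - ln V| <= eps / W.
  move=> /hs; rewrite lt_min => /andP[h1 h2]; split.
    by move: h2; rewrite ltr_norml => /andP[h2 _]; rewrite -/(q i) in h2; lra.
  by rewrite distrC; apply: hr; rewrite /ball/= distrC.
have E : \sum_(i < p.+1) wt i * ln (s i) - d0 =
    \sum_(i < p.+1) wt i * (ln (q i * s i) - ln V).
  have t i : (i < p.+1)%N -> wt i * (ln (q i * s i) - ln V) =
      wt i * ln (s i) - (ln V + 2 * d0 * ln 2 * j%:R) * wt i - 2 * d0 * ln 2 * (i%:R * wt i).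
    move=> /hz[h _]; have s0 : 0 < s i by rewrite -(pmulr_rgt0 _ (q0 i)).
    rewrite lnM ?posrE// lq natrD; ring.
  rewrite [RHS](eq_bigr _ (fun (i : 'I_p.+1) _ => t i (ltn_ord i))) !sumrB -!mulr_sumr w0 w1 mulr0 subr0.
  by congr (_ - _); field; rewrite gt_eqF// ln_two_gt0.
rewrite E (le_trans (ler_norm_sum _ _ _))//.
apply: (@le_trans _ _ (\sum_(i < p.+1) `|wt i| * (eps / W))).
  by apply: ler_sum => i _; rewrite normrM ler_wpM2l//; have [] := hz i (ltn_ord i).
rewrite -mulr_suml mulrCA ler_piMr ?(ltW eps0)// ler_pdivrMr// mul1r /W lerDr//.
Qed.

End LogRegression.

Lemma sample_sizes_large {R : realType} (n : nat -> nat -> nat) (jN : nat -> nat) (C : R) (p n0 : nat) :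
  (forall B : R, \forall N \near \oo, B < N%:R / 2 ^+ jN N) ->
  (forall N j : nat, `|(n N j)%:R - N%:R / 2 ^+ j| <= C) ->
  \forall N \near \oo, forall i, (i < p.+1)%N -> (n0 <= n N (jN N + i))%N.
Proof.
(* The factor 2^p covers the coarser scales up to j + p, and C the bounded error in the number of
   coefficients. *)
move=> hN hn; have := hN ((n0%:R + C) * 2 ^+ p); apply: filterS => N hB i ip.
have C0 : 0 <= C by apply: le_trans (hn 0 0); exact: normr_ge0.
have := hn N (jN N + i)%N; rewrite ler_norml => /andP[h _].
rewrite -(ler_nat R); suff : n0%:R + C <= N%:R / 2 ^+ (jN N + i) by move=> ?; lra.
have p0 k : 0 < 2 ^+ k :> R by rewrite exprn_gt0.
rewrite exprD invfM mulrA ler_pdivlMr//; apply: le_trans (ltW hB).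
by rewrite ler_wpM2l ?addr_ge0// ler_weXn2l// ler1n.
Qed.

Lemma wcoef_W0 {R : realType} {dsp : measure_display} {T : measurableType dsp}
    (A alpha C de : R) (g : nat -> int -> R) (M K : nat) (X Y : int -> T -> R) (G : R -> R) j k t :
  1 < alpha -> 0 <= C -> 0 < de < 2^-1 -> K%:R + de <= M%:R ->
  (forall (j : nat) (l : R), - pi <= l <= pi ->
    cmod (ghat_re A g j l) (ghat_im A g j l)
    <= C * 2 `^ (j%:R / 2) * `|2 ^+ j * l| ^+ M * (1 + 2 ^+ j * `|l|) `^ (- alpha - M%:R)) ->
  (forall t w, iter K (@bdiff R) (fun s => Y s w) t = G (X t w)) ->
  W0 (flen A) (win A) (fnorm A de g K) X G j k t =
  (2 ^+ j) `^ (- (K%:R + de)) * wcoef A g (fun s => Y s t) j k.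
Proof.
move=> al1 C0 de01 KM gC hY; rewrite (wcoef_fred al1 C0 de01 KM gC) mulr_sumr.
by apply: eq_bigr => i _; rewrite hY mulrA.
Qed.

Lemma sig2hat_measurable {R : realType} {dsp : measure_display} {T : measurableType dsp}
    (A : R) (g : nat -> int -> R) (Y : int -> T -> R) j k n :
  (forall t, measurable_fun setT (Y t)) ->
  measurable_fun setT (fun w => sig2hat A g (fun t => Y t w) j k n).
Proof.
move=> mY; apply: measurable_funM => //; apply: measurable_sum => i.
apply: measurable_funX; apply: measurable_sum => l.
exact: measurable_funM.
Qed.

Theorem theorem6p1 (R : realType) (dsp : measure_display) (T : measurableType dsp)
  (P : probability T R)
  (d : R) (fstar : R -> R) (beta : R) (X : int -> T -> R) (G : R -> R) (q0 K : nat)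
  (Y : int -> T -> R) (A alpha : R) (M : nat) (g : nat -> int -> R)
  (p : nat) (wt : nat -> R) (jN : nat -> nat) (k0 : nat -> nat -> int) (n : nat -> nat -> nat) :
  (* long memory parameter *)
  0 < d < 2^-1 ->
  (* Assumption A(i): f* bounded spectral density, continuous and positive at 0, Hoelder at 0 *)
  measurable_fun setT fstar ->
  (forall x, 0 <= fstar x) ->
  (forall x, fstar (- x) = fstar x) ->
  (exists B : R, forall x, `|fstar x| <= B) ->
  {for 0, continuous fstar} ->
  0 < fstar 0 ->
  0 < beta <= 2 ->
  (exists C : R, forall l : R, - pi <= l <= pi ->
      `|fstar l - fstar 0| <= C * fstar 0 * `|l| `^ beta) ->
  (* X centered stationary Gaussian, unit variance, spectral density f *)
  centered_gaussian_process P X (autocov (spec_density d fstar)) ->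
  autocov (spec_density d fstar) 0 = 1 ->
  (* G(X_0) centered, square integrable *)
  measurable_fun setT G ->
  P.-integrable setT (fun w => (G (X 0 w) ^+ 2)%:E) ->
  (\int[P]_w (G (X 0 w))%:E = 0)%E ->
  (* Hermite rank q0 *)
  (0 < q0)%N ->
  hcoef P (X 0) G q0 != 0 ->
  (forall q : nat, (0 < q < q0)%N -> hcoef P (X 0) G q = 0) ->
  (* Assumption A(ii) *)
  q0%:R < (1 - 2 * d)^-1 ->
  (forall lam : R, 0 < lam -> exists C : R, forall q : nat,
      `|hcoef P (X 0) G q| <= C * (q`!)%:R `^ d * expR (- (lam * q%:R))) ->
  (* (Delta^K Y)_t = G(X_t) *)
  (forall t, measurable_fun setT (Y t)) ->
  (forall t w, iter K (@bdiff R) (fun s => Y s w) t = G (X t w)) ->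
  (* (W-1) *)
  0 < A ->
  (forall (j : nat) (tau : int), g j tau != 0 -> `|tau%:~R| <= A * 2 ^+ j :> R) ->
  (* (W-2) *)
  1 < alpha ->
  (K%:R + hdelta d q0 <= M%:R) ->
  (exists C : R, forall (j : nat) (l : R), - pi <= l <= pi ->
      cmod (ghat_re A g j l) (ghat_im A g j l)
      <= C * 2 `^ (j%:R / 2) * `|2 ^+ j * l| ^+ M * (1 + 2 ^+ j * `|l|) `^ (- alpha - M%:R)) ->
  (* (W-3) *)
  (exists (Phi : nat -> R -> R) (ginf_re ginf_im : R -> R),
      (exists l, ginf_re l != 0 \/ ginf_im l != 0) /\
      forall B eps : R, 0 < eps -> \forall j \near \oo, forall l : R, `|l| <= B ->
        cmod (resc_re A g Phi j l - ginf_re l) (resc_im A g Phi j l - ginf_im l) <= eps) ->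
  (* weights *)
  (1 <= p)%N ->
  \sum_(i < p.+1) wt i = 0 ->
  \sum_(i < p.+1) i%:R * wt i = (2 * ln 2)^-1 ->
  (* scales j_N *)
  (forall m : nat, \forall N \near \oo, (m <= jN N)%N) ->
  (forall B : R, \forall N \near \oo, B < N%:R / 2 ^+ jN N) ->
  (* n_j = N 2^{-j} + O(1) coefficients W_{j,k}, k = k0 .. k0 + n_j - 1,
     each computable from Y_1, ..., Y_N *)
  (exists C : R, forall N j : nat, `|(n N j)%:R - N%:R / 2 ^+ j| <= C) ->
  (forall (N j i : nat), (i < n N j)%N -> forall tau : int, g j tau != 0 ->
      (1 <= (2 ^ j)%N%:Z * (k0 N j + i%:Z) - tau <= N%:Z)%R) ->
  (* conclusion: d-hat -> K + delta(q0) in probability *)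
  forall eps : R, 0 < eps ->
    (fun N : nat => P [set w | eps <
        `|dhat A g (fun t => Y t w) p wt (jN N) (k0 N) (n N) - (K%:R + hdelta d q0)|])
    @ \oo --> 0%E.
Proof.
move=> hd mfs fs0 fsE [B fsB] cfs fs0_gt0 hbeta _ gX cov1 mG iG EG q00 cq0 crank q0d cdec mY hY A0 _ al1 KM
  [Cw gCw] [Phi [gre [gim [gnz gcv]]]] p1 w0 w1 hjN hNj [Cn hn] _ eps eps0.
rewrite autocov_cov in gX cov1.
set de := hdelta d q0; pose gg := q0%:R * (1 - 2 * d).
have d2 : 0 < 1 - 2 * d by case/andP: hd => _; lra.
have deE : de = (1 - gg) / 2 by rewrite /de /hdelta /gg; field.
have gg1 : gg < 1 by rewrite /gg -ltr_pdivlMr// mul1r.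
have gg0 : 0 < gg by rewrite mulr_gt0// ltr0n.
have de01 : 0 < de < 2^-1 by rewrite deE; apply/andP; split; lra.
have gC (j : nat) (l : R) : - pi <= l <= pi ->
    cmod (ghat_re A g j l) (ghat_im A g j l)
    <= `|Cw| * 2 `^ (j%:R / 2) * `|2 ^+ j * l| ^+ M * (1 + 2 ^+ j * `|l|) `^ (- alpha - M%:R).
  move=> /(gCw j) /le_trans; apply; rewrite ler_wpM2r ?powR_ge0// ler_wpM2r ?exprn_ge0//.
  by rewrite ler_wpM2r ?powR_ge0// ler_norm.
have C0 : 0 <= `|Cw| by exact: normr_ge0.
have [V V0 hV] := qf_fnorm_cvg al1 C0 de01 KM gC gnz gcv.
pose D := `|Cw| * 3 ^+ K * \int[lebesgue_measure]_y decay alpha y.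
pose C := Num.max 1 (Num.max (2 * A + 5) D).
have hC1 : 1 <= C by rewrite le_max lexx.
have hCA : 2 * A + 5 <= C by rewrite !le_max lexx !orbT.
have hCD : D <= C by rewrite !le_max lexx !orbT.
have mC j : (flen A j)%:R <= C * 2 ^+ j.
  by apply: le_trans (flen_le A0 j) _; rewrite ler_wpM2r// exprn_ge0.
have aC j (i : 'I_(flen A j)) : `|fnorm A de g K j i| <= C * (2 ^+ j) `^ (gg / 2 - 1).
  apply: le_trans (fnorm_le al1 C0 de01 KM gC i) _.
  rewrite (_ : - de - 2^-1 = gg / 2 - 1); last by rewrite deE; field.
  by rewrite ler_wpM2r ?powR_ge0.
have lG := l2_of_X0 gX cov1 mG iG.
have cfE q := hcoef_gauss gX cov1 mG iG q.
(* Degree 0 is the centering of G; the rank hypothesis covers the degrees from 1 to q0 - 1. *)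
have cf_rank q : (q < q0)%N -> hcoef P (X 0) G q = 0.
  case: q => [_|q hq]; last by apply: crank; rewrite hq.
  by rewrite /hcoef; under eq_integral do rewrite mulr1; rewrite EG.
(* Since d < 1/2, (q!)^d is at most sqrt(q!). *)
have cfdec (lam : R) : 0 < lam -> exists C : R, forall q,
    `|hcoef P (X 0) G q| <= C * Num.sqrt q`!%:R * expR (- (lam * q%:R)).
  move=> /cdec[Cl hl]; exists `|Cl| => q; apply: (le_trans (hl q)).
  rewrite ler_wpM2r ?expR_ge0//; apply: (@le_trans _ _ (`|Cl| * q`!%:R `^ d)).
    by rewrite ler_wpM2r ?powR_ge0// ler_norm.
  rewrite ler_wpM2l// -powR12_sqrt// ler_powR ?ler1n ?fact_gt0//.
  by case/andP: hd => _ /ltW.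
have fsB' x : fstar x <= B by apply: le_trans (fsB x); exact: ler_norm.
have {}hV : qf (fun i : 'I_(flen A j) => fnorm A de g K j i) (@tpos (flen A) (win A) j 0)
  (rho ((1 - gg) / 2)) @[j --> \oo] --> V by rewrite -deE.
have [V2 V20 hV2] := quadratic_mean_cvg hd mfs fs0 fsB' cfs fs0_gt0 hC1 q00 gg1 mC aC gX cov1
  lG cfE cfdec cf_rank cq0 V0 hV.
pose S N := [set w | eps < `|dhat A g (fun t => Y t w) p wt (jN N) (k0 N) (n N) - (K%:R + hdelta d q0)|].
have mS N : measurable (S N).
  pose f w := `|dhat A g (fun t => Y t w) p wt (jN N) (k0 N) (n N) - (K%:R + hdelta d q0)|.
  have mf : measurable_fun setT f.
    apply: measurableT_comp => //; apply: measurable_funB => //; apply: measurable_sum => i.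
    apply: measurable_funM => //; apply: measurableT_comp; first exact: measurable_ln.
    exact: sig2hat_measurable.
  rewrite (_ : S N = setT `&` f @^-1` `]eps, +oo[%classic); first by apply: mf => //; exact: measurable_itv.
  by rewrite setTI; apply/seteqP; split => w; rewrite /S /= in_itv/= andbT.
apply/fine_cvgP; split.
  by apply: nearW => N; apply: fin_num_measure; exact: mS.
apply/cvgr0Pnorm_le => eta eta0.
have [e e0 he] := log_regression (K%:R + de) V20 w0 w1 eps0.
(* Level for each of the p + 1 scales: the deviations are added up before Markov's inequality at
   height e, which leaves probability at most [eta]. *)
have ep : 0 < eta * e / p.+1%:R by rewrite divr_gt0// mulr_gt0.
have [J [n0 hJ]] := hV2 _ ep.
have := sample_sizes_large p n0 hNj hn; have := hjN J; apply: filterS2 => N hN hnN.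
pose j i := (jN N + i)%N.
pose z i t := (n N (j i))%:R^-1 * (\sum_(k < n N (j i))
  W0 (flen A) (win A) (fnorm A de g K) X G (j i) (k0 N (j i) + k%:Z) t ^+ 2) - V2.
have zE i t : z i t = ((2 ^+ j i) `^ (- (K%:R + de))) ^+ 2 *
    sig2hat A g (fun s => Y s t) (j i) (k0 N (j i)) (n N (j i)) - V2.
  congr (_ - _); rewrite /sig2hat mulrCA; congr (_ * _); rewrite mulr_sumr; apply: eq_bigr => k _.
  by rewrite (wcoef_W0 _ _ _ al1 C0 de01 KM gC hY) exprMn.
have hz i : (i < p.+1)%N -> itb P setT (z i) /\ \int[P]_t `|z i t| <= eta * e / p.+1%:R.
  by move=> ip; apply: hJ; [exact: leq_trans hN (leq_addr _ _)|exact: hnN].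
have jz (i : 'I_p.+1) : itb P setT (fun t => `|z i t|).
  exact: (integrable_norm (hz i (ltn_ord i)).1).
pose F t := \sum_(i < p.+1) `|z i t|.
have jF : itb P setT F by apply: itb_sum.
have F0 t : 0 <= F t by rewrite sumr_ge0.
have IF : \int[P]_t `|F t| <= eta * e.
  under eq_Rintegral do rewrite ger0_norm//.
  rewrite (Rint_sum measurableT)//; apply: (@le_trans _ _ (\sum_(i < p.+1) eta * e / p.+1%:R)).
    by apply: ler_sum => i _; exact: (hz i (ltn_ord i)).2.
  by rewrite sumr_const card_ord -[_ *+ _]mulr_natr divfK.
have hS t : S N t -> e <= `|F t|.
  rewrite /S /= ltNge => /negP St; rewrite leNgt; apply/negP => Fe; apply: St.
  apply: (he (jN N) (fun i => sig2hat A g (fun s => Y s t) (j i) (k0 N (j i)) (n N (j i)))) => i ip.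
  rewrite -zE; apply: le_lt_trans Fe; rewrite (ger0_norm (F0 t)) /F.
  by rewrite (bigD1 (Ordinal ip))//= lerDl sumr_ge0.
have := markov_le e0 (mS N) jF hS; rewrite /= ger0_norm; last by rewrite fine_ge0.
rewrite -[in X in (X <= _)%E -> _](fineK (fin_num_measure P _ (mS N))) lee_fin => /le_trans; apply.
by rewrite ler_pdivrMl// mulrC.
Qed.
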